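(* Let $(w,v)$ be the solution of the interface problem $$\mathrm i w_t+w_{xx}=0,\quad (x,t)\in(-\infty,0)\times(0,T),\qquad w(x,0)=w_0(x),\quad x\in(-\infty,0),$$ $$v_t+v_{xxx}=0,\quad (x,t)\in(0,\infty)\times(0,T),\qquad v(x,0)=v_0(x),\quad x\in(0,\infty),$$ $$\partial_x^j w(0,t)=\partial_x^j v(0,t),\quad t\in[0,T],\quad j\in\{0,1\},$$ where $w_0,v_0$ are given initial data (the common interface values are not prescribed). Then, for $t\in(0,T)$ and $x<0$, $$w(x,t)=\frac1{2\pi}\int_{\mathbb R}e^{-\mathrm ikx-\mathrm ik^2t}\,\widehat w_0(-k)\,\mathrm dk-\frac1{2\pi}\int_{\mathcal C_{\mathrm S}}e^{-\mathrm ikx-\mathrm ik^2t}\,\widehat w_0(k)\,\mathrm dk+\frac1{2\pi}\int_{\widetilde{\mathbb R}}e^{-\mathrm i\sigma(k)x+\mathrm ikt}\,\frac{(1-\alpha^2)\rho(k)\,\widehat w_0(\sigma(k))-\widehat v_0(\rho(k))+\widehat v_0(\alpha^2\rho(k))}{(\alpha-1)\rho(k)\left[\rho(k)+\alpha^2\sigma(k)\right]}\,\mathrm dk,$$ and, for $t\in(0,T)$ and $x>0$, $$v(x,t)=\frac1{2\pi}\int_{\mathbb R}e^{\mathrm ikx+\mathrm ik^3t}\,\widehat v_0(k)\,\mathrm dk+\frac1{2\pi}\int_{\mathcal C_3}e^{\mathrm ikx+\mathrm ik^3t}\left[\alpha\,\widehat v_0(\alpha k)+\alpha^2\,\widehat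 v_0(\alpha^2k)\right]\mathrm dk+\frac1{2\pi}\int_{\widetilde{\mathbb R}}e^{\mathrm i\alpha\rho(k)x+\mathrm ikt}\,\frac{(1-\alpha^2)\rho(k)\,\widehat w_0(\sigma(k))-\widehat v_0(\rho(k))+\widehat v_0(\alpha^2\rho(k))}{(\alpha-1)\rho(k)\left[\rho(k)+\alpha^2\sigma(k)\right]}\,\mathrm dk.$$
   Context: Half line Fourier transforms: for $f$ on $(0,\infty)$, $\widehat f(k)=\int_0^\infty e^{-\mathrm ikx}f(x)\,\mathrm dx$, $\operatorname{Im}k\le0$; for $g$ on $(-\infty,0)$, $\widehat g(k)=\int_{-\infty}^0e^{-\mathrm ikx}g(x)\,\mathrm dx$, $\operatorname{Im}k\ge0$ (which one is meant is determined by the domain of the function; so $\widehat w_0$ is the negative, $\widehat v_0$ the positive half line transform). Principal roots: $z^{1/n}=|z|^{1/n}e^{\mathrm i\arg(z)/n}$ with $-\pi<\arg z\le\pi$. Set $\sigma(\lambda)=e^{\mathrm i\pi/4}(\mathrm i\lambda)^{1/2}$, $\rho(\lambda)=e^{-\mathrm i\pi/6}(\mathrm i\lambda)^{1/3}$, and $\alpha=e^{2\pi\mathrm i/3}$. Contours (boundaries positively oriented, i.e. the region lies to the left): $\mathcal C_{\mathrm S}=\partial\{k\in\mathbb C:0<\arg k<\pi/2\}$; $\mathcal C_3=\partial\{k\in\mathbb C:\pi/3<\arg k<2\pi/3\}$; $\widetilde{\mathbb R}=\partial(\mathbb C^+\cup B(0,\mathcal R))$ for an arbitrary $\mathcal R>0$,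 where $\mathbb C^+$ is the open upper half plane (so $\widetilde{\mathbb R}$ is the real line traversed left to right, bypassing $0$ along a semicircle in the lower half plane). Integrals along unbounded contours are improper integrals (limits of integrals over the part of the contour in $|k|\le K$ as $K\to\infty$). Standing assumption: data and solution are sufficiently smooth and decay sufficiently fast at infinity; concretely, $w_0,v_0$ are restrictions to the half lines of Schwartz functions, and a solution is a pair $(w,v)$ such that each of $w,v$, its $t$ derivative and its $x$ derivatives up to the order of its PDE are continuous on the closed half line times $[0,T]$, tend to $0$ as $|x|\to\infty$, and are dominated, uniformly in $t\in[0,T]$, by an integrable function of $x$, and such that the PDEs, initial and interface conditions hold. *)

(* Defs.v *)
From Stdlib Require Import Reals Lra List.
From Coquelicot Require Import Coquelicot.
Import ListNotations.
Open Scope R_scope.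

(** * Complex exponential and principal roots *)

Definition Cexp (z : C) : C :=
  (exp (Re z) * cos (Im z), exp (Re z) * sin (Im z)).

Definition Carg (z : C) : R :=
  if Rle_dec 0 (Im z) then acos (Re z / Cmod z) else - acos (Re z / Cmod z).

Lemma Carg_spec (z : C) : z <> 0%C ->
  - PI < Carg z <= PI /\ z = (Cmod z * Cexp (Ci * Carg z))%C.
Proof.
  intros Hz.
  assert (Hm : 0 < Cmod z) by now apply Cmod_gt_0.
  destruct z as [a b]; unfold Carg; cbn [Re Im fst snd] in *.
  set (m := Cmod (a, b)) in *.
  assert (Hm2 : m * m = a * a + b * b).
  { unfold m, Cmod; cbn [fst snd]; rewrite sqrt_sqrt; nra. }
  assert (Hq : a / m * m = a) by (field; lra).
  assert (Hq1 : -1 <= a / m <= 1).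
  { split; apply Rmult_le_reg_r with m; try lra; rewrite Hq; nra. }
  assert (Hs : sqrt (1 - Rsqr (a / m)) * m = Rabs b).
  { rewrite <- (sqrt_Rsqr_abs b).
    rewrite <- (sqrt_Rsqr m) at 2 by lra.
    rewrite <- sqrt_mult; unfold Rsqr; [f_equal|nra|nra].
    transitivity (m * m - (a / m * m) * (a / m * m)); [ring|rewrite Hq; lra]. }
  assert (Hexp : forall y : R, (m * Cexp (Ci * y))%C = (m * cos y, m * sin y)).
  { intros y. unfold Cexp.
    replace (Re (Ci * y)) with 0 by (cbn; ring).
    replace (Im (Ci * y)) with y by (cbn; ring).
    rewrite exp_0; unfold Cmult; cbn [fst snd RtoC]; f_equal; ring. }
  pose proof (acos_bound (a / m)) as Hb.
  pose proof (cos_acos (a / m) Hq1) as Hc.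
  pose proof (sin_acos (a / m) Hq1) as Hsn.
  destruct (Rle_dec 0 b) as [Hb0|Hb0].
  - split; [pose proof PI_RGT_0; lra|].
    rewrite Hexp, Hc, Hsn, (Rabs_right b) in * by lra; f_equal; lra.
  - rewrite (Rabs_left b) in Hs by lra. split.
    + assert (acos (a / m) <> PI).
      { intros E. rewrite E, sin_PI in Hsn. rewrite <- Hsn in Hs. lra. }
      lra.
    + rewrite Hexp, cos_neg, sin_neg, Hc, Hsn; f_equal; lra.
Qed.

(* The value at 0 is singled out because [Rpower 0 y = 1] in Stdlib. *)
Definition Croot (n : nat) (z : C) : C :=
  if Ceq_dec z 0%C then 0%C
  else (Rpower (Cmod z) (/ INR n) * Cexp (Ci * (Carg z / INR n)%R))%C.

Definition alpha : C := Cexp (2 * PI * Ci / 3).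
Definition sigmaC (l : C) : C := (Cexp (Ci * PI / 4) * Croot 2 (Ci * l))%C.
Definition rhoC (l : C) : C := (Cexp (- (Ci * PI / 6)) * Croot 3 (Ci * l))%C.

(** * Half line Fourier transforms *)

(* Total operators: meaningful where the improper integral converges, in
   particular for [Im k <= 0] (resp. [Im k >= 0]) and rapidly decaying [f]. *)
Definition hat_pos (f : R -> C) (k : C) : C :=
  RInt_gen (V := C_R_CompleteNormedModule)
    (fun x : R => Cexp (- (Ci * k * x)) * f x)%C
    (at_point 0) (Rbar_locally p_infty).

Definition hat_neg (f : R -> C) (k : C) : C :=
  RInt_gen (V := C_R_CompleteNormedModule)
    (fun x : R => Cexp (- (Ci * k * x)) * f x)%C
    (Rbar_locally m_infty) (at_point 0).

(** * Contour integrals *)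

Inductive piece : Type :=
  | Segment (a b : C)
  | Arc (c : C) (r th0 th1 : R).   (* s |-> c + r e^{is}, s from th0 to th1 *)

Definition is_piece_int (F : C -> C) (p : piece) (I : C) : Prop :=
  match p with
  | Segment a b =>
      is_RInt (V := C_R_NormedModule)
        (fun s : R => F (a + s * (b - a)) * (b - a))%C 0 1 I
  | Arc c r th0 th1 =>
      is_RInt (V := C_R_NormedModule)
        (fun s : R => F (c + r * Cexp (Ci * s)) * (Ci * r * Cexp (Ci * s)))%C
        th0 th1 I
  end.

Fixpoint is_path_int (F : C -> C) (l : list piece) (I : C) : Prop :=
  match l with
  | nil => I = 0%C
  | p :: l' => exists I1 I2 : C,
      is_piece_int F p I1 /\ is_path_int F l' I2 /\ I = (I1 + I2)%C
  end.

(* An unbounded contour is given by its parts in [|k| <= K], for [K] large. *)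
Definition contour : Type := R -> list piece.

Definition is_contour_int (F : C -> C) (G : contour) (I : C) : Prop :=
  filterlimi (fun K : R => is_path_int F (G K)) (Rbar_locally p_infty)
    (locally (T := C_UniformSpace) I).

Definition real_line : contour := fun K => [Segment (- K)%R K].

(* Boundary of [{k : th1 < arg k < th2}], with the sector to its left. *)
Definition sector_boundary (th1 th2 : R) : contour := fun K =>
  [Segment (K * Cexp (Ci * th2))%C 0%C; Segment 0%C (K * Cexp (Ci * th1))%C].

Definition C_S : contour := sector_boundary 0 (PI / 2).
Definition C_3 : contour := sector_boundary (PI / 3) (2 * PI / 3).

(* Boundary of the union of the upper half plane and the ball [B(0,r)]. *)
Definition R_tilde (r : R) : contour := fun K =>
  [Segment (- K)%R (- r)%R; Arc 0%C r (- PI) 0; Segment r K].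

(** * Data and solutions *)

Definition schwartz (f : R -> C) : Prop :=
  exists D : nat -> R -> C,
    (forall x, D 0%nat x = f x) /\
    (forall n x, is_derive (V := C_R_NormedModule) (D n) x (D (S n) x)) /\
    (forall m n : nat, exists M : R, forall x,
        Rabs x ^ m * Cmod (D n x) <= M).

(* Derivative relative to [D]: one-sided at the endpoints of an interval. *)
Definition is_derive_within (D : R -> Prop) (f : R -> C) (x : R) (l : C)
  : Prop :=
  filterdiff (V := C_R_NormedModule) f (within D (locally x))
    (fun h : R => scal h (l : C_R_NormedModule)).

(* [X] is a closed half line with endpoint 0 and [e] its infinite end.  For
   [e = m_infty] the integral of [g] runs from 0 to [m_infty], which only
   changes its sign.  Riemann integrability of [g] is no loss compared with
   Lebesgue's: for [f] continuous, the least majorant [sup_t |f x t|] is a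
   continuous function of [x]. *)
Definition admissible (X : R -> Prop) (e : Rbar) (T : R) (f : R -> R -> C)
  : Prop :=
  continuous_on (U := C_UniformSpace)
    (fun p : R * R => X (fst p) /\ 0 <= snd p <= T)
    (fun p : R * R => f (fst p) (snd p)) /\
  (forall t, 0 <= t <= T ->
     filterlim (fun x => f x t) (Rbar_locally e)
       (locally (T := C_UniformSpace) (RtoC 0))) /\
  (exists g : R -> R,
     ex_RInt_gen g (at_point 0) (Rbar_locally e) /\
     forall x t, X x -> 0 <= t <= T -> Cmod (f x t) <= g x).

(* [ut] is the t derivative of [u] and [ux j] its j-th x derivative, j <= n. *)
Definition regular (X : R -> Prop) (e : Rbar) (T : R) (n : nat)
    (u ut : R -> R -> C) (ux : nat -> R -> R -> C) : Prop :=
  (forall x t, X x -> 0 <= t <= T ->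
     ux 0%nat x t = u x t /\
     is_derive_within (fun s => 0 <= s <= T) (fun s => u x s) t (ut x t) /\
     forall j, (j < n)%nat ->
       is_derive_within X (fun y => ux j y t) x (ux (S j) x t)) /\
  admissible X e T ut /\
  (forall j, (j <= n)%nat -> admissible X e T (ux j)).

Definition interface_solution (T : R) (w0 v0 : R -> C) (w v : R -> R -> C)
  : Prop :=
  exists (wt vt : R -> R -> C) (wx vx : nat -> R -> R -> C),
    regular (fun x => x <= 0) m_infty T 2 w wt wx /\
    regular (fun x => 0 <= x) p_infty T 3 v vt vx /\
    (forall x t, x < 0 -> 0 < t < T ->
       (Ci * wt x t + wx 2%nat x t = 0)%C) /\
    (forall x t, 0 < x -> 0 < t < T -> (vt x t + vx 3%nat x t = 0)%C) /\
    (forall x, x < 0 -> w x 0 = w0 x) /\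
    (forall x, 0 < x -> v x 0 = v0 x) /\
    (forall j t, (j <= 1)%nat -> 0 <= t <= T -> wx j 0 t = vx j 0 t).

Definition interface_term (w0 v0 : R -> C) (k : C) : C :=
  (((1 - alpha ^ 2) * rhoC k * hat_neg w0 (sigmaC k)
      - hat_pos v0 (rhoC k) + hat_pos v0 (alpha ^ 2 * rhoC k))
   / ((alpha - 1) * rhoC k * (rhoC k + alpha ^ 2 * sigmaC k)))%C.

(* Main.v *)
(** On each half line the equation, multiplied by an exponential solution of the adjoint problem, is a
    divergence.  For [Im lam <= 0] this relates the transforms of the solution at the times [0] and [T] to the
    transforms over [[0, T]] in time, with kernel [e^{-i lam t}], of the solution and its x derivatives at a
    point.  Using the decaying exponentials, with [sigma^2 = -lam] for [w] and with the cube roots [rho],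
    [alpha^2 rho] of [lam] for [v], the interface conditions leave a linear system for these time transforms,
    and the transform of [w(x, .)] or [v(x, .)] becomes [N_0(lam) - e^{-i lam T} N_T(lam)], where [N_0] and
    [N_T] depend only on the data at times [0] and [T].

    Integrating against [e^{i lam t}] over the lower half of [|lam| = K] inverts the time transform as
    [K -> oo], and the contribution of [N_T] vanishes by Jordan's lemma since [t < T].  In [u = ln lam] the
    roots are entire.  The arc for the part of [N_0] containing the interface value is deformed into the third
    contour; for the remaining parts, [k = sigma] or [k = alpha rho] turns the arc into arcs in the k plane
    which, up to arcs whose contribution vanishes, close the rays of the first two contours.  The integrals
    over these rays converge because they decay exponentially or, on the real line, because the transform is
    [i f(0) / k + O(1/k^2)] and the phase oscillates. *)

Require Import Defs.
From Stdlib Require Import Reals Lra Lia FunctionalExtensionality.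
From Coquelicot Require Import Coquelicot.
Open Scope R_scope.


(** The functionals [N_0] and [N_T] cannot be written with full half line transforms alone. At
    distance [a] from the interface the exponential that grows away from the interface is bounded
    only relative to its value at [a], so it is paired with the data on [(0, a)], and the decaying
    ones with the data beyond [a]. The integral over the real line has to be cut at [a] in the same
    way before it can be deformed; afterwards every arc is either one produced by [N_0] or one that
    vanishes. The linear system has no exceptional [lam] because [rho] and [alpha^2 sigma] enclose
    an acute angle throughout the lower half plane, which also bounds the denominator from below.
    Transforms of the data are holomorphic only inside a half plane, while the contours run along
    its boundary. Hence Cauchy's theorem is derived from Green's theorem for functions that are
    continuously differentiable up to the boundary, and transforms are extended past the real axis
    by a projection. Nothing is estimated along the third contour: its integral converges because
    all other terms of the limit do. *)

Definition CInt (f : R -> C) (a b : R) : C := RInt (V := C_R_CompleteNormedModule) f a b.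
Notation is_CInt := (is_RInt (V := C_R_NormedModule)).
Notation ex_CInt := (ex_RInt (V := C_R_NormedModule)).
Notation Ccont := (continuous (U := C_UniformSpace)).
Notation CRderive := (is_derive (K := R_AbsRing) (V := C_R_NormedModule)).

(** * Elementary inequalities for the modulus *)

Lemma C_ext (z w : C) : Re z = Re w -> Im z = Im w -> z = w.
Proof. destruct z, w; simpl; intros; subst; reflexivity. Qed.

Lemma norm_C_R (z : C) : norm (z : C_R_NormedModule) = Cmod z.
Proof.
  destruct z as [a b]. unfold Cmod. cbn.
  unfold prod_norm. cbn. f_equal.
  unfold norm; simpl. unfold abs; simpl.
  f_equal; rewrite !Rmult_1_r; rewrite <- Rabs_mult; apply Rabs_pos_eq; nra.
Qed.

Lemma im_le_Cmod (z : C) : Rabs (Im z) <= Cmod z.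
Proof.
  destruct z as [a b]; simpl. unfold Cmod; simpl.
  rewrite <- sqrt_Rsqr_abs. apply sqrt_le_1; unfold Rsqr; nra.
Qed.

Lemma Cmod_le_abs (z : C) : Cmod z <= Rabs (Re z) + Rabs (Im z).
Proof.
  destruct z as [a b]; simpl.
  replace (a, b) with (RtoC a + Ci * RtoC b)%C
    by (apply C_ext; simpl; ring).
  eapply Rle_trans; [apply Cmod_triangle|].
  rewrite Cmod_mult, Cmod_Ci, !Cmod_R. lra.
Qed.

Lemma Cmod_minus_triangle (z w : C) : Cmod (z - w) <= Cmod z + Cmod w.
Proof. unfold Cminus. rewrite <- (Cmod_opp w). apply Cmod_triangle. Qed.

Lemma Cmod_minus_sym (z w : C) : Cmod (z - w) = Cmod (w - z).
Proof. rewrite <- Cmod_opp. f_equal. ring. Qed.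

(** * The complex exponential *)

Lemma Cexp_plus (z w : C) : Cexp (z + w) = (Cexp z * Cexp w)%C.
Proof.
  destruct z as [a b], w as [c d]. unfold Cexp. apply C_ext; simpl;
  rewrite exp_plus, ?cos_plus, ?sin_plus; ring.
Qed.

Lemma Cexp_0 : Cexp 0 = 1%C.
Proof. apply C_ext; simpl; rewrite exp_0, ?cos_0, ?sin_0; ring. Qed.

Lemma Cexp_neq_0 (z : C) : Cexp z <> 0%C.
Proof.
  intros H. assert (E : (Cexp z * Cexp (- z) = 1)%C).
  { rewrite <- Cexp_plus. replace (z + - z)%C with (RtoC 0) by ring. apply Cexp_0. }
  rewrite H in E. apply (f_equal Re) in E. simpl in E. lra.
Qed.

Lemma Cexp_R (x : R) : Cexp (RtoC x) = RtoC (exp x).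
Proof. apply C_ext; simpl; rewrite ?cos_0, ?sin_0; ring. Qed.

Lemma Cmod_Cexp (z : C) : Cmod (Cexp z) = exp (Re z).
Proof.
  unfold Cexp, Cmod; simpl.
  rewrite !Rmult_1_r.
  replace (_ + _) with (exp (Re z) * exp (Re z) * (Rsqr (sin (Im z)) + Rsqr (cos (Im z))))
    by (unfold Rsqr; ring).
  rewrite sin2_cos2, Rmult_1_r. apply sqrt_square. left; apply exp_pos.
Qed.

(** * Continuity of complex valued functions *)

Section Continuity.
Context {U : UniformSpace}.

Lemma Ccont_pair (f g : U -> R) (x : U) :
  continuous f x -> continuous g x -> Ccont (fun y => (f y, g y)) x.
Proof.
  intros Hf Hg P [e He]. unfold filtermap.
  apply (filter_imp (fun y => ball (f x) e (f y) /\ ball (g x) e (g y))).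
  - intros y [H1 H2]. apply He. now split.
  - apply filter_and.
    + exact (Hf _ (locally_ball (f x) e)).
    + exact (Hg _ (locally_ball (g x) e)).
Qed.

Lemma Ccont_Re (f : U -> C) (x : U) : Ccont f x -> continuous (fun y => Re (f y)) x.
Proof.
  intros Hf P [e He]. unfold filtermap.
  apply (filter_imp (fun y => ball (f x : C_UniformSpace) e (f y))).
  - intros y [H1 H2]. now apply He.
  - exact (Hf _ (locally_ball (f x : C_UniformSpace) e)).
Qed.

Lemma Ccont_Im (f : U -> C) (x : U) : Ccont f x -> continuous (fun y => Im (f y)) x.
Proof.
  intros Hf P [e He]. unfold filtermap.
  apply (filter_imp (fun y => ball (f x : C_UniformSpace) e (f y))).
  - intros y [H1 H2]. now apply He.
  - exact (Hf _ (locally_ball (f x : C_UniformSpace) e)).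
Qed.

Lemma Ccont_RtoC (f : U -> R) (x : U) : continuous f x -> Ccont (fun y => RtoC (f y)) x.
Proof. intros Hf. apply Ccont_pair; [exact Hf|apply continuous_const]. Qed.

Lemma Ccont_plus (f g : U -> C) (x : U) :
  Ccont f x -> Ccont g x -> Ccont (fun y => (f y + g y)%C) x.
Proof.
  intros Hf Hg. apply Ccont_pair.
  - exact (continuous_plus (V := R_NormedModule) _ _ _ (Ccont_Re f x Hf) (Ccont_Re g x Hg)).
  - exact (continuous_plus (V := R_NormedModule) _ _ _ (Ccont_Im f x Hf) (Ccont_Im g x Hg)).
Qed.

Lemma Ccont_opp (f : U -> C) (x : U) : Ccont f x -> Ccont (fun y => (- f y)%C) x.
Proof.
  intros Hf. apply Ccont_pair.
  - exact (continuous_opp (V := R_NormedModule) _ _ (Ccont_Re f x Hf)).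
  - exact (continuous_opp (V := R_NormedModule) _ _ (Ccont_Im f x Hf)).
Qed.

Lemma Ccont_minus (f g : U -> C) (x : U) :
  Ccont f x -> Ccont g x -> Ccont (fun y => (f y - g y)%C) x.
Proof. intros. apply Ccont_plus; [|apply Ccont_opp]; assumption. Qed.

Lemma Ccont_mult (f g : U -> C) (x : U) :
  Ccont f x -> Ccont g x -> Ccont (fun y => (f y * g y)%C) x.
Proof.
  intros Hf Hg.
  pose proof (Ccont_Re f x Hf) as f1. pose proof (Ccont_Im f x Hf) as f2.
  pose proof (Ccont_Re g x Hg) as g1. pose proof (Ccont_Im g x Hg) as g2.
  apply Ccont_pair.
  - exact (continuous_minus (V := R_NormedModule) _ _ _
      (continuous_mult (K := R_AbsRing) _ _ _ f1 g1) (continuous_mult (K := R_AbsRing) _ _ _ f2 g2)).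
  - exact (continuous_plus (V := R_NormedModule) _ _ _
      (continuous_mult (K := R_AbsRing) _ _ _ f1 g2) (continuous_mult (K := R_AbsRing) _ _ _ f2 g1)).
Qed.

Lemma Ccont_Cexp (f : U -> C) (x : U) : Ccont f x -> Ccont (fun y => Cexp (f y)) x.
Proof.
  intros Hf. pose proof (Ccont_Re _ _ Hf) as H1. pose proof (Ccont_Im _ _ Hf) as H2.
  apply Ccont_pair; apply (continuous_mult (K := R_AbsRing)).
  - apply (continuous_comp (fun y => Re (f y)) exp); [exact H1|apply continuous_exp].
  - apply (continuous_comp (fun y => Im (f y)) cos); [exact H2|apply continuous_cos].
  - apply (continuous_comp (fun y => Re (f y)) exp); [exact H1|apply continuous_exp].
  - apply (continuous_comp (fun y => Im (f y)) sin); [exact H2|apply continuous_sin].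
Qed.

Lemma Ccont_inv (f : U -> C) (x : U) :
  Ccont f x -> f x <> 0%C -> Ccont (fun y => (/ f y)%C) x.
Proof.
  intros Hf Hn. pose proof (Ccont_Re _ _ Hf) as H1. pose proof (Ccont_Im _ _ Hf) as H2.
  assert (Hd : Re (f x) ^ 2 + Im (f x) ^ 2 <> 0).
  { intros E. apply Hn. apply C_ext; simpl; nra. }
  assert (Hi : continuous (fun y => / (Re (f y) ^ 2 + Im (f y) ^ 2)) x).
  { apply (continuous_comp (fun y => Re (f y) ^ 2 + Im (f y) ^ 2) Rinv).
    - apply (continuous_plus (V := R_NormedModule)); simpl;
      apply (continuous_mult (K := R_AbsRing)); try assumption;
      apply (continuous_mult (K := R_AbsRing)); try assumption; apply continuous_const.
    - now apply continuous_Rinv. }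
  apply Ccont_pair; apply (continuous_mult (K := R_AbsRing)); try exact Hi.
  - exact H1.
  - apply (continuous_opp (V := R_NormedModule)); exact H2.
Qed.

Lemma Ccont_const (c : C) (x : U) : Ccont (fun _ => c) x.
Proof. apply continuous_const. Qed.

Lemma Ccont_pow (f : U -> C) (n : nat) (x : U) : Ccont f x -> Ccont (fun y => (f y ^ n)%C) x.
Proof.
  intros Hf. induction n; simpl; [apply Ccont_const|now apply Ccont_mult].
Qed.

Lemma continuous_Cmod (f : U -> C) (x : U) : Ccont f x -> continuous (fun y => Cmod (f y)) x.
Proof.
  intros Hf. pose proof (Ccont_Re _ _ Hf) as H1. pose proof (Ccont_Im _ _ Hf) as H2.
  unfold Cmod.
  apply (continuous_comp (fun y => fst (f y) ^ 2 + snd (f y) ^ 2) sqrt).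
  - apply (continuous_plus (V := R_NormedModule)); simpl;
    apply (continuous_mult (K := R_AbsRing)); try assumption;
    apply (continuous_mult (K := R_AbsRing)); try assumption; apply continuous_const.
  - apply continuous_sqrt.
Qed.

Lemma Rcont_mult (f g : U -> R) x : continuous f x -> continuous g x ->
  continuous (fun y => f y * g y) x.
Proof. apply (continuous_mult (K := R_AbsRing)). Qed.
Lemma Rcont_plus (f g : U -> R) x : continuous f x -> continuous g x ->
  continuous (fun y => f y + g y) x.
Proof. apply (continuous_plus (V := R_NormedModule)). Qed.
Lemma Rcont_minus (f g : U -> R) x : continuous f x -> continuous g x ->
  continuous (fun y => f y - g y) x.
Proof. apply (continuous_minus (V := R_NormedModule)). Qed.
Lemma Rcont_opp (f : U -> R) x : continuous f x -> continuous (fun y => - f y) x.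
Proof. apply (continuous_opp (V := R_NormedModule)). Qed.

End Continuity.

Lemma Ccont_comp {U : UniformSpace} (g : U -> C) (f : C -> C) (x : U) :
  Ccont g x -> continuous (T:=C_UniformSpace) (U:=C_UniformSpace) f (g x) -> Ccont (fun y => f (g y)) x.
Proof. intros. now apply (continuous_comp g f). Qed.

Create HintDb ccont.
#[export] Hint Resolve Ccont_RtoC Ccont_plus Ccont_opp Ccont_minus Ccont_mult
  Ccont_Cexp Ccont_const Ccont_pow continuous_Cmod Rcont_mult Rcont_plus
  Rcont_minus Rcont_opp continuous_id continuous_const Ccont_Re Ccont_Im : ccont.
Ltac ccont := auto 40 with ccont.

(* [ring] needs the carrier [C] rather than a module structure on it. *)
Ltac cring := cbv beta; match goal with |- @eq _ ?a ?b => change (@eq C a b) end; first [ring | simpl; ring | simpl].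

(** * Derivatives of complex valued functions of a real variable *)

(** The derivative lives in a normed module over the reals, so [f] is written as
    [Re f * 1 + Im f * i] with real coefficients. *)
Lemma CRderive_pair (f : R -> C) (x : R) (l : C) :
  is_derive (fun y => Re (f y)) x (Re l) -> is_derive (fun y => Im (f y)) x (Im l) ->
  CRderive f x l.
Proof.
  intros H1 H2.
  apply (is_derive_ext (V := C_R_NormedModule)
    (fun y => plus (scal (Re (f y)) (RtoC 1 : C_R_NormedModule)) (scal (Im (f y)) (Ci : C_R_NormedModule)))).
  - intros y. apply C_ext; simpl; unfold scal, plus; simpl; unfold mult; simpl; ring.
  - replace (l : C_R_NormedModule) with (plus (scal (Re l) (RtoC 1 : C_R_NormedModule)) (scal (Im l) (Ci : C_R_NormedModule)))
      by (apply C_ext; simpl; unfold scal, plus; simpl; unfold mult; simpl; ring).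
    apply (is_derive_plus (V := C_R_NormedModule)); now apply (is_derive_scal_l (V := C_R_NormedModule)).
Qed.

Lemma CRderive_Re (f : R -> C) (x : R) (l : C) :
  CRderive f x l -> is_derive (fun y => Re (f y)) x (Re l).
Proof.
  intros H. unfold is_derive in *.
  apply (filterdiff_comp (V := C_R_NormedModule) f (fun z : C => fst z)
    (fun y : R => scal y (l : C_R_NormedModule)) (fun z : C => fst z) H).
  apply filterdiff_linear, is_linear_fst.
Qed.

Lemma CRderive_Im (f : R -> C) (x : R) (l : C) :
  CRderive f x l -> is_derive (fun y => Im (f y)) x (Im l).
Proof.
  intros H. unfold is_derive in *.
  apply (filterdiff_comp (V := C_R_NormedModule) f (fun z : C => snd z)
    (fun y : R => scal y (l : C_R_NormedModule)) (fun z : C => snd z) H).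
  apply filterdiff_linear, is_linear_snd.
Qed.

Lemma CRderive_eq (f : R -> C) (x : R) (l l' : C) : CRderive f x l -> l = l' -> CRderive f x l'.
Proof. now intros ? <-. Qed.

Lemma CRderive_const (c : C) (x : R) : CRderive (fun _ => c) x (RtoC 0).
Proof. apply CRderive_pair; apply (is_derive_const (V := R_NormedModule)). Qed.

Lemma CRderive_RtoC (x : R) : CRderive (fun y => RtoC y) x (RtoC 1).
Proof. apply CRderive_pair; simpl; [apply (is_derive_id (K := R_AbsRing))|apply (is_derive_const (V := R_NormedModule))]. Qed.

Lemma CRderive_real (f : R -> R) (x l : R) : is_derive f x l -> CRderive (fun y => RtoC (f y)) x (RtoC l).
Proof. intros H. apply CRderive_pair; [exact H|]. apply (is_derive_const (V := R_NormedModule) 0). Qed.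

Lemma CRderive_plus (f g : R -> C) (x : R) (a b : C) :
  CRderive f x a -> CRderive g x b -> CRderive (fun y => (f y + g y)%C) x (a + b)%C.
Proof. apply (is_derive_plus (V := C_R_NormedModule)). Qed.

Lemma CRderive_opp (f : R -> C) (x : R) (a : C) :
  CRderive f x a -> CRderive (fun y => (- f y)%C) x (- a)%C.
Proof. apply (is_derive_opp (V := C_R_NormedModule)). Qed.

Lemma CRderive_minus (f g : R -> C) (x : R) (a b : C) :
  CRderive f x a -> CRderive g x b -> CRderive (fun y => (f y - g y)%C) x (a - b)%C.
Proof. intros. apply CRderive_plus; [|apply CRderive_opp]; assumption. Qed.

Lemma CRderive_mult (f g : R -> C) (x : R) (a b : C) :
  CRderive f x a -> CRderive g x b ->
  CRderive (fun y => (f y * g y)%C) x (a * g x + f x * b)%C.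
Proof.
  intros Hf Hg.
  pose proof (CRderive_Re _ _ _ Hf). pose proof (CRderive_Im _ _ _ Hf).
  pose proof (CRderive_Re _ _ _ Hg). pose proof (CRderive_Im _ _ _ Hg).
  assert (M : forall u v x a b, is_derive u x a -> is_derive v x b ->
    is_derive (fun y => u y * v y) x (a * v x + u x * b)).
  { intros u v x0 a0 b0 Hu Hv. apply (is_derive_mult (K := R_AbsRing) u v x0 a0 b0 Hu Hv).
    intros; apply Rmult_comm. }
  apply CRderive_pair.
  - replace (Re (a * g x + f x * b)) with
      ((Re a * Re (g x) + Re (f x) * Re b) - (Im a * Im (g x) + Im (f x) * Im b))
      by (simpl; unfold Re, Im; ring).
    apply (is_derive_minus (V := R_NormedModule) (fun t => Re (f t) * Re (g t)) (fun t => Im (f t) * Im (g t)));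
    now apply M.
  - replace (Im (a * g x + f x * b)) with
      ((Re a * Im (g x) + Re (f x) * Im b) + (Im a * Re (g x) + Im (f x) * Re b))
      by (simpl; unfold Re, Im; ring).
    apply (is_derive_plus (V := R_NormedModule) (fun t => Re (f t) * Im (g t)) (fun t => Im (f t) * Re (g t)));
    now apply M.
Qed.

Lemma CRderive_cmult (c : C) (f : R -> C) (x : R) (a : C) :
  CRderive f x a -> CRderive (fun y => (c * f y)%C) x (c * a)%C.
Proof.
  intros H. eapply CRderive_eq; [apply CRderive_mult; [apply CRderive_const|exact H]|].
  simpl. ring.
Qed.

Lemma CRderive_Cexp (f : R -> C) (x : R) (a : C) :
  CRderive f x a -> CRderive (fun y => Cexp (f y)) x (a * Cexp (f x))%C.
Proof.
  intros Hf.
  pose proof (CRderive_Re _ _ _ Hf) as H1. pose proof (CRderive_Im _ _ _ Hf) as H2.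
  assert (M : forall (u v : R -> R) c d, is_derive u x c -> is_derive v x d ->
    is_derive (fun y => exp (u y) * cos (v y)) x (c * exp (u x) * cos (v x) - exp (u x) * (d * sin (v x))) /\
    is_derive (fun y => exp (u y) * sin (v y)) x (c * exp (u x) * sin (v x) + exp (u x) * (d * cos (v x)))).
  { intros u v c d Hu Hv. split; auto_derive;
    try (repeat split; eexists; eassumption);
    replace (Derive (fun x => u x) x) with c by (symmetry; exact (is_derive_unique u x c Hu));
    replace (Derive (fun x => v x) x) with d by (symmetry; exact (is_derive_unique v x d Hv)); ring. }
  destruct (M _ _ _ _ H1 H2) as [M1 M2].
  apply CRderive_pair.
  - replace (Re (a * Cexp (f x))) with (Re a * exp (Re (f x)) * cos (Im (f x)) - exp (Re (f x)) * (Im a * sin (Im (f x))))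
      by (simpl; unfold Re, Im; ring). exact M1.
  - replace (Im (a * Cexp (f x))) with (Re a * exp (Re (f x)) * sin (Im (f x)) + exp (Re (f x)) * (Im a * cos (Im (f x))))
      by (simpl; unfold Re, Im; ring). exact M2.
Qed.

Lemma CRderive_Ccont (f : R -> C) (x : R) (l : C) : CRderive f x l -> Ccont f x.
Proof.
  intros H. apply (ex_derive_continuous (V := C_R_NormedModule) f). now exists l.
Qed.

(** * Integrals of complex valued functions *)

Lemma ex_CInt_cont (f : R -> C) (a b : R) :
  (forall z, Rmin a b <= z <= Rmax a b -> Ccont f z) -> ex_CInt f a b.
Proof. apply (ex_RInt_continuous (V := C_R_CompleteNormedModule)). Qed.

Lemma ex_CInt_le (f : R -> C) (a b : R) : a <= b ->
  (forall z, a <= z <= b -> Ccont f z) -> ex_CInt f a b.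
Proof. intros. apply ex_CInt_cont. rewrite Rmin_left, Rmax_right by lra. assumption. Qed.

Lemma CInt_correct (f : R -> C) (a b : R) : ex_CInt f a b -> is_CInt f a b (CInt f a b).
Proof. apply (RInt_correct (V := C_R_CompleteNormedModule)). Qed.

Lemma is_CInt_unique (f : R -> C) (a b : R) (l : C) : is_CInt f a b l -> CInt f a b = l.
Proof. apply (is_RInt_unique (V := C_R_CompleteNormedModule)). Qed.

Lemma is_CInt_pair (f : R -> C) (a b : R) (l : C) :
  is_RInt (fun t => Re (f t)) a b (Re l) -> is_RInt (fun t => Im (f t)) a b (Im l) ->
  is_CInt f a b l.
Proof.
  intros H1 H2. replace l with (Re l, Im l) by now destruct l.
  now apply (is_RInt_fct_extend_pair (U := R_NormedModule) (V := R_NormedModule)).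
Qed.

Lemma is_CInt_Re (f : R -> C) (a b : R) (l : C) :
  is_CInt f a b l -> is_RInt (fun t => Re (f t)) a b (Re l).
Proof. apply (is_RInt_fct_extend_fst (U := R_NormedModule) (V := R_NormedModule)). Qed.

Lemma is_CInt_Im (f : R -> C) (a b : R) (l : C) :
  is_CInt f a b l -> is_RInt (fun t => Im (f t)) a b (Im l).
Proof. apply (is_RInt_fct_extend_snd (U := R_NormedModule) (V := R_NormedModule)). Qed.

Lemma is_CInt_ext (f g : R -> C) (a b : R) (l : C) :
  (forall x, Rmin a b < x < Rmax a b -> f x = g x) -> is_CInt f a b l -> is_CInt g a b l.
Proof. apply (is_RInt_ext (V := C_R_NormedModule)). Qed.

Lemma is_CInt_plus (f g : R -> C) (a b : R) (lf lg : C) :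
  is_CInt f a b lf -> is_CInt g a b lg -> is_CInt (fun y => (f y + g y)%C) a b (lf + lg)%C.
Proof. apply (is_RInt_plus (V := C_R_NormedModule)). Qed.

Lemma is_CInt_minus (f g : R -> C) (a b : R) (lf lg : C) :
  is_CInt f a b lf -> is_CInt g a b lg -> is_CInt (fun y => (f y - g y)%C) a b (lf - lg)%C.
Proof. apply (is_RInt_minus (V := C_R_NormedModule)). Qed.

Lemma is_CInt_opp (f : R -> C) (a b : R) (lf : C) :
  is_CInt f a b lf -> is_CInt (fun y => (- f y)%C) a b (- lf)%C.
Proof. apply (is_RInt_opp (V := C_R_NormedModule)). Qed.

(** Linearity of the integral covers real scalars only, whence the passage through real and
    imaginary parts. *)
Lemma is_CInt_cmult (c : C) (f : R -> C) (a b : R) (l : C) :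
  is_CInt f a b l -> is_CInt (fun y => (c * f y)%C) a b (c * l)%C.
Proof.
  intros H. pose proof (is_CInt_Re _ _ _ _ H) as H1. pose proof (is_CInt_Im _ _ _ _ H) as H2.
  apply is_CInt_pair.
  - apply (is_RInt_minus (V := R_NormedModule) (fun y => Re c * Re (f y)) (fun y => Im c * Im (f y)));
    now apply (is_RInt_scal (V := R_NormedModule)).
  - apply (is_RInt_plus (V := R_NormedModule) (fun y => Re c * Im (f y)) (fun y => Im c * Re (f y)));
    now apply (is_RInt_scal (V := R_NormedModule)).
Qed.

Lemma is_CInt_swap (f : R -> C) (a b : R) (l : C) :
  is_CInt f a b l -> is_CInt f b a (- l)%C.
Proof. intros H. apply (is_RInt_swap (V := C_R_NormedModule)) in H. exact H. Qed.

Lemma is_CInt_lin (f : R -> C) (u v a b : R) (l : C) :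
  is_CInt f (u * a + v) (u * b + v) l ->
  is_CInt (fun y => (u * f (u * y + v)%R)%C) a b l.
Proof.
  intros H. apply (is_RInt_comp_lin (V := C_R_NormedModule)) in H.
  eapply is_CInt_ext; [|exact H]. intros x _. apply C_ext; unfold scal; simpl;
  unfold scal; simpl; unfold mult; simpl; ring.
Qed.

Lemma CInt_ext (f g : R -> C) (a b : R) :
  (forall x, Rmin a b < x < Rmax a b -> f x = g x) -> CInt f a b = CInt g a b.
Proof. apply (RInt_ext (V := C_R_CompleteNormedModule)). Qed.

Lemma CInt_Chasles (f : R -> C) (a b c : R) :
  ex_CInt f a b -> ex_CInt f b c -> (CInt f a b + CInt f b c)%C = CInt f a c.
Proof. apply (RInt_Chasles (V := C_R_CompleteNormedModule)). Qed.

Lemma CInt_plus (f g : R -> C) (a b : R) : ex_CInt f a b -> ex_CInt g a b ->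
  CInt (fun y => (f y + g y)%C) a b = (CInt f a b + CInt g a b)%C.
Proof. apply (RInt_plus (V := C_R_CompleteNormedModule)). Qed.

Lemma CInt_minus (f g : R -> C) (a b : R) : ex_CInt f a b -> ex_CInt g a b ->
  CInt (fun y => (f y - g y)%C) a b = (CInt f a b - CInt g a b)%C.
Proof. apply (RInt_minus (V := C_R_CompleteNormedModule)). Qed.

Lemma CInt_cmult (c : C) (f : R -> C) (a b : R) : ex_CInt f a b ->
  CInt (fun y => (c * f y)%C) a b = (c * CInt f a b)%C.
Proof. intros H. apply is_CInt_unique, is_CInt_cmult, CInt_correct, H. Qed.

Lemma CInt_pair (f : R -> C) (a b : R) : ex_CInt f a b ->
  CInt f a b = (RInt (fun t => Re (f t)) a b, RInt (fun t => Im (f t)) a b).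
Proof.
  intros H. apply CInt_correct in H. apply C_ext; simpl; symmetry; apply is_RInt_unique.
  - now apply is_CInt_Re in H.
  - now apply is_CInt_Im in H.
Qed.

Lemma Cmod_is_CInt_le (f : R -> C) (g : R -> R) (a b : R) (l : C) (m : R) : a <= b ->
  (forall x, a <= x <= b -> Cmod (f x) <= g x) ->
  is_CInt f a b l -> is_RInt g a b m -> Cmod l <= m.
Proof.
  intros H1 H2 H3 H4. rewrite <- norm_C_R.
  apply (norm_RInt_le (V := C_R_NormedModule) f g a b l m H1); try assumption.
  intros x Hx. rewrite norm_C_R. now apply H2.
Qed.

Lemma Cmod_CInt_le (f : R -> C) (g : R -> R) (a b : R) : a <= b ->
  (forall x, a <= x <= b -> Cmod (f x) <= g x) ->
  ex_CInt f a b -> ex_RInt g a b -> Cmod (CInt f a b) <= RInt g a b.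
Proof.
  intros H1 H2 H3 H4. eapply Cmod_is_CInt_le; eauto.
  - now apply CInt_correct.
  - now apply (RInt_correct (V := R_CompleteNormedModule)).
Qed.

Lemma Cmod_is_CInt_const (f : R -> C) (M : R) (a b : R) (l : C) : a <= b ->
  (forall x, a <= x <= b -> Cmod (f x) <= M) -> is_CInt f a b l -> Cmod l <= (b - a) * M.
Proof.
  intros H1 H2 H3. apply (Cmod_is_CInt_le f (fun _ => M) a b); try assumption.
  apply (is_RInt_const (V := R_NormedModule)).
Qed.

Lemma Cmod_CInt_const (f : R -> C) (M : R) (a b : R) : a <= b ->
  (forall x, a <= x <= b -> Cmod (f x) <= M) ->
  ex_CInt f a b -> Cmod (CInt f a b) <= (b - a) * M.
Proof.
  intros H1 H2 H3. apply (Cmod_is_CInt_const f); try assumption. now apply CInt_correct.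
Qed.

(** Projection onto [[a, b]]. Composition with it extends a function continuous on the interval to
    one continuous everywhere. *)
Definition clamp (a b x : R) : R := Rmax a (Rmin x b).

Lemma clamp_in (a b x : R) : a <= b -> a <= clamp a b x <= b.
Proof. intros. unfold clamp, Rmax, Rmin. repeat destruct Rle_dec; lra. Qed.

Lemma clamp_id (a b x : R) : a <= x <= b -> clamp a b x = x.
Proof. intros. unfold clamp, Rmax, Rmin. repeat destruct Rle_dec; lra. Qed.

Lemma continuous_Rmax_l (a x : R) : continuous (fun y => Rmax a y) x.
Proof.
  apply continuity_pt_filterlim.
  apply (continuity_pt_ext (fun y => (a + y + Rabs (a - y)) / 2)).
  - intros t. unfold Rmax, Rabs. destruct Rle_dec, Rcase_abs; lra.
  - reg.
Qed.

Lemma continuous_clamp (a b x : R) : continuous (clamp a b) x.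
Proof.
  apply (continuous_comp (fun y => Rmin y b) (fun y => Rmax a y)); [|apply continuous_Rmax_l].
  apply continuity_pt_filterlim.
  apply (continuity_pt_ext (fun y => (y + b - Rabs (y - b)) / 2)).
  - intros t. unfold Rmin, Rabs. destruct Rle_dec, Rcase_abs; lra.
  - reg.
Qed.

(** Differentiability is assumed in the open interval only, as the equations hold only there. Minus
    a primitive of the extended [g], the function [f] has zero derivative inside, and the mean value
    theorem makes the difference constant up to the end points. *)
Lemma RInt_FTC (f g : R -> R) (a b : R) : a <= b ->
  (forall x, a <= x <= b -> continuous f x) ->
  (forall x, a <= x <= b -> continuous g x) ->
  (forall x, a < x < b -> is_derive f x (g x)) ->
  is_RInt g a b (f b - f a).
Proof.
  intros Hab Hf Hg Hd.
  assert (Ig : forall y, a <= y <= b -> ex_RInt g a y).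
  { intros y Hy. apply (ex_RInt_continuous (V := R_CompleteNormedModule)).
    rewrite Rmin_left, Rmax_right by lra. intros z Hz. apply Hg. lra. }
  (* extend g by constants, so that its primitive is continuous across the end points *)
  set (G := fun x => g (clamp a b x)).
  assert (HG : forall x, continuous G x).
  { intros x. apply (continuous_comp (clamp a b) g); [apply continuous_clamp|].
    apply Hg, clamp_in, Hab. }
  assert (HGg : forall x, a <= x <= b -> G x = g x).
  { intros x Hx. unfold G. now rewrite clamp_id. }
  assert (HI : forall x, is_derive (fun y => RInt G a y) x (G x)).
  { intros x. apply (is_derive_RInt (V := R_NormedModule) G (fun y => RInt G a y) a x); [|apply HG].
    apply filter_forall. intros y. apply (RInt_correct (V := R_CompleteNormedModule)).
    apply (ex_RInt_continuous (V := R_CompleteNormedModule)). intros; apply HG. }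
  destruct (MVT_gen (fun x => f x - RInt G a x) a b (fun _ => 0)) as [c [_ Hc]].
  - rewrite Rmin_left, Rmax_right by lra. intros x Hx.
    replace 0 with (g x - G x) by (rewrite HGg by lra; ring).
    apply (is_derive_minus (V := R_NormedModule)); [apply Hd; lra|apply HI].
  - rewrite Rmin_left, Rmax_right by lra. intros x Hx.
    apply continuity_pt_filterlim.
    apply (continuous_minus (V := R_NormedModule)); [apply Hf; lra|].
    apply (ex_derive_continuous (V := R_NormedModule)). eexists; apply HI.
  - rewrite RInt_point in Hc. unfold zero in Hc; simpl in Hc.
    replace (f b - f a) with (RInt G a b) by lra.
    apply (is_RInt_ext G).
    + rewrite Rmin_left, Rmax_right by lra. intros; apply HGg; lra.
    + apply (RInt_correct (V := R_CompleteNormedModule)).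
      apply (ex_RInt_continuous (V := R_CompleteNormedModule)). intros; apply HG.
Qed.

Lemma is_CInt_FTC (f g : R -> C) (a b : R) : a <= b ->
  (forall x, a <= x <= b -> Ccont f x) ->
  (forall x, a <= x <= b -> Ccont g x) ->
  (forall x, a < x < b -> CRderive f x (g x)) ->
  is_CInt g a b (f b - f a)%C.
Proof.
  intros Hab Hf Hg Hd. apply is_CInt_pair.
  - apply (RInt_FTC (fun x => Re (f x)) (fun x => Re (g x))); try assumption; intros.
    + now apply Ccont_Re, Hf.
    + now apply Ccont_Re, Hg.
    + now apply CRderive_Re, Hd.
  - apply (RInt_FTC (fun x => Im (f x)) (fun x => Im (g x))); try assumption; intros.
    + now apply Ccont_Im, Hf.
    + now apply Ccont_Im, Hg.
    + now apply CRderive_Im, Hd.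
Qed.

Lemma Ccont_eps {U : UniformSpace} (f : U -> C) (x : U) :
  (forall e : R, 0 < e -> locally x (fun y => Cmod (f y - f x) < e)) -> Ccont f x.
Proof.
  intros H P [e He]. unfold filtermap.
  apply (filter_imp (fun y => Cmod (f y - f x) < e)); [|apply H, cond_pos].
  intros y Hy. apply He. split.
  - eapply Rle_lt_trans; [|exact Hy]. exact (re_le_Cmod (f y - f x)).
  - eapply Rle_lt_trans; [|exact Hy]. exact (im_le_Cmod (f y - f x)).
Qed.

Lemma locally_Cmod (z : C) (P : C -> Prop) (d : R) : 0 < d ->
  (forall w, Cmod (w - z) < d -> P w) -> locally (T := C_UniformSpace) z P.
Proof.
  intros Hd H. assert (Hd2 : 0 < d / 2) by lra. exists (mkposreal _ Hd2).
  intros w [H1 H2]. apply H. eapply Rle_lt_trans; [apply Cmod_le_abs|].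
  change (Rabs (fst w - fst z) < d / 2) in H1. change (Rabs (snd w - snd z) < d / 2) in H2.
  change (Rabs (fst w - fst z) + Rabs (snd w - snd z) < d). lra.
Qed.

Lemma locally_Cmod_inv (z : C) (P : C -> Prop) : locally (T := C_UniformSpace) z P ->
  exists d, 0 < d /\ forall w, Cmod (w - z) < d -> P w.
Proof.
  intros [d Hd]. exists d. split; [apply cond_pos|]. intros w Hw. apply Hd. split.
  - eapply Rle_lt_trans; [|exact Hw]. exact (re_le_Cmod (w - z)).
  - eapply Rle_lt_trans; [|exact Hw]. exact (im_le_Cmod (w - z)).
Qed.

(** * Fubini's theorem on a rectangle *)

Notation cont2 f x y := (continuous (T := prod_UniformSpace R_UniformSpace R_UniformSpace) (U := C_UniformSpace)
  (fun p => f (fst p) (snd p)) (x, y)).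

Lemma RInt_param_continuous_le (f : R -> R -> R) (a b c : R) : a <= b ->
  (forall x y, continuity_2d_pt f x y) -> continuous (fun y => RInt (fun x => f x y) a b) c.
Proof.
  intros Hab Hf.
  assert (Hc : forall y x, continuous (fun x => f x y) x).
  { intros y x. apply (continuous_comp (fun x => (x, y)) (fun p => f (fst p) (snd p))).
    - apply (Ccont_pair (fun x : R => x) (fun _ => y)); [apply continuous_id|apply continuous_const].
    - now apply continuity_2d_pt_filterlim. }
  assert (Ex : forall y, ex_RInt (fun x => f x y) a b).
  { intros y. apply (ex_RInt_continuous (V := R_CompleteNormedModule)). intros; apply Hc. }
  intros P [e He]. unfold filtermap.
  (* The [+ 1] allows [a = b] and makes the final inequality strict. *)
  assert (Hd : 0 < e / (b - a + 1)) by (apply Rdiv_lt_0_compat; [apply cond_pos|lra]).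
  destruct (uniform_continuity_2d_1d f a b c (fun x _ => Hf x c) (mkposreal _ Hd)) as [d H].
  exists d. intros y Hy. apply He.
  change (Rabs (y - c) < d) in Hy. apply Rabs_def2 in Hy.
  change (Rabs (RInt (fun x => f x y) a b - RInt (fun x => f x c) a b) < e).
  assert (E : RInt (fun x => f x y) a b - RInt (fun x => f x c) a b = RInt (fun x => f x y - f x c) a b).
  { symmetry. apply (RInt_minus (V := R_CompleteNormedModule)); apply Ex. }
  rewrite E. eapply Rle_lt_trans.
  - apply abs_RInt_le_const with (M := e / (b - a + 1)); [assumption| |].
    + apply (ex_RInt_minus (V := R_NormedModule)); apply Ex.
    + intros t Ht. left.
      assert (Hdp := cond_pos d). apply H; try lra.
      rewrite Rminus_diag, Rabs_R0. apply cond_pos.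
  - apply Rlt_le_trans with ((b - a + 1) * (e / (b - a + 1))); [nra|].
    right. field. lra.
Qed.

Lemma RInt_param_continuous (f : R -> R -> R) (a b c : R) :
  (forall x y, continuity_2d_pt f x y) -> continuous (fun y => RInt (fun x => f x y) a b) c.
Proof.
  intros Hf. destruct (Rle_dec a b) as [H|H].
  - now apply RInt_param_continuous_le.
  - apply (continuous_ext (fun y => - RInt (fun x => f x y) b a)).
    + intros y. apply (opp_RInt_swap (V := R_CompleteNormedModule)).
      apply (ex_RInt_continuous (V := R_CompleteNormedModule)). intros z _.
      apply (continuous_comp (fun x => (x, y)) (fun p => f (fst p) (snd p))).
      * apply (Ccont_pair (fun x : R => x) (fun _ => y)); [apply continuous_id|apply continuous_const].
      * now apply continuity_2d_pt_filterlim.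
    + apply (continuous_opp (V := R_NormedModule)).
      apply RInt_param_continuous_le; [lra|assumption].
Qed.

(** As functions of the upper limit in [x], the two sides have the same derivative and both vanish
    at [a]. Differentiation under the integral sign looks at a neighbourhood, hence continuity in
    the whole plane. *)
Lemma RInt_fubini_global (f : R -> R -> R) (a b c d : R) : a <= b -> c <= d ->
  (forall x y, continuity_2d_pt f x y) ->
  RInt (fun x => RInt (fun y => f x y) c d) a b = RInt (fun y => RInt (fun x => f x y) a b) c d.
Proof.
  intros Hab Hcd Hf.
  assert (Hf' : forall x y, continuity_2d_pt (fun u v => f v u) x y).
  { intros x y eps. destruct (Hf y x eps) as [dl Hdl]. exists dl. intros u v Hu Hv. now apply Hdl. }
  assert (Hc1 : forall y x, continuous (fun x => f x y) x).
  { intros y x. apply (continuous_comp (fun x => (x, y)) (fun p => f (fst p) (snd p))).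
    - apply (Ccont_pair (fun x : R => x) (fun _ => y)); [apply continuous_id|apply continuous_const].
    - now apply continuity_2d_pt_filterlim. }
  assert (Ig : forall x, continuous (fun x => RInt (fun y => f x y) c d) x).
  { intros x. now apply (RInt_param_continuous (fun y x => f x y)). }
  assert (D1 : forall x, is_derive (fun X => RInt (fun x => RInt (fun y => f x y) c d) a X) x (RInt (fun y => f x y) c d)).
  { intros x. apply (is_derive_RInt (V := R_NormedModule) (fun x => RInt (fun y => f x y) c d) _ a x); [|apply Ig].
    apply filter_forall. intros y. apply (RInt_correct (V := R_CompleteNormedModule)).
    apply (ex_RInt_continuous (V := R_CompleteNormedModule)). intros; apply Ig. }
  assert (D0 : forall X y, is_derive (fun X => RInt (fun x => f x y) a X) X (f X y)).
  { intros X y. apply (is_derive_RInt (V := R_NormedModule) (fun x => f x y) _ a X); [|apply Hc1].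
    apply filter_forall. intros Y. apply (RInt_correct (V := R_CompleteNormedModule)).
    apply (ex_RInt_continuous (V := R_CompleteNormedModule)). intros; apply Hc1. }
  assert (D2 : forall X, is_derive (fun X => RInt (fun y => RInt (fun x => f x y) a X) c d) X (RInt (fun y => f X y) c d)).
  { intros X.
    replace (RInt (fun y => f X y) c d) with (RInt (fun y => Derive (fun X => RInt (fun x => f x y) a X) X) c d)
      by (apply RInt_ext; intros; now apply is_derive_unique).
    apply (is_derive_RInt_param (fun X y => RInt (fun x => f x y) a X)).
    - apply filter_forall. intros Y y _. eexists. apply D0.
    - intros y _. apply (continuity_2d_pt_ext f); [|apply Hf].
      intros u v. symmetry. apply is_derive_unique, D0.
    - apply filter_forall. intros Y. apply (ex_RInt_continuous (V := R_CompleteNormedModule)).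
      intros y _. now apply RInt_param_continuous. }
  assert (FT : is_RInt (fun _ => 0) a b
    ((RInt (fun x => RInt (fun y => f x y) c d) a b - RInt (fun y => RInt (fun x => f x y) a b) c d)
     - (RInt (fun x => RInt (fun y => f x y) c d) a a - RInt (fun y => RInt (fun x => f x y) a a) c d))).
  { apply (RInt_FTC (fun X => RInt (fun x => RInt (fun y => f x y) c d) a X - RInt (fun y => RInt (fun x => f x y) a X) c d)).
    - assumption.
    - intros X _. apply (continuous_minus (V := R_NormedModule));
      apply (ex_derive_continuous (V := R_NormedModule)); eexists; [apply D1|apply D2].
    - intros. apply continuous_const.
    - intros X _. replace 0 with (RInt (fun y => f X y) c d - RInt (fun y => f X y) c d) by ring.
      apply (is_derive_minus (V := R_NormedModule)); [apply D1|apply D2]. }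
  apply (is_RInt_unique (V := R_CompleteNormedModule)) in FT.
  assert (E0 : RInt (fun _ => 0) a b = 0)
    by (rewrite (RInt_const (V := R_CompleteNormedModule)); apply Rmult_0_r).
  assert (E1 : RInt (fun x => RInt (fun y => f x y) c d) a a = 0)
    by apply (RInt_point (V := R_CompleteNormedModule)).
  assert (E2 : RInt (fun y => RInt (fun x => f x y) a a) c d = 0).
  { rewrite (RInt_ext _ (fun _ => 0)) by (intros; apply (RInt_point (V := R_CompleteNormedModule))).
    rewrite (RInt_const (V := R_CompleteNormedModule)). apply Rmult_0_r. }
  change (RInt (fun _ => 0) a b = RInt (fun x => RInt (fun y => f x y) c d) a b -
     RInt (fun y => RInt (fun x => f x y) a b) c d -
     (RInt (fun x => RInt (fun y => f x y) c d) a a -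
      RInt (fun y => RInt (fun x => f x y) a a) c d)) in FT.
  lra.
Qed.

(** Clamping both variables extends the integrand continuously to the plane and leaves it alone on
    the rectangle. *)
Lemma CInt_fubini (f : R -> R -> C) (a b c d : R) : a <= b -> c <= d ->
  (forall x y, a <= x <= b -> c <= y <= d -> cont2 f x y) ->
  CInt (fun x => CInt (fun y => f x y) c d) a b = CInt (fun y => CInt (fun x => f x y) a b) c d.
Proof.
  intros Hab Hcd Hf.
  set (g := fun x y => f (clamp a b x) (clamp c d y)).
  assert (Hg : forall x y, cont2 g x y).
  { intros x y. unfold g.
    apply (Ccont_comp (U := prod_UniformSpace R_UniformSpace R_UniformSpace)
      (fun p => (clamp a b (fst p), clamp c d (snd p))) (fun q => f (fst q) (snd q))).
    - apply Ccont_pair.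
      + apply (continuous_comp fst (clamp a b)); [apply continuous_fst|apply continuous_clamp].
      + apply (continuous_comp snd (clamp c d)); [apply continuous_snd|apply continuous_clamp].
    - apply Hf; now apply clamp_in. }
  assert (Hx : forall y x, Ccont (fun x => g x y) x).
  { intros y x. apply (continuous_comp (fun x => (x, y)) (fun p => g (fst p) (snd p)));
    [apply (Ccont_pair (fun x : R => x) (fun _ => y)); [apply continuous_id|apply continuous_const]|apply Hg]. }
  assert (Hy : forall x y, Ccont (fun y => g x y) y).
  { intros x y. apply (continuous_comp (fun y => (x, y)) (fun p => g (fst p) (snd p)));
    [apply (Ccont_pair (fun _ => x) (fun y : R => y)); [apply continuous_const|apply continuous_id]|apply Hg]. }
  assert (H2 : forall x y, continuity_2d_pt (fun x y => Re (g x y)) x y /\ continuity_2d_pt (fun x y => Im (g x y)) x y).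
  { intros x y. split; apply continuity_2d_pt_filterlim.
    - apply (Ccont_Re (U := prod_UniformSpace R_UniformSpace R_UniformSpace) (fun p => g (fst p) (snd p)) (x, y)), Hg.
    - apply (Ccont_Im (U := prod_UniformSpace R_UniformSpace R_UniformSpace) (fun p => g (fst p) (snd p)) (x, y)), Hg. }
  assert (H2' : forall x y, continuity_2d_pt (fun y x => Re (g x y)) y x /\ continuity_2d_pt (fun y x => Im (g x y)) y x).
  { intros x y. split; intros eps; [destruct (proj1 (H2 x y) eps) as [dl Hdl]|destruct (proj2 (H2 x y) eps) as [dl Hdl]];
    exists dl; intros u v Hu Hv; now apply Hdl. }
  assert (E1 : forall x, CInt (fun y => g x y) c d = (RInt (fun y => Re (g x y)) c d, RInt (fun y => Im (g x y)) c d)).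
  { intros x. apply (CInt_pair (fun y => g x y)), ex_CInt_cont. intros; apply Hy. }
  assert (E2 : forall y, CInt (fun x => g x y) a b = (RInt (fun x => Re (g x y)) a b, RInt (fun x => Im (g x y)) a b)).
  { intros y. apply (CInt_pair (fun x => g x y)), ex_CInt_cont. intros; apply Hx. }
  transitivity (CInt (fun x => CInt (fun y => g x y) c d) a b).
  { apply CInt_ext. rewrite Rmin_left, Rmax_right by lra. intros x Hx'.
    apply CInt_ext. rewrite Rmin_left, Rmax_right by lra. intros y Hy'.
    unfold g. now rewrite !clamp_id by lra. }
  transitivity (CInt (fun y => CInt (fun x => g x y) a b) c d).
  2: { apply CInt_ext. rewrite Rmin_left, Rmax_right by lra. intros y Hy'.
    apply CInt_ext. rewrite Rmin_left, Rmax_right by lra. intros x Hx'.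
    unfold g. now rewrite !clamp_id by lra. }
  rewrite (CInt_ext (fun x => CInt (fun y => g x y) c d) (fun x => (RInt (fun y => Re (g x y)) c d, RInt (fun y => Im (g x y)) c d)))
    by (intros; apply E1).
  rewrite (CInt_ext (fun y => CInt (fun x => g x y) a b) (fun y => (RInt (fun x => Re (g x y)) a b, RInt (fun x => Im (g x y)) a b)))
    by (intros; apply E2).
  rewrite !CInt_pair.
  - simpl. f_equal; apply RInt_fubini_global; try assumption; intros; apply H2.
  - apply ex_CInt_cont. intros y _. apply Ccont_pair.
    + apply (RInt_param_continuous (fun x y => Re (g x y))). intros; apply H2.
    + apply (RInt_param_continuous (fun x y => Im (g x y))). intros; apply H2.
  - apply ex_CInt_cont. intros x _. apply Ccont_pair.
    + apply (RInt_param_continuous (fun y x => Re (g x y))). intros; apply H2'.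
    + apply (RInt_param_continuous (fun y x => Im (g x y))). intros; apply H2'.
Qed.

(** * Complex derivatives *)

(** The derivative is integrated along the segment from [w] to [z], on which the real part stays
    below the larger end value. *)
Lemma Cmod_Cexp_minus_le (z w : C) :
  Cmod (Cexp z - Cexp w) <= Cmod (z - w) * exp (Rmax (Re z) (Re w)).
Proof.
  assert (H : is_CInt (fun s : R => (z - w) * Cexp (w + s * (z - w)))%C 0 1
     (Cexp (w + 1%R * (z - w)) - Cexp (w + 0%R * (z - w)))%C).
  { apply (is_CInt_FTC (fun s : R => Cexp (w + s * (z - w))%C)); [lra| | |].
    - intros; ccont.
    - intros; ccont.
    - intros x _. apply CRderive_Cexp. eapply CRderive_eq.
      + apply CRderive_plus; [apply CRderive_const|].
        apply CRderive_mult; [apply CRderive_RtoC|apply CRderive_const].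
      + cring. }
  replace (w + 1%R * (z - w))%C with z in H by ring.
  replace (w + 0%R * (z - w))%C with w in H by ring.
  replace (Cmod (z - w) * exp (Rmax (Re z) (Re w))) with ((1 - 0) * (Cmod (z - w) * exp (Rmax (Re z) (Re w)))) by ring.
  refine (Cmod_is_CInt_const _ _ 0 1 _ _ _ H); [lra|]. intros x Hx; cbv beta.
  rewrite Cmod_mult, Cmod_Cexp. apply Rmult_le_compat_l; [apply Cmod_ge_0|].
  assert (E : Re (w + x * (z - w)) <= Rmax (Re z) (Re w)).
  { simpl. unfold Re, Rmax. destruct Rle_dec; nra. }
  destruct E as [E|E]; [left; now apply exp_increasing|rewrite E; lra].
Qed.

Lemma exp_le (x y : R) : x <= y -> exp x <= exp y.
Proof. intros [E|E]; [left; now apply exp_increasing|rewrite E; lra]. Qed.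

(** The remainder is the integral of [h (e^{sh} - 1)] over [0 <= s <= 1], and the preceding bound
    applies to its second factor. *)
Lemma Cmod_Cexp_taylor (h : C) :
  Cmod (Cexp h - 1 - h) <= Cmod h ^ 2 * exp (Rmax 0 (Re h)).
Proof.
  assert (H : is_CInt (fun s : R => h * (Cexp (s * h) - 1))%C 0 1
     ((Cexp (1%R * h) - 1%R * h) - (Cexp (0%R * h) - 0%R * h))%C).
  { apply (is_CInt_FTC (fun s : R => Cexp (s * h) - s * h)%C); [lra| | |].
    - intros; ccont.
    - intros; ccont.
    - intros x _. eapply CRderive_eq.
      + apply CRderive_minus; [apply CRderive_Cexp|];
        (apply CRderive_mult; [apply CRderive_RtoC|apply CRderive_const]).
      + cring. }
  replace (1%R * h)%C with h in H by ring.
  replace (0%R * h)%C with (RtoC 0) in H by ring. rewrite Cexp_0 in H.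
  replace (Cexp h - 1 - h)%C with (Cexp h - h - (1 - 0))%C by ring.
  replace (Cmod h ^ 2 * exp (Rmax 0 (Re h))) with ((1 - 0) * (Cmod h ^ 2 * exp (Rmax 0 (Re h)))) by ring.
  refine (Cmod_is_CInt_const _ _ 0 1 _ _ _ H); [lra|]. intros x Hx; cbv beta.
  rewrite Cmod_mult. simpl. rewrite Rmult_1_r, Rmult_assoc.
  apply Rmult_le_compat_l; [apply Cmod_ge_0|].
  rewrite <- Cexp_0. eapply Rle_trans; [apply Cmod_Cexp_minus_le|].
  replace (x * h - 0)%C with (x * h)%C by ring. rewrite Cmod_mult, Cmod_R, Rabs_pos_eq by lra.
  apply Rmult_le_compat.
  - pose proof (Cmod_ge_0 h). nra.
  - left; apply exp_pos.
  - pose proof (Cmod_ge_0 h). nra.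
  - apply exp_le. simpl. unfold Re, Rmax. destruct h as [h1 h2]; simpl.
    repeat destruct Rle_dec; nra.
Qed.

(** The error is compared with [|h|] instead of being divided by [h], so [h = 0] is no exception. *)
Definition Cderive (f : C -> C) (z l : C) : Prop :=
  forall e, 0 < e -> exists d, 0 < d /\ forall h, Cmod h < d ->
    Cmod (f (z + h) - f z - h * l)%C <= e * Cmod h.

(** Quadratic error bounds are what Taylor estimates of exponentials, and of transforms of decaying
    functions, provide. *)
Lemma Cderive_quadratic (f : C -> C) (z l : C) (d B : R) : 0 < d -> 0 <= B ->
  (forall h, Cmod h < d -> Cmod (f (z + h) - f z - h * l)%C <= B * Cmod h ^ 2) ->
  Cderive f z l.
Proof.
  intros Hd HB H e He. exists (Rmin d (e / (B + 1))).
  assert (0 < e / (B + 1)) by (apply Rdiv_lt_0_compat; lra).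
  split; [now apply Rmin_pos|]. intros h Hh.
  pose proof (Rmin_l d (e / (B + 1))). pose proof (Rmin_r d (e / (B + 1))).
  eapply Rle_trans; [apply H; lra|].
  pose proof (Cmod_ge_0 h).
  assert ((B + 1) * Cmod h <= e).
  { replace e with ((B + 1) * (e / (B + 1))) by (field; lra).
    apply Rmult_le_compat_l; lra. }
  nra.
Qed.

Lemma Cderive_eq (f : C -> C) (z l l' : C) : Cderive f z l -> l = l' -> Cderive f z l'.
Proof. now intros ? <-. Qed.

Lemma Cderive_const (c z : C) : Cderive (fun _ => c) z 0.
Proof.
  intros e He. exists 1. split; [lra|]. intros h _.
  replace (c - c - h * 0)%C with (RtoC 0) by ring. rewrite Cmod_0.
  pose proof (Cmod_ge_0 h). nra.
Qed.

Lemma Cderive_id (z : C) : Cderive (fun w => w) z 1.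
Proof.
  intros e He. exists 1. split; [lra|]. intros h _.
  replace (z + h - z - h * 1)%C with (RtoC 0) by ring. rewrite Cmod_0.
  pose proof (Cmod_ge_0 h). nra.
Qed.

Lemma Cderive_plus (f g : C -> C) (z a b : C) :
  Cderive f z a -> Cderive g z b -> Cderive (fun w => f w + g w)%C z (a + b)%C.
Proof.
  intros Hf Hg e He.
  destruct (Hf (e / 2)) as [d1 [P1 H1]]; [lra|]. destruct (Hg (e / 2)) as [d2 [P2 H2]]; [lra|].
  exists (Rmin d1 d2). split; [now apply Rmin_pos|]. intros h Hh.
  pose proof (Rmin_l d1 d2). pose proof (Rmin_r d1 d2).
  replace (f (z + h) + g (z + h) - (f z + g z) - h * (a + b))%C
    with ((f (z + h) - f z - h * a) + (g (z + h) - g z - h * b))%C by ring.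
  eapply Rle_trans; [apply Cmod_triangle|].
  specialize (H1 h ltac:(lra)). specialize (H2 h ltac:(lra)). lra.
Qed.

Lemma Cderive_lip (f : C -> C) (z l : C) : Cderive f z l ->
  exists d, 0 < d /\ forall h, Cmod h < d -> Cmod (f (z + h) - f z)%C <= (Cmod l + 1) * Cmod h.
Proof.
  intros H. destruct (H 1) as [d [Pd Hd]]; [lra|]. exists d. split; [exact Pd|]. intros h Hh.
  replace (f (z + h) - f z)%C with ((f (z + h) - f z - h * l) + h * l)%C by ring.
  eapply Rle_trans; [apply Cmod_triangle|]. rewrite Cmod_mult.
  specialize (Hd h Hh). lra.
Qed.

Lemma Cderive_comp (f g : C -> C) (z a b : C) :
  Cderive f (g z) a -> Cderive g z b -> Cderive (fun w => f (g w)) z (b * a)%C.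
Proof.
  intros Hf Hg e He.
  destruct (Cderive_lip _ _ _ Hg) as [d1 [P1 H1]].
  pose proof (Cmod_ge_0 a) as Ka. pose proof (Cmod_ge_0 b) as Kb.
  destruct (Hf (e / 2 / (Cmod b + 1))) as [d2 [P2 H2]].
  { repeat apply Rdiv_lt_0_compat; lra. }
  destruct (Hg (e / 2 / (Cmod a + 1))) as [d3 [P3 H3]].
  { repeat apply Rdiv_lt_0_compat; lra. }
  assert (P4 : 0 < d2 / (Cmod b + 1)) by (apply Rdiv_lt_0_compat; lra).
  exists (Rmin d1 (Rmin d3 (d2 / (Cmod b + 1)))).
  split; [repeat apply Rmin_pos; assumption|]. intros h Hh.
  apply Rmin_Rgt_l in Hh. destruct Hh as [Hh1 Hh]. apply Rmin_Rgt_l in Hh. destruct Hh as [Hh3 Hh2].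
  pose proof (Cmod_ge_0 h) as Kh.
  set (k := (g (z + h) - g z)%C).
  assert (Hk : Cmod k <= (Cmod b + 1) * Cmod h) by now apply H1.
  assert (Hk2 : Cmod k < d2).
  { eapply Rle_lt_trans; [exact Hk|].
    replace d2 with ((Cmod b + 1) * (d2 / (Cmod b + 1))) by (field; lra).
    apply Rmult_lt_compat_l; lra. }
  specialize (H2 k Hk2). specialize (H3 h Hh3).
  replace (g z + k)%C with (g (z + h)%C) in H2 by (unfold k; ring).
  replace (f (g (z + h)) - f (g z) - h * (b * a))%C
    with ((f (g (z + h)) - f (g z) - k * a) + (g (z + h) - g z - h * b) * a)%C by (unfold k; ring).
  eapply Rle_trans; [apply Cmod_triangle|]. rewrite Cmod_mult.
  assert (e / 2 / (Cmod b + 1) * Cmod k <= e / 2 * Cmod h).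
  { replace (e / 2 * Cmod h) with (e / 2 / (Cmod b + 1) * ((Cmod b + 1) * Cmod h)) by (field; lra).
    apply Rmult_le_compat_l; [|assumption]. left. repeat apply Rdiv_lt_0_compat; lra. }
  assert (Cmod (g (z + h) - g z - h * b)%C * Cmod a <= e / 2 * Cmod h).
  { apply Rle_trans with (e / 2 / (Cmod a + 1) * Cmod h * (Cmod a + 1)).
    - apply Rmult_le_compat; try lra. apply Cmod_ge_0.
    - right. field. lra. }
  lra.
Qed.

Lemma Cderive_square (z : C) : Cderive (fun w => w * w)%C z (2 * z)%C.
Proof.
  apply (Cderive_quadratic _ _ _ 1 1); try lra. intros h _.
  replace ((z + h) * (z + h) - z * z - h * (2 * z))%C with (h * h)%C by ring.
  rewrite Cmod_mult. lra.
Qed.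

Lemma Cderive_cmult (c : C) (f : C -> C) (z a : C) :
  Cderive f z a -> Cderive (fun w => c * f w)%C z (c * a)%C.
Proof.
  intros Hf. eapply Cderive_eq; [apply (Cderive_comp (fun w => c * w)%C f z c a); [|exact Hf]|ring].
  apply (Cderive_quadratic _ _ _ 1 0); try lra. intros h _.
  replace (c * (f z + h) - c * f z - h * c)%C with (RtoC 0) by ring. rewrite Cmod_0. lra.
Qed.

(* [f g = ((f + g)^2 - (f - g)^2) / 4] *)
Lemma Cderive_mult (f g : C -> C) (z a b : C) :
  Cderive f z a -> Cderive g z b -> Cderive (fun w => f w * g w)%C z (a * g z + f z * b)%C.
Proof.
  intros Hf Hg.
  assert (H : Cderive (fun w => /4 * ((f w + g w) * (f w + g w)) + - / 4 * ((f w + -1 * g w) * (f w + -1 * g w)))%C z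
    (/ 4 * ((a + b) * (2 * (f z + g z))) + - / 4 * ((a + -1 * b) * (2 * (f z + -1 * g z))))%C).
  { apply Cderive_plus; apply Cderive_cmult.
    - apply (Cderive_comp (fun w => w * w)%C (fun w => f w + g w)%C); [apply Cderive_square|now apply Cderive_plus].
    - apply (Cderive_comp (fun w => w * w)%C (fun w => f w + -1 * g w)%C); [apply Cderive_square|].
      apply Cderive_plus; [assumption|now apply Cderive_cmult]. }
  intros e He. destruct (H e He) as [d [Pd Hd]]. exists d. split; [exact Pd|]. intros h Hh.
  specialize (Hd h Hh). eapply Rle_trans; [|exact Hd]. right. f_equal. field.
Qed.

Lemma Cderive_Cexp (z : C) : Cderive Cexp z (Cexp z).
Proof.
  apply (Cderive_quadratic _ _ _ 1 (exp (Re z) * exp 1)); [lra| |].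
  - left. apply Rmult_lt_0_compat; apply exp_pos.
  - intros h Hh. rewrite Cexp_plus.
    replace (Cexp z * Cexp h - Cexp z - h * Cexp z)%C with (Cexp z * (Cexp h - 1 - h))%C by ring.
    rewrite Cmod_mult, Cmod_Cexp, Rmult_assoc. apply Rmult_le_compat_l; [left; apply exp_pos|].
    eapply Rle_trans; [apply Cmod_Cexp_taylor|]. rewrite Rmult_comm.
    apply Rmult_le_compat_r; [apply pow_le, Cmod_ge_0|]. apply exp_le.
    pose proof (re_le_Cmod h) as H. pose proof (Rle_abs (Re h)).
    unfold Rmax. destruct Rle_dec; lra.
Qed.

Lemma Cderive_inv (z : C) : z <> 0%C -> Cderive Cinv z (- / (z * z))%C.
Proof.
  intros Hz. assert (Hm : 0 < Cmod z) by now apply Cmod_gt_0.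
  apply (Cderive_quadratic _ _ _ (Cmod z / 2) (2 / Cmod z ^ 3)); [lra| |].
  - left. apply Rdiv_lt_0_compat; [lra|now apply pow_lt].
  - intros h Hh.
    assert (Hzh : Cmod z / 2 <= Cmod (z + h)).
    { pose proof (Cmod_triangle (z + h) (- h)) as T. rewrite Cmod_opp in T.
      replace (z + h + - h)%C with z in T by ring. lra. }
    assert (Hn : (z + h)%C <> 0%C).
    { intros E. rewrite E, Cmod_0 in Hzh. lra. }
    replace (/ (z + h) - / z - h * - / (z * z))%C with ((h * h) * / (z * z * (z + h)))%C
      by (field; repeat split; auto).
    rewrite Cmod_mult, Cmod_inv, !Cmod_mult.
    + rewrite Rmult_comm. replace (Cmod h * Cmod h) with (Cmod h ^ 2) by ring.
      apply Rmult_le_compat_r; [apply pow_le, Cmod_ge_0|].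
      replace (2 / Cmod z ^ 3) with (/ (Cmod z * Cmod z * (Cmod z / 2))) by (field; lra).
      apply Rinv_le_contravar; [|apply Rmult_le_compat_l; nra].
      repeat apply Rmult_lt_0_compat; lra.
    + repeat apply Cmult_neq_0; auto.
Qed.

(** Restriction to a straight line: the way in which complex derivatives enter Green's theorem,
    whose hypotheses are real derivatives. *)
Lemma CRderive_path (f : C -> C) (z0 d l : C) (s : R) :
  Cderive f (z0 + s * d)%C l -> CRderive (fun x : R => f (z0 + x * d)%C) s (d * l)%C.
Proof.
  intros H. split; [apply is_linear_scal_l|]. intros x Hx.
  apply (is_filter_lim_locally_unique (K := R_AbsRing) (V := R_NormedModule)) in Hx. subst x.
  intros [e He].
  assert (Kd := Cmod_ge_0 d).
  destruct (H (e / (Cmod d + 1))) as [dl [Pd Hd]]; [apply Rdiv_lt_0_compat; lra|].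
  assert (P4 : 0 < dl / (Cmod d + 1)) by (apply Rdiv_lt_0_compat; lra).
  exists (mkposreal _ P4). intros y Hy. change (Rabs (y - s) < dl / (Cmod d + 1)) in Hy.
  change (norm (minus y s)) with (Rabs (y - s)).
  rewrite norm_C_R.
  match goal with |- Cmod ?X <= _ =>
    replace X with (f ((z0 + s * d) + (y - s)%R * d) - f (z0 + s * d) - (y - s)%R * d * l)%C end.
  - assert (E : Cmod ((y - s)%R * d)%C = Rabs (y - s) * Cmod d) by now rewrite Cmod_mult, Cmod_R.
    eapply Rle_trans; [apply Hd|].
    + rewrite E. apply Rle_lt_trans with (Rabs (y - s) * (Cmod d + 1)).
      * pose proof (Rabs_pos (y - s)). nra.
      * replace dl with (dl / (Cmod d + 1) * (Cmod d + 1)) by (field; lra).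
        apply Rmult_lt_compat_r; lra.
    + rewrite E. simpl. pose proof (Rabs_pos (y - s)).
      apply Rle_trans with (e / (Cmod d + 1) * (Rabs (y - s) * (Cmod d + 1))).
      * apply Rmult_le_compat_l; [left; apply Rdiv_lt_0_compat; lra|nra].
      * right. field. lra.
  - replace (z0 + s * d + (y - s)%R * d)%C with (z0 + y * d)%C by (rewrite RtoC_minus; ring).
    generalize (f (z0 + y * d)%C), (f (z0 + s * d)%C). intros A B.
    apply C_ext; unfold minus, plus, opp, scal, Re, Im; simpl; unfold scal, plus, opp; simpl;
    unfold mult; simpl; ring.
Qed.

Lemma Cderive_Ccont (f : C -> C) (z l : C) : Cderive f z l -> continuous (T := C_UniformSpace) (U := C_UniformSpace) f z.
Proof.
  intros H. destruct (Cderive_lip _ _ _ H) as [d [Pd Hd]].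
  apply (Ccont_eps (U := C_UniformSpace)). intros e He. pose proof (Cmod_ge_0 l) as Kl.
  assert (0 < e / (Cmod l + 1)) by (apply Rdiv_lt_0_compat; lra).
  apply (locally_Cmod z _ (Rmin d (e / (Cmod l + 1)))); [now apply Rmin_pos|].
  intros w Hw. apply Rmin_Rgt_l in Hw. destruct Hw as [H1 H2].
  replace w with (z + (w - z))%C by ring.
  eapply Rle_lt_trans; [apply Hd, H1|].
  replace e with ((Cmod l + 1) * (e / (Cmod l + 1))) by (field; lra).
  apply Rmult_lt_compat_l; lra.
Qed.

(** * Functions that are C1 up to the boundary *)

(* [V] is the region with boundary, [U] its interior. *)
Definition Hol (U V : C -> Prop) (f : C -> C) : Prop := exists f' : C -> C,
  (forall z, V z -> continuous (T := C_UniformSpace) (U := C_UniformSpace) f z) /\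
  (forall z, V z -> continuous (T := C_UniformSpace) (U := C_UniformSpace) f' z) /\
  (forall z, U z -> Cderive f z (f' z)).

Lemma Hol_entire (U V : C -> Prop) (f f' : C -> C) :
  (forall z, Cderive f z (f' z)) ->
  (forall z, continuous (T := C_UniformSpace) (U := C_UniformSpace) f' z) -> Hol U V f.
Proof.
  intros H H'. exists f'. repeat split; auto. intros z _. eapply Cderive_Ccont, H.
Qed.

Section Hol.
Variables U V : C -> Prop.

Lemma Hol_const (c : C) : Hol U V (fun _ => c).
Proof. apply (Hol_entire _ _ _ (fun _ => 0%C)); intros; [apply Cderive_const|apply Ccont_const]. Qed.

Lemma Hol_id : Hol U V (fun z => z).
Proof. apply (Hol_entire _ _ _ (fun _ => 1%C)); intros; [apply Cderive_id|apply Ccont_const]. Qed.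

Lemma Hol_plus (f g : C -> C) : Hol U V f -> Hol U V g -> Hol U V (fun z => f z + g z)%C.
Proof.
  intros [f' [F1 [F2 F3]]] [g' [G1 [G2 G3]]]. exists (fun z => f' z + g' z)%C. repeat split; intros.
  - apply Ccont_plus; auto.
  - apply Ccont_plus; auto.
  - apply Cderive_plus; auto.
Qed.

Lemma Hol_mult (f g : C -> C) : Hol U V f -> Hol U V g -> Hol U V (fun z => f z * g z)%C.
Proof.
  intros [f' [F1 [F2 F3]]] [g' [G1 [G2 G3]]]. exists (fun z => f' z * g z + f z * g' z)%C. repeat split; intros.
  - apply Ccont_mult; auto.
  - apply Ccont_plus; apply Ccont_mult; auto.
  - apply Cderive_mult; auto.
Qed.

Lemma Hol_opp (f : C -> C) : Hol U V f -> Hol U V (fun z => - f z)%C.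
Proof.
  intros [f' [F1 [F2 F3]]]. exists (fun z => - f' z)%C. repeat split; intros.
  - apply Ccont_opp; auto.
  - apply Ccont_opp; auto.
  - intros e He. destruct (F3 z H e He) as [d [Pd Hd]]. exists d. split; [assumption|].
    intros h Hh. rewrite <- Cmod_opp.
    replace (- (- f (z + h) - - f z - h * - f' z))%C with (f (z + h) - f z - h * f' z)%C by ring. auto.
Qed.

Lemma Hol_minus (f g : C -> C) : Hol U V f -> Hol U V g -> Hol U V (fun z => f z - g z)%C.
Proof. intros. apply Hol_plus; [|apply Hol_opp]; assumption. Qed.

Lemma Hol_comp (U' V' : C -> Prop) (f g : C -> C) : Hol U' V' f -> Hol U V g ->
  (forall z, U z -> U' (g z)) -> (forall z, V z -> V' (g z)) -> Hol U V (fun z => f (g z)).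
Proof.
  intros [f' [F1 [F2 F3]]] [g' [G1 [G2 G3]]] HU HV. exists (fun z => g' z * f' (g z))%C. repeat split; intros.
  - apply (Ccont_comp (U := C_UniformSpace) g f); auto.
  - apply Ccont_mult; [auto|]. apply (Ccont_comp (U := C_UniformSpace) g f'); auto.
  - apply Cderive_comp; auto.
Qed.

Lemma Hol_Cexp (f : C -> C) : Hol U V f -> Hol U V (fun z => Cexp (f z)).
Proof.
  intros H. apply (Hol_comp (fun _ => True) (fun _ => True) Cexp f); auto.
  apply (Hol_entire _ _ _ Cexp); intros; [apply Cderive_Cexp|].
  apply (Ccont_Cexp (U := C_UniformSpace) (fun z => z)). apply continuous_id.
Qed.

Lemma Hol_inv (f : C -> C) : (forall z, U z -> f z <> 0%C) -> (forall z, V z -> f z <> 0%C) ->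
  Hol U V f -> Hol U V (fun z => / f z)%C.
Proof.
  intros H1 H2 [f' [F1 [F2 F3]]]. exists (fun z => f' z * - / (f z * f z))%C. repeat split; intros.
  - apply Ccont_inv; auto.
  - apply Ccont_mult; [auto|]. apply Ccont_opp, Ccont_inv; [apply Ccont_mult; auto|].
    apply Cmult_neq_0; auto.
  - apply (Cderive_comp Cinv f); auto. apply Cderive_inv; auto.
Qed.

Lemma Hol_pow (f : C -> C) (n : nat) : Hol U V f -> Hol U V (fun z => f z ^ n)%C.
Proof. intros H. induction n; simpl; [apply Hol_const|now apply Hol_mult]. Qed.

Lemma Hol_ext (f g : C -> C) : (forall z, f z = g z) -> Hol U V f -> Hol U V g.
Proof.
  intros E [f' [F1 [F2 F3]]]. exists f'. repeat split; intros; auto.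
  - apply (continuous_ext f); auto.
  - intros e He. destruct (F3 z H e He) as [d [Pd Hd]]. exists d. split; [assumption|].
    intros h Hh. rewrite <- !E. auto.
Qed.

End Hol.
#[export] Hint Resolve Hol_const Hol_id Hol_plus Hol_mult Hol_opp Hol_minus Hol_Cexp Hol_pow : holo.
Ltac holo := auto 40 with holo.

Lemma cont2_slice1 (f : R -> R -> C) (x y : R) : cont2 f x y -> Ccont (fun x => f x y) x.
Proof.
  intros H. apply (continuous_comp (fun x => (x, y)) (fun p => f (fst p) (snd p))); [|exact H].
  apply (Ccont_pair (fun x : R => x) (fun _ => y)); [apply continuous_id|apply continuous_const].
Qed.

Lemma cont2_slice2 (f : R -> R -> C) (x y : R) : cont2 f x y -> Ccont (fun y => f x y) y.
Proof.
  intros H. apply (continuous_comp (fun y => (x, y)) (fun p => f (fst p) (snd p))); [|exact H].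
  apply (Ccont_pair (fun _ => x) (fun y : R => y)); [apply continuous_const|apply continuous_id].
Qed.

(** * Green's theorem on a rectangle, and Cauchy's theorem *)

(** Both sides are the integral of [H] over the rectangle, with the inner integration done first in
    one variable or in the other. Cauchy's theorem on rectangles and sectors and the global
    relations are all instances. *)
Lemma green (A B H : R -> R -> C) (a b c d : R) : a <= b -> c <= d ->
  (forall x y, a <= x <= b -> c <= y <= d -> cont2 A x y /\ cont2 B x y /\ cont2 H x y) ->
  (forall x y, a < x < b -> c < y < d -> CRderive (fun y => A x y) y (H x y)) ->
  (forall x y, a < x < b -> c < y < d -> CRderive (fun x => B x y) x (H x y)) ->
  CInt (fun x => (A x d - A x c)%C) a b = CInt (fun y => (B b y - B a y)%C) c d.
Proof.
  intros Hab Hcd Hc HA HB.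
  transitivity (CInt (fun x => CInt (fun y => H x y) c d) a b).
  - apply CInt_ext. rewrite Rmin_left, Rmax_right by lra. intros x Hx.
    symmetry. apply is_CInt_unique. apply (is_CInt_FTC (fun y => A x y)); try assumption.
    + intros y Hy. destruct (Hc x y) as [h _]; [lra..|]. exact (cont2_slice2 A x y h).
    + intros y Hy. destruct (Hc x y) as [_ [_ h]]; [lra..|]. exact (cont2_slice2 H x y h).
    + intros y Hy. now apply HA.
  - rewrite CInt_fubini; try assumption; [|intros; now apply Hc].
    apply CInt_ext. rewrite Rmin_left, Rmax_right by lra. intros y Hy.
    apply is_CInt_unique. apply (is_CInt_FTC (fun x => B x y)); try assumption.
    + intros x Hx. destruct (Hc x y) as [_ [h _]]; [lra..|]. exact (cont2_slice1 B x y h).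
    + intros x Hx. destruct (Hc x y) as [_ [_ h]]; [lra..|]. exact (cont2_slice1 H x y h).
    + intros x Hx. now apply HB.
Qed.

Notation holcont := (continuous (T := C_UniformSpace) (U := C_UniformSpace)).
Notation dir th := (Cexp (Ci * RtoC th)).

Ltac cont2tac := try assumption; lazymatch goal with
  | |- continuous (fun _ => ?c) _ => apply Ccont_const
  | |- continuous (fun p => Cplus (@?f p) (@?g p)) _ => apply Ccont_plus; cont2tac
  | |- continuous (fun p => Cminus (@?f p) (@?g p)) _ => apply Ccont_minus; cont2tac
  | |- continuous (fun p => Cmult (@?f p) (@?g p)) _ => apply Ccont_mult; cont2tac
  | |- continuous (fun p => Copp (@?f p)) _ => apply Ccont_opp; cont2tac
  | |- continuous (fun p => Cexp (@?f p)) _ => apply Ccont_Cexp; cont2tac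
  | |- continuous (fun p => RtoC (@?f p)) _ => apply Ccont_RtoC; cont2tac
  | |- continuous fst _ => apply continuous_fst
  | |- continuous snd _ => apply continuous_snd
  | |- continuous (fun p => fst p) _ => apply continuous_fst
  | |- continuous (fun p => snd p) _ => apply continuous_snd
  | |- _ => idtac end.

(** The Cauchy-Riemann equations in the form needed by [green]: the [y] derivative of [f] and the
    [x] derivative of [i f] are both [i f']. *)
Lemma cauchy_rectangle (U V : C -> Prop) (f : C -> C) (a b c d : R) : a <= b -> c <= d ->
  (forall x y, a <= x <= b -> c <= y <= d -> V (x + Ci * y)%C) ->
  (forall x y, a < x < b -> c < y < d -> U (x + Ci * y)%C) ->
  Hol U V f ->
  CInt (fun x => (f (x + Ci * d)%C - f (x + Ci * c)%C)%C) a b =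
  CInt (fun y => (Ci * f (b + Ci * y)%C - Ci * f (a + Ci * y)%C)%C) c d.
Proof.
  intros Hab Hcd HV HU [f' [F1 [F2 F3]]].
  assert (L : forall x y : R, continuous (T := prod_UniformSpace R_UniformSpace R_UniformSpace) (U := C_UniformSpace)
    (fun p => (fst p + Ci * snd p)%C) (x, y)) by (intros; cont2tac).
  apply (green (fun x y => f (x + Ci * y)%C) (fun x y => (Ci * f (x + Ci * y)%C)%C) (fun x y => (Ci * f' (x + Ci * y)%C)%C)); try assumption.
  - intros x y Hx Hy. specialize (HV x y Hx Hy).
    assert (C1 : cont2 (fun x y => f (x + Ci * y)%C) x y).
    { apply (Ccont_comp (U := prod_UniformSpace R_UniformSpace R_UniformSpace) (fun p => (fst p + Ci * snd p)%C) f); auto. }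
    assert (C2 : cont2 (fun x y => f' (x + Ci * y)%C) x y).
    { apply (Ccont_comp (U := prod_UniformSpace R_UniformSpace R_UniformSpace) (fun p => (fst p + Ci * snd p)%C) f'); auto. }
    repeat split; cont2tac.
  - intros x y Hx Hy. specialize (HU x y Hx Hy).
    apply (is_derive_ext (V := C_R_NormedModule) (fun t : R => f (x + t * Ci)%C)).
    + intros t. now rewrite (Cmult_comm t Ci).
    + apply CRderive_path. rewrite (Cmult_comm y Ci). auto.
  - intros x y Hx Hy. specialize (HU x y Hx Hy). apply CRderive_cmult.
    apply (is_derive_ext (V := C_R_NormedModule) (fun t : R => f (Ci * y + t * 1)%C)).
    + intros t. f_equal. ring.
    + eapply CRderive_eq; [apply (CRderive_path _ _ _ (f' (x + Ci * y)%C))|cring].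
      replace (Ci * y + x * 1)%C with (x + Ci * y)%C by ring. apply F3, HU.
Qed.

(** * Unit directions, rays, arcs and Cauchy's theorem on a sector *)

Lemma dir_plus (a b : R) : dir (a + b) = (dir a * dir b)%C.
Proof. rewrite RtoC_plus, Cmult_plus_distr_l. apply Cexp_plus. Qed.

Lemma Cmod_dir (a : R) : Cmod (dir a) = 1.
Proof. rewrite Cmod_Cexp. simpl. rewrite <- exp_0. f_equal. ring. Qed.

Lemma Re_dir (a : R) : Re (dir a) = cos a.
Proof. simpl. replace (0 * a - 1 * 0) with 0 by ring. rewrite exp_0. replace (0 * 0 + 1 * a) with a by ring. ring. Qed.

Lemma Im_dir (a : R) : Im (dir a) = sin a.
Proof. simpl. replace (0 * a - 1 * 0) with 0 by ring. rewrite exp_0. replace (0 * 0 + 1 * a) with a by ring. ring. Qed.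

Lemma dir_0 : dir 0 = 1%C.
Proof. replace (Ci * 0)%C with (RtoC 0) by ring. apply Cexp_0. Qed.

Lemma dir_PI : dir PI = (-1)%C.
Proof. apply C_ext; [rewrite Re_dir, cos_PI|rewrite Im_dir, sin_PI]; simpl; ring. Qed.

Lemma dir_mPI : dir (- PI) = (-1)%C.
Proof. apply C_ext; [rewrite Re_dir, cos_neg, cos_PI|rewrite Im_dir, sin_neg, sin_PI]; simpl; ring. Qed.

Lemma dir_PI2 : dir (PI / 2) = Ci.
Proof. apply C_ext; [rewrite Re_dir, cos_PI2|rewrite Im_dir, sin_PI2]; simpl; ring. Qed.

Definition ray (F : C -> C) (K th : R) : C := CInt (fun s : R => F (s * dir th) * dir th)%C 0 K.
Definition arc (F : C -> C) (K c d : R) : C :=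
  CInt (fun th : R => Ci * (K * dir th) * F (K * dir th))%C c d.

(** In polar coordinates [F(z) dz] is a closed form on a rectangle in [(s, th)]. The side [s = 0]
    contributes nothing because of the factor [s], so the vertex is harmless although [F] is not
    assumed differentiable there. *)
Lemma cauchy_sector (U V : C -> Prop) (F : C -> C) (K c d : R) : 0 <= K -> c <= d ->
  (forall s th, 0 <= s -> c <= th <= d -> V (s * dir th)%C) ->
  (forall s th, 0 < s -> c < th < d -> U (s * dir th)%C) ->
  Hol U V F -> arc F K c d = (ray F K d - ray F K c)%C.
Proof.
  intros HK Hcd HV HU HF. pose proof HF as [F' [F1 [F2 F3]]].
  assert (L : forall x y : R, continuous (T := prod_UniformSpace R_UniformSpace R_UniformSpace) (U := C_UniformSpace)
    (fun p => (fst p * dir (snd p))%C) (x, y)) by (intros; cont2tac).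
  assert (Hr : forall th, c <= th <= d -> ex_CInt (fun s : R => F (s * dir th) * dir th)%C 0 K).
  { intros th Hth. apply ex_CInt_le; [assumption|]. intros s Hs. apply Ccont_mult; [|apply Ccont_const].
    apply (Ccont_comp (fun s : R => s * dir th)%C F); [|apply F1, HV; lra]. ccont. }
  unfold ray. rewrite <- CInt_minus by (apply Hr; lra).
  rewrite (green (fun s th => F (s * dir th) * dir th)%C (fun s th => Ci * (s * dir th) * F (s * dir th))%C
    (fun s th => Ci * dir th * (F (s * dir th) + s * dir th * F' (s * dir th)))%C); try assumption.
  - unfold arc. apply CInt_ext. intros th _. rewrite !Cmult_0_l. ring.
  - intros s th Hs Hth. assert (Hv : V (s * dir th)%C) by (apply HV; lra).
    assert (C1 : cont2 (fun x y => F (x * dir y)%C) s th).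
    { apply (Ccont_comp (U := prod_UniformSpace R_UniformSpace R_UniformSpace) (fun p => (fst p * dir (snd p))%C) F); auto. }
    assert (C2 : cont2 (fun x y => F' (x * dir y)%C) s th).
    { apply (Ccont_comp (U := prod_UniformSpace R_UniformSpace R_UniformSpace) (fun p => (fst p * dir (snd p))%C) F'); auto. }
    repeat split; cont2tac.
  - intros s th Hs Hth. assert (Hu : U (s * dir th)%C) by (apply HU; lra).
    (* A rotation is a straight path in direction [i] for the exponent, so [CRderive_path] can be
       applied to [z -> F (s e^z)]. *)
    assert (E : forall t : R, (s * Cexp (Ci * t) = s * Cexp (0 + t * Ci))%C)
      by (intros; do 2 f_equal; ring).
    assert (Dd : CRderive (fun y : R => Cexp (Ci * y)) th (Ci * dir th)%C).
    { apply CRderive_Cexp. eapply CRderive_eq; [apply CRderive_cmult, CRderive_RtoC|cring]. }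
    assert (DF : CRderive (fun y : R => F (s * dir y)%C) th (Ci * (s * dir th * F' (s * dir th)))%C).
    { apply (is_derive_ext (V := C_R_NormedModule) (fun t : R => F (s * Cexp (0 + t * Ci))%C)).
      - intros t. now rewrite <- E.
      - eapply CRderive_eq; [apply (CRderive_path (fun z => F (s * Cexp z)%C))|].
        + apply (Cderive_comp F (fun z => s * Cexp z)%C); [rewrite <- E; apply F3, Hu|].
          apply Cderive_cmult, Cderive_Cexp.
        + rewrite <- E. reflexivity. }
    eapply CRderive_eq; [apply CRderive_mult; [exact DF|exact Dd]|]. cring.
  - intros s th Hs Hth. assert (Hu : U (s * dir th)%C) by (apply HU; lra).
    assert (DF : CRderive (fun s : R => F (s * dir th)%C) s (dir th * F' (s * dir th))%C).
    { apply (is_derive_ext (V := C_R_NormedModule) (fun t : R => F (0 + t * dir th)%C)).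
      - intros t. f_equal. ring.
      - eapply CRderive_eq; [apply (CRderive_path _ _ _ (F' (s * dir th)%C))|reflexivity].
        replace (0 + s * dir th)%C with (s * dir th)%C by ring. apply F3, Hu. }
    eapply CRderive_eq.
    { apply CRderive_mult; [apply CRderive_cmult, CRderive_mult; [apply CRderive_RtoC|apply CRderive_const]|exact DF]. }
    cring.
Qed.

(** * Contour integrals as ray and arc integrals *)

Lemma is_piece_int_ray (F : C -> C) (K th : R) :
  ex_CInt (fun s : R => F (s * dir th) * dir th)%C 0 K ->
  is_piece_int F (Segment 0%C (K * dir th)%C) (ray F K th) /\
  is_piece_int F (Segment (K * dir th)%C 0%C) (- ray F K th)%C.
Proof.
  intros E. apply CInt_correct in E. fold (ray F K th) in E. split; simpl.
  - pose proof (is_CInt_lin (fun s : R => F (s * dir th) * dir th)%C K 0 0 1 (ray F K th)) as Li.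
    replace (K * 0 + 0) with 0 in Li by ring. replace (K * 1 + 0) with K in Li by ring.
    apply (is_CInt_ext _ _ _ _ _) with (2 := Li E).
    intros s _. cbv beta. rewrite Rplus_0_r, RtoC_mult.
    replace (0 + s * (K * dir th - 0))%C with (K * s * dir th)%C by ring. ring.
  - apply is_CInt_swap in E.
    pose proof (is_CInt_lin (fun s : R => F (s * dir th) * dir th)%C (- K) K 0 1 (- ray F K th)%C) as Li.
    replace (- K * 0 + K) with K in Li by ring. replace (- K * 1 + K) with 0 in Li by ring.
    apply (is_CInt_ext _ _ _ _ _) with (2 := Li E).
    intros s _. cbv beta. rewrite RtoC_plus, RtoC_mult, RtoC_opp.
    replace (K * dir th + s * (0 - K * dir th))%C with ((- K * s + K) * dir th)%C by ring. ring.
Qed.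

Lemma sector_boundary_int (F : C -> C) (K c d : R) :
  ex_CInt (fun s : R => F (s * dir c) * dir c)%C 0 K ->
  ex_CInt (fun s : R => F (s * dir d) * dir d)%C 0 K ->
  is_path_int F (sector_boundary c d K) (ray F K c - ray F K d)%C.
Proof.
  intros Ec Ed. exists (- ray F K d)%C, (ray F K c)%C. split; [|split].
  - apply (proj2 (is_piece_int_ray F K d Ed)).
  - exists (ray F K c), 0%C. split; [|split; [reflexivity|ring]].
    apply (proj1 (is_piece_int_ray F K c Ec)).
  - ring.
Qed.

(** The ray of direction [PI] runs from 0 to [-K], so the negative half line enters with a minus
    sign. *)
Lemma real_line_int (F : C -> C) (K : R) : 0 <= K -> (forall s : R, Ccont (fun s : R => F (RtoC s)) s) ->
  is_path_int F (real_line K) (ray F K 0 - ray F K PI)%C.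
Proof.
  intros HK HF. exists (ray F K 0 - ray F K PI)%C, 0%C.
  split; [|split; [reflexivity|ring]]. simpl.
  assert (E : forall a b, a <= b -> ex_CInt (fun x : R => F x) a b).
  { intros a b Hab. apply ex_CInt_le; [assumption|]. intros s Hs. apply HF. }
  assert (R0 : ray F K 0 = CInt (fun x : R => F x) 0 K).
  { unfold ray. apply CInt_ext. intros x _. rewrite dir_0, !Cmult_1_r. reflexivity. }
  assert (RP : ray F K PI = (- CInt (fun x : R => F x) (- K) 0)%C).
  { unfold ray. apply is_CInt_unique.
    eapply is_CInt_ext; [|apply (is_CInt_lin (fun x : R => F x) (-1) 0 0 K)].
    - intros x _. cbv beta. rewrite dir_PI.
      replace (x * -1)%C with (RtoC (-1 * x + 0)) by (rewrite RtoC_plus, RtoC_mult; ring). ring.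
    - replace (-1 * 0 + 0) with 0 by ring. replace (-1 * K + 0) with (- K) by ring.
      apply is_CInt_swap, CInt_correct, E. lra. }
  rewrite R0, RP.
  replace (CInt (fun x : R => F x) 0 K - - CInt (fun x : R => F x) (- K) 0)%C
    with (CInt (fun x : R => F x) (- K) 0 + CInt (fun x : R => F x) 0 K)%C by ring.
  rewrite CInt_Chasles by (apply E; lra).
  eapply is_CInt_ext; [|apply (is_CInt_lin (fun x : R => F x) (2 * K) (- K) 0 1)].
  - intros s _. cbv beta.
    replace (RtoC (- K) + s * (K - RtoC (- K)))%C with (RtoC (2 * K * s + - K))
      by (rewrite !RtoC_plus, !RtoC_mult, !RtoC_opp; ring).
    rewrite RtoC_mult, RtoC_opp. ring.
  - replace (2 * K * 0 + - K) with (- K) by ring. replace (2 * K * 1 + - K) with K by ring.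
    apply CInt_correct, E. lra.
Qed.

Lemma Cexp_ln (x : R) : 0 < x -> Cexp (ln x) = RtoC x.
Proof. intros. now rewrite Cexp_R, exp_ln. Qed.

Definition strip (u : C) : Prop := - PI <= Im u <= 0.
Definition ostrip (u : C) : Prop := - PI < Im u < 0.

(* [u = ln k] maps the contour to three sides of a rectangle, the fourth side of which
   is the arc of radius [K] in the lower half plane. *)
Lemma R_tilde_int (F G : C -> C) (r K : R) : 0 < r <= K ->
  (forall u, strip u -> F (Cexp u) = G u) -> Hol ostrip strip G ->
  is_path_int F (R_tilde r K)
    (CInt (fun th : R => Ci * Cexp (ln K + Ci * th) * G (ln K + Ci * th))%C (- PI) 0).
Proof.
  intros HrK HFG HG. pose proof PI_RGT_0 as HPI.
  set (f := fun u => (Cexp u * G u)%C).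
  assert (Hf : Hol ostrip strip f) by (unfold f; holo).
  assert (Hlog : ln r <= ln K).
  { destruct (Req_dec r K) as [->|]; [lra|]. left. apply ln_increasing; lra. }
  assert (Hs : forall x y : R, - PI <= y <= 0 -> strip (x + Ci * y)%C).
  { intros x y Hy. unfold strip. simpl. lra. }
  pose proof (cauchy_rectangle ostrip strip f (ln r) (ln K) (- PI) 0 Hlog ltac:(lra)
    (fun x y _ Hy => Hs x y Hy) ltac:(intros; unfold ostrip; simpl; lra) Hf) as HC.
  assert (Gc : forall u, strip u -> holcont G u) by (destruct HG as [? [? _]]; assumption).
  assert (fc : forall u, strip u -> holcont f u) by (destruct Hf as [? [? _]]; assumption).
  assert (Ih : forall th : R, - PI <= th <= 0 -> forall a b, ex_CInt (fun x : R => f (x + Ci * th)%C) a b).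
  { intros th Hth a b. apply ex_CInt_cont. intros x _.
    apply (Ccont_comp (fun x : R => x + Ci * th)%C f); [ccont|]. apply fc, Hs, Hth. }
  assert (Iv : forall x : R, ex_CInt (fun th : R => Ci * f (x + Ci * th)%C)%C (- PI) 0).
  { intros x. apply ex_CInt_le; [lra|]. intros th Hth. apply Ccont_mult; [apply Ccont_const|].
    apply (Ccont_comp (fun th : R => x + Ci * th)%C f); [ccont|]. apply fc, Hs, Hth. }
  rewrite CInt_minus in HC by (apply Ih; lra). rewrite CInt_minus in HC by apply Iv.
  (* In the variable [e^x] a horizontal side is the segment between the radii [r] and [K] in
     direction [th]; the two real pieces of the contour are [th = 0] and [th = - PI]. *)
  assert (Sub : forall th : R, - PI <= th <= 0 ->
    is_CInt (fun x : R => dir th * G (ln x + Ci * th)%C)%C r K (CInt (fun x : R => f (x + Ci * th)%C) (ln r) (ln K))).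
  { intros th Hth.
    set (h := fun x : R => (dir th * G (ln x + Ci * th)%C)%C).
    assert (hc : forall x, 0 < x -> Ccont h x).
    { intros x Hx. apply Ccont_mult; [apply Ccont_const|].
      apply (Ccont_comp (fun x : R => ln x + Ci * th)%C G); [|apply Gc, Hs, Hth].
      apply Ccont_plus; [|apply Ccont_const]. apply Ccont_RtoC.
      apply (ex_derive_continuous (V := R_NormedModule)). eexists. now apply is_derive_ln. }
    assert (E : CInt (fun x : R => f (x + Ci * th)%C) (ln r) (ln K) = CInt h r K).
    { rewrite <- (exp_ln r) at 2 by lra. rewrite <- (exp_ln K) at 2 by lra.
      apply is_CInt_unique. eapply is_CInt_ext; [|apply (is_RInt_comp (V := C_R_CompleteNormedModule) h exp exp)].
      - intros x _. unfold h, f. rewrite ln_exp, Cexp_plus, Cexp_R.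
        unfold scal; simpl. apply C_ext; simpl; unfold scal; simpl; unfold mult, Re, Im; simpl; ring.
      - intros x _. apply hc, exp_pos.
      - intros x _. split; [|apply continuous_exp]. apply is_derive_exp. }
    rewrite E. apply CInt_correct, ex_CInt_le; [lra|]. intros x Hx. apply hc. lra. }
  exists (- CInt (fun x : R => f (x + Ci * (- PI)%R)%C) (ln r) (ln K))%C.
  exists (CInt (fun th : R => Ci * f (ln r + Ci * th)%C)%C (- PI) 0
     + CInt (fun x : R => f (x + Ci * 0%R)%C) (ln r) (ln K))%C.
  split; [|split].
  - simpl. eapply is_CInt_ext; [|apply (is_CInt_lin (fun x : R => dir (- PI) * G (ln x + Ci * (- PI)%R)%C)%C (r - K) K 0 1)].
    + rewrite Rmin_left, Rmax_right by lra. intros s Hs'. cbv beta.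
      assert (Hx : 0 < (r - K) * s + K) by nra.
      replace (RtoC (- K) + s * (RtoC (- r) - RtoC (- K)))%C
        with (Cexp (ln ((r - K) * s + K) + Ci * (- PI)%R)).
      * rewrite HFG by (apply Hs; lra). rewrite dir_mPI, !RtoC_minus, !RtoC_opp. ring.
      * rewrite Cexp_plus, Cexp_ln, dir_mPI by assumption.
        rewrite RtoC_plus, RtoC_mult, RtoC_minus, !RtoC_opp. ring.
    + replace ((r - K) * 0 + K) with K by ring. replace ((r - K) * 1 + K) with r by ring.
      apply is_CInt_swap, Sub. lra.
  - exists (CInt (fun th : R => Ci * f (ln r + Ci * th)%C)%C (- PI) 0).
    exists (CInt (fun x : R => f (x + Ci * 0%R)%C) (ln r) (ln K)).
    split; [|split; [|reflexivity]].
    + simpl. eapply is_CInt_ext; [|apply CInt_correct, Iv].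
      rewrite Rmin_left, Rmax_right by lra. intros th Hth. unfold f.
      rewrite <- HFG by (apply Hs; lra).
      rewrite Cexp_plus, Cexp_ln, Cplus_0_l by lra. ring.
    + exists (CInt (fun x : R => f (x + Ci * 0%R)%C) (ln r) (ln K)), 0%C.
      split; [|split; [reflexivity|symmetry; apply Cplus_0_r]]. simpl.
      eapply is_CInt_ext; [|apply (is_CInt_lin (fun x : R => dir 0 * G (ln x + Ci * 0%R)%C)%C (K - r) r 0 1)].
      * rewrite Rmin_left, Rmax_right by lra. intros s Hs'. cbv beta.
        assert (Hx : 0 < (K - r) * s + r) by nra.
        replace (r + s * (K - r))%C with (Cexp (ln ((K - r) * s + r) + Ci * 0%R)).
        -- rewrite HFG by (apply Hs; lra). rewrite dir_0, !RtoC_minus. ring.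
        -- rewrite Cexp_plus, Cexp_ln, dir_0 by assumption.
           rewrite RtoC_plus, RtoC_mult, RtoC_minus. ring.
      * replace ((K - r) * 0 + r) with r by ring. replace ((K - r) * 1 + r) with K by ring.
        apply Sub. lra.
  - transitivity (CInt (fun th : R => Ci * f (ln K + Ci * th)%C)%C (- PI) 0).
    + apply CInt_ext. intros th _. unfold f. ring.
    + transitivity ((CInt (fun th : R => Ci * f (ln K + Ci * th)%C)%C (- PI) 0
        - CInt (fun th : R => Ci * f (ln r + Ci * th)%C)%C (- PI) 0)
        + CInt (fun th : R => Ci * f (ln r + Ci * th)%C)%C (- PI) 0)%C; [cring|].
      rewrite <- HC. cring.
Qed.

(** * Jordan's lemma *)

(** A weak form of [sin y >= 2 y / PI]: the slope is at least 1/2 up to [PI / 3], and from there on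
    [sin y >= 1/2 >= y / 4], since [PI <= 4]. *)
Lemma sin_ge_quarter (y : R) : 0 <= y <= PI / 2 -> y / 4 <= sin y.
Proof.
  intros Hy. pose proof PI_RGT_0. pose proof PI_4.
  destruct (Rle_dec y (PI / 3)) as [H3|H3].
  - destruct (MVT_gen sin 0 y cos) as [c [Hc E]].
    + intros x _. apply is_derive_sin.
    + intros x _. apply continuity_sin.
    + rewrite Rmin_left, Rmax_right in Hc by lra. rewrite sin_0 in E.
      assert (1 / 2 <= cos c) by (rewrite <- cos_PI3; apply cos_decr_1; lra).
      nra.
  - assert (sin (PI / 6) <= sin y) by (apply sin_incr_1; lra).
    rewrite sin_PI6 in *. lra.
Qed.

(** One exponential for each half of [[0, PI]]; their sum integrates in closed form without
    splitting the interval. *)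
Lemma exp_sin_le (c y : R) : 0 <= c -> 0 <= y <= PI ->
  exp (- (c * sin y)) <= exp (- (c / 4 * y)) + exp (- (c / 4 * (PI - y))).
Proof.
  intros Hc Hy. pose proof (exp_pos (- (c / 4 * y))). pose proof (exp_pos (- (c / 4 * (PI - y)))).
  destruct (Rle_dec y (PI / 2)) as [H2|H2].
  - assert (S := sin_ge_quarter y ltac:(lra)).
    assert (exp (- (c * sin y)) <= exp (- (c / 4 * y))) by (apply exp_le; nra). lra.
  - assert (S := sin_ge_quarter (PI - y) ltac:(lra)). rewrite sin_PI_x in S.
    assert (exp (- (c * sin y)) <= exp (- (c / 4 * (PI - y)))) by (apply exp_le; nra). lra.
Qed.

Lemma jordan (f : R -> C) (a b m c M : R) : 0 < m -> 0 < c -> 0 <= M -> b = a + PI / m ->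
  (forall th, a <= th <= b -> Cmod (f th) <= M * exp (- (c * sin (m * (th - a))))) ->
  ex_CInt f a b -> Cmod (CInt f a b) <= 8 * M / (m * c).
Proof.
  intros Hm Hc HM -> Hf Ex. pose proof PI_RGT_0.
  assert (Hpm : 0 < PI / m) by (apply Rdiv_lt_0_compat; lra).
  assert (Hk : 0 < 4 * M / (m * c) \/ 4 * M / (m * c) = 0).
  { destruct HM as [HM| <-]; [left; apply Rdiv_lt_0_compat; nra|right; field; lra]. }
  (* A primitive of the majorant [g] below; each of the two exponentials contributes at most
     [4 M / (m c)]. *)
  set (h := fun th => 4 * M / (m * c) * (exp (- (c / 4 * (PI - m * (th - a)))) - exp (- (c / 4 * (m * (th - a)))))).
  set (g := fun th => M * (exp (- (c / 4 * (m * (th - a)))) + exp (- (c / 4 * (PI - m * (th - a)))))).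
  assert (I : is_RInt g a (a + PI / m) (h (a + PI / m) - h a)).
  { apply (is_RInt_derive (V := R_CompleteNormedModule) h g).
    - intros x _. unfold h, g. auto_derive; [trivial|]. unfold Rminus. field. lra.
    - intros x _. unfold g. apply (ex_derive_continuous (V := R_NormedModule)).
      auto_derive. trivial. }
  eapply Rle_trans.
  - refine (Cmod_is_CInt_le f g _ _ _ _ _ _ (CInt_correct _ _ _ Ex) I); [lra|].
    intros x Hx. eapply Rle_trans; [apply Hf, Hx|].
    unfold g. apply Rmult_le_compat_l; [assumption|]. apply exp_sin_le; [lra|].
    split; [apply Rmult_le_pos; lra|].
    replace PI with (m * (PI / m)) by (field; lra). apply Rmult_le_compat_l; lra.
  - unfold h. replace (m * (a + PI / m - a)) with PI by (field; lra).
    replace (m * (a - a)) with 0 by ring.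
    replace (- (c / 4 * (PI - PI))) with 0 by ring. replace (- (c / 4 * 0)) with 0 by ring.
    rewrite Rminus_0_r, exp_0.
    pose proof (exp_pos (- (c / 4 * PI))).
    replace (8 * M / (m * c)) with (4 * M / (m * c) * 2) by (field; lra).
    rewrite <- Rmult_minus_distr_l. apply Rmult_le_compat_l; [destruct Hk; lra|].
    lra.
Qed.

Lemma RInt_exp_bound (k a : R) : 0 < k -> 0 <= a -> RInt (fun z => exp (- (k * z))) 0 a <= / k.
Proof.
  intros Hk Ha.
  assert (I : is_RInt (fun z => exp (- (k * z))) 0 a (- exp (- (k * a)) / k - - exp (- (k * 0)) / k)).
  { apply (is_RInt_derive (V := R_CompleteNormedModule) (fun z => - exp (- (k * z)) / k)).
    - intros x _. auto_derive; [trivial|]. field. lra.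
    - intros x _. apply (ex_derive_continuous (V := R_NormedModule)). auto_derive. trivial. }
  rewrite (is_RInt_unique (V := R_CompleteNormedModule) _ _ _ _ I).
  rewrite Rmult_0_r, Ropp_0, exp_0.
  assert (0 <= exp (- (k * a)) / k) by (apply Rmult_le_pos; [left; apply exp_pos|left; now apply Rinv_0_lt_compat]).
  unfold Rdiv in *. lra.
Qed.

(** * Laplace-Fourier transforms in the upper half plane *)

Definition upper (z : C) : Prop := 0 <= Im z.

Definition Lfin (a : R) (f : R -> C) (mu : C) : C := CInt (fun y => Cexp (Ci * mu * y) * f y)%C 0 a.

(** Inequalities with one constant, up to and including the real axis. Unlike differentiability they
    survive the passage from the interval [[0, a]] to the half line. *)
Definition transform (F F' : C -> C) (B : R) : Prop := forall m n, upper m -> upper n ->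
  Cmod (F m) <= B /\ Cmod (F' m) <= B /\ Cmod (F' n - F' m)%C <= B * Cmod (n - m)%C /\
  Cmod (F n - F m - (n - m) * F' m)%C <= B * Cmod (n - m)%C ^ 2.

(* Composition with [clampIm] extends a transform continuously to the whole plane. *)
Definition clampIm (z : C) : C := (Re z, Rmax 0 (Im z)).

Lemma clampIm_upper (z : C) : upper (clampIm z).
Proof. unfold upper, clampIm; simpl. apply Rmax_l. Qed.

Lemma clampIm_id (z : C) : upper z -> clampIm z = z.
Proof. intros H. apply C_ext; simpl; [reflexivity|]. now apply Rmax_right. Qed.

Lemma clampIm_lip (z w : C) : Cmod (clampIm z - clampIm w) <= Cmod (z - w).
Proof.
  unfold Cmod. apply sqrt_le_1_alt. apply Rplus_le_compat; simpl; [right; reflexivity|].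
  rewrite !Rmult_1_r. apply Rsqr_le_abs_1. unfold Im.
  unfold Rmax, Rabs. destruct z as [? z], w as [? w]; simpl.
  repeat destruct Rle_dec; repeat destruct Rcase_abs; lra.
Qed.

(** Only points closer than 1 are compared, because for a transform the Lipschitz bound is read off
    its Taylor bound, whose quadratic term is then dominated by a linear one. *)
Lemma lip_clampIm_holcont (F : C -> C) (B : R) (z : C) : 0 <= B ->
  (forall m n, upper m -> upper n -> Cmod (n - m) < 1 -> Cmod (F n - F m)%C <= B * Cmod (n - m)%C) ->
  holcont (fun z => F (clampIm z)) z.
Proof.
  intros HB H. apply (Ccont_eps (U := C_UniformSpace)). intros e He.
  assert (P : 0 < e / (B + 1)) by (apply Rdiv_lt_0_compat; lra).
  apply (locally_Cmod z _ (Rmin 1 (e / (B + 1)))); [apply Rmin_pos; lra|].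
  intros w Hw. apply Rmin_Rgt_l in Hw. destruct Hw as [H1 H2].
  pose proof (clampIm_lip w z) as L.
  eapply Rle_lt_trans; [apply H; try apply clampIm_upper; lra|].
  pose proof (Cmod_ge_0 (clampIm w - clampIm z)).
  apply Rle_lt_trans with ((B + 1) * Cmod (w - z)); [nra|].
  replace e with ((B + 1) * (e / (B + 1))) by (field; lra).
  apply Rmult_lt_compat_l; lra.
Qed.

Lemma transform_Hol (F F' : C -> C) (B : R) : 0 <= B -> transform F F' B ->
  Hol (fun z => 0 < Im z) (fun _ => True) (fun z => F (clampIm z)).
Proof.
  intros HB H. exists (fun z => F' (clampIm z)). repeat split.
  - intros z _. apply lip_clampIm_holcont with (2 * B); [lra|]. intros m n Hm Hn H1.
    destruct (H m n Hm Hn) as [_ [K2 [_ K]]].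
    replace (F n - F m)%C with ((F n - F m - (n - m) * F' m) + (n - m) * F' m)%C by ring.
    eapply Rle_trans; [apply Cmod_triangle|]. rewrite Cmod_mult.
    pose proof (Cmod_ge_0 (n - m)). 
    assert (Cmod (n - m) * Cmod (F' m) <= Cmod (n - m) * B) by (apply Rmult_le_compat_l; lra).
    assert (B * Cmod (n - m) ^ 2 <= B * Cmod (n - m)) by (apply Rmult_le_compat_l; [lra|]; simpl; nra).
    lra.
  - intros z _. apply lip_clampIm_holcont with B; [assumption|]. intros m n Hm Hn _.
    apply (H m n Hm Hn).
  (* The radius [Im z] keeps [z + h] in the upper half plane, where [clampIm] is the identity. *)
  - intros z Hz. apply (Cderive_quadratic _ _ _ (Im z) B); try assumption.
    intros h Hh. pose proof (im_le_Cmod h) as K. pose proof (Rabs_le_between (Im h) (Cmod h)) as [K' _].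
    specialize (K' K).
    assert (U1 : upper z) by (unfold upper; lra).
    assert (U2 : upper (z + h)) by (unfold upper, Im in *; simpl; unfold Im in *; lra).
    rewrite !clampIm_id by assumption.
    destruct (H z (z + h)%C U1 U2) as [_ [_ [_ E]]].
    replace (z + h - z)%C with h in E by ring. exact E.
Qed.

Lemma Re_Ci_mult (mu : C) (y : R) : Re (Ci * mu * y)%C = - (Im mu * y).
Proof. simpl. unfold Im, Re. ring. Qed.

Lemma Cmod_kernel_le (mu : C) (y : R) : upper mu -> 0 <= y -> Cmod (Cexp (Ci * mu * y)) <= 1.
Proof.
  intros Hm Hy. rewrite Cmod_Cexp, Re_Ci_mult, <- exp_0. apply exp_le.
  unfold upper in Hm. pose proof (Rmult_le_pos _ _ Hm Hy). lra.
Qed.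

Lemma kernel_lip (m n : C) (y : R) : upper m -> upper n -> 0 <= y ->
  Cmod (Cexp (Ci * n * y) - Cexp (Ci * m * y)) <= Cmod (n - m) * y.
Proof.
  intros Hm Hn Hy. eapply Rle_trans; [apply Cmod_Cexp_minus_le|].
  replace (Ci * n * y - Ci * m * y)%C with (Ci * ((n - m) * y))%C by ring.
  rewrite !Cmod_mult, Cmod_Ci, Cmod_R, Rabs_pos_eq, Rmult_1_l by assumption.
  rewrite !Re_Ci_mult. unfold upper in *.
  pose proof (Rmult_le_pos _ _ Hm Hy). pose proof (Rmult_le_pos _ _ Hn Hy).
  rewrite <- (Rmult_1_r (Cmod (n - m) * y)) at 2. apply Rmult_le_compat_l.
  - apply Rmult_le_pos; [apply Cmod_ge_0|assumption].
  - rewrite <- exp_0. apply exp_le. unfold Rmax. destruct Rle_dec; lra.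
Qed.

(** With [e^{imy}] factored out, the Taylor remainder grows at most like [exp (- Im (n - m) y)], and
    the factor compensates this because [Im n >= 0]. *)
Lemma kernel_taylor (m n : C) (y : R) : upper m -> upper n -> 0 <= y ->
  Cmod (Cexp (Ci * n * y) - Cexp (Ci * m * y) - (n - m) * (Ci * y * Cexp (Ci * m * y)))
   <= Cmod (n - m) ^ 2 * y ^ 2.
Proof.
  intros Hm Hn Hy.
  replace (Ci * n * y)%C with (Ci * m * y + Ci * (n - m) * y)%C by ring. rewrite Cexp_plus.
  replace (Cexp (Ci * m * y) * Cexp (Ci * (n - m) * y) - Cexp (Ci * m * y) - (n - m) * (Ci * y * Cexp (Ci * m * y)))%C
    with (Cexp (Ci * m * y) * (Cexp (Ci * (n - m) * y) - 1 - Ci * (n - m) * y))%C by ring.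
  rewrite Cmod_mult.
  pose proof (Cmod_Cexp_taylor (Ci * (n - m) * y)) as T.
  rewrite Re_Ci_mult in T. rewrite Cmod_Cexp, Re_Ci_mult.
  assert (E : Cmod (Ci * (n - m) * y) = Cmod (n - m) * y)
    by (rewrite !Cmod_mult, Cmod_Ci, Cmod_R, Rabs_pos_eq by assumption; ring).
  rewrite E in T.
  apply Rle_trans with (exp (- (Im m * y)) * ((Cmod (n - m) * y) ^ 2 * exp (Rmax 0 (- (Im (n - m) * y))))).
  - apply Rmult_le_compat_l; [left; apply exp_pos|exact T].
  - replace (exp (- (Im m * y)) * ((Cmod (n - m) * y) ^ 2 * exp (Rmax 0 (- (Im (n - m) * y)))))
      with (Cmod (n - m) ^ 2 * y ^ 2 * (exp (- (Im m * y)) * exp (Rmax 0 (- (Im (n - m) * y))))) by ring.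
    rewrite <- exp_plus. rewrite <- (Rmult_1_r (Cmod (n - m) ^ 2 * y ^ 2)) at 2.
    apply Rmult_le_compat_l; [apply Rmult_le_pos; apply pow_le; [apply Cmod_ge_0|assumption]|].
    rewrite <- exp_0. apply exp_le.
    pose proof (Rmult_le_pos _ _ Hm Hy) as A1. pose proof (Rmult_le_pos _ _ Hn Hy) as A2.
    replace (Im (n - m)) with (Im n - Im m) by (simpl; unfold Im; ring).
    unfold Rmax. destruct Rle_dec; lra.
Qed.

(* The bound [M] controls [f], [y f] and [y^2 f] in L1, uniformly in the length of the interval. *)
Definition decays (I : R -> Prop) (f : R -> C) (M : R) : Prop :=
  forall y, I y -> 0 <= y -> Ccont f y /\ Cmod (f y) * (1 + y) ^ 4 <= M.

Lemma RInt_inv_square (a : R) : 0 <= a ->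
  is_RInt (fun y => / (1 + y) ^ 2) 0 a (1 - / (1 + a)).
Proof.
  intros Ha. replace (1 - / (1 + a)) with (- / (1 + a) - - / (1 + 0)) by (rewrite Rplus_0_r; field; lra).
  apply (is_RInt_derive (V := R_CompleteNormedModule) (fun y => - / (1 + y)));
  rewrite Rmin_left, Rmax_right by lra; intros x Hx.
  - auto_derive; [lra|]. field. lra.
  - apply (ex_derive_continuous (V := R_NormedModule)). auto_derive. nra.
Qed.

(** The integral of [(1 + y)^-2] over the half line is 1, so no constant appears. *)
Lemma Cmod_CInt_decay (f : R -> C) (a M : R) : 0 <= a -> 0 <= M ->
  (forall y, 0 <= y <= a -> Cmod (f y) * (1 + y) ^ 2 <= M) -> ex_CInt f 0 a ->
  Cmod (CInt f 0 a) <= M.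
Proof.
  intros Ha HM Hf Ex.
  apply Rle_trans with (M * (1 - / (1 + a))).
  - refine (Cmod_is_CInt_le f (fun y => M * / (1 + y) ^ 2) 0 a _ _ Ha _ (CInt_correct _ _ _ Ex) _).
    + intros y Hy. assert (0 < (1 + y) ^ 2) by nra.
      apply Rmult_le_reg_r with ((1 + y) ^ 2); [assumption|].
      rewrite Rmult_assoc, Rinv_l by lra. rewrite Rmult_1_r. now apply Hf.
    + apply (is_RInt_scal (V := R_NormedModule) (fun y => / (1 + y) ^ 2)), RInt_inv_square, Ha.
  - assert (0 < / (1 + a)) by (apply Rinv_0_lt_compat; lra). nra.
Qed.

Lemma Lfin_transform (a : R) (f : R -> C) (M : R) : 0 <= a ->
  decays (fun y => y <= a) f M ->
  transform (Lfin a f) (Lfin a (fun y => Ci * y * f y)%C) M.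
Proof.
  intros Ha Hf m n Hm Hn.
  assert (HM : 0 <= M).
  { destruct (Hf 0) as [_ H]; [lra..|]. eapply Rle_trans; [|exact H].
    apply Rmult_le_pos; [apply Cmod_ge_0|apply pow_le; lra]. }
  assert (Hc : forall y, 0 <= y <= a -> Ccont f y) by (intros y Hy; apply Hf; lra).
  assert (Hb : forall y, 0 <= y <= a -> Cmod (f y) * (1 + y) ^ 4 <= M) by (intros y Hy; apply Hf; lra).
  assert (E0 : forall mu, ex_CInt (fun y => Cexp (Ci * mu * y) * f y)%C 0 a).
  { intros mu. apply ex_CInt_le; [assumption|]. intros y Hy. specialize (Hc y Hy). ccont. }
  assert (E1 : forall mu, ex_CInt (fun y => Cexp (Ci * mu * y) * (Ci * y * f y))%C 0 a).
  { intros mu. apply ex_CInt_le; [assumption|]. intros y Hy. specialize (Hc y Hy). ccont. }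
  assert (pw : forall y, 0 <= y -> (1 + y) ^ 2 <= (1 + y) ^ 4 /\ y * (1 + y) ^ 2 <= (1 + y) ^ 4 /\ y ^ 2 * (1 + y) ^ 2 <= (1 + y) ^ 4).
  { intros y Hy. replace ((1 + y) ^ 4) with ((1 + y) ^ 2 * (1 + y) ^ 2) by ring.
    assert (1 <= (1 + y) ^ 2) by nra. assert (y <= (1 + y) ^ 2) by nra. assert (y ^ 2 <= (1 + y) ^ 2) by nra.
    repeat split; nra. }
  (* In each of the four bounds [f] is multiplied by a kernel expression of size [A p], with [p] one
     of [1], [y], [y^2]; the fourth power in [decays] leaves a square to integrate. *)
  assert (Bd : forall (h : R -> C) y p, 0 <= y <= a -> 0 <= p -> p * (1 + y) ^ 2 <= (1 + y) ^ 4 ->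
     forall A, 0 <= A -> Cmod (h y) <= A * p -> Cmod (h y * f y) * (1 + y) ^ 2 <= A * M).
  { intros h y p Hy Hp Hp4 A HA Hh. rewrite Cmod_mult. pose proof (Hb y Hy).
    pose proof (Cmod_ge_0 (f y)). pose proof (Cmod_ge_0 (h y)).
    assert (0 <= (1 + y) ^ 2) by nra.
    apply Rle_trans with (A * p * Cmod (f y) * (1 + y) ^ 2).
    - apply Rmult_le_compat_r; [assumption|]. apply Rmult_le_compat_r; assumption.
    - replace (A * p * Cmod (f y) * (1 + y) ^ 2) with (A * (Cmod (f y) * (p * (1 + y) ^ 2))) by ring.
      apply Rmult_le_compat_l; [assumption|].
      apply Rle_trans with (Cmod (f y) * (1 + y) ^ 4); [|assumption].
      apply Rmult_le_compat_l; assumption. }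
  assert (K1 : forall y, 0 <= y <= a -> Cmod (Cexp (Ci * m * y)) <= 1) by (intros; apply Cmod_kernel_le; tauto).
  pose proof (Cmod_ge_0 (n - m)) as Kn.
  split; [|split; [|split]].
  - apply Cmod_CInt_decay; auto. intros y Hy. destruct (pw y) as [p0 [p1 p2]]; [lra|].
    rewrite <- (Rmult_1_l M).
    apply (Bd (fun y => Cexp (Ci * m * y)) y 1); try lra. rewrite Rmult_1_l. now apply K1.
  - apply Cmod_CInt_decay; auto. intros y Hy. destruct (pw y) as [p0 [p1 p2]]; [lra|].
    rewrite <- (Rmult_1_l M). rewrite Cmult_assoc.
    apply (Bd (fun y => Cexp (Ci * m * y) * (Ci * y))%C y y); try lra.
    rewrite !Cmod_mult, Cmod_Ci, Cmod_R, Rabs_pos_eq by lra.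
    specialize (K1 y Hy). nra.
  - unfold Lfin. rewrite <- CInt_minus by apply E1. rewrite Rmult_comm.
    apply Cmod_CInt_decay; auto; [now apply Rmult_le_pos| |].
    + intros y Hy. destruct (pw y) as [p0 [p1 p2]]; [lra|].
      replace (Cexp (Ci * n * y) * (Ci * y * f y) - Cexp (Ci * m * y) * (Ci * y * f y))%C
        with ((Cexp (Ci * n * y) - Cexp (Ci * m * y)) * (Ci * y) * f y)%C by ring.
      apply (Bd (fun y => (Cexp (Ci * n * y) - Cexp (Ci * m * y)) * (Ci * y))%C y (y ^ 2)); try lra; [nra|].
      rewrite !Cmod_mult, Cmod_Ci, Cmod_R, Rabs_pos_eq by lra.
      pose proof (kernel_lip m n y Hm Hn (proj1 Hy)). nra.
    + apply (ex_RInt_minus (V := C_R_NormedModule)); apply E1.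
  - unfold Lfin. rewrite <- CInt_minus by apply E0. rewrite <- CInt_cmult by apply E1.
    rewrite <- CInt_minus;
      [|apply (ex_RInt_minus (V := C_R_NormedModule)); apply E0|].
    + rewrite Rmult_comm. apply Cmod_CInt_decay; auto; [apply Rmult_le_pos; [now apply pow_le|assumption]| |].
      * intros y Hy. destruct (pw y) as [p0 [p1 p2]]; [lra|].
        replace (Cexp (Ci * n * y) * f y - Cexp (Ci * m * y) * f y - (n - m) * (Cexp (Ci * m * y) * (Ci * y * f y)))%C
          with ((Cexp (Ci * n * y) - Cexp (Ci * m * y) - (n - m) * (Ci * y * Cexp (Ci * m * y))) * f y)%C by ring.
        apply (Bd (fun y => (Cexp (Ci * n * y) - Cexp (Ci * m * y) - (n - m) * (Ci * y * Cexp (Ci * m * y))))%C y (y ^ 2)); try lra; [nra|now apply pow_le|].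
        apply kernel_taylor; try assumption; lra.
      * apply ex_CInt_le; [assumption|]. intros y Hy. specialize (Hc y Hy). ccont.
    + apply ex_CInt_le; [assumption|]. intros y Hy. specialize (Hc y Hy). ccont.
Qed.

(** * Limits at infinity of complex valued functions *)

Notation Clim f l := (filterlim f (Rbar_locally p_infty) (locally (T := C_UniformSpace) (l : C))).

Lemma Clim_eps (f : R -> C) (l : C) :
  Clim f l <-> (forall e, 0 < e -> exists X, forall x, X < x -> Cmod (f x - l) < e).
Proof.
  split.
  - intros H e He.
    assert (N : locally (T := C_UniformSpace) l (fun z => Cmod (z - l) < e)) by now apply (locally_Cmod l _ e).
    destruct (H _ N) as [X HX]. exists X. exact HX.
  - intros H P HP. destruct (locally_Cmod_inv l P HP) as [d [Hd Hd2]].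
    destruct (H d Hd) as [X HX]. exists X. intros x Hx. apply Hd2, HX, Hx.
Qed.

Lemma Clim_unique (f : R -> C) (l l' : C) : Clim f l -> Clim f l' -> l = l'.
Proof. apply (filterlim_locally_unique (V := C_R_NormedModule)). Qed.

Lemma Clim_eq (f : R -> C) (l l' : C) : Clim f l -> l = l' -> Clim f l'.
Proof. now intros ? <-. Qed.

Lemma Clim_ext_loc (f g : R -> C) (l : C) (X : R) :
  (forall x, X < x -> f x = g x) -> Clim f l -> Clim g l.
Proof. intros H. apply filterlim_ext_loc. now exists X. Qed.

Lemma Clim_const (c : C) : Clim (fun _ => c) c.
Proof. apply filterlim_const. Qed.

Lemma Clim_plus (f g : R -> C) (a b : C) : Clim f a -> Clim g b -> Clim (fun x => f x + g x)%C (a + b)%C.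
Proof.
  intros Hf Hg. apply Clim_eps. intros e He.
  destruct (proj1 (Clim_eps f a) Hf (e / 2)) as [X HX]; [lra|].
  destruct (proj1 (Clim_eps g b) Hg (e / 2)) as [Y HY]; [lra|].
  exists (Rmax X Y). intros x Hx. pose proof (Rmax_l X Y). pose proof (Rmax_r X Y).
  replace (f x + g x - (a + b))%C with ((f x - a) + (g x - b))%C by ring.
  eapply Rle_lt_trans; [apply Cmod_triangle|].
  specialize (HX x ltac:(lra)). specialize (HY x ltac:(lra)). lra.
Qed.

Lemma Clim_cmult (c : C) (f : R -> C) (a : C) : Clim f a -> Clim (fun x => c * f x)%C (c * a)%C.
Proof.
  intros Hf. apply Clim_eps. intros e He. pose proof (Cmod_ge_0 c).
  destruct (proj1 (Clim_eps f a) Hf (e / (Cmod c + 1))) as [X HX]; [apply Rdiv_lt_0_compat; lra|].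
  exists X. intros x Hx. specialize (HX x Hx).
  replace (c * f x - c * a)%C with (c * (f x - a))%C by ring. rewrite Cmod_mult.
  apply Rle_lt_trans with ((Cmod c + 1) * Cmod (f x - a)); [pose proof (Cmod_ge_0 (f x - a)); nra|].
  replace e with ((Cmod c + 1) * (e / (Cmod c + 1))) by (field; lra).
  apply Rmult_lt_compat_l; lra.
Qed.

Lemma Clim_minus (f g : R -> C) (a b : C) : Clim f a -> Clim g b -> Clim (fun x => f x - g x)%C (a - b)%C.
Proof.
  intros Hf Hg. apply (Clim_ext_loc (fun x => f x + (-1) * g x)%C _ _ 0); [intros; ring|].
  replace (a - b)%C with (a + (-1) * b)%C by ring. apply Clim_plus; [|apply Clim_cmult]; assumption.
Qed.

Lemma Clim_bound (f : R -> C) (l : C) (B X : R) : Clim f l ->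
  (forall x, X < x -> Cmod (f x) <= B) -> Cmod l <= B.
Proof.
  intros Hf HB. apply Rnot_lt_le. intros Hlt.
  destruct (proj1 (Clim_eps f l) Hf (Cmod l - B)) as [Y HY]; [lra|].
  set (x := Rmax X Y + 1).
  assert (X < x) by (unfold x; pose proof (Rmax_l X Y); lra).
  assert (Y < x) by (unfold x; pose proof (Rmax_r X Y); lra).
  specialize (HY x ltac:(assumption)). specialize (HB x ltac:(assumption)).
  pose proof (Cmod_minus_triangle (f x) (f x - l)) as T.
  replace (f x - (f x - l))%C with l in T by ring. lra.
Qed.

Lemma Clim_0_le (f : R -> C) (g : R -> R) (X : R) :
  (forall x, X < x -> Cmod (f x) <= g x) ->
  (forall e, 0 < e -> exists Y, forall x, Y < x -> g x < e) -> Clim f 0%C.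
Proof.
  intros Hf Hg. apply Clim_eps. intros e He. destruct (Hg e He) as [Y HY].
  exists (Rmax X Y). intros x Hx. pose proof (Rmax_l X Y). pose proof (Rmax_r X Y).
  replace (f x - 0)%C with (f x) by ring.
  eapply Rle_lt_trans; [apply Hf; lra|apply HY; lra].
Qed.

Lemma Clim_comp (f : R -> C) (g : R -> R) (l : C) : Clim f l ->
  (forall A, exists X, forall x, X < x -> A < g x) -> Clim (fun x => f (g x)) l.
Proof.
  intros Hf Hg. apply (filterlim_comp _ _ _ g f _ (Rbar_locally p_infty)); [|exact Hf].
  intros P [A HA]. destruct (Hg A) as [X HX]. exists X. intros x Hx. apply HA, HX, Hx.
Qed.

(** * Improper integrals of dominated functions *)

(** The form of decay granted to a solution: an integrable majorant without any rate. For the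
    initial data the quantitative [decays] is available. *)
Definition dominated (f : R -> C) (g : R -> R) : Prop :=
  (forall y, 0 <= y -> Ccont f y) /\ (forall y, 0 <= y -> Cmod (f y) <= g y) /\
  ex_RInt_gen g (at_point 0) (Rbar_locally p_infty).

(** Convergence provides integrals over [[0, b]] for large [b] only; the others come by
    restriction. *)
Lemma ex_RInt_gen_lim (g : R -> R) : ex_RInt_gen g (at_point 0) (Rbar_locally p_infty) ->
  exists l, (forall b, 0 <= b -> ex_RInt g 0 b) /\
    forall e, 0 < e -> exists X, forall b, X < b -> Rabs (RInt g 0 b - l) < e.
Proof.
  intros [l Hl]. exists l.
  assert (K : forall e, 0 < e -> exists X, forall b, X < b -> exists z, is_RInt g 0 b z /\ Rabs (z - l) < e).
  { intros e He. destruct (Hl _ (locally_ball l (mkposreal e He))) as [Q S HQ [X HX] H].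
    exists X. intros b Hb. destruct (H 0 b HQ (HX b Hb)) as [z [Hz1 Hz2]]. exists z. now split. }
  split.
  - intros b Hb. destruct (K 1 ltac:(lra)) as [X HX].
    set (c := Rmax b X + 1). destruct (HX c) as [z [Hz _]].
    { unfold c. pose proof (Rmax_r b X). lra. }
    apply (ex_RInt_Chasles_1 (V := R_CompleteNormedModule) g 0 b c).
    + unfold c. pose proof (Rmax_l b X). lra.
    + now exists z.
  - intros e He. destruct (K e He) as [X HX]. exists X. intros b Hb.
    destruct (HX b Hb) as [z [Hz1 Hz2]].
    now rewrite (is_RInt_unique (V := R_CompleteNormedModule) _ _ _ _ Hz1).
Qed.

Lemma RInt_Chasles_R (g : R -> R) (a b c : R) : ex_RInt g a b -> ex_RInt g b c ->
  RInt g a c = RInt g a b + RInt g b c.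
Proof. intros H1 H2. symmetry. apply (RInt_Chasles (V := R_CompleteNormedModule) g a b c H1 H2). Qed.

Lemma dominated_nonneg (f : R -> C) (g : R -> R) : dominated f g -> forall y, 0 <= y -> 0 <= g y.
Proof. intros [_ [H _]] y Hy. eapply Rle_trans; [apply Cmod_ge_0|now apply H]. Qed.

(** Cauchy's criterion: the increments are bounded by those of the convergent integral of [g]. *)
Lemma dominated_lim (f : R -> C) (g : R -> R) : dominated f g -> exists l, Clim (fun b => CInt f 0 b) l.
Proof.
  intros [Hc [Hb Hg]]. destruct (ex_RInt_gen_lim g Hg) as [G [Eg Lg]].
  assert (Ex : forall a b, 0 <= a -> 0 <= b -> ex_CInt f a b).
  { intros a b Ha Hb'. apply ex_CInt_cont. intros z Hz. apply Hc.
    destruct Hz as [Hz _]. eapply Rle_trans; [|exact Hz]. unfold Rmin; destruct Rle_dec; lra. }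
  assert (Dif : forall a b, 0 <= a <= b -> Cmod (CInt f 0 b - CInt f 0 a) <= RInt g 0 b - RInt g 0 a).
  { intros a b Hab. rewrite <- (CInt_Chasles f 0 a b) by (apply Ex; lra).
    assert (Eab : ex_RInt g a b).
    { apply (ex_RInt_Chasles_2 (V := R_CompleteNormedModule) g 0 a b); [lra|]. apply Eg; lra. }
    rewrite (RInt_Chasles_R g 0 a b) by (assumption || apply Eg; lra).
    replace (CInt f 0 a + CInt f a b - CInt f 0 a)%C with (CInt f a b) by ring.
    apply Rle_trans with (RInt g a b); [|lra].
    apply Cmod_CInt_le; [lra| |apply Ex; lra|assumption]. intros y Hy. apply Hb. lra. }
  apply (filterlim_locally_cauchy (U := C_R_CompleteNormedModule)).
  intros [e He].
  destruct (Lg (e / 2)) as [X HX]; [lra|].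
  exists (fun x => Rmax 0 X < x). split; [now exists (Rmax 0 X)|].
  assert (S : forall u v, Rmax 0 X < u -> Rmax 0 X < v -> Cmod (CInt f 0 v - CInt f 0 u) < e).
  { assert (S : forall u v, Rmax 0 X < u -> u <= v -> Cmod (CInt f 0 v - CInt f 0 u) < e).
    { intros u v Hu Huv. pose proof (Rmax_l 0 X). pose proof (Rmax_r 0 X).
      eapply Rle_lt_trans; [apply Dif; lra|].
      pose proof (Rabs_def2 _ _ (HX u ltac:(lra))). pose proof (Rabs_def2 _ _ (HX v ltac:(lra))). lra. }
    intros u v Hu Hv. destruct (Rle_dec u v); [now apply S|].
    rewrite Cmod_minus_sym. apply S; [assumption|lra]. }
  intros u v Hu Hv. specialize (S u v Hu Hv). split.
  - eapply Rle_lt_trans; [|exact S]. exact (re_le_Cmod (CInt f 0 v - CInt f 0 u)).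
  - eapply Rle_lt_trans; [|exact S]. exact (im_le_Cmod (CInt f 0 v - CInt f 0 u)).
Qed.

Lemma dominated_bound (f : R -> C) (g : R -> R) : dominated f g -> exists B, 0 <= B /\
  forall b, 0 <= b -> RInt g 0 b <= B.
Proof.
  intros Hd. pose proof (dominated_nonneg f g Hd) as Hn. destruct Hd as [_ [_ Hg]].
  destruct (ex_RInt_gen_lim g Hg) as [G [Eg Lg]].
  destruct (Lg 1 ltac:(lra)) as [X HX].
  assert (K : forall b, 0 <= b -> RInt g 0 b <= G + 1).
  { intros b Hb. set (c := Rmax b X + 1).
    assert (b <= c) by (unfold c; pose proof (Rmax_l b X); lra).
    assert (X < c) by (unfold c; pose proof (Rmax_r b X); lra).
    pose proof (Rabs_def2 _ _ (HX c ltac:(assumption))) as H1.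
    assert (Ebc : ex_RInt g b c).
    { apply (ex_RInt_Chasles_2 (V := R_CompleteNormedModule) g 0 b c); [lra|]. apply Eg; lra. }
    pose proof (RInt_Chasles_R g 0 b c (Eg b Hb) Ebc) as E.
    assert (0 <= RInt g b c) by (apply RInt_ge_0; [lra|assumption|intros; apply Hn; lra]).
    lra. }
  exists (G + 1). split; [|exact K].
  specialize (K 0 ltac:(lra)).
  pose proof (RInt_point (V := R_CompleteNormedModule) 0 g) as E. unfold zero in E; simpl in E.
  rewrite <- E. exact K.
Qed.

Lemma is_RInt_gen_lim (f : R -> C) (l : C) : (forall b, 0 <= b -> ex_CInt f 0 b) ->
  Clim (fun b => CInt f 0 b) l ->
  is_RInt_gen (V := C_R_NormedModule) f (at_point 0) (Rbar_locally p_infty) l.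
Proof.
  intros Ex H P HP. destruct (H P HP) as [X HX].
  exists (fun x => x = 0) (fun x => Rmax 0 X < x); [reflexivity|now exists (Rmax 0 X)|].
  intros x y -> Hy. pose proof (Rmax_l 0 X). pose proof (Rmax_r 0 X).
  exists (CInt f 0 y). split; [|apply HX; lra]. apply CInt_correct, Ex. simpl in *. lra.
Qed.

Lemma is_RInt_gen_lim_neg (f : R -> C) (l : C) : (forall b, 0 <= b -> ex_CInt (fun y => f (- y)) 0 b) ->
  Clim (fun b => CInt (fun y => f (- y)) 0 b) l ->
  is_RInt_gen (V := C_R_NormedModule) f (Rbar_locally m_infty) (at_point 0) l.
Proof.
  intros Ex H P HP. destruct (H P HP) as [X HX].
  exists (fun x => x < - Rmax 0 X) (fun x => x = 0); [now exists (- Rmax 0 X)|reflexivity|].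
  intros x y Hx ->. pose proof (Rmax_l 0 X). pose proof (Rmax_r 0 X).
  exists (CInt (fun y => f (- y)) 0 (- x)). split; [|apply HX; simpl in *; lra].
  assert (E := CInt_correct _ _ _ (Ex (- x) ltac:(simpl in *; lra))). simpl.
  pose proof (is_CInt_lin (fun y => f (- y)) (-1) 0 0 x (CInt (fun y => f (- y)) 0 (- x))) as Li.
  replace (-1 * 0 + 0) with 0 in Li by ring. replace (-1 * x + 0) with (- x) in Li by ring.
  specialize (Li E). apply is_CInt_opp, is_CInt_swap in Li.
  replace (- - CInt (fun y => f (- y)%R) 0 (- x)%R)%C with (CInt (fun y => f (- y)) 0 (- x)) in Li by ring.
  eapply is_CInt_ext; [|exact Li]. intros z _. cbv beta.
  replace (- (-1 * z + 0)) with z by ring. ring.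
Qed.

(** With this sign the kernel is bounded for [Im mu >= 0], and one half plane serves both problems:
    the positive half line transform at [k] is the value at [-k], the negative one is the value at
    [k] for the reflected function. *)
Definition L (f : R -> C) (mu : C) : C :=
  RInt_gen (V := C_R_CompleteNormedModule) (fun y : R => Cexp (Ci * mu * y) * f y)%C
    (at_point 0) (Rbar_locally p_infty).

Lemma dominated_kernel (f : R -> C) (g : R -> R) (mu : C) : dominated f g -> upper mu ->
  dominated (fun y : R => Cexp (Ci * mu * y) * f y)%C g.
Proof.
  intros [Hc [Hb Hg]] Hm. split; [|split; [|assumption]].
  - intros y Hy. specialize (Hc y Hy). ccont.
  - intros y Hy. rewrite Cmod_mult. pose proof (Cmod_kernel_le mu y Hm Hy).
    pose proof (Cmod_ge_0 (f y)). specialize (Hb y Hy). nra.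
Qed.

Lemma dominated_ex (f : R -> C) (g : R -> R) : dominated f g -> forall a b, 0 <= a -> 0 <= b -> ex_CInt f a b.
Proof.
  intros [Hc _] a b Ha Hb. apply ex_CInt_cont. intros z Hz. apply Hc.
  destruct Hz as [Hz _]. eapply Rle_trans; [|exact Hz]. unfold Rmin; destruct Rle_dec; lra.
Qed.

Lemma L_is_RInt_gen (f : R -> C) (mu : C) (l : C) :
  is_RInt_gen (V := C_R_NormedModule) (fun y : R => Cexp (Ci * mu * y) * f y)%C
    (at_point 0) (Rbar_locally p_infty) l -> L f mu = l.
Proof. apply (is_RInt_gen_unique (V := C_R_CompleteNormedModule)). Qed.

Lemma L_lim (f : R -> C) (g : R -> R) (mu : C) : dominated f g -> upper mu ->
  Clim (fun b => Lfin b f mu) (L f mu).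
Proof.
  intros Hd Hm. pose proof (dominated_kernel f g mu Hd Hm) as Hk.
  destruct (dominated_lim _ _ Hk) as [l Hl].
  rewrite (L_is_RInt_gen f mu l); [exact Hl|].
  apply is_RInt_gen_lim; [|exact Hl]. intros b Hb. apply (dominated_ex _ _ Hk); lra.
Qed.

Lemma L_bound (f : R -> C) (g : R -> R) : dominated f g -> exists B, 0 <= B /\
  (forall mu, upper mu -> Cmod (L f mu) <= B) /\
  (forall mu a, upper mu -> 0 <= a -> Cmod (Lfin a f mu) <= B).
Proof.
  intros Hd. destruct (dominated_bound f g Hd) as [B [HB HI]]. exists B.
  assert (K : forall mu a, upper mu -> 0 <= a -> Cmod (Lfin a f mu) <= B).
  { intros mu a Hm Ha. pose proof (dominated_kernel f g mu Hd Hm) as Hk.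
    eapply Rle_trans; [|apply (HI a Ha)].
    apply Cmod_CInt_le; [assumption| |apply (dominated_ex _ _ Hk); lra|].
    - intros y Hy. apply Hk. lra.
    - destruct Hd as [_ [_ Hg]]. destruct (ex_RInt_gen_lim g Hg) as [G [Eg _]]. now apply Eg. }
  split; [assumption|split; [|assumption]].
  intros mu Hm. apply (Clim_bound _ _ B 0 (L_lim f g mu Hd Hm)). intros x Hx. apply K; [assumption|lra].
Qed.

(** Isolates the part of the transform beyond [a], which [real_line_arcs] deforms differently from
    the part on [[0, a]]. *)
Lemma L_shift (f : R -> C) (g : R -> R) (mu : C) (a : R) : dominated f g -> upper mu -> 0 <= a ->
  (L f mu - Lfin a f mu)%C = (Cexp (Ci * mu * a) * L (fun y => f (a + y)%R) mu)%C.
Proof.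
  intros Hd Hm Ha. pose proof (dominated_kernel f g mu Hd Hm) as Hk.
  set (h := fun y : R => (Cexp (Ci * mu * y) * f y)%C) in *.
  assert (E : forall b, 0 <= b -> Lfin b (fun y => f (a + y)%R) mu =
     (Cexp (- (Ci * mu * a)) * (Lfin (a + b) f mu - Lfin a f mu))%C).
  { intros b Hb. unfold Lfin at 2 3. fold h.
    rewrite <- (CInt_Chasles h 0 a (a + b)) by (apply (dominated_ex _ _ Hk); lra).
    replace (CInt h 0 a + CInt h a (a + b) - CInt h 0 a)%C with (CInt h a (a + b)) by ring.
    apply is_CInt_unique.
    pose proof (is_CInt_lin h 1 a 0 b (CInt h a (a + b))) as Li.
    replace (1 * 0 + a) with a in Li by ring. replace (1 * b + a) with (a + b) in Li by ring.
    specialize (Li (CInt_correct _ _ _ (dominated_ex _ _ Hk a (a + b) Ha ltac:(lra)))).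
    apply (is_CInt_cmult (Cexp (- (Ci * mu * a)))) in Li.
    eapply is_CInt_ext; [|exact Li]. intros y _. unfold h. cbv beta.
    replace (1 * y + a) with (a + y) by ring.
    replace (Cexp (Ci * mu * y)) with (Cexp (- (Ci * mu * a)) * Cexp (Ci * mu * (a + y)%R))%C; [ring|].
    rewrite <- Cexp_plus. f_equal. rewrite RtoC_plus. ring. }
  assert (Lm : Clim (fun b => Lfin b (fun y => f (a + y)%R) mu) (Cexp (- (Ci * mu * a)) * (L f mu - Lfin a f mu))%C).
  { apply (Clim_ext_loc (fun b => Cexp (- (Ci * mu * a)) * (Lfin (a + b) f mu - Lfin a f mu))%C _ _ 0).
    - intros x Hx. symmetry. apply E. lra.
    - apply Clim_cmult, Clim_minus; [|apply Clim_const].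
      apply (Clim_comp (fun b => Lfin b f mu) (fun b => a + b)); [now apply (L_lim f g)|].
      intros A. exists A. intros x Hx. lra. }
  assert (Ex : forall b, 0 <= b -> ex_CInt (fun y : R => Cexp (Ci * mu * y) * f (a + y)%R)%C 0 b).
  { intros b Hb. apply ex_CInt_le; [assumption|]. intros y Hy.
    assert (Ccont (fun y => f (a + y)) y).
    { apply (continuous_comp (fun y => a + y) f); [ccont|apply Hd; lra]. }
    ccont. }
  rewrite (L_is_RInt_gen (fun y => f (a + y)%R) mu _ (is_RInt_gen_lim _ _ Ex Lm)).
  rewrite Cmult_assoc, <- Cexp_plus. replace (Ci * mu * a + - (Ci * mu * a))%C with (RtoC 0) by ring.
  rewrite Cexp_0. ring.
Qed.

(** Initial values are prescribed on the open half line only, and the integral does not see the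
    value at 0. *)
Lemma L_ext (f h : R -> C) (mu : C) : (forall y, 0 < y -> f y = h y) -> 
  (exists g, dominated f g) -> upper mu -> L f mu = L h mu.
Proof.
  intros E [g Hd] Hm. pose proof (dominated_kernel f g mu Hd Hm) as Hk.
  symmetry. apply L_is_RInt_gen.
  apply (is_RInt_gen_ext (V := C_R_NormedModule) (fun y : R => Cexp (Ci * mu * y) * f y)%C).
  - exists (fun x => x = 0) (fun x => 0 < x); [reflexivity|now exists 0|].
    intros x y -> Hy z Hz. simpl in Hz. rewrite Rmin_left, Rmax_right in Hz by lra. now rewrite E.
  - pose proof (L_lim f g mu Hd Hm) as Hl.
    apply is_RInt_gen_lim; [|exact Hl]. intros b Hb. apply (dominated_ex _ _ Hk); lra.
Qed.

Lemma ex_RInt_gen_inv_square (M : R) :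
  ex_RInt_gen (fun y => M * / (1 + y) ^ 2) (at_point 0) (Rbar_locally p_infty).
Proof.
  exists (M * 1). apply (is_RInt_gen_scal (V := R_NormedModule)).
  intros P [e He].
  exists (fun x => x = 0) (fun x => / e < x /\ 0 < x); [reflexivity| |].
  - exists (Rmax (/ e) 0). intros x Hx. pose proof (Rmax_l (/ e) 0). pose proof (Rmax_r (/ e) 0). lra.
  - intros x y -> [Hy1 Hy2]. exists (1 - / (1 + y)). split; [apply RInt_inv_square; lra|].
    apply He. change (Rabs (1 - / (1 + y) - 1) < e).
    assert (He0 := cond_pos e).
    assert (0 < / (1 + y)) by (apply Rinv_0_lt_compat; lra).
    replace (1 - / (1 + y) - 1) with (- / (1 + y)) by ring.
    rewrite Rabs_Ropp, Rabs_pos_eq by lra.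
    rewrite <- (Rinv_inv e). apply Rinv_lt_contravar; [|lra].
    apply Rmult_lt_0_compat; [now apply Rinv_0_lt_compat|lra].
Qed.

Lemma dominated_inv_square (f : R -> C) (M : R) : (forall y, 0 <= y -> Ccont f y) ->
  (forall y, 0 <= y -> Cmod (f y) * (1 + y) ^ 2 <= M) -> dominated f (fun y => M * / (1 + y) ^ 2).
Proof.
  intros Hc Hb. split; [assumption|split; [|apply ex_RInt_gen_inv_square]].
  intros y Hy. assert (0 < (1 + y) ^ 2) by nra.
  apply Rmult_le_reg_r with ((1 + y) ^ 2); [assumption|].
  rewrite Rmult_assoc, Rinv_l by lra. rewrite Rmult_1_r. now apply Hb.
Qed.

Lemma decays_dominated (f : R -> C) (M : R) : decays (fun _ => True) f M ->
  dominated f (fun y => M * / (1 + y) ^ 2) /\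
  dominated (fun y => Ci * y * f y)%C (fun y => M * / (1 + y) ^ 2).
Proof.
  intros H.
  assert (P : forall y, 0 <= y -> Cmod (f y) * (1 + y) ^ 2 <= Cmod (f y) * (1 + y) ^ 4 /\
     y * Cmod (f y) * (1 + y) ^ 2 <= Cmod (f y) * (1 + y) ^ 4).
  { intros y Hy. pose proof (Cmod_ge_0 (f y)).
    assert (1 <= (1 + y) ^ 2) by nra. assert (y <= (1 + y) ^ 2) by nra.
    replace ((1 + y) ^ 4) with ((1 + y) ^ 2 * (1 + y) ^ 2) by ring.
    split; [apply Rmult_le_compat_l; nra|].
    replace (y * Cmod (f y) * (1 + y) ^ 2) with (Cmod (f y) * (y * (1 + y) ^ 2)) by ring.
    apply Rmult_le_compat_l; nra. }
  split; apply dominated_inv_square.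
  - intros y Hy. now apply H.
  - intros y Hy. destruct (H y I Hy). destruct (P y Hy). lra.
  - intros y Hy. destruct (H y I Hy). ccont.
  - intros y Hy. destruct (H y I Hy). destruct (P y Hy).
    rewrite !Cmod_mult, Cmod_Ci, Cmod_R, Rabs_pos_eq, Rmult_1_l by assumption. lra.
Qed.

(** The constant for [Lfin a] does not depend on [a], so every inequality passes to the limit. *)
Lemma L_transform (f : R -> C) (M : R) : decays (fun _ => True) f M ->
  transform (L f) (L (fun y => Ci * y * f y)%C) M.
Proof.
  intros H m n Hm Hn. destruct (decays_dominated f M H) as [D0 D1].
  assert (K : forall a, 0 < a -> _) by
    (intros a Ha; exact (Lfin_transform a f M (Rlt_le _ _ Ha) (fun y _ Hy => H y I Hy) m n Hm Hn)).
  pose proof (L_lim _ _ m D0 Hm) as l1. pose proof (L_lim _ _ n D0 Hn) as l2.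
  pose proof (L_lim _ _ m D1 Hm) as l3. pose proof (L_lim _ _ n D1 Hn) as l4.
  split; [|split; [|split]].
  - apply (Clim_bound _ _ _ 0 l1). intros a Ha. destruct (K a Ha) as [k1 _]. exact k1.
  - apply (Clim_bound _ _ _ 0 l3). intros a Ha. destruct (K a Ha) as [_ [k2 _]]. exact k2.
  - apply (Clim_bound _ _ _ 0 (Clim_minus _ _ _ _ l4 l3)). intros a Ha.
    destruct (K a Ha) as [_ [_ [k3 _]]]. exact k3.
  - apply (Clim_bound _ _ _ 0 (Clim_minus _ _ _ _ (Clim_minus _ _ _ _ l2 l1) (Clim_cmult (n - m)%C _ _ l3))).
    intros a Ha. destruct (K a Ha) as [_ [_ [_ k4]]]. exact k4.
Qed.

Lemma decays_M_nonneg (I : R -> Prop) (f : R -> C) (M : R) : I 0 -> decays I f M -> 0 <= M.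
Proof.
  intros HI H. destruct (H 0 HI (Rle_refl 0)) as [_ K]. eapply Rle_trans; [|exact K].
  apply Rmult_le_pos; [apply Cmod_ge_0|apply pow_le; lra].
Qed.

(** With [x = c + s y] one has [1 + y <= (1 + |c|) (1 + |x|)] and [(1 + |x|)^4 <= 8 (1 + |x|^4)], so
    the moments of orders 0 and 4 suffice. *)
Lemma schwartz_decays (D : nat -> R -> C) (n : nat) (s c : R) : Rabs s = 1 ->
  (forall n x, CRderive (D n) x (D (S n) x)) ->
  (forall m n : nat, exists M : R, forall x, Rabs x ^ m * Cmod (D n x) <= M) ->
  exists M, decays (fun _ => True) (fun y => D n (c + s * y)) M.
Proof.
  intros Hs HD HM. destruct (HM 0%nat n) as [M0 H0]. destruct (HM 4%nat n) as [M4 H4].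
  exists ((1 + Rabs c) ^ 4 * (8 * (M0 + M4))). intros y _ Hy. split.
  - apply (continuous_comp (fun y => c + s * y) (D n)).
    + apply Rcont_plus; [apply continuous_const|]. apply Rcont_mult; [apply continuous_const|apply continuous_id].
    + eapply CRderive_Ccont, HD.
  - set (x := c + s * y). specialize (H0 x). specialize (H4 x). simpl in H0.
    pose proof (Cmod_ge_0 (D n x)) as Kd.
    assert (E : 1 + y <= (1 + Rabs c) * (1 + Rabs x)).
    { assert (y <= Rabs x + Rabs c).
      { replace y with (Rabs (s * y)) by (rewrite Rabs_mult, Hs, (Rabs_pos_eq y); lra).
        replace (s * y) with (x - c) by (unfold x; ring). eapply Rle_trans; [apply Rabs_triang|].
        rewrite Rabs_Ropp. lra. }
      pose proof (Rabs_pos x). pose proof (Rabs_pos c). nra. }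
    assert (E4 : (1 + y) ^ 4 <= (1 + Rabs c) ^ 4 * (1 + Rabs x) ^ 4)
      by (rewrite <- Rpow_mult_distr; apply pow_incr; lra).
    assert (E5 : (1 + Rabs x) ^ 4 <= 8 * (1 + Rabs x ^ 4)).
    { pose proof (Rabs_pos x) as P. generalize (Rabs x), P. intros u Hu.
      assert (A1 : (1 + u) ^ 2 <= 2 * (1 + u ^ 2)) by (pose proof (pow2_ge_0 (1 - u)); lra).
      assert (A2 : (1 + u ^ 2) ^ 2 <= 2 * (1 + u ^ 4)) by (pose proof (pow2_ge_0 (1 - u ^ 2)); lra).
      assert (A3 : ((1 + u) ^ 2) ^ 2 <= (2 * (1 + u ^ 2)) ^ 2).
      { apply pow_incr. split; [apply pow2_ge_0|exact A1]. }
      replace ((1 + u) ^ 4) with (((1 + u) ^ 2) ^ 2) by ring. lra. }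
    assert (P1 : 0 <= (1 + Rabs c) ^ 4) by (apply pow_le; pose proof (Rabs_pos c); lra).
    apply Rle_trans with (Cmod (D n x) * ((1 + Rabs c) ^ 4 * (8 * (1 + Rabs x ^ 4)))).
    + apply Rmult_le_compat_l; [assumption|]. eapply Rle_trans; [exact E4|].
      now apply Rmult_le_compat_l.
    + replace (Cmod (D n x) * ((1 + Rabs c) ^ 4 * (8 * (1 + Rabs x ^ 4))))
        with ((1 + Rabs c) ^ 4 * (8 * (1 * Cmod (D n x) + Rabs x ^ 4 * Cmod (D n x)))) by ring.
      apply Rmult_le_compat_l; [assumption|]. lra.
Qed.

(** * Large frequencies *)

Lemma L_by_parts (f f' : R -> C) (M M' : R) (k : R) : k <> 0 ->
  (forall x, CRderive f x (f' x)) -> decays (fun _ => True) f M -> decays (fun _ => True) f' M' ->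
  (Ci * k * L f k)%C = (- f 0%R - L f' k)%C.
Proof.
  intros Hk Hd D D'. assert (Hu : upper k) by (unfold upper; simpl; lra).
  destruct (decays_dominated f M D) as [D0 _]. destruct (decays_dominated f' M' D') as [D1 _].
  pose proof (L_lim _ _ k D0 Hu) as l0. pose proof (L_lim _ _ k D1 Hu) as l1.
  assert (E : forall b, 0 <= b ->
    (Ci * k * Lfin b f k + Lfin b f' k)%C = (Cexp (Ci * k * b) * f b - f 0%R)%C).
  { intros b Hb. unfold Lfin. rewrite <- CInt_cmult, <- CInt_plus.
    - apply is_CInt_unique.
      replace (f 0%R) with (Cexp (Ci * k * 0%R) * f 0%R)%C.
      2: { replace (Ci * k * 0%R)%C with (RtoC 0) by ring. rewrite Cexp_0. ring. }
      apply (is_CInt_FTC (fun y : R => Cexp (Ci * k * y) * f y)%C); [assumption| | |].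
      + intros y _. pose proof (CRderive_Ccont _ _ _ (Hd y)). ccont.
      + intros y Hy. pose proof (CRderive_Ccont _ _ _ (Hd y)). destruct (D' y I (proj1 Hy)). ccont.
      + intros y _. eapply CRderive_eq.
        * apply CRderive_mult; [|apply Hd]. apply CRderive_Cexp, CRderive_cmult, CRderive_RtoC.
        * cbv beta. ring.
    - apply ex_CInt_le; [assumption|]. intros y Hy. pose proof (CRderive_Ccont _ _ _ (Hd y)). ccont.
    - apply ex_CInt_le; [assumption|]. intros y Hy. destruct (D' y I (proj1 Hy)). ccont.
    - apply ex_CInt_le; [assumption|]. intros y Hy. pose proof (CRderive_Ccont _ _ _ (Hd y)). ccont. }
  assert (Z : Clim (fun b : R => Cexp (Ci * k * b) * f b)%C 0%C).
  { apply (Clim_0_le _ (fun b => M * / (1 + b) ^ 2) 0).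
    - intros b Hb. apply (dominated_kernel _ _ _ D0 Hu). lra.
    - intros e He. assert (HM := decays_M_nonneg _ _ _ I D).
      exists (M / e). intros b Hb.
      assert (0 <= M / e) by (apply Rmult_le_pos; [assumption|left; now apply Rinv_0_lt_compat]).
      assert (P2 : 0 < (1 + b) ^ 2) by nra.
      apply Rmult_lt_reg_r with ((1 + b) ^ 2); [assumption|].
      rewrite Rmult_assoc, Rinv_l by lra. rewrite Rmult_1_r.
      apply Rle_lt_trans with (e * (M / e)); [right; field; lra|].
      apply Rmult_lt_compat_l; [assumption|]. nra. }
  pose proof (Clim_plus _ _ _ _ (Clim_cmult (Ci * k)%C _ _ l0) l1) as l2.
  assert (l3 : Clim (fun b => Ci * k * Lfin b f k + Lfin b f' k)%C (0 - f 0%R)%C).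
  { apply (Clim_ext_loc (fun b : R => Cexp (Ci * k * b) * f b - f 0%R)%C _ _ 0).
    - intros b Hb. symmetry. apply E. lra.
    - apply Clim_minus; [exact Z|apply Clim_const]. }
  pose proof (Clim_unique _ _ _ l2 l3) as Eq.
  replace (Ci * k * L f k)%C with (Ci * k * L f k + L f' k - L f' k)%C by ring.
  rewrite Eq. ring.
Qed.

(** Two integrations by parts leave the remainder [(f'(0) + L f'' k) / (ik)^2]. *)
Lemma L_expansion (f f' f'' : R -> C) (M M' M'' : R) :
  (forall x, CRderive f x (f' x)) -> (forall x, CRderive f' x (f'' x)) ->
  decays (fun _ => True) f M -> decays (fun _ => True) f' M' -> decays (fun _ => True) f'' M'' ->
  exists B, 0 <= B /\ forall k : R, k <> 0 ->
    Cmod (L f k - Ci * f 0%R / k)%C <= B / k ^ 2.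
Proof.
  intros H H' D D' D''. exists (Cmod (f' 0) + M'').
  assert (HM := decays_M_nonneg _ _ _ I D'').
  split; [pose proof (Cmod_ge_0 (f' 0)); lra|]. intros k Hk.
  assert (Hkc : RtoC k <> 0%C) by (intros E; apply (f_equal Re) in E; simpl in E; lra).
  assert (Hi : Ci <> 0%C) by (intros E; apply (f_equal Im) in E; simpl in E; lra).
  pose proof (L_by_parts f f' M M' k Hk H D D') as E1.
  pose proof (L_by_parts f' f'' M' M'' k Hk H' D' D'') as E2.
  assert (Hu : upper k) by (unfold upper; simpl; lra).
  destruct (L_transform f'' M'' D'' k k Hu Hu) as [B0 _].
  assert (EE : (L f k - Ci * f 0%R / k)%C = (/ (Ci * k) * / (Ci * k) * (f' 0%R + L f'' k))%C).
  { assert (Ci2 : (Ci * Ci = -1)%C) by (apply C_ext; simpl; ring).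
    replace (L f k) with (/ (Ci * k) * (Ci * k * L f k))%C by (field; auto).
    rewrite E1.
    replace (L f' k) with (/ (Ci * k) * (Ci * k * L f' k))%C by (field; auto).
    rewrite E2.
    replace (Ci * f 0%R / k)%C with (- (/ (Ci * k) * f 0%R))%C.
    2: { transitivity (/ (Ci * k) * (- (f 0%R)))%C; [ring|].
         transitivity (/ (Ci * k) * (Ci * Ci * f 0%R))%C; [rewrite Ci2; ring|field; auto]. }
    field; auto. }
  rewrite EE, !Cmod_mult, !Cmod_inv, !Cmod_mult, Cmod_Ci, Cmod_R, Rmult_1_l
    by (apply Cmult_neq_0; auto).
  assert (0 < Rabs k) by now apply Rabs_pos_lt.
  rewrite <- (pow2_abs k).
  replace ((Cmod (f' 0) + M'') / Rabs k ^ 2) with (/ Rabs k * / Rabs k * (Cmod (f' 0) + M'')) by (field; lra).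
  apply Rmult_le_compat_l.
  - apply Rmult_le_pos; left; now apply Rinv_0_lt_compat.
  - eapply Rle_trans; [apply Cmod_triangle|]. lra.
Qed.

Lemma Clim_CInt_tail (f : R -> C) (B : R) : (forall s, 0 <= s -> Ccont f s) ->
  (forall s, 1 <= s -> Cmod (f s) * s ^ 2 <= B) -> exists l, Clim (fun K => CInt f 0 K) l.
Proof.
  intros Hc Hb.
  assert (Ex : forall a b, 0 <= a <= b -> ex_CInt f a b).
  { intros a b Hab. apply ex_CInt_le; [lra|]. intros; apply Hc; lra. }
  assert (D : dominated (fun y => f (1 + y)) (fun y => B * / (1 + y) ^ 2)).
  { apply dominated_inv_square.
    - intros y Hy. apply (continuous_comp (fun y => 1 + y) f); [ccont|apply Hc; lra].
    - intros y Hy. apply Hb. lra. }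
  destruct (dominated_lim _ _ D) as [l Hl]. exists (CInt f 0 1 + l)%C.
  apply (Clim_ext_loc (fun K => CInt f 0 1 + CInt (fun y => f (1 + y)%R) 0 (K - 1)%R)%C _ _ 1).
  - intros K HK. rewrite <- (CInt_Chasles f 0 1 K) by (apply Ex; lra). f_equal.
    apply is_CInt_unique.
    pose proof (is_CInt_lin f 1 1 0 (K - 1) (CInt f 1 K)) as Li.
    replace (1 * 0 + 1) with 1 in Li by ring. replace (1 * (K - 1) + 1) with K in Li by ring.
    specialize (Li (CInt_correct _ _ _ (Ex 1 K ltac:(lra)))).
    eapply is_CInt_ext; [|exact Li]. intros y _. cbv beta. replace (1 * y + 1) with (1 + y) by ring. ring.
  - apply Clim_plus; [apply Clim_const|].
    apply (Clim_comp (fun b => CInt (fun y => f (1 + y)) 0 b) (fun K => K - 1)); [exact Hl|].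
    intros A. exists (A + 1). intros; lra.
Qed.

(* [e^{i(as+bs^n)} / s] is the derivative of [e^{i(as+bs^n)} s^{-n} / (ibn)] up to O(s^{-2}). *)
Lemma oscillatory_converges (G : R -> C) (c : C) (a b B : R) (p : nat) : (1 <= p)%nat -> b <> 0 ->
  (forall s, 0 <= s -> Ccont G s) ->
  (forall s, 1 <= s -> Cmod (G s - c / s) <= B / s ^ 2) ->
  exists l, Clim (fun K => CInt (fun s : R => Cexp (Ci * (a * s + b * s ^ S p)%R) * G s)%C 0 K) l.
Proof.
  intros Hp Hb HG HB.
  set (N := INR (S p)). assert (HN : 0 < N) by (apply lt_0_INR; lia).
  set (E := fun s : R => Cexp (Ci * (a * s + b * s ^ S p)%R)).
  assert (Em : forall s, Cmod (E s) = 1) by (intros; apply Cmod_dir).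
  set (d := fun s : R => (Ci * (a + b * (N * s ^ p))%R)%C).
  assert (DE : forall s : R, CRderive E s (d s * E s)%C).
  { intros s. apply CRderive_Cexp, CRderive_cmult.
    apply (CRderive_real (fun s => a * s + b * s ^ S p) s (a + b * (N * s ^ p))).
    auto_derive; [trivial|].
      transitivity (a * 1 + b * (1 * (N * s ^ p))); [reflexivity|ring]. }
  set (kap := (/ (Ci * (b * N)%R))%C).
  assert (Hbn : (b * N)%R <> 0) by (apply Rmult_integral_contrapositive; split; lra).
  assert (Hk0 : (Ci * (b * N)%R)%C <> 0%C).
  { apply Cmult_neq_0; intros X; [apply (f_equal Im) in X|apply (f_equal Re) in X]; simpl in X; lra. }
  set (P := fun s : R => (kap * (E s * (/ s ^ S p)%R))%C).
  set (P' := fun s : R => (kap * (d s * E s * (/ s ^ S p)%R + E s * (- N / (s * s ^ S p))%R))%C).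
  assert (DP : forall s, 0 < s -> CRderive P s (P' s)).
  { intros s Hs. apply CRderive_cmult.
    apply (CRderive_mult E (fun s => RtoC (/ s ^ S p)) s (d s * E s)%C (- N / (s * s ^ S p))%R); [apply DE|].
    assert (0 < s ^ p) by now apply pow_lt.
    apply (CRderive_real (fun s => / s ^ S p) s (- N / (s * s ^ S p))).
      auto_derive; [nra|].
    transitivity (- (1 * (N * s ^ p)) * / (s * s ^ p * (s * s ^ p))); [reflexivity|].
    simpl (s ^ S p). field. lra. }
  assert (EP : forall s, 0 < s -> (E s / s - P' s)%C =
     (- kap * E s * (Ci * (a / s ^ S p)%R - (N / (s * s ^ S p))%R))%C).
  { intros s Hs. assert (Hs0 : s <> 0) by lra. assert (0 < s ^ p) by now apply pow_lt.
    assert (E1 : (kap * (Ci * (b * N)%R) = 1)%C) by (unfold kap; apply Cinv_l, Hk0).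
    assert (E2 : (RtoC (/ s) = / s)%C) by now apply RtoC_inv.
    assert (E3 : (a / s ^ S p)%R = (a * / s ^ S p)%R) by reflexivity.
    unfold P', d, Cdiv. rewrite <- E2.
    replace (/ s) with ((s ^ p) * / s ^ S p) by (simpl; field; lra).
    replace (- N / (s * s ^ S p)) with (- (N / (s * s ^ S p))) by (field; simpl; split; nra).
    rewrite E3, RtoC_opp, !RtoC_plus, !RtoC_mult. rewrite RtoC_mult in E1.
    generalize (RtoC (/ s ^ S p)), (RtoC (N / (s * s ^ S p))). intros u v.
    transitivity (E s * (s ^ p)%R * u * (kap * (Ci * (b * N))) - kap * (Ci * (a + b * (N * (s ^ p)%R)) * E s * u + E s * - v))%C;
    [rewrite E1; ring|ring]. }
  assert (Pow : forall s, 1 <= s -> s ^ 2 <= s ^ S p).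
  { intros s Hs. apply Rle_pow; [assumption|lia]. }
  (* the O(s^{-2}) remainder, multiplied by a cut-off to make sense near 0 *)
  assert (HE : forall s, Ccont E s) by (intros s; eapply CRderive_Ccont, DE).
  set (F := fun s : R => (E s * G s)%C).
  set (H := fun s : R => (F s - c * P' (Rmax 1 s))%C).
  assert (HPc : forall s, 0 < s -> Ccont P' s).
  { intros s Hs. unfold P', d. specialize (HE s). assert (0 < s ^ p) by now apply pow_lt.
    assert (c1 : continuous (fun s => / s ^ S p) s).
    { apply (ex_derive_continuous (V := R_NormedModule)). auto_derive. simpl; nra. }
    assert (c2 : continuous (fun s => - N / (s * s ^ S p)) s).
    { apply (ex_derive_continuous (V := R_NormedModule)). auto_derive. simpl.
      assert (0 < s * (s * s ^ p)) by (repeat apply Rmult_lt_0_compat; lra). lra. }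
    assert (c3 : continuous (fun s => s ^ p) s).
    { apply (ex_derive_continuous (V := R_NormedModule)). auto_derive. trivial. }
    ccont. }
  destruct (Clim_CInt_tail H (B + Cmod c * (Cmod kap * (Rabs a + N)))) as [l Hl].
  - intros s Hs. apply Ccont_minus; [apply Ccont_mult; auto|].
    apply Ccont_mult; [apply Ccont_const|].
    apply (continuous_comp (fun s => Rmax 1 s) P'); [apply continuous_Rmax_l|].
    apply HPc. pose proof (Rmax_l 1 s). lra.
  - intros s Hs. unfold H, F. rewrite Rmax_right by lra.
    replace (E s * G s - c * P' s)%C with (E s * (G s - c / s) + c * (E s / s - P' s))%C by (unfold Cdiv; ring).
    assert (S2 : 0 < s ^ 2) by nra.
    eapply Rle_trans; [apply Rmult_le_compat_r; [lra|apply Cmod_triangle]|].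
    rewrite Rmult_plus_distr_r. apply Rplus_le_compat.
    + rewrite Cmod_mult, Em, Rmult_1_l. apply Rle_trans with (B / s ^ 2 * s ^ 2).
      * apply Rmult_le_compat_r; [lra|now apply HB].
      * right. field. lra.
    + rewrite EP by lra. rewrite !Cmod_mult, Cmod_opp, Em, !Rmult_1_r, !Rmult_assoc.
      apply Rmult_le_compat_l; [apply Cmod_ge_0|]. apply Rmult_le_compat_l; [apply Cmod_ge_0|].
      specialize (Pow s Hs).
      assert (I1 : / s ^ S p * s ^ 2 <= 1).
      { apply Rmult_le_reg_l with (s ^ S p); [lra|]. rewrite <- Rmult_assoc, Rinv_r by lra. lra. }
      assert (I0 : 0 < / s ^ S p) by (apply Rinv_0_lt_compat; lra).
      apply Rle_trans with ((Rabs a * / s ^ S p + N * / s ^ S p) * s ^ 2).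
      * apply Rmult_le_compat_r; [lra|]. eapply Rle_trans; [apply Cmod_minus_triangle|].
        rewrite Cmod_mult, Cmod_Ci, !Cmod_R, Rmult_1_l.
        apply Rplus_le_compat.
        -- unfold Rdiv. rewrite Rabs_mult, (Rabs_pos_eq (/ s ^ S p)) by lra. lra.
        -- rewrite Rabs_pos_eq.
           ++ unfold Rdiv. apply Rmult_le_compat_l; [lra|]. apply Rinv_le_contravar; nra.
           ++ apply Rmult_le_pos; [lra|]. left. apply Rinv_0_lt_compat. nra.
      * pose proof (Rabs_pos a). nra.
  (* The primitive [P] vanishes at infinity, which leaves [- P 1]; the cut-off adds a fixed integral
     over [[0, 1]]. *)
  - exists (l + c * ((0 - P 1) + CInt (fun s => P' (Rmax 1 s)) 0 1))%C.
    assert (Ex : forall K, 0 <= K -> ex_CInt (fun s => P' (Rmax 1 s)) 0 K).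
    { intros K HK. apply ex_CInt_le; [assumption|]. intros s Hs.
      apply (continuous_comp (fun s => Rmax 1 s) P'); [apply continuous_Rmax_l|].
      apply HPc. pose proof (Rmax_l 1 s). lra. }
    assert (ExF : forall K, 0 <= K -> ex_CInt F 0 K).
    { intros K HK. apply ex_CInt_le; [assumption|]. intros s Hs. apply Ccont_mult; [apply HE|apply HG; lra]. }
    apply (Clim_ext_loc (fun K => CInt H 0 K + c * ((P K - P 1) + CInt (fun s => P' (Rmax 1 s)) 0 1))%C _ _ 1).
    + intros K HK. transitivity (CInt F 0 K); [|reflexivity].
      unfold H. rewrite CInt_minus.
      2: now apply ExF; lra.
      2: { destruct (Ex K ltac:(lra)) as [z Hz]. exists (c * z)%C. now apply is_CInt_cmult. }
      rewrite CInt_cmult by (apply Ex; lra).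
      assert (E1 : CInt (fun s => P' (Rmax 1 s)) 0 K = (CInt (fun s => P' (Rmax 1 s)) 0 1 + (P K - P 1))%C).
      { rewrite <- (CInt_Chasles _ 0 1 K); [|apply Ex; lra|].
        - f_equal. apply is_CInt_unique. apply (is_CInt_ext P').
          + rewrite Rmin_left, Rmax_right by lra. intros s Hs. rewrite Rmax_right by lra. reflexivity.
          + apply (is_CInt_FTC P P'); [lra| | |].
            * intros s Hs. eapply CRderive_Ccont, DP. lra.
            * intros s Hs. apply HPc. lra.
            * intros s Hs. apply DP. lra.
        - apply (ex_RInt_Chasles_2 (V := C_R_CompleteNormedModule) (fun s => P' (Rmax 1 s)) 0 1 K); [lra|].
          apply Ex; lra. }
      rewrite E1. change (CInt (fun y => F y) 0 K) with (CInt F 0 K). ring.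
    + apply Clim_plus; [exact Hl|]. apply Clim_cmult, Clim_plus; [|apply Clim_const].
      apply Clim_minus; [|apply Clim_const].
      apply (Clim_0_le _ (fun s => Cmod kap * / s) 1).
      * intros s Hs. unfold P. rewrite !Cmod_mult, Em, Rmult_1_l, Cmod_R.
        assert (s ^ 2 <= s ^ S p) by (apply Pow; lra).
        apply Rmult_le_compat_l; [apply Cmod_ge_0|].
        rewrite Rabs_pos_eq by (left; apply Rinv_0_lt_compat; nra).
        apply Rinv_le_contravar; nra.
      * intros e He. pose proof (Cmod_ge_0 kap).
        assert (0 <= Cmod kap / e) by (apply Rmult_le_pos; [assumption|left; now apply Rinv_0_lt_compat]).
        exists (Cmod kap / e). intros s Hs.
        apply Rmult_lt_reg_r with s; [lra|]. rewrite Rmult_assoc, Rinv_l, Rmult_1_r by lra.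
        replace (Cmod kap) with (e * (Cmod kap / e)) by (field; lra).
        apply Rmult_lt_compat_l; lra.
Qed.

(** * Transforms over a finite interval on large arcs *)

Lemma Cmod_bounded (f : R -> C) (a : R) : 0 <= a -> (forall y, 0 <= y <= a -> Ccont f y) ->
  exists M, 0 <= M /\ forall y, 0 <= y <= a -> Cmod (f y) <= M.
Proof.
  intros Ha Hf. destruct (continuity_ab_maj (fun y => Cmod (f y)) 0 a Ha) as [x [Hx _]].
  - intros c Hc. apply continuity_pt_filterlim. apply continuous_Cmod, Hf, Hc.
  - exists (Cmod (f x)). split; [apply Cmod_ge_0|exact Hx].
Qed.

Lemma continuous_decays (f : R -> C) (a : R) : 0 <= a -> (forall y, 0 <= y <= a -> Ccont f y) ->
  exists M, 0 <= M /\ decays (fun y => y <= a) f M.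
Proof.
  intros Ha Hf. destruct (Cmod_bounded f a Ha Hf) as [M [HM Hb]].
  exists (M * (1 + a) ^ 4). split; [apply Rmult_le_pos; [assumption|apply pow_le; lra]|].
  intros y Hy1 Hy2. split; [apply Hf; lra|].
  apply Rmult_le_compat; [apply Cmod_ge_0|apply pow_le; lra|apply Hb; lra|apply pow_incr; lra].
Qed.

Lemma Lfin_Hol (f : R -> C) (a : R) : 0 <= a -> (forall y, 0 <= y <= a -> Ccont f y) ->
  Hol (fun z => 0 < Im z) (fun _ => True) (fun z => Lfin a f (clampIm z)).
Proof.
  intros Ha Hf. destruct (continuous_decays f a Ha Hf) as [M [HM Hd]].
  eapply (transform_Hol _ _ M HM). apply (Lfin_transform a f M Ha Hd).
Qed.

Lemma Hol_cont (U V : C -> Prop) (f : C -> C) (z : C) : Hol U V f -> V z -> holcont f z.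
Proof. intros [f' [H _]] Hz. now apply H. Qed.

Lemma upper_polar (K th : R) : 0 <= K -> 0 <= th <= PI -> upper (K * dir th)%C.
Proof.
  intros HK Hth. unfold upper.
  replace (Im (K * dir th)) with (K * Im (dir th)) by (simpl; unfold Im; simpl; ring).
  rewrite Im_dir. apply Rmult_le_pos; [assumption|]. now apply sin_ge_0.
Qed.

Lemma Im_polar (K th : R) : Im (K * dir th)%C = K * sin th.
Proof. rewrite <- (Im_dir th). simpl; unfold Im; simpl; ring. Qed.

Lemma Lfin_polar_cont (f : R -> C) (a K : R) : 0 <= a -> 0 <= K -> (forall y, 0 <= y <= a -> Ccont f y) ->
  forall th : R, 0 <= th <= PI -> Ccont (fun th : R => Lfin a f (clampIm (K * dir th)%C)) th.
Proof.
  intros Ha HK Hf th Hth.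
  apply (Ccont_comp (fun th : R => K * dir th)%C (fun z => Lfin a f (clampIm z))); [ccont|].
  apply (Hol_cont _ _ _ _ (Lfin_Hol f a Ha Hf) I).
Qed.

(** On a large arc the second bound is small away from the real axis, and the first controls the two
    short pieces near it. *)
Lemma Lfin_sin_bound (f : R -> C) (a M : R) (mu : C) : 0 <= a -> 0 <= M ->
  (forall y, 0 <= y <= a -> Ccont f y /\ Cmod (f y) <= M) -> upper mu ->
  Cmod (Lfin a f mu) <= M * a /\ (0 < Im mu -> Cmod (Lfin a f mu) <= M / Im mu).
Proof.
  intros Ha HM Hf Hm.
  assert (Ex : ex_CInt (fun y : R => Cexp (Ci * mu * y) * f y)%C 0 a).
  { apply ex_CInt_le; [assumption|]. intros y Hy. destruct (Hf y Hy). ccont. }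
  split.
  - replace (M * a) with ((a - 0) * M) by ring. apply Cmod_CInt_const; [assumption| |exact Ex].
    intros y Hy. rewrite Cmod_mult. pose proof (Cmod_kernel_le mu y Hm (proj1 Hy)).
    pose proof (Cmod_ge_0 (f y)). destruct (Hf y Hy). nra.
  - intros Hi. apply Rle_trans with (RInt (fun z => M * exp (- (Im mu * z))) 0 a).
    + apply Cmod_CInt_le; [assumption| |exact Ex|].
      * intros y Hy. rewrite Cmod_mult, Cmod_Cexp, Re_Ci_mult, Rmult_comm.
        apply Rmult_le_compat_r; [left; apply exp_pos|]. now apply Hf.
      * apply (ex_RInt_continuous (V := R_CompleteNormedModule)). intros y _.
        apply (ex_derive_continuous (V := R_NormedModule)). auto_derive. trivial.
    + rewrite (RInt_scal (V := R_CompleteNormedModule) (fun z => exp (- (Im mu * z)))).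
      * unfold Rdiv. apply Rmult_le_compat_l; [assumption|]. now apply RInt_exp_bound.
      * apply (ex_RInt_continuous (V := R_CompleteNormedModule)). intros y _.
        apply (ex_derive_continuous (V := R_NormedModule)). auto_derive. trivial.
Qed.

(** For a merely continuous [f] no rate is available. Two pieces of angle [d] near the real axis are
    made small by the choice of [d]; on the rest [Im mu >= K d / 4]. *)
Lemma Lfin_arc_vanishes (f : R -> C) (a : R) : 0 <= a -> (forall y, 0 <= y <= a -> Ccont f y) ->
  Clim (fun K => CInt (fun th : R => Lfin a f (clampIm (K * dir th)%C)) 0 PI) 0%C.
Proof.
  intros Ha Hf. destruct (Cmod_bounded f a Ha Hf) as [M [HM Hb]]. pose proof PI_RGT_0 as Hpi.
  apply Clim_eps. intros e He.
  set (d := Rmin (PI / 2) (e / (4 * (M * a + 1)))).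
  assert (HMa : 0 <= M * a) by now apply Rmult_le_pos.
  assert (d1 : d <= PI / 2) by apply Rmin_l.
  assert (d2 : d <= e / (4 * (M * a + 1))) by apply Rmin_r.
  assert (d0 : 0 < d) by (apply Rmin_pos; [lra|apply Rdiv_lt_0_compat; lra]).
  assert (d3 : 2 * (d * (M * a)) < e / 2 + 0).
  { apply Rle_lt_trans with (2 * (e / (4 * (M * a + 1)) * (M * a))).
    - apply Rmult_le_compat_l; [lra|]. now apply Rmult_le_compat_r.
    - assert (e / (4 * (M * a + 1)) * (4 * (M * a + 1)) = e) by (field; lra).
      assert (0 < e / (4 * (M * a + 1))) by (apply Rdiv_lt_0_compat; lra). nra. }
  exists (Rmax 1 (8 * (M + 1) * PI / (d * e))). intros K HK.
  assert (K1 : 1 < K) by (eapply Rle_lt_trans; [apply Rmax_l|exact HK]).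
  assert (K2 : 8 * (M + 1) * PI / (d * e) < K) by (eapply Rle_lt_trans; [apply Rmax_r|exact HK]).
  set (g := fun th : R => Lfin a f (clampIm (K * dir th)%C)).
  assert (Ex : forall x y, 0 <= x <= y -> y <= PI -> ex_CInt g x y).
  { intros x y Hxy Hy. apply ex_CInt_le; [lra|]. intros th Hth.
    apply (Lfin_polar_cont f a K); try assumption; lra. }
  assert (B : forall th, 0 <= th <= PI -> Cmod (g th) <= M * a).
  { intros th Hth.
    destruct (Lfin_sin_bound f a M (clampIm (K * dir th)%C) Ha HM) as [Q _]; [|apply clampIm_upper|exact Q].
    intros y Hy. split; auto. }
  assert (B' : forall th, d <= th <= PI - d -> Cmod (g th) <= M / (K * (d / 4))).
  { intros th Hth. assert (Hu : upper (K * dir th)) by (apply upper_polar; lra).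
    unfold g. rewrite clampIm_id by assumption.
    assert (S : d / 4 <= sin th).
    { destruct (Rle_dec th (PI / 2)).
      - assert (th / 4 <= sin th) by (apply sin_ge_quarter; lra). lra.
      - assert ((PI - th) / 4 <= sin (PI - th)) by (apply sin_ge_quarter; lra). rewrite sin_PI_x in *. lra. }
    assert (S' : K * (d / 4) <= K * sin th) by (apply Rmult_le_compat_l; lra).
    assert (0 < K * (d / 4)) by (apply Rmult_lt_0_compat; lra).
    destruct (Lfin_sin_bound f a M (K * dir th)%C Ha HM) as [_ Q]; [intros y Hy; split; auto|assumption|].
    rewrite Im_polar in Q. eapply Rle_trans; [apply Q; lra|].
    unfold Rdiv. apply Rmult_le_compat_l; [assumption|]. apply Rinv_le_contravar; lra. }
  fold g. rewrite <- (CInt_Chasles g 0 d PI) by (apply Ex; lra).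
  rewrite <- (CInt_Chasles g d (PI - d) PI) by (apply Ex; lra).
  replace (CInt g 0 d + (CInt g d (PI - d) + CInt g (PI - d) PI) - 0)%C
    with (CInt g 0 d + (CInt g d (PI - d) + CInt g (PI - d) PI))%C by ring.
  assert (I1 : Cmod (CInt g 0 d) <= (d - 0) * (M * a))
    by (apply Cmod_CInt_const; [lra|intros; apply B; lra|apply Ex; lra]).
  assert (I3 : Cmod (CInt g (PI - d) PI) <= (PI - (PI - d)) * (M * a))
    by (apply Cmod_CInt_const; [lra|intros; apply B; lra|apply Ex; lra]).
  assert (I2 : Cmod (CInt g d (PI - d)) <= (PI - d - d) * (M / (K * (d / 4))))
    by (apply Cmod_CInt_const; [lra|intros; apply B'; lra|apply Ex; lra]).
  assert (I4 : (PI - d - d) * (M / (K * (d / 4))) <= e / 2).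
  { assert (P0 : 0 < K * (d / 4)) by (apply Rmult_lt_0_compat; lra).
    assert (P1 : 0 < d * e) by now apply Rmult_lt_0_compat.
    assert (P2 : 0 <= M / (K * (d / 4))) by (apply Rmult_le_pos; [assumption|left; now apply Rinv_0_lt_compat]).
    apply Rle_trans with (PI * (M / (K * (d / 4)))); [apply Rmult_le_compat_r; lra|].
    apply Rmult_le_reg_r with (K * (d / 4)); [assumption|].
    replace (PI * (M / (K * (d / 4))) * (K * (d / 4))) with (PI * M) by (field; lra).
    assert (Q : 8 * (M + 1) * PI < K * (d * e)).
    { replace (8 * (M + 1) * PI) with (8 * (M + 1) * PI / (d * e) * (d * e)) by (field; lra).
      now apply Rmult_lt_compat_r. }
    nra. }
  eapply Rle_lt_trans; [apply Cmod_triangle|].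
  eapply Rle_lt_trans; [apply Rplus_le_compat_l, Cmod_triangle|]. lra.
Qed.

(** By parts, [mu Lfin a f mu = - i e^{i mu a} f(a) + i f(0) + i Lfin a f' mu]. The first term
    vanishes by Jordan's lemma and the last by [Lfin_arc_vanishes]; the constant remains, integrated
    over an angle [PI]. *)
Lemma half_arc (f f' : R -> C) (a : R) : 0 < a ->
  (forall y, 0 <= y <= a -> Ccont f y) -> (forall y, 0 <= y <= a -> Ccont f' y) ->
  (forall y, 0 < y < a -> CRderive f y (f' y)) ->
  Clim (fun K => CInt (fun th : R => K * dir th * Lfin a f (K * dir th))%C 0 PI) (Ci * PI * f 0%R)%C.
Proof.
  intros Ha Hf Hf' Hd. pose proof PI_RGT_0 as Hpi.
  assert (Parts : forall mu, (mu * Lfin a f mu)%C = (- Ci * (Cexp (Ci * mu * a) * f a) + Ci * f 0%R + Ci * Lfin a f' mu)%C).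
  { intros mu.
    assert (E0 : ex_CInt (fun y : R => Cexp (Ci * mu * y) * f y)%C 0 a).
    { apply ex_CInt_le; [lra|]. intros y Hy. specialize (Hf y Hy). ccont. }
    assert (E1 : ex_CInt (fun y : R => Cexp (Ci * mu * y) * f' y)%C 0 a).
    { apply ex_CInt_le; [lra|]. intros y Hy. specialize (Hf' y Hy). ccont. }
    assert (E : (Ci * mu * Lfin a f mu + Lfin a f' mu)%C = (Cexp (Ci * mu * a) * f a - Cexp (Ci * mu * 0%R) * f 0%R)%C).
    { unfold Lfin. rewrite <- CInt_cmult, <- CInt_plus; try assumption.
      - apply is_CInt_unique.
        apply (is_CInt_FTC (fun y : R => Cexp (Ci * mu * y) * f y)%C); [lra| | |].
        + intros y Hy. specialize (Hf y Hy). ccont.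
        + intros y Hy. specialize (Hf y Hy). specialize (Hf' y Hy). ccont.
        + intros y Hy. eapply CRderive_eq.
          * apply CRderive_mult; [|apply Hd, Hy]. apply CRderive_Cexp, CRderive_cmult, CRderive_RtoC.
          * cbv beta. ring.
      - destruct E0 as [z Hz]. exists (Ci * mu * z)%C. now apply is_CInt_cmult. }
    replace (Ci * mu * 0%R)%C with (RtoC 0) in E by ring. rewrite Cexp_0 in E.
    assert (Ci2 : (Ci * Ci = -1)%C) by (apply C_ext; simpl; ring).
    transitivity (- (Ci * Ci) * (mu * Lfin a f mu))%C; [rewrite Ci2; ring|].
    transitivity (- Ci * (Ci * mu * Lfin a f mu + Lfin a f' mu) + Ci * Lfin a f' mu)%C; [ring|].
    rewrite E. ring. }
  apply (Clim_ext_loc (fun K => - Ci * CInt (fun th : R => Cexp (Ci * (K * dir th) * a) * f a)%C 0 PI + Ci * PI * f 0%R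
    + Ci * CInt (fun th : R => Lfin a f' (clampIm (K * dir th)%C)) 0 PI)%C _ _ 1).
  - intros K HK.
    assert (X1 : ex_CInt (fun th : R => Cexp (Ci * (K * dir th) * a) * f a)%C 0 PI)
      by (apply ex_CInt_le; [lra|intros; ccont]).
    assert (X3 : ex_CInt (fun th : R => Lfin a f' (clampIm (K * dir th)%C)) 0 PI).
    { apply ex_CInt_le; [lra|]. intros th Hth. apply (Lfin_polar_cont f' a K); try assumption; lra. }
    symmetry. apply is_CInt_unique.
    apply (is_CInt_ext (fun th : R => (- Ci * (Cexp (Ci * (K * dir th) * a) * f a) + Ci * f 0%R) + Ci * Lfin a f' (clampIm (K * dir th)))%C).
    + rewrite Rmin_left, Rmax_right by lra. intros th Hth.
      rewrite clampIm_id by (apply upper_polar; lra). symmetry. apply Parts.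
    + apply is_CInt_plus; [apply is_CInt_plus|].
      * apply (is_CInt_cmult (- Ci)%C (fun th : R => Cexp (Ci * (K * dir th) * a) * f a)%C), CInt_correct, X1.
      * replace (Ci * PI * f 0%R)%C with (scal (PI - 0) ((Ci * f 0%R)%C : C_R_NormedModule)).
        -- apply (is_RInt_const (V := C_R_NormedModule)).
        -- rewrite Rminus_0_r. apply C_ext; unfold scal; simpl; unfold scal, Re, Im; simpl; unfold mult; simpl; ring.
      * apply (is_CInt_cmult Ci (fun th : R => Lfin a f' (clampIm (K * dir th)%C))), CInt_correct, X3.
  - apply Clim_eq with (- Ci * 0 + Ci * PI * f 0%R + Ci * 0)%C; [|ring].
    apply Clim_plus; [apply Clim_plus; [|apply Clim_const]|]; apply Clim_cmult.
    + apply (Clim_0_le _ (fun K => 8 * Cmod (f a) / (1 * (K * a))) 0).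
      * intros K HK. apply (jordan _ 0 PI 1 (K * a) (Cmod (f a))).
        -- lra.
        -- now apply Rmult_lt_0_compat.
        -- apply Cmod_ge_0.
        -- field.
        -- intros th Hth. rewrite Cmod_mult, Cmod_Cexp, Rmult_comm.
           apply Rmult_le_compat_l; [apply Cmod_ge_0|].
           rewrite Re_Ci_mult, Im_polar. right. f_equal. rewrite Rminus_0_r, Rmult_1_l. ring.
        -- apply ex_CInt_le; [lra|intros; ccont].
      * intros e He. exists (8 * (Cmod (f a) + 1) / (a * e)). intros K HK.
        pose proof (Cmod_ge_0 (f a)). assert (0 < a * e) by now apply Rmult_lt_0_compat.
        assert (0 < 8 * (Cmod (f a) + 1) / (a * e)) by (apply Rdiv_lt_0_compat; lra).
        assert (Ka : 0 < 1 * (K * a)) by (rewrite Rmult_1_l; apply Rmult_lt_0_compat; lra).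
        apply Rmult_lt_reg_r with (1 * (K * a)); [assumption|].
        replace (8 * Cmod (f a) / (1 * (K * a)) * (1 * (K * a))) with (8 * Cmod (f a)) by (field; lra).
        assert (8 * (Cmod (f a) + 1) < K * (a * e)).
        { replace (8 * (Cmod (f a) + 1)) with (8 * (Cmod (f a) + 1) / (a * e) * (a * e)) by (field; lra).
          now apply Rmult_lt_compat_r. }
        nra.
    + exact (Lfin_arc_vanishes f' a (Rlt_le _ _ Ha) Hf').
Qed.

Lemma CInt_translate (f : R -> C) (v a b : R) : ex_CInt f (a + v) (b + v) ->
  CInt (fun y => f (y + v)) a b = CInt f (a + v) (b + v).
Proof.
  intros Ex. apply is_CInt_unique.
  pose proof (is_CInt_lin f 1 v a b (CInt f (a + v) (b + v))) as Li.
  rewrite !Rmult_1_l in Li. specialize (Li (CInt_correct _ _ _ Ex)).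
  eapply is_CInt_ext; [|exact Li]. intros y _. cbv beta. rewrite Rmult_1_l. ring.
Qed.

Lemma Lfin_ex (f : R -> C) (a : R) (mu : C) : 0 <= a -> (forall y, 0 <= y <= a -> Ccont f y) ->
  ex_CInt (fun y : R => Cexp (Ci * mu * y) * f y)%C 0 a.
Proof. intros Ha Hf. apply ex_CInt_le; [assumption|]. intros y Hy. specialize (Hf y Hy). ccont. Qed.

(** The factor [e^{i mu a}] compensates the growth of the transform at [-mu] in the upper half
    plane: the product is a bounded transform of the function read backwards from [a]. *)
Lemma Lfin_reflect (f : R -> C) (a : R) (mu : C) : 0 <= a -> (forall y, 0 <= y <= a -> Ccont f y) ->
  (Cexp (Ci * mu * a) * Lfin a f (- mu))%C = Lfin a (fun z => f (a - z)) mu.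
Proof.
  intros Ha Hf. symmetry. apply is_CInt_unique.
  pose proof (Lfin_ex f a (- mu)%C Ha Hf) as Ex.
  apply CInt_correct in Ex. apply is_CInt_swap in Ex.
  pose proof (is_CInt_lin (fun y : R => Cexp (Ci * - mu * y) * f y)%C (-1) a 0 a (- CInt (fun y : R => Cexp (Ci * - mu * y) * f y)%C 0 a)%C) as Li.
  replace (-1 * 0 + a) with a in Li by ring. replace (-1 * a + a) with 0 in Li by ring.
  specialize (Li Ex). apply (is_CInt_cmult (- Cexp (Ci * mu * a))) in Li.
  replace (Cexp (Ci * mu * a) * Lfin a f (- mu))%C
    with (- Cexp (Ci * mu * a) * - CInt (fun y : R => Cexp (Ci * - mu * y) * f y) 0 a)%C
    by (unfold Lfin; ring).
  eapply is_CInt_ext; [|exact Li]. intros y _. cbv beta.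
  replace (-1 * y + a) with (a - y) by ring.
  replace (Cexp (Ci * mu * y)) with (Cexp (Ci * mu * a) * Cexp (Ci * - mu * (a - y)%R))%C; [ring|].
  rewrite <- Cexp_plus. f_equal. rewrite RtoC_minus. ring.
Qed.

Lemma Lfin_split (f : R -> C) (a b : R) (mu : C) : 0 <= a <= b -> (forall y, 0 <= y <= b -> Ccont f y) ->
  Lfin b f mu = (Lfin a f mu + Cexp (Ci * mu * a) * Lfin (b - a) (fun z => f (a + z)%R) mu)%C.
Proof.
  intros Hab Hf. unfold Lfin at 1.
  assert (Ex : forall x y, 0 <= x <= y -> y <= b -> ex_CInt (fun y : R => Cexp (Ci * mu * y) * f y)%C x y).
  { intros x y Hx Hy. apply ex_CInt_le; [lra|]. intros z Hz. specialize (Hf z ltac:(lra)). ccont. }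
  rewrite <- (CInt_Chasles _ 0 a b) by (apply Ex; lra). f_equal.
  unfold Lfin. rewrite <- CInt_cmult.
  - pose proof (CInt_translate (fun y : R => Cexp (Ci * mu * y) * f y)%C a 0 (b - a)) as Tr.
    replace (0 + a) with a in Tr by ring. replace (b - a + a) with b in Tr by ring.
    rewrite <- Tr by (apply Ex; lra). apply CInt_ext. intros y _.
    rewrite (Rplus_comm a y). rewrite RtoC_plus, Cmult_plus_distr_l, Cexp_plus. ring.
  - apply Lfin_ex; [lra|]. intros y Hy. apply (continuous_comp (fun y => a + y) f); [ccont|apply Hf; lra].
Qed.

Lemma reflected_cont (h : R -> C) (t y : R) : Ccont h (t - y) -> Ccont (fun y => h (t - y)) y.
Proof. intros H. apply (continuous_comp (fun y => t - y) h); [ccont|exact H]. Qed.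

Lemma shifted_cont (h : R -> C) (t y : R) : Ccont h (t + y) -> Ccont (fun y => h (t + y)) y.
Proof. intros H. apply (continuous_comp (fun y => t + y) h); [ccont|exact H]. Qed.

(** * Fourier inversion in time *)

(* The part [s < t] of the transform is moved to the upper half plane, where it decays. *)
Lemma entire_arc_swap (h : R -> C) (t K : R) : 0 <= t -> 0 <= K -> (forall s, 0 <= s <= t -> Ccont h s) ->
  CInt (fun th : R => Ci * (K * dir th) * (Cexp (Ci * (K * dir th) * t) * Lfin t h (- (K * dir th))))%C (- PI) 0 =
  (- CInt (fun th : R => Ci * (K * dir th) * Lfin t (fun z => h (t - z)%R) (K * dir th))%C 0 PI)%C.
Proof.
  intros Ht HK Hh. pose proof PI_RGT_0 as Hpi.
  (* One entire function, represented by [Fl] below and by [Fu] above the real axis. Cauchy's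
     theorem on each half disc reduces the arc to the diameter, where the two agree. *)
  set (Fl := fun z => (Cexp (Ci * z * t) * Lfin t h (clampIm (- z)))%C).
  set (Fu := fun z => Lfin t (fun y => h (t - y)) (clampIm z)).
  assert (Hr : forall y, 0 <= y <= t -> Ccont (fun y => h (t - y)) y)
    by (intros y Hy; apply reflected_cont, Hh; lra).
  assert (Low : forall s th, 0 <= s -> - PI <= th <= 0 -> upper (- (s * dir th))).
  { intros s th Hs Hth. replace (- (s * dir th))%C with (s * dir (th + PI))%C.
    - apply upper_polar; lra.
    - rewrite dir_plus, dir_PI. ring. }
  assert (A1 : arc Fl K (- PI) 0 = (ray Fl K 0 - ray Fl K (- PI))%C).
  { apply (cauchy_sector (fun z => Im z < 0) (fun _ => True)); try lra; auto.
    - intros s th Hs Hth. rewrite Im_polar.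
      assert (sin th < 0) by (apply sin_lt_0_var; lra). nra.
    - apply Hol_mult; [holo|].
      apply (Hol_comp _ _ (fun z => 0 < Im z) (fun _ => True) (fun z => Lfin t h (clampIm z)) (fun z => - z)%C).
      + exact (Lfin_Hol h t Ht Hh).
      + holo.
      + intros z Hz. simpl. unfold Im in *. lra.
      + auto. }
  assert (A2 : arc Fu K 0 PI = (ray Fu K PI - ray Fu K 0)%C).
  { apply (cauchy_sector (fun z => 0 < Im z) (fun _ => True)); try lra; auto.
    - intros s th Hs Hth. rewrite Im_polar.
      apply Rmult_lt_0_compat; [assumption|]. apply sin_gt_0; lra.
    - exact (Lfin_Hol (fun y => h (t - y)) t Ht Hr). }
  assert (Real : forall x : R, Fl (RtoC x) = Fu (RtoC x)).
  { intros x. unfold Fl, Fu.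
    rewrite !clampIm_id by (unfold upper; simpl; lra). now apply Lfin_reflect. }
  assert (R1 : ray Fl K 0 = ray Fu K 0).
  { unfold ray. apply CInt_ext. intros s _. rewrite dir_0, !Cmult_1_r, Real. reflexivity. }
  assert (R2 : ray Fl K (- PI) = ray Fu K PI).
  { unfold ray. apply CInt_ext. intros s _. rewrite dir_mPI, dir_PI.
    replace (s * -1)%C with (RtoC (- s)) by (rewrite RtoC_opp; ring). now rewrite Real. }
  transitivity (arc Fl K (- PI) 0).
  - unfold arc. apply CInt_ext. rewrite Rmin_left, Rmax_right by lra. intros th Hth. unfold Fl.
    rewrite clampIm_id by (apply Low; lra). reflexivity.
  - rewrite A1, R1, R2. transitivity (- arc Fu K 0 PI)%C; [rewrite A2; ring|].
    apply (f_equal Copp). unfold arc. apply CInt_ext. rewrite Rmin_left, Rmax_right by lra. intros th Hth. unfold Fu.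
    rewrite clampIm_id by (apply upper_polar; lra). reflexivity.
Qed.

(** The transform is split at time [t]. The past is moved to the upper arc, the future stays on the
    lower one, and by [half_arc] each contributes [PI h(t)], half of the result. *)
Lemma time_inversion (h h' : R -> C) (T t : R) : 0 < t < T ->
  (forall s, 0 <= s <= T -> Ccont h s) -> (forall s, 0 <= s <= T -> Ccont h' s) ->
  (forall s, 0 < s < T -> CRderive h s (h' s)) ->
  Clim (fun K => CInt (fun th : R => Ci * (K * dir th) *
     (Cexp (Ci * (K * dir th) * t) * Lfin T h (- (K * dir th))))%C (- PI) 0) (2 * PI * h t)%C.
Proof.
  intros Ht Hh Hh' Hd. pose proof PI_RGT_0 as Hpi.
  pose proof (half_arc (fun z => h (t - z)) (fun z => - h' (t - z)%R)%C t ltac:(lra)) as H1.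
  pose proof (half_arc (fun z => h (t + z)) (fun z => h' (t + z)%R) (T - t) ltac:(lra)) as H2.
  assert (D1 : forall y, 0 < y < t -> CRderive (fun z => h (t - z)) y (- h' (t - y)%R)%C).
  { intros y Hy.
    pose proof (is_derive_comp (K := R_AbsRing) (V := C_R_NormedModule) h (fun z => t - z) y (h' (t - y)) (-1)) as Dc.
    eapply CRderive_eq; [apply Dc|].
    - apply Hd; lra.
    - auto_derive; [trivial|ring].
    - apply C_ext; unfold scal; simpl; unfold scal, Re, Im; simpl; unfold mult; simpl; ring. }
  assert (D2 : forall y, 0 < y < T - t -> CRderive (fun z => h (t + z)) y (h' (t + y)%R)%C).
  { intros y Hy.
    pose proof (is_derive_comp (K := R_AbsRing) (V := C_R_NormedModule) h (fun z => t + z) y (h' (t + y)) 1) as Dc.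
    eapply CRderive_eq; [apply Dc|].
    - apply Hd; lra.
    - auto_derive; [trivial|ring].
    - apply C_ext; unfold scal; simpl; unfold scal, Re, Im; simpl; unfold mult; simpl; ring. }
  specialize (H1 ltac:(intros y Hy; apply reflected_cont, Hh; lra)
    ltac:(intros y Hy; apply Ccont_opp, reflected_cont, Hh'; lra) D1).
  specialize (H2 ltac:(intros y Hy; apply shifted_cont, Hh; lra)
    ltac:(intros y Hy; apply shifted_cont, Hh'; lra) D2).
  cbv beta in H1, H2. rewrite Rminus_0_r in H1. rewrite Rplus_0_r in H2.
  apply Clim_eq with (- (Ci * (Ci * PI * h t)) + - Ci * (Ci * PI * h t))%C.
  2: { assert (Ci2 : (Ci * Ci = -1)%C) by (apply C_ext; simpl; ring).
       transitivity (- 2 * (Ci * Ci) * PI * h t)%C; [ring|rewrite Ci2; ring]. }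
  assert (hc : forall y, 0 <= y <= t -> Ccont h y) by (intros; apply Hh; lra).
  assert (Exu : forall f a, 0 <= a -> (forall y, 0 <= y <= a -> Ccont f y) -> forall K, 0 <= K ->
    ex_CInt (fun th : R => K * dir th * Lfin a f (K * dir th))%C 0 PI).
  { intros f a Ha Hf K HK.
    destruct (ex_CInt_le (fun th : R => K * dir th * Lfin a f (clampIm (K * dir th)))%C 0 PI) as [z Hz]; [lra| |].
    - intros th Hth. pose proof (Lfin_polar_cont f a K Ha HK Hf th Hth). ccont.
    - exists z. eapply is_CInt_ext; [|exact Hz]. rewrite Rmin_left, Rmax_right by lra.
      intros th Hth. now rewrite clampIm_id by (apply upper_polar; lra). }
  apply (Clim_ext_loc (fun K =>
    (-1) * (Ci * CInt (fun th : R => K * dir th * Lfin t (fun z => h (t - z)%R) (K * dir th))%C 0 PI) +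
    - Ci * CInt (fun th : R => K * dir th * Lfin (T - t) (fun z => h (t + z)%R) (K * dir th))%C 0 PI)%C _ _ 0).
  - intros K HK.
    pose proof (entire_arc_swap h t K ltac:(lra) ltac:(lra) hc) as Sw.
    assert (X1 : CInt (fun th : R => Ci * (K * dir th) * Lfin t (fun z => h (t - z)%R) (K * dir th))%C 0 PI =
      (Ci * CInt (fun th : R => K * dir th * Lfin t (fun z => h (t - z)%R) (K * dir th)) 0 PI)%C).
    { rewrite <- CInt_cmult.
      - apply CInt_ext. intros; ring.
      - apply Exu; try lra. intros y Hy; apply reflected_cont, Hh; lra. }
    assert (X2 : CInt (fun th : R => Ci * (K * dir th) * Lfin (T - t) (fun z => h (t + z)%R) (- (K * dir th)))%C (- PI) 0 =
      (- Ci * CInt (fun th : R => K * dir th * Lfin (T - t) (fun z => h (t + z)%R) (K * dir th)) 0 PI)%C).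
    { rewrite <- CInt_cmult.
      - pose proof (CInt_translate (fun th : R => - Ci * (K * dir th * Lfin (T - t) (fun z => h (t + z)%R) (K * dir th)))%C PI (- PI) 0) as Tr.
        replace (- PI + PI) with 0 in Tr by ring. replace (0 + PI) with PI in Tr by ring.
        rewrite <- Tr.
        + apply CInt_ext. intros th _. rewrite dir_plus, dir_PI.
          replace (K * (dir th * -1))%C with (- (K * dir th))%C by ring. ring.
        + destruct (Exu (fun z => h (t + z)) (T - t) ltac:(lra) ltac:(intros y Hy; apply shifted_cont, Hh; lra) K ltac:(lra)) as [z Hz].
          exists (- Ci * z)%C. now apply is_CInt_cmult.
      - apply Exu; try lra. intros y Hy; apply shifted_cont, Hh; lra. }
    replace ((-1) * (Ci * CInt (fun th : R => K * dir th * Lfin t (fun z => h (t - z)%R) (K * dir th)) 0 PI))%C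
      with (- (Ci * CInt (fun th : R => K * dir th * Lfin t (fun z => h (t - z)%R) (K * dir th)) 0 PI))%C by ring.
    rewrite <- X1, <- X2, <- Sw.
    assert (Low : forall th, - PI <= th <= 0 -> upper (- (K * dir th))).
    { intros th Hth. replace (- (K * dir th))%C with (K * dir (th + PI))%C.
      - apply upper_polar; lra.
      - rewrite dir_plus, dir_PI. ring. }
    assert (Cl : forall f a th, 0 <= a -> (forall y, 0 <= y <= a -> Ccont f y) ->
       Ccont (fun th : R => Lfin a f (clampIm (- (K * dir th)))) th).
    { intros f a th Ha Hf.
      apply (Ccont_comp (fun th : R => - (K * dir th))%C (fun z => Lfin a f (clampIm z))); [ccont|].
      apply (Hol_cont _ _ _ _ (Lfin_Hol f a Ha Hf) I). }
    rewrite <- CInt_plus.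
    + apply CInt_ext. rewrite Rmin_left, Rmax_right by lra. intros th Hth.
      rewrite (Lfin_split h t T) by (lra || assumption).
      replace (Cexp (Ci * (K * dir th) * t) * (Lfin t h (- (K * dir th)) +
         Cexp (Ci * - (K * dir th) * t) * Lfin (T - t) (fun z => h (t + z)%R) (- (K * dir th))))%C
        with (Cexp (Ci * (K * dir th) * t) * Lfin t h (- (K * dir th)) +
         (Cexp (Ci * (K * dir th) * t) * Cexp (Ci * - (K * dir th) * t)) * Lfin (T - t) (fun z => h (t + z)%R) (- (K * dir th)))%C by ring.
      rewrite <- Cexp_plus.
      replace (Ci * (K * dir th) * t + Ci * - (K * dir th) * t)%C with (RtoC 0) by ring. rewrite Cexp_0. ring.
    + destruct (ex_CInt_le (fun th : R => Ci * (K * dir th) * (Cexp (Ci * (K * dir th) * t) * Lfin t h (clampIm (- (K * dir th)))))%C (- PI) 0) as [z Hz]; [lra| |].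
      * intros th Hth. pose proof (Cl h t th ltac:(lra) hc). ccont.
      * exists z. eapply is_CInt_ext; [|exact Hz]. rewrite Rmin_left, Rmax_right by lra. intros th Hth.
        now rewrite clampIm_id by (apply Low; lra).
    + destruct (ex_CInt_le (fun th : R => Ci * (K * dir th) * Lfin (T - t) (fun z => h (t + z)%R) (clampIm (- (K * dir th))))%C (- PI) 0) as [z Hz]; [lra| |].
      * intros th Hth. pose proof (Cl (fun z => h (t + z)) (T - t) th ltac:(lra) ltac:(intros y Hy; apply shifted_cont, Hh; lra)). ccont.
      * exists z. eapply is_CInt_ext; [|exact Hz]. rewrite Rmin_left, Rmax_right by lra. intros th Hth.
        now rewrite clampIm_id by (apply Low; lra).
  - apply Clim_plus.
    + apply Clim_eq with ((-1) * (Ci * (Ci * PI * h t)))%C; [|ring]. apply Clim_cmult, Clim_cmult, H1.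
    + apply Clim_cmult, H2.
Qed.

(** * Global relations *)

(* The pair [(p, q)] solves [(e^{i m x - i lam t} p)_t + (e^{i m x - i lam t} q)_x = 0]. *)
Definition conserved (T : R) (lam m : C) (p pt q : R -> R -> C) : Prop :=
  (forall x t, cont2 p x t /\ cont2 pt x t /\ cont2 q x t) /\
  (forall x t, 0 < x -> 0 < t < T -> CRderive (fun t => p x t) t (pt x t) /\
    CRderive (fun x => q x t) x (- (pt x t - Ci * lam * p x t) - Ci * m * q x t)%C).

(** Green's theorem on [[0, b] x [0, T]]: the sides of constant [t] give space transforms of [p],
    those of constant [x] give time transforms of the flux [q]. *)
Lemma conserved_green (T b : R) (lam m : C) (p pt q : R -> R -> C) : 0 < T -> 0 <= b ->
  conserved T lam m p pt q ->
  (Cexp (- (Ci * lam * T)) * Lfin b (fun x => p x T) m - Lfin b (fun x => p x 0%R) m)%C =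
  (Lfin T (fun t => q 0%R t) (- lam) - Cexp (Ci * m * b) * Lfin T (fun t => q b t) (- lam))%C.
Proof.
  intros HT Hb [Hc Hd].
  assert (cp : forall x t, Ccont (fun x => p x t) x) by (intros x t; destruct (Hc x t) as [h _]; exact (cont2_slice1 p x t h)).
  assert (cq : forall x t, Ccont (fun t => q x t) t) by (intros x t; destruct (Hc x t) as [_ [_ h]]; exact (cont2_slice2 q x t h)).
  set (E := fun x t : R => Cexp (Ci * m * x - Ci * lam * t)).
  assert (dEt : forall x t : R, CRderive (fun t => E x t) t (- (Ci * lam) * E x t)%C).
  { intros x t. unfold E. eapply CRderive_eq.
    - apply CRderive_Cexp. apply CRderive_minus; [apply CRderive_const|apply CRderive_cmult, CRderive_RtoC].
    - cbv beta. ring. }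
  assert (dEx : forall x t : R, CRderive (fun x => E x t) x (Ci * m * E x t)%C).
  { intros x t. unfold E. eapply CRderive_eq.
    - apply CRderive_Cexp. apply CRderive_minus; [apply CRderive_cmult, CRderive_RtoC|apply CRderive_const].
    - cbv beta. ring. }
  pose proof (green (fun x t => E x t * p x t)%C (fun x t => (-1) * (E x t * q x t))%C
    (fun x t => E x t * (pt x t - Ci * lam * p x t))%C 0 b 0 T Hb (Rlt_le _ _ HT)) as G.
  assert (G' : CInt (fun x => E x T * p x T - E x 0%R * p x 0%R)%C 0 b =
    CInt (fun t => (-1) * (E b t * q b t) - (-1) * (E 0%R t * q 0%R t))%C 0 T).
  { apply G; clear G.
    - intros x t _ _. destruct (Hc x t) as [c1 [c2 c3]].
      assert (cE : cont2 E x t) by (unfold E; cont2tac).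
      unfold E in *. repeat split; cont2tac.
    - intros x t Hx Ht. destruct (Hd x t ltac:(lra) ltac:(lra)) as [d1 _].
      eapply CRderive_eq; [apply CRderive_mult; [apply dEt|exact d1]|]. cbv beta. ring.
    - intros x t Hx Ht. destruct (Hd x t ltac:(lra) ltac:(lra)) as [_ d2].
      eapply CRderive_eq; [apply CRderive_cmult, CRderive_mult; [apply dEx|exact d2]|]. cbv beta. ring. }
  clear G.
  assert (XL : forall (s : R) k, ex_CInt (fun x => Cexp (Ci * k * x) * p x s)%C 0 b)
    by (intros; apply (Lfin_ex (fun x => p x s)); [assumption|intros; apply cp]).
  assert (XR : forall (s : R) k, ex_CInt (fun t => Cexp (Ci * k * t) * q s t)%C 0 T)
    by (intros; apply (Lfin_ex (fun t => q s t)); [lra|intros; apply cq]).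
  transitivity (CInt (fun x => E x T * p x T - E x 0%R * p x 0%R)%C 0 b).
  - unfold Lfin. rewrite <- CInt_cmult by apply XL. rewrite <- CInt_minus.
    + apply CInt_ext. intros x _. unfold E, Cminus. rewrite !Cexp_plus.
      replace (- (Ci * lam * 0%R))%C with (RtoC 0) by ring. rewrite Cexp_0. ring.
    + destruct (XL T m) as [z Hz]. exists (Cexp (- (Ci * lam * T)) * z)%C. now apply is_CInt_cmult.
    + apply XL.
  - rewrite G'. unfold Lfin. rewrite <- CInt_cmult by apply XR. rewrite <- CInt_minus.
    + apply CInt_ext. intros t _. unfold E, Cminus. rewrite !Cexp_plus.
      replace (Ci * m * 0%R)%C with (RtoC 0) by ring. rewrite Cexp_0.
      replace (- (Ci * lam * t))%C with (Ci * - lam * t)%C by ring. ring.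
    + apply XR.
    + destruct (XR b (- lam)%C) as [z Hz]. exists (Cexp (Ci * m * b) * z)%C. now apply is_CInt_cmult.
Qed.

Definition dominated2 (T : R) (p : R -> R -> C) (g : R -> R) : Prop :=
  ex_RInt_gen g (at_point 0) (Rbar_locally p_infty) /\
  forall x t, 0 <= x -> 0 <= t <= T -> Cmod (p x t) <= g x.

(** An integrable function need not tend to 0, but if it stayed above [e] on a unit interval
    arbitrarily far out, the integral could not converge. *)
Lemma integrable_small (g : R -> R) : ex_RInt_gen g (at_point 0) (Rbar_locally p_infty) ->
  forall X e, 0 < e -> exists x, X < x /\ 0 < x /\ g x < e.
Proof.
  intros Hg X e He. destruct (ex_RInt_gen_lim g Hg) as [G [Eg Lg]].
  destruct (Lg (e / 4)) as [Y HY]; [lra|].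
  set (Z := Rmax 0 (Rmax X Y) + 1).
  assert (HZ : 0 < Z /\ X < Z /\ Y < Z).
  { unfold Z. pose proof (Rmax_l 0 (Rmax X Y)). pose proof (Rmax_r 0 (Rmax X Y)).
    pose proof (Rmax_l X Y). pose proof (Rmax_r X Y). lra. }
  destruct (Classical_Prop.classic (exists x, Z < x < Z + 1 /\ g x < e)) as [[x [Hx Hgx]]|Hn].
  { exists x. repeat split; lra. }
  exfalso.
  assert (Ez : ex_RInt g Z (Z + 1)).
  { apply (ex_RInt_Chasles_2 (V := R_CompleteNormedModule) g 0 Z (Z + 1)); [lra|]. apply Eg; lra. }
  assert (Low : e <= RInt g Z (Z + 1)).
  { replace e with (RInt (fun _ => e) Z (Z + 1)).
    - apply RInt_le; [lra|apply (ex_RInt_const (V := R_NormedModule))|assumption|].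
      intros x Hx. apply Rnot_lt_le. intros Hlt. apply Hn. exists x. split; [lra|assumption].
    - rewrite (RInt_const (V := R_CompleteNormedModule)). unfold scal; simpl; unfold mult; simpl. ring. }
  pose proof (RInt_Chasles_R g 0 Z (Z + 1) (Eg Z ltac:(lra)) Ez).
  pose proof (Rabs_def2 _ _ (HY Z ltac:(lra))). pose proof (Rabs_def2 _ _ (HY (Z + 1) ltac:(lra))). lra.
Qed.

(** The flux term at [b] is at most [T g'(b)]. This is small at suitable points arbitrarily far out,
    which is enough because the other side of [conserved_green] converges as [b] grows. *)
Lemma conserved_global (T : R) (lam m : C) (p pt q : R -> R -> C) (g g' : R -> R) : 0 < T ->
  conserved T lam m p pt q -> dominated2 T p g -> dominated2 T q g' ->
  Im lam <= 0 -> upper m ->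
  Lfin T (fun t => q 0%R t) (- lam) =
  (Cexp (- (Ci * lam * T)) * L (fun x => p x T) m - L (fun x => p x 0%R) m)%C.
Proof.
  intros HT Hs [Hg Hp] [Hg' Hq] Hl Hm. pose proof Hs as [Hc Hd].
  assert (Dp : forall t, 0 <= t <= T -> dominated (fun x => p x t) g).
  { intros t Ht. split; [|split]; auto. intros x Hx. destruct (Hc x t) as [h _]. exact (cont2_slice1 p x t h). }
  assert (Lim : Clim (fun b => Cexp (- (Ci * lam * T)) * Lfin b (fun x => p x T) m - Lfin b (fun x => p x 0%R) m)%C
     (Cexp (- (Ci * lam * T)) * L (fun x => p x T) m - L (fun x => p x 0%R) m)%C).
  { apply Clim_minus; [apply Clim_cmult|]; apply (L_lim _ g); try assumption; apply Dp; lra. }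
  set (A := Lfin T (fun t => q 0%R t) (- lam)) in *.
  set (B := (Cexp (- (Ci * lam * T)) * L (fun x => p x T) m - L (fun x => p x 0%R) m)%C) in *.
  assert (Z : forall e, 0 < e -> Cmod (A - B) < e).
  { intros e He. destruct (proj1 (Clim_eps _ _) Lim (e / 2)) as [X HX]; [lra|].
    destruct (integrable_small g' Hg' X (e / (2 * T))) as [b [Hb1 [Hb2 Hb3]]].
    { apply Rdiv_lt_0_compat; lra. }
    specialize (HX b Hb1).
    rewrite (conserved_green T b lam m p pt q HT (Rlt_le _ _ Hb2) Hs) in HX. fold A in HX.
    assert (K : Cmod (Cexp (Ci * m * b) * Lfin T (fun t => q b t) (- lam))%C <= e / 2).
    { rewrite Cmod_mult. pose proof (Cmod_kernel_le m b Hm (Rlt_le _ _ Hb2)).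
      assert (Ql : upper (- lam)) by (unfold upper, Im in *; simpl; lra).
      destruct (Lfin_sin_bound (fun t => q b t) T (g' b) (- lam)%C) as [Q _]; try lra; try assumption.
      - eapply Rle_trans; [apply Cmod_ge_0|apply (Hq b 0); lra].
      - intros t Ht. destruct (Hc b t) as [_ [_ h]]. split; [exact (cont2_slice2 q b t h)|apply Hq; lra].
      - pose proof (Cmod_ge_0 (Lfin T (fun t => q b t) (- lam))).
        assert (g' b * T <= e / 2).
        { replace (e / 2) with (e / (2 * T) * T) by (field; lra). apply Rmult_le_compat_r; lra. }
        nra. }
    replace (A - B)%C with ((A - Cexp (Ci * m * b) * Lfin T (fun t => q b t) (- lam) - B) +
      Cexp (Ci * m * b) * Lfin T (fun t => q b t) (- lam))%C by ring.
    eapply Rle_lt_trans; [apply Cmod_triangle|]. lra. }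
  assert (Z0 : Cmod (A - B) = 0).
  { destruct (Cmod_ge_0 (A - B)) as [H0|H0]; [|now symmetry].
    specialize (Z _ H0). lra. }
  apply Cmod_eq_0 in Z0. replace A with (A - B + B)%C by ring. rewrite Z0. ring.
Qed.

Lemma cont2_shift (a : R) (p : R -> R -> C) (x t : R) : cont2 p (a + x) t -> cont2 (fun x t => p (a + x)%R t) x t.
Proof.
  intros H. apply (Ccont_comp (U := prod_UniformSpace R_UniformSpace R_UniformSpace)
    (fun z => (a + fst z, snd z)) (fun z => p (fst z) (snd z))); [|exact H].
  apply Ccont_pair; [|apply continuous_snd]. apply Rcont_plus; [apply continuous_const|apply continuous_fst].
Qed.

Lemma CRderive_shift (a : R) (f : R -> C) (x : R) (l : C) : CRderive f (a + x) l -> CRderive (fun x => f (a + x)) x l.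
Proof.
  intros H. pose proof (is_derive_comp (K := R_AbsRing) (V := C_R_NormedModule) f (fun z => a + z) x l 1) as Dc.
  eapply CRderive_eq; [apply Dc; [exact H|]|].
  - auto_derive; [trivial|ring].
  - apply C_ext; unfold scal; simpl; unfold scal, Re, Im; simpl; unfold mult; simpl; ring.
Qed.

Lemma conserved_shift (T a : R) (lam m : C) (p pt q : R -> R -> C) : 0 <= a ->
  conserved T lam m p pt q ->
  conserved T lam m (fun x t => p (a + x)%R t) (fun x t => pt (a + x)%R t) (fun x t => q (a + x)%R t).
Proof.
  intros Ha [Hc Hd]. split.
  - intros x t. destruct (Hc (a + x) t) as [c1 [c2 c3]].
    exact (conj (cont2_shift a p x t c1) (conj (cont2_shift a pt x t c2) (cont2_shift a q x t c3))).
  - intros x t Hx Ht. destruct (Hd (a + x) t ltac:(lra) Ht) as [d1 d2]. split; [exact d1|].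
    apply (CRderive_shift a (fun x => q x t)), d2.
Qed.

Lemma dominated2_shift (T a : R) (p : R -> R -> C) (g : R -> R) : 0 <= a ->
  dominated2 T p g -> dominated2 T (fun x t => p (a + x)%R t) (fun x => g (a + x)).
Proof.
  intros Ha [Hg Hp]. split; [|intros; apply Hp; lra].
  destruct Hg as [l Hl]. destruct (ex_RInt_gen_lim g (ex_intro _ l Hl)) as [G [Eg _]].
  exists (minus l (RInt g 0 a)).
  intros P [e He].
  destruct (Hl _ (locally_ball l e)) as [Q S HQ [X HX] H].
  exists (fun x => x = 0) (fun b => Rmax 0 X < b); [reflexivity|now exists (Rmax 0 X)|].
  intros x b -> Hb. pose proof (Rmax_l 0 X). pose proof (Rmax_r 0 X).
  destruct (H 0 (a + b) HQ (HX (a + b) ltac:(lra))) as [z [Hz1 Hz2]]. simpl in Hz1.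
  exists (minus z (RInt g 0 a)). split.
  - simpl.
    assert (Ea : is_RInt g a (a + b) (minus z (RInt g 0 a))).
    { replace (minus z (RInt g 0 a)) with (plus (opp (RInt g 0 a)) z)
        by (unfold minus, plus, opp; simpl; ring).
      apply (is_RInt_Chasles (V := R_NormedModule) g a 0 (a + b)); [|exact Hz1].
      apply (is_RInt_swap (V := R_NormedModule)), (RInt_correct (V := R_CompleteNormedModule)), Eg, Ha. }
    pose proof (is_RInt_comp_lin (V := R_NormedModule) g 1 a 0 b (minus z (RInt g 0 a))) as Li.
    replace (1 * 0 + a) with a in Li by ring. replace (1 * b + a) with (a + b) in Li by ring.
    specialize (Li Ea). eapply (is_RInt_ext (V := R_NormedModule)); [|exact Li].
    intros y _. unfold scal; simpl; unfold mult; simpl. rewrite Rmult_1_l. f_equal. ring.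
  - apply He. change (Rabs (z - l) < e) in Hz2.
    change (Rabs (z - RInt g 0 a - (l - RInt g 0 a)) < e).
    replace (z - RInt g 0 a - (l - RInt g 0 a)) with (z - l) by ring. exact Hz2.
Qed.

Lemma Lfin_plus (f h : R -> C) (a : R) (mu : C) : 0 <= a ->
  (forall y, 0 <= y <= a -> Ccont f y) -> (forall y, 0 <= y <= a -> Ccont h y) ->
  Lfin a (fun y => f y + h y)%C mu = (Lfin a f mu + Lfin a h mu)%C.
Proof.
  intros Ha Hf Hh. unfold Lfin. rewrite <- CInt_plus by (apply Lfin_ex; assumption).
  apply CInt_ext. intros; ring.
Qed.

Lemma Lfin_cmult (c : C) (f : R -> C) (a : R) (mu : C) : 0 <= a ->
  (forall y, 0 <= y <= a -> Ccont f y) -> Lfin a (fun y => c * f y)%C mu = (c * Lfin a f mu)%C.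
Proof.
  intros Ha Hf. unfold Lfin. rewrite <- CInt_cmult by (apply Lfin_ex; assumption).
  apply CInt_ext. intros; ring.
Qed.

(* [u(x,t) = w(-x,t)] solves the same equation on the positive half line; the equation
   enters through [u_xx = -i u_t]. *)
Definition schroedinger (T : R) (u0 u1 ut : R -> R -> C) (g : R -> R) : Prop :=
  (forall x t, cont2 u0 x t /\ cont2 u1 x t /\ cont2 ut x t) /\
  (forall x t, 0 < x -> 0 < t < T -> CRderive (fun t => u0 x t) t (ut x t) /\
    CRderive (fun x => u0 x t) x (u1 x t) /\ CRderive (fun x => u1 x t) x (- Ci * ut x t)%C) /\
  dominated2 T u0 g /\ dominated2 T u1 g.

(** Here the equation enters by taking [- v_t] for the derivative of [v_xx]. *)
Definition airy (T : R) (v0 v1 v2 vt : R -> R -> C) (g : R -> R) : Prop :=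
  (forall x t, cont2 v0 x t /\ cont2 v1 x t /\ cont2 v2 x t /\ cont2 vt x t) /\
  (forall x t, 0 < x -> 0 < t < T -> CRderive (fun t => v0 x t) t (vt x t) /\
    CRderive (fun x => v0 x t) x (v1 x t) /\ CRderive (fun x => v1 x t) x (v2 x t) /\
    CRderive (fun x => v2 x t) x (- vt x t)%C) /\
  dominated2 T v0 g /\ dominated2 T v1 g /\ dominated2 T v2 g.

Lemma ex_RInt_gen_scal_R (g : R -> R) (c : R) : ex_RInt_gen g (at_point 0) (Rbar_locally p_infty) ->
  ex_RInt_gen (fun x => c * g x) (at_point 0) (Rbar_locally p_infty).
Proof. intros [l H]. exists (c * l). now apply (is_RInt_gen_scal (V := R_NormedModule)). Qed.

(* [X0], [XT] are the values of a functional at the initial and final data. *)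
Definition jump (e XT X0 : C) : C := (e * XT - X0)%C.

Section Schroedinger.
Variables (T : R) (u0 u1 ut : R -> R -> C) (g : R -> R) (lam m : C).
Hypotheses (HT : 0 < T) (Hu : schroedinger T u0 u1 ut g) (Hl : Im lam <= 0)
  (Hm : (m * m)%C = (- lam)%C).

Let U0 (x : R) := Lfin T (fun t => u0 x t) (- lam).
Let U1 (x : R) := Lfin T (fun t => u1 x t) (- lam).
Let e := Cexp (- (Ci * lam * T)).

(** Stated for either root: the relation on [(a, oo)] takes [n = m], the one on [(0, a)] takes
    [n = - m]. *)
Lemma schroedinger_conserved (n : C) : (n * n)%C = (- lam)%C ->
  conserved T lam n u0 ut (fun x t => - Ci * u1 x t + - n * u0 x t)%C.
Proof.
  intros Hn. destruct Hu as [Hc [Hd _]]. split.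
  - intros x t. destruct (Hc x t) as [c0 [c1 c2]]. repeat split; try assumption. cont2tac.
  - intros x t Hx Ht. destruct (Hd x t Hx Ht) as [d1 [d2 d3]]. split; [exact d1|].
    eapply CRderive_eq.
    + apply CRderive_plus; apply CRderive_cmult; [exact d3|exact d2].
    + assert (Ci2 : (Ci * Ci = -1)%C) by (apply C_ext; simpl; ring).
      transitivity ((Ci * Ci) * ut x t - n * u1 x t)%C; [ring|].
      transitivity (- ut x t + (Ci * (lam + n * n)) * u0 x t + (Ci * Ci) * n * u1 x t)%C;
      [rewrite Hn, Ci2; ring|ring].
Qed.

Lemma schroedinger_flux (n : C) (x : R) :
  Lfin T (fun t => - Ci * u1 x t + - n * u0 x t)%C (- lam) = (- Ci * U1 x + - n * U0 x)%C.
Proof.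
  destruct Hu as [Hc _].
  assert (c0 : forall t, Ccont (fun t => u0 x t) t) by (intros t; destruct (Hc x t) as [h _]; exact (cont2_slice2 u0 x t h)).
  assert (c1 : forall t, Ccont (fun t => u1 x t) t) by (intros t; destruct (Hc x t) as [_ [h _]]; exact (cont2_slice2 u1 x t h)).
  unfold U0, U1. rewrite Lfin_plus; [|lra| |].
  - rewrite !Lfin_cmult; auto; lra.
  - intros y _. specialize (c1 y). ccont.
  - intros y _. specialize (c0 y). ccont.
Qed.

Lemma schroedinger_infinite (a : R) : 0 <= a -> upper m ->
  (- Ci * U1 a + - m * U0 a)%C =
  jump e (L (fun x => u0 (a + x)%R T) m) (L (fun x => u0 (a + x)%R 0%R) m).
Proof.
  intros Ha Hum. destruct Hu as [_ [_ [H0 H1]]].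
  pose proof (schroedinger_conserved m Hm) as Hs.
  assert (Hq : dominated2 T (fun x t => - Ci * u1 x t + - m * u0 x t)%C (fun x => (1 + Cmod m) * g x)).
  { split; [apply ex_RInt_gen_scal_R, H0|]. intros x t Hx Ht.
    eapply Rle_trans; [apply Cmod_triangle|]. rewrite !Cmod_mult, !Cmod_opp, Cmod_Ci.
    destruct H0 as [_ H0]. destruct H1 as [_ H1]. specialize (H0 x t Hx Ht). specialize (H1 x t Hx Ht).
    pose proof (Cmod_ge_0 m). nra. }
  pose proof (conserved_global T lam m _ _ _ _ _ HT (conserved_shift T a lam m _ _ _ Ha Hs)
    (dominated2_shift T a _ _ Ha H0) (dominated2_shift T a _ _ Ha Hq) Hl Hum) as G.
  cbv beta in G. rewrite Rplus_0_r in G. rewrite schroedinger_flux in G. exact G.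
Qed.

(** The exponential belonging to [- m] may grow with [x]. Multiplying the relation by [e^{ima}] and
    reading the data backwards from [a] makes it bounded. *)
Lemma schroedinger_finite (a : R) : 0 <= a ->
  jump e (Lfin a (fun z => u0 (a - z)%R T) m) (Lfin a (fun z => u0 (a - z)%R 0%R) m) =
  (Cexp (Ci * m * a) * (- Ci * U1 0%R + m * U0 0%R) - (- Ci * U1 a + m * U0 a))%C.
Proof.
  intros Ha. assert (Hm' : (- m * - m)%C = (- lam)%C) by (rewrite <- Hm; ring).
  pose proof (conserved_green T a lam (- m) _ _ _ HT Ha (schroedinger_conserved (- m)%C Hm')) as G.
  cbv beta in G. rewrite !schroedinger_flux in G.
  destruct Hu as [Hc _].
  assert (c0 : forall x t, Ccont (fun x => u0 x t) x) by (intros x t; destruct (Hc x t) as [h _]; exact (cont2_slice1 u0 x t h)).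
  assert (R1 : forall s, Lfin a (fun z => u0 (a - z)%R s) m = (Cexp (Ci * m * a) * Lfin a (fun x => u0 x s) (- m))%C).
  { intros s. symmetry. apply (Lfin_reflect (fun x => u0 x s)); [assumption|intros; apply c0]. }
  rewrite !R1. unfold jump, e.
  transitivity (Cexp (Ci * m * a) * (Cexp (- (Ci * lam * T)) * Lfin a (fun x => u0 x T) (- m) -
     Lfin a (fun x => u0 x 0%R) (- m)))%C; [ring|].
  rewrite G.
  assert (Ee : (Cexp (Ci * m * a) * Cexp (Ci * - m * a) = 1)%C).
  { rewrite <- Cexp_plus. replace (Ci * m * a + Ci * - m * a)%C with (RtoC 0) by ring. apply Cexp_0. }
  transitivity (Cexp (Ci * m * a) * (- Ci * U1 0 + m * U0 0) -
    (Cexp (Ci * m * a) * Cexp (Ci * - m * a)) * (- Ci * U1 a + m * U0 a))%C; [ring|].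
  rewrite Ee. ring.
Qed.

End Schroedinger.

Section Airy.
Variables (T : R) (v0 v1 v2 vt : R -> R -> C) (g : R -> R) (lam m : C).
Hypotheses (HT : 0 < T) (Hv : airy T v0 v1 v2 vt g) (Hl : Im lam <= 0)
  (Hm : (m * m * m)%C = lam).

Let V0 (x : R) := Lfin T (fun t => v0 x t) (- lam).
Let V1 (x : R) := Lfin T (fun t => v1 x t) (- lam).
Let V2 (x : R) := Lfin T (fun t => v2 x t) (- lam).
Let e := Cexp (- (Ci * lam * T)).

(** The exponential is [e^{-imx - i lam t}], as in [hat_pos], so that [m] runs through the cube
    roots of [lam] themselves. *)
Lemma airy_conserved :
  conserved T lam (- m) v0 vt (fun x t => v2 x t + Ci * m * v1 x t + - (m * m) * v0 x t)%C.
Proof.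
  destruct Hv as [Hc [Hd _]]. split.
  - intros x t. destruct (Hc x t) as [c0 [c1 [c2 c3]]]. repeat split; try assumption. cont2tac.
  - intros x t Hx Ht. destruct (Hd x t Hx Ht) as [d1 [d2 [d3 d4]]]. split; [exact d1|].
    eapply CRderive_eq.
    + apply CRderive_plus; [apply CRderive_plus|]; [exact d4|apply CRderive_cmult; exact d3|apply CRderive_cmult; exact d2].
    + assert (Ci2 : (Ci * Ci = -1)%C) by (apply C_ext; simpl; ring).
      transitivity (- vt x t + Ci * m * v2 x t + (-1) * (m * m) * v1 x t + Ci * (lam - m * m * m) * v0 x t)%C;
      [rewrite Hm; ring|]. rewrite <- Ci2. ring.
Qed.

Lemma airy_flux (x : R) :
  Lfin T (fun t => v2 x t + Ci * m * v1 x t + - (m * m) * v0 x t)%C (- lam) = (V2 x + Ci * m * V1 x + - (m * m) * V0 x)%C.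
Proof.
  destruct Hv as [Hc _].
  assert (c0 : forall t, Ccont (fun t => v0 x t) t) by (intros t; destruct (Hc x t) as [h _]; exact (cont2_slice2 v0 x t h)).
  assert (c1 : forall t, Ccont (fun t => v1 x t) t) by (intros t; destruct (Hc x t) as [_ [h _]]; exact (cont2_slice2 v1 x t h)).
  assert (c2 : forall t, Ccont (fun t => v2 x t) t) by (intros t; destruct (Hc x t) as [_ [_ [h _]]]; exact (cont2_slice2 v2 x t h)).
  unfold V0, V1, V2. rewrite Lfin_plus; [|lra| |].
  - rewrite Lfin_plus; [|lra| |].
    + rewrite !Lfin_cmult; auto; lra.
    + intros y _. apply c2.
    + intros y _. specialize (c1 y). ccont.
  - intros y _. specialize (c1 y). specialize (c2 y). ccont.
  - intros y _. specialize (c0 y). ccont.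
Qed.

Lemma airy_infinite (a : R) : 0 <= a -> upper (- m) ->
  (V2 a + Ci * m * V1 a + - (m * m) * V0 a)%C =
  jump e (L (fun x => v0 (a + x)%R T) (- m)) (L (fun x => v0 (a + x)%R 0%R) (- m)).
Proof.
  intros Ha Hum. destruct Hv as [_ [_ [H0 [H1 H2]]]].
  pose proof airy_conserved as Hs.
  assert (Hq : dominated2 T (fun x t => v2 x t + Ci * m * v1 x t + - (m * m) * v0 x t)%C
     (fun x => (1 + Cmod m + Cmod m * Cmod m) * g x)).
  { split; [apply ex_RInt_gen_scal_R, H0|]. intros x t Hx Ht.
    eapply Rle_trans; [apply Cmod_triangle|].
    eapply Rle_trans; [apply Rplus_le_compat_r, Cmod_triangle|].
    rewrite !Cmod_mult, !Cmod_opp, !Cmod_mult, Cmod_Ci.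
    destruct H0 as [_ H0]. destruct H1 as [_ H1]. destruct H2 as [_ H2].
    specialize (H0 x t Hx Ht). specialize (H1 x t Hx Ht). specialize (H2 x t Hx Ht).
    pose proof (Cmod_ge_0 m). pose proof (Rmult_le_compat_l (Cmod m) _ _ ltac:(lra) H1).
    pose proof (Rmult_le_compat_l (Cmod m * Cmod m) _ _ ltac:(nra) H0). lra. }
  pose proof (conserved_global T lam (- m)%C _ _ _ _ _ HT (conserved_shift T a lam (- m)%C _ _ _ Ha Hs)
    (dominated2_shift T a _ _ Ha H0) (dominated2_shift T a _ _ Ha Hq) Hl Hum) as G.
  cbv beta in G. rewrite Rplus_0_r in G. rewrite airy_flux in G. exact G.
Qed.

Lemma airy_finite (a : R) : 0 <= a ->
  jump e (Lfin a (fun z => v0 (a - z)%R T) m) (Lfin a (fun z => v0 (a - z)%R 0%R) m) =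
  (Cexp (Ci * m * a) * (V2 0%R + Ci * m * V1 0%R + - (m * m) * V0 0%R) - (V2 a + Ci * m * V1 a + - (m * m) * V0 a))%C.
Proof.
  intros Ha.
  pose proof (conserved_green T a lam (- m) _ _ _ HT Ha airy_conserved) as G.
  cbv beta in G. rewrite !airy_flux in G.
  destruct Hv as [Hc _].
  assert (c0 : forall x t, Ccont (fun x => v0 x t) x) by (intros x t; destruct (Hc x t) as [h _]; exact (cont2_slice1 v0 x t h)).
  assert (R1 : forall s, Lfin a (fun z => v0 (a - z)%R s) m = (Cexp (Ci * m * a) * Lfin a (fun x => v0 x s) (- m))%C).
  { intros s. symmetry. apply (Lfin_reflect (fun x => v0 x s)); [assumption|intros; apply c0]. }
  rewrite !R1. unfold jump, e.
  transitivity (Cexp (Ci * m * a) * (Cexp (- (Ci * lam * T)) * Lfin a (fun x => v0 x T) (- m) -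
     Lfin a (fun x => v0 x 0%R) (- m)))%C; [ring|].
  rewrite G.
  assert (Ee : (Cexp (Ci * m * a) * Cexp (Ci * - m * a) = 1)%C).
  { rewrite <- Cexp_plus. replace (Ci * m * a + Ci * - m * a)%C with (RtoC 0) by ring. apply Cexp_0. }
  transitivity (Cexp (Ci * m * a) * (V2 0 + Ci * m * V1 0 + - (m * m) * V0 0) -
    (Cexp (Ci * m * a) * Cexp (Ci * - m * a)) * (V2 a + Ci * m * V1 a + - (m * m) * V0 a))%C; [ring|].
  rewrite Ee. ring.
Qed.

End Airy.

(** * The cube root of unity *)

Lemma alpha_dir : alpha = dir (2 * PI / 3).
Proof.
  unfold alpha. f_equal. rewrite RtoC_div, RtoC_mult by lra. field.
Qed.

Lemma alpha_cube : (alpha * alpha * alpha)%C = 1%C.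
Proof.
  rewrite alpha_dir, <- !dir_plus. replace (2 * PI / 3 + 2 * PI / 3 + 2 * PI / 3) with (2 * PI) by field.
  apply C_ext; [rewrite Re_dir, cos_2PI|rewrite Im_dir, sin_2PI]; reflexivity.
Qed.

Lemma alpha_neq_1 : (alpha - 1)%C <> 0%C.
Proof.
  rewrite alpha_dir. intros H. apply (f_equal Re) in H.
  change (Re (dir (2 * PI / 3)) + - 1 = 0) in H. rewrite Re_dir in H.
  replace (2 * PI / 3) with (2 * (PI / 3)) in H by field. rewrite cos_2PI3 in H. lra.
Qed.

Lemma alpha_sum : (1 + alpha + alpha * alpha)%C = 0%C.
Proof.
  assert (H : ((alpha - 1) * (1 + alpha + alpha * alpha) = 0)%C).
  { transitivity (alpha * alpha * alpha - 1)%C; [ring|]. rewrite alpha_cube. ring. }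
  pose proof alpha_neq_1 as Hn.
  transitivity (/ (alpha - 1) * ((alpha - 1) * (1 + alpha + alpha * alpha)))%C; [field; auto|].
  rewrite H. ring.
Qed.

(** * Solving for the interface value *)

Definition den (rho sigma : C) : C := ((alpha - 1) * rho * (rho + alpha ^ 2 * sigma))%C.

(* The functionals of the data: boundary value, and value at distance [a] from the interface. *)
Definition bval (f h : R -> C) (rho sigma : C) : C :=
  (((1 - alpha ^ 2) * rho * L f sigma - L h (- rho) + L h (- (alpha ^ 2 * rho))) / den rho sigma)%C.

Definition uval (a : R) (f h : R -> C) (rho sigma : C) : C :=
  (Cexp (Ci * sigma * a) * bval f h rho sigma - Cexp (Ci * sigma * a) * L f sigma / (2 * sigma)
   + (Lfin a (fun z => f (a - z)%R) sigma + L (fun z => f (a + z)%R) sigma) / (2 * sigma))%C.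

Definition vval (a : R) (f h : R -> C) (rho sigma : C) : C :=
  (Cexp (Ci * (alpha * rho) * a) * bval f h rho sigma
   - Cexp (Ci * (alpha * rho) * a) * (rho * L h (- rho) + alpha ^ 2 * rho * L h (- (alpha ^ 2 * rho))) / (3 * rho ^ 3)
   - (alpha * rho * Lfin a (fun z => h (a - z)%R) (alpha * rho)
      - rho * L (fun z => h (a + z)%R) (- rho)
      - alpha ^ 2 * rho * L (fun z => h (a + z)%R) (- (alpha ^ 2 * rho))) / (3 * rho ^ 3))%C.

Section Solve.
Variables (T : R) (u0 u1 ut : R -> R -> C) (gu : R -> R) (v0 v1 v2 vt : R -> R -> C) (gv : R -> R).
Variables (rho sigma lam : C).
Hypotheses (HT : 0 < T) (Hu : schroedinger T u0 u1 ut gu) (Hv : airy T v0 v1 v2 vt gv)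
  (Hi0 : forall t, 0 <= t <= T -> u0 0 t = v0 0 t)
  (Hi1 : forall t, 0 <= t <= T -> u1 0 t = (- v1 0%R t)%C)
  (Hl : Im lam <= 0) (Hs : (sigma * sigma)%C = (- lam)%C) (Hr : (rho * rho * rho)%C = lam)
  (us : upper sigma) (ur : upper (- rho)) (ur2 : upper (- (alpha ^ 2 * rho)))
  (Hs0 : sigma <> 0%C) (Hr0 : rho <> 0%C) (Hden : (rho + alpha ^ 2 * sigma)%C <> 0%C).

Let e := Cexp (- (Ci * lam * T)).
Let f0 x := u0 x 0. Let fT x := u0 x T. Let h0 x := v0 x 0. Let hT x := v0 x T.

Lemma cube2 : (alpha ^ 2 * rho * (alpha ^ 2 * rho) * (alpha ^ 2 * rho) = lam)%C.
Proof.
  transitivity ((alpha * alpha * alpha) * (alpha * alpha * alpha) * (rho * rho * rho))%C; [ring|].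
  rewrite alpha_cube, Hr. ring.
Qed.

Lemma cube1 : (alpha * rho * (alpha * rho) * (alpha * rho) = lam)%C.
Proof.
  transitivity ((alpha * alpha * alpha) * (rho * rho * rho))%C; [ring|].
  rewrite alpha_cube, Hr. ring.
Qed.

Lemma shift0 (f : R -> R -> C) (t : R) : (fun x => f (0 + x)%R t) = (fun x => f x t).
Proof. apply functional_extensionality. intros x. now rewrite Rplus_0_l. Qed.

(** The relations [E1], [E2], [E3] for [sigma], [rho], [alpha^2 rho] at the interface involve the
    time transforms of [v], [v_x] and [v_xx]; the combination [(1 - alpha^2) rho E1 - E2 + E3]
    eliminates the last two. The first derivative enters [E1] with the opposite sign, as [u] is [w]
    reflected. *)
Lemma boundary_value :
  Lfin T (fun t => v0 0%R t) (- lam) = (bval f0 h0 rho sigma - e * bval fT hT rho sigma)%C.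
Proof.
  pose proof (schroedinger_infinite T u0 u1 ut gu lam sigma HT Hu Hl Hs 0 (Rle_refl 0) us) as E1.
  pose proof (airy_infinite T v0 v1 v2 vt gv lam rho HT Hv Hl Hr 0 (Rle_refl 0) ur) as E2.
  pose proof (airy_infinite T v0 v1 v2 vt gv lam (alpha ^ 2 * rho)%C HT Hv Hl cube2 0 (Rle_refl 0) ur2) as E3.
  rewrite !shift0 in E1, E2, E3.
  assert (B0 : Lfin T (fun t => u0 0 t) (- lam) = Lfin T (fun t => v0 0 t) (- lam)).
  { apply CInt_ext. rewrite Rmin_left, Rmax_right by lra. intros t Ht. rewrite Hi0 by lra. reflexivity. }
  assert (B1 : Lfin T (fun t => u1 0 t) (- lam) = (- Lfin T (fun t => v1 0 t) (- lam))%C).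
  { transitivity (Lfin T (fun t => (-1) * v1 0%R t)%C (- lam)).
    - apply CInt_ext. rewrite Rmin_left, Rmax_right by lra. intros t Ht. rewrite Hi1 by lra. ring.
    - rewrite (Lfin_cmult (-1)%C (fun t => v1 0 t)); [ring|lra|]. intros y _. destruct Hv as [Hc _]. destruct (Hc 0 y) as [_ [h _]].
      exact (cont2_slice2 v1 0 y h). }
  rewrite B0, B1 in E1. fold e in E1, E2, E3.
  change (fun x => u0 x T) with fT in E1, E2, E3. change (fun x => u0 x 0) with f0 in E1, E2, E3.
  change (fun x => v0 x T) with hT in E1, E2, E3. change (fun x => v0 x 0) with h0 in E1, E2, E3.
  unfold bval, jump in *.
  set (N := Lfin T (fun t => v0 0 t) (- lam)) in *.
  set (V1 := Lfin T (fun t => v1 0 t) (- lam)) in *.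
  set (V2 := Lfin T (fun t => v2 0 t) (- lam)) in *.
  assert (Hd : den rho sigma <> 0%C).
  { unfold den. repeat apply Cmult_neq_0; try assumption. apply alpha_neq_1. }
  assert (A4 : (alpha ^ 2 * alpha ^ 2 = alpha)%C).
  { transitivity (alpha * alpha * alpha * alpha)%C; [ring|]. rewrite alpha_cube. ring. }
  assert (A5 : (alpha ^ 2 * alpha = 1)%C) by (rewrite <- alpha_cube; ring).
  assert (K : (den rho sigma * N =
    - ((1 - alpha ^ 2) * rho * (e * L fT sigma - L f0 sigma) - (e * L hT (- rho) - L h0 (- rho))
       + (e * L hT (- (alpha ^ 2 * rho)) - L h0 (- (alpha ^ 2 * rho)))))%C).
  { rewrite <- E1, <- E2, <- E3. unfold den.
    transitivity (((alpha - 1) * rho * rho + (alpha ^ 2 * alpha - alpha ^ 2) * rho * sigma) * N)%C; [ring|].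
    rewrite A5.
    transitivity ((((alpha ^ 2 * alpha ^ 2) - 1) * rho * rho + (1 - alpha ^ 2) * rho * sigma) * N)%C; [rewrite A4; ring|].
    ring. }
  transitivity (/ den rho sigma * (den rho sigma * N))%C; [field; assumption|].
  rewrite K. field. assumption.
Qed.

(** The fluxes at [a] for [- sigma] and [sigma] differ by [2 sigma] times the wanted transform. The
    one for [sigma] comes from the data beyond [a]; the one for [- sigma] from the data on [(0, a)]
    and the flux at the interface, which the boundary value and the relation at 0 determine. *)
Lemma schroedinger_value (a : R) : 0 <= a ->
  Lfin T (fun t => u0 a t) (- lam) = (uval a f0 h0 rho sigma - e * uval a fT hT rho sigma)%C.
Proof.
  intros Ha.
  pose proof (schroedinger_infinite T u0 u1 ut gu lam sigma HT Hu Hl Hs 0 (Rle_refl 0) us) as E1.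
  pose proof (schroedinger_infinite T u0 u1 ut gu lam sigma HT Hu Hl Hs a Ha us) as E2.
  pose proof (schroedinger_finite T u0 u1 ut gu lam sigma HT Hu Hs a Ha) as E3.
  pose proof boundary_value as EB. rewrite !shift0 in E1.
  assert (B0 : Lfin T (fun t => u0 0 t) (- lam) = Lfin T (fun t => v0 0 t) (- lam)).
  { apply CInt_ext. rewrite Rmin_left, Rmax_right by lra. intros t Ht. rewrite Hi0 by lra. reflexivity. }
  rewrite <- B0 in EB. fold e in E1, E2, E3.
  change (fun x => u0 x T) with fT in E1. change (fun x => u0 x 0) with f0 in E1.
  unfold uval. 
  change (fun z => fT (a - z)%R) with (fun z => u0 (a - z) T). change (fun z => f0 (a - z)%R) with (fun z => u0 (a - z) 0).
  change (fun z => fT (a + z)%R) with (fun z => u0 (a + z) T). change (fun z => f0 (a + z)%R) with (fun z => u0 (a + z) 0).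
  set (N := Lfin T (fun t => u0 0 t) (- lam)) in *.
  set (U1 := Lfin T (fun t => u1 0 t) (- lam)) in *.
  set (Na := Lfin T (fun t => u0 a t) (- lam)) in *.
  set (U1a := Lfin T (fun t => u1 a t) (- lam)) in *.
  set (E := Cexp (Ci * sigma * a)) in *.
  assert (H2 : (2 : C) <> 0%C) by (intros X; apply (f_equal Re) in X; simpl in X; lra).
  assert (K : (2 * sigma * Na = E * (2 * sigma * N + (- Ci * U1 + - sigma * N)) - (E * (- Ci * U1 + sigma * N) - (- Ci * U1a + sigma * Na)) - (- Ci * U1a + - sigma * Na))%C) by ring.
  rewrite E1, E2, <- E3, EB in K. unfold jump in K.
  transitivity (/ (2 * sigma) * (2 * sigma * Na))%C; [field; auto|].
  rewrite K. field. auto.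
Qed.

(** At [a] the fluxes for [rho] and [alpha^2 rho] come from the data beyond [a], the flux for
    [alpha rho] from the data on [(0, a)] and its value at 0. That value follows from the other two
    fluxes at 0 and the boundary value. *)
Lemma airy_value (a : R) : 0 <= a ->
  Lfin T (fun t => v0 a t) (- lam) = (vval a f0 h0 rho sigma - e * vval a fT hT rho sigma)%C.
Proof.
  intros Ha.
  pose proof (airy_infinite T v0 v1 v2 vt gv lam rho HT Hv Hl Hr 0 (Rle_refl 0) ur) as D1.
  pose proof (airy_infinite T v0 v1 v2 vt gv lam (alpha ^ 2 * rho)%C HT Hv Hl cube2 0 (Rle_refl 0) ur2) as D2.
  pose proof (airy_infinite T v0 v1 v2 vt gv lam rho HT Hv Hl Hr a Ha ur) as E1.
  pose proof (airy_infinite T v0 v1 v2 vt gv lam (alpha ^ 2 * rho)%C HT Hv Hl cube2 a Ha ur2) as E2.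
  pose proof (airy_finite T v0 v1 v2 vt gv lam (alpha * rho)%C HT Hv cube1 a Ha) as E3.
  pose proof boundary_value as EB. rewrite !shift0 in D1, D2.
  fold e in D1, D2, E1, E2, E3.
  change (fun x => v0 x T) with hT in D1, D2. change (fun x => v0 x 0) with h0 in D1, D2.
  unfold vval.
  change (fun z => hT (a - z)%R) with (fun z => v0 (a - z) T). change (fun z => h0 (a - z)%R) with (fun z => v0 (a - z) 0).
  change (fun z => hT (a + z)%R) with (fun z => v0 (a + z) T). change (fun z => h0 (a + z)%R) with (fun z => v0 (a + z) 0).
  set (N := Lfin T (fun t => v0 0 t) (- lam)) in *.
  set (V1 := Lfin T (fun t => v1 0 t) (- lam)) in *. set (V2 := Lfin T (fun t => v2 0 t) (- lam)) in *.
  set (Na := Lfin T (fun t => v0 a t) (- lam)) in *.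
  set (V1a := Lfin T (fun t => v1 a t) (- lam)) in *. set (V2a := Lfin T (fun t => v2 a t) (- lam)) in *.
  set (E := Cexp (Ci * (alpha * rho) * a)) in *.
  assert (H3 : (3 : C) <> 0%C) by (intros X; apply (f_equal Re) in X; simpl in X; lra).
  assert (A3 : (alpha ^ 3 = 1)%C) by (rewrite <- alpha_cube; ring).
  (* sum over the three cube roots mu of lam of mu (V2 + i mu V1 - mu^2 V0) = -3 lam V0 *)
  assert (Sum : forall W0 W1 W2 : C,
     (rho * (W2 + Ci * rho * W1 + - (rho * rho) * W0)
     + alpha ^ 2 * rho * (W2 + Ci * (alpha ^ 2 * rho) * W1 + - (alpha ^ 2 * rho * (alpha ^ 2 * rho)) * W0)
     + alpha * rho * (W2 + Ci * (alpha * rho) * W1 + - (alpha * rho * (alpha * rho)) * W0)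
     = - (3) * rho ^ 3 * W0)%C).
  { intros W0 W1 W2.
    transitivity ((1 + alpha + alpha * alpha) * rho * W2 + (1 + alpha * alpha + alpha ^ 3 * alpha) * Ci * rho * rho * W1
      - (1 + alpha ^ 3 + alpha ^ 3 * alpha ^ 3) * rho ^ 3 * W0)%C; [ring|].
    rewrite A3. transitivity ((1 + alpha + alpha * alpha) * (rho * W2 + Ci * rho * rho * W1) - 3 * rho ^ 3 * W0)%C; [ring|].
    rewrite alpha_sum. ring. }
  pose proof (Sum N V1 V2) as S0. pose proof (Sum Na V1a V2a) as Sa. rewrite D1, D2 in S0. rewrite E1, E2 in Sa.
  set (Q0 := (V2 + Ci * (alpha * rho) * V1 + - (alpha * rho * (alpha * rho)) * N)%C) in *.
  set (Qa := (V2a + Ci * (alpha * rho) * V1a + - (alpha * rho * (alpha * rho)) * Na)%C) in *.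
  assert (HQ0 : (alpha * rho * Q0 = - (3) * rho ^ 3 * N - rho * jump e (L hT (- rho)) (L h0 (- rho))
     - alpha ^ 2 * rho * jump e (L hT (- (alpha ^ 2 * rho))) (L h0 (- (alpha ^ 2 * rho))))%C).
  { rewrite <- S0. ring. }
  assert (HQa : (alpha * rho * Qa = E * (alpha * rho * Q0) - alpha * rho * jump e (Lfin a (fun z => v0 (a - z)%R T) (alpha * rho))
    (Lfin a (fun z => v0 (a - z)%R 0%R) (alpha * rho)))%C).
  { rewrite E3. ring. }
  transitivity (- / (3 * rho ^ 3) * (- (3) * rho ^ 3 * Na))%C; [field; auto|].
  rewrite <- Sa, HQa, HQ0, EB. unfold jump. field. auto.
Qed.

End Solve.

(** * The roots in the logarithmic coordinate *)

(* The roots [sigma], [rho] at [e^u]: entire in [u], whereas in [lam] they have a branch cut. *)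
Definition sg (u : C) : C := (Ci * Cexp (u / 2))%C.
Definition rh (u : C) : C := Cexp (u / 3).

Lemma Cexp_polar (z : C) : Cexp z = (exp (Re z) * dir (Im z))%C.
Proof.
  rewrite <- Cexp_R, <- Cexp_plus. f_equal. apply C_ext; simpl; unfold Re, Im; ring.
Qed.

(** Both arguments lie in [(- PI, PI]], so half their difference is less than [PI] in modulus;
    equality of the directions makes its sine vanish. *)
Lemma Carg_Cexp (z : C) : - PI < Im z <= PI -> Carg (Cexp z) = Im z.
Proof.
  intros Hz. destruct (Carg_spec (Cexp z) (Cexp_neq_0 z)) as [Ha E].
  rewrite Cmod_Cexp in E. set (a := Carg (Cexp z)) in *.
  assert (Ed : dir (Im z) = dir a).
  { rewrite Cexp_polar in E. assert (He : RtoC (exp (Re z)) <> 0%C).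
    { intros X. apply (f_equal Re) in X. simpl in X. pose proof (exp_pos (Re z)). lra. }
    transitivity (/ exp (Re z) * (exp (Re z) * dir (Im z)))%C; [field; auto|].
    rewrite E. field. auto. }
  assert (Ec : cos (a - Im z) = 1).
  { rewrite cos_minus. pose proof (f_equal Re Ed) as E1. pose proof (f_equal Im Ed) as E2.
    rewrite !Re_dir in E1. rewrite !Im_dir in E2. rewrite E1, E2.
    pose proof (sin2_cos2 a). unfold Rsqr in *. lra. }
  set (y := (a - Im z) / 2).
  assert (Es : sin y = 0).
  { assert (Y : a - Im z = 2 * y) by (unfold y; field). rewrite Y, cos_2a_sin in Ec.
    assert (sin y * sin y = 0) by lra. nra. }
  destruct (Rtotal_order y 0) as [H|[H|H]].
  - exfalso. assert (0 < sin (- y)) by (apply sin_gt_0; unfold y in *; lra).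
    rewrite sin_neg in *. lra.
  - unfold y in H. lra.
  - exfalso. assert (0 < sin y) by (apply sin_gt_0; unfold y in *; lra). lra.
Qed.

Lemma Croot_Cexp (n : nat) (z : C) : (0 < n)%nat -> - PI < Im z <= PI ->
  Croot n (Cexp z) = Cexp (z / INR n).
Proof.
  intros Hn Hz. unfold Croot. destruct (Ceq_dec (Cexp z) 0) as [H|_]; [now apply Cexp_neq_0 in H|].
  rewrite Carg_Cexp, Cmod_Cexp by assumption.
  assert (Hn' : 0 < INR n) by now apply lt_0_INR.
  unfold Rpower. rewrite ln_exp, <- Cexp_R, <- Cexp_plus. f_equal.
  rewrite RtoC_mult, RtoC_div, RtoC_inv by lra.
  replace z with (Re z + Ci * Im z)%C at 3 by (apply C_ext; simpl; unfold Re, Im; ring).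
  field. intros X. apply (f_equal Re) in X. simpl in X. lra.
Qed.

Lemma Ci_mult_Cexp (u : C) : (Ci * Cexp u)%C = Cexp (Ci * (PI / 2)%R + u).
Proof. rewrite Cexp_plus, dir_PI2. reflexivity. Qed.

(** On the strip [i e^u] has argument in [[- PI/2, PI/2]], off the cut, so its principal root is the
    exponential of half the logarithm. The factor [e^{i PI/4}] occurs twice and gives [i]; in [rhoC]
    the two factors cancel. *)
Lemma sigmaC_Cexp (u : C) : strip u -> sigmaC (Cexp u) = sg u.
Proof.
  intros [H1 H2]. pose proof PI_RGT_0. unfold sigmaC, sg. rewrite !Ci_mult_Cexp.
  rewrite Croot_Cexp; [|lia|].
  - rewrite <- Cexp_plus. f_equal. replace (INR 2) with 2 by (simpl; ring).
    rewrite RtoC_div by lra. field.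
  - replace (Im (Ci * (PI / 2)%R + u)) with (PI / 2 + Im u) by (simpl; unfold Im; ring). lra.
Qed.

Lemma rhoC_Cexp (u : C) : strip u -> rhoC (Cexp u) = rh u.
Proof.
  intros [H1 H2]. pose proof PI_RGT_0. unfold rhoC, rh. rewrite !Ci_mult_Cexp.
  rewrite Croot_Cexp; [|lia|].
  - rewrite <- Cexp_plus. f_equal. replace (INR 3) with 3 by (simpl; ring).
    rewrite RtoC_div by lra. field.
  - replace (Im (Ci * (PI / 2)%R + u)) with (PI / 2 + Im u) by (simpl; unfold Im; ring). lra.
Qed.

Lemma sg_square (u : C) : (sg u * sg u)%C = (- Cexp u)%C.
Proof.
  unfold sg. assert (Ci2 : (Ci * Ci = -1)%C) by (apply C_ext; simpl; ring).
  transitivity ((Ci * Ci) * (Cexp (u / 2) * Cexp (u / 2)))%C; [ring|].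
  rewrite Ci2, <- Cexp_plus. replace (u / 2 + u / 2)%C with u by field. ring.
Qed.

Lemma rh_cube (u : C) : (rh u * rh u * rh u)%C = Cexp u.
Proof. unfold rh. rewrite <- !Cexp_plus. f_equal. field. Qed.

Lemma Re_half (u : C) : Re (u / 2)%C = Re u / 2 /\ Im (u / 2)%C = Im u / 2.
Proof. split; simpl; unfold Re, Im; field. Qed.

Lemma Re_third (u : C) : Re (u / 3)%C = Re u / 3 /\ Im (u / 3)%C = Im u / 3.
Proof. split; simpl; unfold Re, Im; field. Qed.

Lemma sg_polar (u : C) : sg u = (exp (Re u / 2) * dir (PI / 2 + Im u / 2))%C.
Proof.
  unfold sg. rewrite Cexp_polar. destruct (Re_half u) as [-> ->].
  rewrite dir_plus, dir_PI2. ring.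
Qed.

Lemma rh_polar (u : C) : rh u = (exp (Re u / 3) * dir (Im u / 3))%C.
Proof. unfold rh. rewrite Cexp_polar. destruct (Re_third u) as [-> ->]. reflexivity. Qed.

Lemma mrh_polar (u : C) : (- rh u)%C = (exp (Re u / 3) * dir (PI + Im u / 3))%C.
Proof. rewrite rh_polar, dir_plus, dir_PI. ring. Qed.

Lemma alpha2_dir : (alpha ^ 2)%C = dir (4 * PI / 3).
Proof.
  rewrite alpha_dir. simpl. rewrite Cmult_1_r, <- dir_plus. do 3 f_equal. field.
Qed.

Lemma malpha2_dir : (- alpha ^ 2)%C = dir (PI / 3).
Proof.
  rewrite alpha2_dir. replace (4 * PI / 3) with (PI + PI / 3) by field. rewrite dir_plus, dir_PI. ring.
Qed.

Lemma ma2rh_polar (u : C) : (- (alpha ^ 2 * rh u))%C = (exp (Re u / 3) * dir (PI / 3 + Im u / 3))%C.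
Proof.
  rewrite rh_polar, dir_plus, <- malpha2_dir. ring.
Qed.

Lemma arh_polar (u : C) : (alpha * rh u)%C = (exp (Re u / 3) * dir (2 * PI / 3 + Im u / 3))%C.
Proof. rewrite rh_polar, dir_plus, <- alpha_dir. ring. Qed.

Lemma strip_upper (u : C) : strip u ->
  upper (sg u) /\ upper (- rh u) /\ upper (- (alpha ^ 2 * rh u)) /\ upper (alpha * rh u).
Proof.
  intros [H1 H2]. pose proof PI_RGT_0.
  rewrite sg_polar, mrh_polar, ma2rh_polar, arh_polar.
  repeat split; apply upper_polar; try (left; apply exp_pos); lra.
Qed.

Lemma Im_polar_pos (K th : R) : 0 < K -> 0 < th < PI -> 0 < Im (K * dir th)%C.
Proof. intros. rewrite Im_polar. apply Rmult_lt_0_compat; [assumption|apply sin_gt_0; lra]. Qed.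

Lemma ostrip_upper (u : C) : ostrip u ->
  0 < Im (sg u) /\ 0 < Im (- rh u)%C /\ 0 < Im (- (alpha ^ 2 * rh u))%C /\ 0 < Im (alpha * rh u)%C.
Proof.
  intros [H1 H2]. pose proof PI_RGT_0.
  rewrite sg_polar, mrh_polar, ma2rh_polar, arh_polar.
  repeat split; apply Im_polar_pos; try apply exp_pos; lra.
Qed.

Lemma sg_neq_0 (u : C) : sg u <> 0%C.
Proof.
  apply Cmult_neq_0; [|apply Cexp_neq_0]. intros X. apply (f_equal Im) in X. simpl in X. lra.
Qed.

Lemma rh_neq_0 (u : C) : rh u <> 0%C.
Proof. apply Cexp_neq_0. Qed.

Lemma Cmod_polar (K th : R) : 0 <= K -> Cmod (K * dir th)%C = K.
Proof. intros. rewrite Cmod_mult, Cmod_dir, Cmod_R, Rabs_pos_eq by assumption. ring. Qed.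

Lemma Cmod_sg (u : C) : Cmod (sg u) = exp (Re u / 2).
Proof. rewrite sg_polar. apply Cmod_polar. left; apply exp_pos. Qed.

Lemma Cmod_rh (u : C) : Cmod (rh u) = exp (Re u / 3).
Proof. rewrite rh_polar. apply Cmod_polar. left; apply exp_pos. Qed.

(** Modulo [2 PI] the arguments of [rh u] and [alpha^2 sg u] differ by [PI/6 - Im u / 6], which lies
    between [PI/6] and [PI/3]. Once the second term is rotated to the positive axis, the first has
    non-negative real part. *)
Lemma sum_lower_bound (u : C) : strip u -> Cmod (sg u) <= Cmod (rh u + alpha ^ 2 * sg u)%C.
Proof.
  intros [H1 H2]. pose proof PI_RGT_0.
  set (q := Im u / 2 + PI / 2 + 4 * PI / 3).
  assert (E : ((rh u + alpha ^ 2 * sg u) * dir (- q))%C =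
     (exp (Re u / 3) * dir (Im u / 3 - q) + exp (Re u / 2))%C).
  { rewrite rh_polar, sg_polar, alpha2_dir.
    replace (Im u / 3 - q) with (Im u / 3 + - q) by ring. rewrite (dir_plus (Im u / 3) (- q)).
    assert (D : (dir (4 * PI / 3) * dir (PI / 2 + Im u / 2) * dir (- q) = 1)%C).
    { rewrite <- !dir_plus. rewrite <- dir_0. do 2 f_equal. f_equal. unfold q. field. }
    transitivity (exp (Re u / 3) * (dir (Im u / 3) * dir (- q)) +
      exp (Re u / 2) * (dir (4 * PI / 3) * dir (PI / 2 + Im u / 2) * dir (- q)))%C; [ring|].
    rewrite D. ring. }
  rewrite Cmod_sg.
  replace (Cmod (rh u + alpha ^ 2 * sg u)) with (Cmod ((rh u + alpha ^ 2 * sg u) * dir (- q))%C)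
    by (rewrite Cmod_mult, Cmod_dir; ring).
  rewrite E. eapply Rle_trans; [|apply re_le_Cmod]. eapply Rle_trans; [|apply Rle_abs].
  replace (Re (exp (Re u / 3) * dir (Im u / 3 - q) + exp (Re u / 2)))
    with (exp (Re u / 3) * Re (dir (Im u / 3 - q)) + exp (Re u / 2)) by (simpl; unfold Re; simpl; ring).
  rewrite Re_dir.
  assert (0 <= cos (Im u / 3 - q)).
  { replace (Im u / 3 - q) with (- (Im u / 6 - PI / 6) - 2 * INR 1 * PI)
      by (unfold q; simpl; field).
    replace (cos (- (Im u / 6 - PI / 6) - 2 * INR 1 * PI)) with (cos (- (Im u / 6 - PI / 6))).
    - apply cos_ge_0; lra.
    - rewrite <- (cos_period (- (Im u / 6 - PI / 6) - 2 * INR 1 * PI) 1). f_equal. ring. }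
  pose proof (exp_pos (Re u / 3)). nra.
Qed.

Lemma Cmod_alpha : Cmod alpha = 1.
Proof. rewrite alpha_dir. apply Cmod_dir. Qed.

Lemma Cmod_alpha_minus_1 : 1 <= Cmod (alpha - 1).
Proof.
  eapply Rle_trans; [|apply re_le_Cmod]. rewrite alpha_dir.
  change (1 <= Rabs (Re (dir (2 * PI / 3)) + - 1)). rewrite Re_dir.
  replace (2 * PI / 3) with (2 * (PI / 3)) by field. rewrite cos_2PI3.
  rewrite Rabs_left; lra.
Qed.

Lemma sum_neq_0 (u : C) : strip u -> (rh u + alpha ^ 2 * sg u)%C <> 0%C.
Proof.
  intros H X. pose proof (sum_lower_bound u H) as Y. rewrite X, Cmod_0, Cmod_sg in Y.
  pose proof (exp_pos (Re u / 2)). lra.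
Qed.

Lemma Cmod_den (u : C) : strip u -> Cmod (rh u) * Cmod (sg u) <= Cmod (den (rh u) (sg u)).
Proof.
  intros H. unfold den. rewrite !Cmod_mult.
  pose proof (sum_lower_bound u H). pose proof Cmod_alpha_minus_1.
  pose proof (Cmod_ge_0 (rh u)). pose proof (Cmod_ge_0 (sg u)).
  apply Rmult_le_compat; try assumption. nra.
Qed.

(** * Decay of the functionals on large arcs *)

Lemma Cmod_div_le (x y : C) (a b : R) : 0 < b -> Cmod x <= a -> b <= Cmod y -> Cmod (x / y)%C <= a / b.
Proof.
  intros Hb Hx Hy. assert (y <> 0%C) by (intros X; rewrite X, Cmod_0 in Hy; lra).
  unfold Cdiv. rewrite Cmod_mult, Cmod_inv by assumption.
  pose proof (Cmod_ge_0 x).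
  apply Rmult_le_compat; [assumption|left; apply Rinv_0_lt_compat; lra|assumption|].
  now apply Rinv_le_contravar.
Qed.

(** For [|rho| >= 1] the numerator is at most [4 B |rho|], while the denominator is at least
    [|rho| |sigma|]. *)
Lemma bval_bound (f h : R -> C) (B : R) (u : C) : strip u -> 0 <= Re u ->
  (forall m, upper m -> Cmod (L f m) <= B /\ Cmod (L h m) <= B) ->
  Cmod (bval f h (rh u) (sg u)) <= 4 * B / Cmod (sg u).
Proof.
  intros Hu Hr HB. destruct (strip_upper u Hu) as [u1 [u2 [u3 _]]].
  destruct (HB _ u1) as [b1 _]. destruct (HB _ u2) as [_ b2]. destruct (HB _ u3) as [_ b3].
  assert (B0 : 0 <= B) by (eapply Rle_trans; [apply Cmod_ge_0|exact b1]).
  assert (S0 : 0 < Cmod (sg u)) by (rewrite Cmod_sg; apply exp_pos).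
  assert (R1 : 1 <= Cmod (rh u)) by (rewrite Cmod_rh, <- exp_0; apply exp_le; lra).
  assert (A2 : Cmod (1 - alpha ^ 2) <= 2).
  { eapply Rle_trans; [apply Cmod_minus_triangle|]. rewrite Cmod_1, Cmod_pow, Cmod_alpha. lra. }
  replace (4 * B / Cmod (sg u)) with (4 * B * Cmod (rh u) / (Cmod (rh u) * Cmod (sg u))) by (field; lra).
  apply Cmod_div_le; [nra| |now apply Cmod_den].
  eapply Rle_trans; [apply Cmod_triangle|].
  eapply Rle_trans; [apply Rplus_le_compat_r, Cmod_minus_triangle|].
  rewrite !Cmod_mult.
  assert (Cmod (1 - alpha ^ 2) * Cmod (rh u) * Cmod (L f (sg u)) <= 2 * Cmod (rh u) * B).
  { apply Rmult_le_compat; try apply Cmod_ge_0; try assumption.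
    - apply Rmult_le_pos; apply Cmod_ge_0.
    - apply Rmult_le_compat_r; lra. }
  nra.
Qed.

Lemma uval_bound (f h : R -> C) (a B : R) (u : C) : strip u -> 0 <= Re u -> 0 <= a ->
  (forall m, upper m -> Cmod (L f m) <= B /\ Cmod (L h m) <= B /\
     Cmod (Lfin a (fun z => f (a - z)%R) m) <= B /\ Cmod (L (fun z => f (a + z)%R) m) <= B) ->
  Cmod (uval a f h (rh u) (sg u)) <= 6 * B / Cmod (sg u).
Proof.
  intros Hu Hr Ha HB. destruct (strip_upper u Hu) as [u1 [u2 [u3 _]]].
  destruct (HB _ u1) as [b1 [_ [b3 b4]]].
  assert (b0 : Cmod (bval f h (rh u) (sg u)) <= 4 * B / Cmod (sg u)).
  { apply bval_bound; try assumption. intros m Hm. destruct (HB m Hm) as [? [? _]]. now split. }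
  assert (B0 : 0 <= B) by (eapply Rle_trans; [apply Cmod_ge_0|exact b1]).
  assert (S0 : 0 < Cmod (sg u)) by (rewrite Cmod_sg; apply exp_pos).
  assert (E1 : Cmod (Cexp (Ci * sg u * a)) <= 1) by now apply Cmod_kernel_le.
  assert (S2 : Cmod (sg u) <= Cmod (2 * sg u)).
  { rewrite Cmod_mult, Cmod_R, Rabs_pos_eq by lra. lra. }
  unfold uval.
  eapply Rle_trans; [apply Cmod_triangle|].
  eapply Rle_trans; [apply Rplus_le_compat_r, Cmod_minus_triangle|].
  assert (K1 : Cmod (Cexp (Ci * sg u * a) * bval f h (rh u) (sg u)) <= 4 * B / Cmod (sg u)).
  { rewrite Cmod_mult. pose proof (Cmod_ge_0 (bval f h (rh u) (sg u))). nra. }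
  assert (K2 : Cmod (Cexp (Ci * sg u * a) * L f (sg u) / (2 * sg u))%C <= B / Cmod (2 * sg u)).
  { apply Cmod_div_le; [lra| |lra]. rewrite Cmod_mult. pose proof (Cmod_ge_0 (L f (sg u))). nra. }
  assert (K3 : Cmod ((Lfin a (fun z => f (a - z)%R) (sg u) + L (fun z => f (a + z)%R) (sg u)) / (2 * sg u))%C <= (2 * B) / Cmod (2 * sg u)).
  { apply Cmod_div_le; [lra| |lra]. eapply Rle_trans; [apply Cmod_triangle|]. lra. }
  assert (K4 : Cmod (2 * sg u) = 2 * Cmod (sg u)) by (rewrite Cmod_mult, Cmod_R, Rabs_pos_eq; lra).
  rewrite K4 in K2, K3.
  replace (6 * B / Cmod (sg u)) with (4 * B / Cmod (sg u) + B / (2 * Cmod (sg u)) + 2 * B / (2 * Cmod (sg u)) + B / (2 * Cmod (sg u)))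
    by (field; lra).
  assert (0 <= B / (2 * Cmod (sg u))) by (apply Rmult_le_pos; [assumption|left; apply Rinv_0_lt_compat; lra]).
  lra.
Qed.

(** Apart from the boundary value the terms are of order [|rho|^-2], and [|sigma| = |lam|^{1/2} <=
    |lam|^{2/3} = |rho|^2] for [|lam| >= 1]. *)
Lemma vval_bound (f h : R -> C) (a B : R) (u : C) : strip u -> 0 <= Re u -> 0 <= a ->
  (forall m, upper m -> Cmod (L f m) <= B /\ Cmod (L h m) <= B /\
     Cmod (Lfin a (fun z => h (a - z)%R) m) <= B /\ Cmod (L (fun z => h (a + z)%R) m) <= B) ->
  Cmod (vval a f h (rh u) (sg u)) <= 6 * B / Cmod (sg u).
Proof.
  intros Hu Hr Ha HB. destruct (strip_upper u Hu) as [u1 [u2 [u3 u4]]].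
  destruct (HB _ u2) as [_ [b2 [_ d2]]]. destruct (HB _ u3) as [_ [b3 [_ d3]]]. destruct (HB _ u4) as [_ [_ [d4 _]]].
  assert (b0 : Cmod (bval f h (rh u) (sg u)) <= 4 * B / Cmod (sg u)).
  { apply bval_bound; try assumption. intros m Hm. destruct (HB m Hm) as [? [? _]]. now split. }
  assert (B0 : 0 <= B) by (eapply Rle_trans; [apply Cmod_ge_0|exact b2]).
  assert (S0 : 0 < Cmod (sg u)) by (rewrite Cmod_sg; apply exp_pos).
  assert (R0 : 0 < Cmod (rh u)) by (rewrite Cmod_rh; apply exp_pos).
  assert (R1 : Cmod (sg u) <= Cmod (rh u) * Cmod (rh u)).
  { rewrite Cmod_rh, Cmod_sg, <- exp_plus. apply exp_le. lra. }
  assert (E1 : Cmod (Cexp (Ci * (alpha * rh u) * a)) <= 1) by now apply Cmod_kernel_le.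
  unfold vval. set (r := Cmod (rh u)) in *. set (E := Cexp (Ci * (alpha * rh u) * a)) in *.
  assert (K4 : Cmod (3 * rh u ^ 3) = 3 * r ^ 3).
  { rewrite Cmod_mult, Cmod_R, Rabs_pos_eq, Cmod_pow by lra. reflexivity. }
  assert (r3 : 0 < 3 * r ^ 3) by (apply Rmult_lt_0_compat; [lra|now apply pow_lt]).
  assert (m2 : Cmod (alpha ^ 2 * rh u) = r) by (rewrite Cmod_mult, Cmod_pow, Cmod_alpha; unfold r; ring).
  assert (m1 : Cmod (alpha * rh u) = r) by (rewrite Cmod_mult, Cmod_alpha; unfold r; ring).
  eapply Rle_trans; [apply Cmod_minus_triangle|].
  eapply Rle_trans; [apply Rplus_le_compat_r, Cmod_minus_triangle|].
  assert (K1 : Cmod (E * bval f h (rh u) (sg u)) <= 4 * B / Cmod (sg u)).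
  { rewrite Cmod_mult. pose proof (Cmod_ge_0 (bval f h (rh u) (sg u))). nra. }
  assert (M : forall x y, Cmod x = r -> Cmod y <= B -> Cmod (x * y) <= r * B).
  { intros x y Hx Hy. rewrite Cmod_mult, Hx. apply Rmult_le_compat_l; lra. }
  assert (K2 : Cmod (E * (rh u * L h (- rh u) + alpha ^ 2 * rh u * L h (- (alpha ^ 2 * rh u))) / (3 * rh u ^ 3))%C <= (2 * r * B) / (3 * r ^ 3)).
  { apply Cmod_div_le; [lra| |lra]. rewrite Cmod_mult.
    assert (Cmod (rh u * L h (- rh u) + alpha ^ 2 * rh u * L h (- (alpha ^ 2 * rh u))) <= 2 * r * B).
    { eapply Rle_trans; [apply Cmod_triangle|].
      pose proof (M (rh u) _ eq_refl b2). pose proof (M _ _ m2 b3). lra. }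
    pose proof (Cmod_ge_0 (rh u * L h (- rh u) + alpha ^ 2 * rh u * L h (- (alpha ^ 2 * rh u)))). nra. }
  assert (K3 : Cmod ((alpha * rh u * Lfin a (fun z => h (a - z)%R) (alpha * rh u) - rh u * L (fun z => h (a + z)%R) (- rh u)
     - alpha ^ 2 * rh u * L (fun z => h (a + z)%R) (- (alpha ^ 2 * rh u))) / (3 * rh u ^ 3))%C <= (3 * r * B) / (3 * r ^ 3)).
  { apply Cmod_div_le; [lra| |lra].
    eapply Rle_trans; [apply Cmod_minus_triangle|].
    eapply Rle_trans; [apply Rplus_le_compat_r, Cmod_minus_triangle|].
    pose proof (M _ _ m1 d4). pose proof (M (rh u) _ eq_refl d2). pose proof (M _ _ m2 d3). lra. }
  assert (K5 : 2 * r * B / (3 * r ^ 3) + 3 * r * B / (3 * r ^ 3) <= 2 * B / Cmod (sg u)).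
  { replace (2 * r * B / (3 * r ^ 3) + 3 * r * B / (3 * r ^ 3)) with (5 / 3 * B * / (r * r)) by (field; lra).
    apply Rle_trans with (2 * B * / (r * r)).
    - apply Rmult_le_compat_r; [left; apply Rinv_0_lt_compat; nra|lra].
    - unfold Rdiv. apply Rmult_le_compat_l; [lra|]. apply Rinv_le_contravar; lra. }
  replace (6 * B / Cmod (sg u)) with (4 * B / Cmod (sg u) + 2 * B / Cmod (sg u)) by (field; lra).
  lra.
Qed.

(** The exponentials combine to [e^{- i lam (T - t)}], which decays in the lower half plane.
    Jordan's lemma gains a factor [1/K], which cancels the length of the arc, and the bound on [X]
    leaves [K^{-1/2}]. *)
Lemma final_time_vanishes (X : R -> R -> C) (B T t : R) : 0 <= B -> t < T ->
  (forall K th : R, 1 <= K -> - PI <= th <= 0 -> Cmod (X K th) <= 6 * B / sqrt K) ->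
  (forall K : R, 1 <= K -> ex_CInt (fun th : R => Ci * (K * dir th) * (Cexp (Ci * (K * dir th) * t) * (Cexp (- (Ci * (K * dir th) * T)) * X K th)))%C (- PI) 0) ->
  Clim (fun K : R => CInt (fun th : R => Ci * (K * dir th) * (Cexp (Ci * (K * dir th) * t) * (Cexp (- (Ci * (K * dir th) * T)) * X K th)))%C (- PI) 0) 0%C.
Proof.
  intros HB Ht HX Ex. pose proof PI_RGT_0.
  apply (Clim_0_le _ (fun K => 48 * B / (T - t) * / sqrt K) 1).
  - intros K HK.
    assert (S0 : 0 < sqrt K) by (apply sqrt_lt_R0; lra).
    assert (SS : sqrt K * sqrt K = K) by (apply sqrt_sqrt; lra).
    replace (48 * B / (T - t) * / sqrt K) with (8 * (6 * B * sqrt K) / (1 * (K * (T - t)))).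
    2: { rewrite <- SS at 2. field. lra. }
    apply (jordan _ (- PI) 0 1 (K * (T - t)) (6 * B * sqrt K)).
    + lra.
    + apply Rmult_lt_0_compat; lra.
    + apply Rmult_le_pos; lra.
    + field.
    + intros th Hth.
      replace (Ci * (K * dir th) * (Cexp (Ci * (K * dir th) * t) * (Cexp (- (Ci * (K * dir th) * T)) * X K th)))%C
        with (Ci * (K * dir th) * (Cexp (Ci * (K * dir th) * t) * Cexp (- (Ci * (K * dir th) * T))) * X K th)%C by ring.
      rewrite <- Cexp_plus.
      rewrite !Cmod_mult, Cmod_Ci, Cmod_dir, Cmod_R, (Rabs_pos_eq K), Cmod_Cexp by lra.
      replace (Re (Ci * (K * dir th) * t + - (Ci * (K * dir th) * T))) with (- (K * (T - t) * sin (1 * (th - - PI)))).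
      * assert (K * Cmod (X K th) <= 6 * B * sqrt K).
        { replace (6 * B * sqrt K) with (K * (6 * B / sqrt K)).
          - apply Rmult_le_compat_l; [lra|]. apply HX; lra.
          - rewrite <- SS at 1. field. lra. }
        pose proof (exp_pos (- (K * (T - t) * sin (1 * (th - - PI))))). nra.
      * replace (Ci * (K * dir th) * t + - (Ci * (K * dir th) * T))%C with (Ci * (K * dir th) * (t - T)%R)%C
          by (rewrite RtoC_minus; ring).
        rewrite Re_Ci_mult, Im_polar. replace (1 * (th - - PI)) with (th + PI) by ring.
        rewrite neg_sin. ring.
    + apply Ex. lra.
  - intros e He.
    assert (Q : 0 <= 48 * B / (T - t)) by (apply Rmult_le_pos; [lra|left; apply Rinv_0_lt_compat; lra]).
    set (c := 48 * B / (T - t)) in *.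
    exists (Rsqr (c / e)). intros K HK.
    assert (Ce : 0 <= c / e) by (apply Rmult_le_pos; [assumption|left; now apply Rinv_0_lt_compat]).
    assert (HK2 : c / e < sqrt K) by (rewrite <- (sqrt_Rsqr (c / e)) by assumption; apply sqrt_lt_1_alt; split; [apply Rle_0_sqr|assumption]).
    apply Rmult_lt_reg_r with (sqrt K); [lra|]. rewrite Rmult_assoc, Rinv_l, Rmult_1_r by lra.
    replace c with (e * (c / e)) by (field; lra). apply Rmult_lt_compat_l; lra.
Qed.

(** * Regular initial data *)

(** What the contours need of the data: decay beyond any point for the deformations, and the
    expansion at large real frequencies for the convergence on the real line. *)
Definition nice (f : R -> C) : Prop :=
  (forall x, Ccont f x) /\
  (forall a, 0 <= a -> exists M, decays (fun _ => True) (fun y => f (a + y)) M) /\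
  exists B, 0 <= B /\ forall k : R, k <> 0 -> Cmod (L f k - Ci * f 0%R / k)%C <= B / k ^ 2.

Lemma Rplus_0_l_fun (f : R -> C) : (fun y => f (0 + y)) = f.
Proof. apply functional_extensionality. intros x. now rewrite Rplus_0_l. Qed.

Lemma schwartz_nice (W : R -> C) (s : R) : schwartz W -> s = 1 \/ s = -1 -> nice (fun y => W (s * y)).
Proof.
  intros [D [D0 [Dd Db]]] Hs.
  assert (As : Rabs s = 1) by (destruct Hs as [-> | ->]; [apply Rabs_R1|rewrite Rabs_left; lra]).
  set (F := fun n y => (s ^ n * D n (s * y)%R)%C).
  assert (HF : forall n x, CRderive (F n) x (F (S n) x)).
  { intros n x. unfold F.
    pose proof (is_derive_comp (K := R_AbsRing) (V := C_R_NormedModule) (D n) (fun z => s * z) x _ s (Dd n (s * x))) as Dc.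
    eapply CRderive_eq; [apply CRderive_cmult, Dc|].
    - auto_derive; [trivial|ring].
    - rewrite <- !RtoC_pow. simpl (s ^ S n). rewrite RtoC_mult.
      apply C_ext; unfold scal; simpl; unfold scal, Re, Im; simpl; unfold mult; simpl; ring. }
  assert (E0 : forall y, W (s * y) = F 0%nat y).
  { intros y. unfold F. rewrite D0. simpl. ring. }
  assert (Ef : (fun y => W (s * y)) = F 0%nat) by (apply functional_extensionality; exact E0).
  rewrite Ef.
  assert (HD : forall n c, exists M, decays (fun _ => True) (fun y => F n (c + y)) M).
  { intros n c. destruct (schwartz_decays D n s (s * c) As Dd Db) as [M HM]. exists M.
    intros y _ Hy. destruct (HM y I Hy) as [H1 H2]. unfold F.
    replace (s * (c + y)) with (s * c + s * y) by ring. split.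
    - apply (Ccont_mult (fun _ => (s ^ n)%C)); [apply Ccont_const|].
      apply (continuous_ext (fun y => D n (s * c + s * y))); [intros z; f_equal; ring|exact H1].
    - rewrite Cmod_mult, Cmod_pow, Cmod_R, As, pow1, Rmult_1_l. exact H2. }
  split; [|split].
  - intros x. eapply CRderive_Ccont, HF.
  - intros a _. apply HD.
  - destruct (HD 0%nat 0) as [M0 H0]. destruct (HD 1%nat 0) as [M1 H1]. destruct (HD 2%nat 0) as [M2 H2].
    rewrite Rplus_0_l_fun in H0, H1, H2.
    apply (L_expansion (F 0%nat) (F 1%nat) (F 2%nat) M0 M1 M2); auto.
Qed.

Lemma nice_decays (f : R -> C) (a : R) : nice f -> 0 <= a ->
  exists M, 0 <= M /\ decays (fun _ => True) (fun y => f (a + y)) M.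
Proof.
  intros [_ [H _]] Ha. destruct (H a Ha) as [M HM]. exists M. split; [|exact HM].
  now apply (decays_M_nonneg _ _ _ I HM).
Qed.

Lemma nice_dominated (f : R -> C) (a : R) : nice f -> 0 <= a -> exists g, dominated (fun y => f (a + y)) g.
Proof.
  intros H Ha. destruct (nice_decays f a H Ha) as [M [_ HM]]. eexists. apply (decays_dominated _ M HM).
Qed.

Lemma nice_dominated_0 (f : R -> C) : nice f -> exists g, dominated f g.
Proof.
  intros H. destruct (nice_dominated f 0 H (Rle_refl 0)) as [g Hg]. rewrite Rplus_0_l_fun in Hg. now exists g.
Qed.

Lemma nice_L_Hol (f : R -> C) (a : R) : nice f -> 0 <= a ->
  Hol (fun z => 0 < Im z) (fun _ => True) (fun z => L (fun y => f (a + y)%R) (clampIm z)).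
Proof.
  intros H Ha. destruct (nice_decays f a H Ha) as [M [HM D]].
  apply (transform_Hol _ _ M HM (L_transform _ M D)).
Qed.

Lemma nice_L_Hol_0 (f : R -> C) : nice f -> Hol (fun z => 0 < Im z) (fun _ => True) (fun z => L f (clampIm z)).
Proof.
  intros H. pose proof (nice_L_Hol f 0 H (Rle_refl 0)) as Q. rewrite Rplus_0_l_fun in Q. exact Q.
Qed.

Lemma nice_Lfin_Hol (f : R -> C) (a : R) : nice f -> 0 <= a ->
  Hol (fun z => 0 < Im z) (fun _ => True) (fun z => Lfin a (fun y => f (a - y)%R) (clampIm z)).
Proof.
  intros [H _] Ha. apply (Lfin_Hol (fun y => f (a - y)) a Ha). intros y _. apply reflected_cont, H.
Qed.

(** * Arcs in the logarithmic coordinate *)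

Definition lg (K th : R) : C := (ln K + Ci * th)%C.

Lemma Cexp_lg (K th : R) : 0 < K -> Cexp (lg K th) = (K * dir th)%C.
Proof. intros H. unfold lg. now rewrite Cexp_plus, Cexp_ln. Qed.

Lemma strip_lg (K th : R) : - PI <= th <= 0 -> strip (lg K th).
Proof. intros H. unfold strip, lg. simpl. lra. Qed.

Lemma Re_lg (K th : R) : Re (lg K th) = ln K.
Proof. unfold lg. simpl. ring. Qed.

Lemma Im_lg (K th : R) : Im (lg K th) = th.
Proof. unfold lg. simpl. ring. Qed.

(* The integral of [e^{i lam t} P] over the lower half of [|lam| = K], where [P] is a function of [u = ln lam]. *)
Definition ArcL (t : R) (P : C -> C) (K : R) : C :=
  CInt (fun th : R => Ci * Cexp (lg K th) * (Cexp (Ci * Cexp (lg K th) * t) * P (lg K th)))%C (- PI) 0.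

Lemma lg_cont (F : C -> C) (K th : R) : (forall u, strip u -> holcont F u) -> - PI <= th <= 0 ->
  Ccont (fun th : R => F (lg K th)) th.
Proof.
  intros HF Hth. apply (Ccont_comp (fun th : R => lg K th) F); [unfold lg; ccont|].
  apply HF, strip_lg, Hth.
Qed.

Lemma ArcL_ex (t : R) (P : C -> C) (K : R) : (forall u, strip u -> holcont P u) ->
  ex_CInt (fun th : R => Ci * Cexp (lg K th) * (Cexp (Ci * Cexp (lg K th) * t) * P (lg K th)))%C (- PI) 0.
Proof.
  intros HP. pose proof PI_RGT_0. apply ex_CInt_le; [lra|]. intros th Hth.
  pose proof (lg_cont P K th HP Hth). assert (Ccont (fun th : R => lg K th) th) by (unfold lg; ccont). ccont.
Qed.

Lemma ArcL_plus (t : R) (P Q : C -> C) (K : R) :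
  (forall u, strip u -> holcont P u) -> (forall u, strip u -> holcont Q u) ->
  ArcL t (fun u => P u + Q u)%C K = (ArcL t P K + ArcL t Q K)%C.
Proof.
  intros HP HQ. unfold ArcL. rewrite <- CInt_plus by now apply ArcL_ex.
  apply CInt_ext. intros; ring.
Qed.

Lemma ArcL_minus (t : R) (P Q : C -> C) (K : R) :
  (forall u, strip u -> holcont P u) -> (forall u, strip u -> holcont Q u) ->
  ArcL t (fun u => P u - Q u)%C K = (ArcL t P K - ArcL t Q K)%C.
Proof.
  intros HP HQ. unfold ArcL. rewrite <- CInt_minus by now apply ArcL_ex.
  apply CInt_ext. intros; ring.
Qed.

(** By the assumed relation, the arc integral of [X0] is that of the time transform, which inverts,
    plus that of the final time term, which vanishes. *)
Lemma ArcL_inversion (h h' : R -> C) (X0 XT : C -> C) (T t B : R) : 0 < t < T -> 0 <= B ->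
  (forall s, Ccont h s) -> (forall s, Ccont h' s) -> (forall s, 0 < s < T -> CRderive h s (h' s)) ->
  (forall u, strip u -> holcont X0 u) ->
  (forall u, strip u -> Lfin T h (- Cexp u) = (X0 u - Cexp (- (Ci * Cexp u * T)) * XT u)%C) ->
  (forall u, strip u -> 0 <= Re u -> Cmod (XT u) <= 6 * B / Cmod (sg u)) ->
  Clim (fun K => ArcL t X0 K) (2 * PI * h t)%C.
Proof.
  intros Ht HB Hh Hh' Hd HX HE Hb. pose proof PI_RGT_0 as Hpi.
  pose proof (time_inversion h h' T t Ht (fun s _ => Hh s) (fun s _ => Hh' s) Hd) as Inv.
  assert (ExL : forall K : R, 0 < K -> ex_CInt (fun th : R => Ci * (K * dir th) *
     (Cexp (Ci * (K * dir th) * t) * Lfin T h (- (K * dir th))))%C (- PI) 0).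
  { intros K HK.
    destruct (ex_CInt_le (fun th : R => Ci * (K * dir th) * (Cexp (Ci * (K * dir th) * t) * Lfin T h (clampIm (- (K * dir th)))))%C (- PI) 0) as [z Hz]; [lra| |].
    - intros th Hth.
      assert (Ccont (fun th : R => Lfin T h (clampIm (- (K * dir th)))) th).
      { apply (Ccont_comp (fun th : R => - (K * dir th))%C (fun z => Lfin T h (clampIm z))); [ccont|].
        apply (Hol_cont _ _ _ _ (Lfin_Hol h T ltac:(lra) (fun y _ => Hh y)) I). }
      ccont.
    - exists z. eapply is_CInt_ext; [|exact Hz]. rewrite Rmin_left, Rmax_right by lra. intros th Hth.
      rewrite clampIm_id; [reflexivity|]. replace (- (K * dir th))%C with (K * dir (th + PI))%C.
      + apply upper_polar; lra.
      + rewrite dir_plus, dir_PI. ring. }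
  assert (Pt : forall K th : R, 0 < K -> - PI <= th <= 0 ->
    (Ci * (K * dir th) * (Cexp (Ci * (K * dir th) * t) * (Cexp (- (Ci * (K * dir th) * T)) * XT (lg K th))))%C =
    (Ci * Cexp (lg K th) * (Cexp (Ci * Cexp (lg K th) * t) * X0 (lg K th))
     - Ci * (K * dir th) * (Cexp (Ci * (K * dir th) * t) * Lfin T h (- (K * dir th))))%C).
  { intros K th HK Hth. pose proof (HE (lg K th) (strip_lg K th Hth)) as E.
    rewrite Cexp_lg in * by assumption. rewrite E. ring. }
  (* No continuity of [XT] is assumed; integrability is inherited from the other two terms of the
     relation. *)
  assert (ExT : forall K : R, 1 <= K -> ex_CInt (fun th : R => Ci * (K * dir th) *
     (Cexp (Ci * (K * dir th) * t) * (Cexp (- (Ci * (K * dir th) * T)) * XT (lg K th))))%C (- PI) 0).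
  { intros K HK. destruct (ArcL_ex t X0 K HX) as [z1 Hz1]. destruct (ExL K ltac:(lra)) as [z2 Hz2].
    exists (z1 - z2)%C. eapply is_CInt_ext; [|exact (is_CInt_minus _ _ _ _ _ _ Hz1 Hz2)].
    rewrite Rmin_left, Rmax_right by lra. intros th Hth. symmetry. apply Pt; lra. }
  assert (Van : Clim (fun K : R => CInt (fun th : R => Ci * (K * dir th) *
     (Cexp (Ci * (K * dir th) * t) * (Cexp (- (Ci * (K * dir th) * T)) * XT (lg K th))))%C (- PI) 0) 0%C).
  { apply (final_time_vanishes (fun K th => XT (lg K th)) B T t HB ltac:(lra)); [|exact ExT].
    intros K th HK Hth.
    replace (sqrt K) with (Cmod (sg (lg K th))).
    - apply Hb; [now apply strip_lg|]. rewrite Re_lg, <- ln_1. apply ln_le; lra.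
    - rewrite Cmod_sg, Re_lg. apply Rsqr_inj.
      + left; apply exp_pos.
      + apply sqrt_pos.
      + unfold Rsqr. rewrite <- exp_plus, sqrt_sqrt by lra.
        replace (ln K / 2 + ln K / 2) with (ln K) by field. apply exp_ln. lra. }
  apply Clim_eq with (0 + 2 * PI * h t)%C; [|ring].
  refine (Clim_ext_loc _ _ _ 1 _ (Clim_plus _ _ _ _ Van Inv)).
  intros K HK. cbv beta. rewrite <- (CInt_plus _ _ _ _ (ExT K ltac:(lra)) (ExL K ltac:(lra))).
  apply CInt_ext. rewrite Rmin_left, Rmax_right by lra. intros th Hth.
  rewrite Pt by lra. ring.
Qed.

(* The substitution turning an arc for [lam = k^n] (up to rotation) into an arc for [k]. *)
Lemma arc_rescale (g : R -> C) (n b : R) : 0 < n ->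
  ex_CInt g (b - PI / n) b ->
  CInt (fun th => (/ n)%R * g (b + th / n)%R)%C (- PI) 0 = CInt g (b - PI / n) b.
Proof.
  intros Hn Ex. apply is_CInt_unique.
  pose proof (is_CInt_lin g (/ n) b (- PI) 0 (CInt g (b - PI / n) b)) as Li.
  replace (/ n * - PI + b) with (b - PI / n) in Li by (field; lra).
  replace (/ n * 0 + b) with b in Li by ring.
  specialize (Li (CInt_correct _ _ _ Ex)).
  eapply is_CInt_ext; [|exact Li]. intros th _. cbv beta. do 2 f_equal. unfold Rdiv. ring.
Qed.

Lemma arc_ex (F : C -> C) (K c d : R) : c <= d ->
  (forall th, c <= th <= d -> holcont F (K * dir th)%C) ->
  ex_CInt (fun th : R => Ci * (K * dir th) * F (K * dir th))%C c d.
Proof.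
  intros Hcd HF. apply ex_CInt_le; [assumption|]. intros th Hth.
  assert (Ccont (fun th : R => F (K * dir th)%C) th).
  { apply (Ccont_comp (fun th : R => K * dir th)%C F); [ccont|now apply HF]. }
  ccont.
Qed.

Lemma arc_Chasles (F : C -> C) (K c d e : R) : c <= d <= e ->
  (forall th, c <= th <= e -> holcont F (K * dir th)%C) ->
  arc F K c e = (arc F K c d + arc F K d e)%C.
Proof.
  intros H HF. unfold arc. symmetry. apply CInt_Chasles; apply arc_ex; try lra; intros; apply HF; lra.
Qed.

(* Jordan's lemma for a factor [e^{i q k^n t}] decaying in a sector of opening [pi / n]. *)
Lemma arc_vanishes (F : C -> C) (c d t B : R) (n : nat) : (2 <= n)%nat -> 0 < t -> 0 <= B -> d = c + PI / INR n ->
  (forall K th, 0 < K -> c <= th <= d -> holcont F (K * dir th)%C /\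
     Cmod (F (K * dir th)%C) <= B * exp (- (K ^ n * t * sin (INR n * (th - c))))) ->
  Clim (fun K => arc F K c d) 0%C.
Proof.
  intros Hn Ht HB Hd HF. pose proof PI_RGT_0.
  assert (Hn0 : 2 <= INR n) by (replace 2 with (INR 2) by reflexivity; now apply le_INR).
  assert (Hp : 0 < PI / INR n) by (apply Rdiv_lt_0_compat; lra).
  apply (Clim_0_le _ (fun K => 8 * B / t * / K) 1).
  - intros K HK. assert (Kn : K * K <= K ^ n).
    { replace (K * K) with (K ^ 2) by ring. apply Rle_pow; [lra|assumption]. }
    eapply Rle_trans.
    + apply (jordan (fun th : R => Ci * (K * dir th) * F (K * dir th))%C c d (INR n) (K ^ n * t) (K * B)).
      * lra.
      * apply Rmult_lt_0_compat; nra.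
      * apply Rmult_le_pos; lra.
      * exact Hd.
      * intros th Hth. destruct (HF K th ltac:(lra) Hth) as [_ b].
        rewrite !Cmod_mult, Cmod_Ci, Cmod_dir, Cmod_R, (Rabs_pos_eq K) by lra.
        rewrite Rmult_1_l, Rmult_1_r, (Rmult_assoc K B). apply Rmult_le_compat_l; lra.
      * apply arc_ex; [lra|]. intros th Hth. destruct (HF K th ltac:(lra) Hth) as [q _]. exact q.
    + replace (8 * B / t * / K) with (8 * (K * B) / (1 * (K * K * t))) by (field; lra).
      assert (K2 : 0 < K * K) by nra. assert (K3 : 0 < K * K * t) by now apply Rmult_lt_0_compat.
      assert (K4 : K * K * t <= K ^ n * t) by (apply Rmult_le_compat_r; lra).
      unfold Rdiv. apply Rmult_le_compat_l; [nra|]. apply Rinv_le_contravar; [lra|].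
      apply Rmult_le_compat; lra.
  - intros e He. assert (Q : 0 <= 8 * B / t) by (apply Rmult_le_pos; [lra|left; now apply Rinv_0_lt_compat]).
    set (q := 8 * B / t) in *.
    assert (0 <= q / e) by (apply Rmult_le_pos; [assumption|left; now apply Rinv_0_lt_compat]).
    exists (q / e). intros K HK. apply Rmult_lt_reg_r with K; [lra|].
    rewrite Rmult_assoc, Rinv_l, Rmult_1_r by lra.
    replace q with (e * (q / e)) by (field; lra). apply Rmult_lt_compat_l; lra.
Qed.

(** [bval] along the strip with clamped transforms, since [Hol] asks for continuity in a full
    neighbourhood of each boundary point. *)
Definition bvalc (f h : R -> C) (u : C) : C :=
  (((1 - alpha ^ 2) * rh u * L f (clampIm (sg u)) - L h (clampIm (- rh u)) + L h (clampIm (- (alpha ^ 2 * rh u))))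
   * / den (rh u) (sg u))%C.

Lemma bvalc_eq (f h : R -> C) (u : C) : strip u -> bvalc f h u = bval f h (rh u) (sg u).
Proof.
  intros Hu. destruct (strip_upper u Hu) as [u1 [u2 [u3 _]]].
  unfold bvalc, bval, Cdiv. now rewrite !clampIm_id.
Qed.

Lemma sg_Hol : Hol ostrip strip sg.
Proof.
  apply (Hol_ext _ _ (fun u => Ci * Cexp (/ 2 * u))%C); [|holo].
  intros u. unfold sg. do 2 f_equal. unfold Cdiv. ring.
Qed.

Lemma rh_Hol : Hol ostrip strip rh.
Proof.
  apply (Hol_ext _ _ (fun u => Cexp (/ 3 * u))%C); [|holo].
  intros u. unfold rh. f_equal. unfold Cdiv. ring.
Qed.

Lemma den_neq_0 (u : C) : strip u -> den (rh u) (sg u) <> 0%C.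
Proof.
  intros H. unfold den. repeat apply Cmult_neq_0; [apply alpha_neq_1|apply rh_neq_0|now apply sum_neq_0].
Qed.

Lemma ostrip_strip (u : C) : ostrip u -> strip u.
Proof. unfold ostrip, strip. lra. Qed.

Lemma Hol_upper (F g : C -> C) : Hol (fun z => 0 < Im z) (fun _ => True) F -> Hol ostrip strip g ->
  (forall u, ostrip u -> 0 < Im (g u)) -> Hol ostrip strip (fun u => F (g u)).
Proof. intros HF Hg H. apply (Hol_comp _ _ _ _ F g HF Hg); auto. Qed.

Lemma bvalc_Hol (f h : R -> C) : nice f -> nice h -> Hol ostrip strip (bvalc f h).
Proof.
  intros Hf Hh. pose proof sg_Hol as S. pose proof rh_Hol as R.
  assert (D : Hol ostrip strip (fun u => den (rh u) (sg u))) by (unfold den; holo).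
  assert (H1 : Hol ostrip strip (fun u => L f (clampIm (sg u)))).
  { apply (Hol_upper (fun z => L f (clampIm z))); [now apply nice_L_Hol_0|assumption|].
    intros u Hu. apply (ostrip_upper u Hu). }
  assert (H2 : Hol ostrip strip (fun u => L h (clampIm (- rh u)))).
  { apply (Hol_upper (fun z => L h (clampIm z)) (fun u => - rh u)%C); [now apply nice_L_Hol_0|holo|].
    intros u Hu. apply (ostrip_upper u Hu). }
  assert (H3 : Hol ostrip strip (fun u => L h (clampIm (- (alpha ^ 2 * rh u))))).
  { apply (Hol_upper (fun z => L h (clampIm z)) (fun u => - (alpha ^ 2 * rh u))%C); [now apply nice_L_Hol_0|holo|].
    intros u Hu. apply (ostrip_upper u Hu). }
  assert (H4 : Hol ostrip strip (fun u => / den (rh u) (sg u))%C).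
  { apply Hol_inv; [|intros; now apply den_neq_0|assumption].
    intros u Hu. now apply den_neq_0, ostrip_strip. }
  unfold bvalc. holo.
Qed.

(** * Convergence of the contour integrals and deformation of the real line *)

Lemma contour_limit (F : C -> C) (G : contour) (I : R -> C) (l : C) (X : R) :
  (forall K, X < K -> is_path_int F (G K) (I K)) -> Clim I l -> is_contour_int F G l.
Proof.
  intros H Hl. unfold is_contour_int. apply (filterlimi_lim_ext_loc I).
  - now exists X.
  - exact Hl.
Qed.

Lemma hat_neg_is_RInt_gen (f : R -> C) (k l : C) :
  is_RInt_gen (V := C_R_NormedModule) (fun x : R => Cexp (- (Ci * k * x)) * f x)%C
    (Rbar_locally m_infty) (at_point 0) l -> hat_neg f k = l.
Proof. apply (is_RInt_gen_unique (V := C_R_CompleteNormedModule)). Qed.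

Lemma hat_neg_L (w0 W : R -> C) (k : C) : nice (fun y => W (- y)) -> (forall x, x < 0 -> w0 x = W x) ->
  upper k -> hat_neg w0 k = L (fun y => W (- y)) k.
Proof.
  intros HW E Hk. destruct (nice_dominated_0 _ HW) as [g D].
  pose proof (L_lim _ _ k D Hk) as Lm. pose proof (dominated_kernel _ _ k D Hk) as Dk.
  apply hat_neg_is_RInt_gen.
  assert (Ef : forall y : R, (Cexp (- (Ci * k * (- y)%R)) * W (- y)%R)%C = (Cexp (Ci * k * y) * W (- y)%R)%C).
  { intros y. rewrite RtoC_opp. apply (f_equal (fun z => Cexp z * W (- y)%R)%C). ring. }
  assert (Q : is_RInt_gen (V := C_R_NormedModule) (fun x : R => Cexp (- (Ci * k * x)) * W x)%C
    (Rbar_locally m_infty) (at_point 0) (L (fun y => W (- y)) k)).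
  { apply is_RInt_gen_lim_neg.
    - intros b Hb. destruct (dominated_ex _ _ Dk 0 b (Rle_refl 0) Hb) as [z Hz]. exists z.
      refine (is_CInt_ext _ _ _ _ _ _ Hz). intros y _. symmetry. exact (Ef y).
    - refine (Clim_ext_loc (fun b => Lfin b (fun y => W (- y)%R) k) _ _ 0 _ Lm).
      intros b Hb. refine (CInt_ext _ _ _ _ _). intros y _. symmetry. exact (Ef y). }
  refine (is_RInt_gen_ext (V := C_R_NormedModule) _ _ _ _ Q).
  exists (fun x => x < 0) (fun x => x = 0); [now exists 0|reflexivity|].
  intros x y Hx -> z Hz. simpl in Hz. rewrite Rmin_left, Rmax_right in Hz by lra. now rewrite E.
Qed.

Lemma hat_pos_L (v0 h : R -> C) (k : C) : nice h -> (forall x, 0 < x -> v0 x = h x) ->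
  upper (- k) -> hat_pos v0 k = L h (- k).
Proof.
  intros Hh E Hk. destruct (nice_dominated_0 _ Hh) as [g D].
  rewrite (L_ext h v0 (- k)%C (fun y Hy => eq_sym (E y Hy)) (ex_intro _ g D) Hk).
  unfold hat_pos, L. f_equal. apply functional_extensionality.
  intros y. do 2 f_equal. ring.
Qed.

Lemma dominated_bounds (f : R -> C) (g : R -> R) (a : R) : dominated f g -> 0 <= a ->
  exists B, 0 <= B /\ forall m, upper m -> Cmod (L f m) <= B /\
    Cmod (Lfin a (fun z => f (a - z)%R) m) <= B /\ Cmod (L (fun z => f (a + z)%R) m) <= B.
Proof.
  intros D Ha.
  assert (D1 : dominated (fun z => f (a + z)) (fun z => g (a + z))).
  { destruct D as [Hc [Hb Hg]].
    destruct (dominated2_shift 0 a (fun x _ => f x) g Ha) as [Q1 Q2]; [split; auto|].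
    split; [|split; [|assumption]].
    - intros y Hy. apply shifted_cont, Hc. lra.
    - intros y Hy. apply Hb. lra. }
  destruct (L_bound _ _ D) as [B0 [P0 [Q0 _]]]. destruct (L_bound _ _ D1) as [B1 [P1 [Q1 _]]].
  assert (Hc : forall y, 0 <= y <= a -> Ccont (fun z => f (a - z)) y)
    by (intros y Hy; apply reflected_cont, D; lra).
  destruct (Cmod_bounded (fun z => f (a - z)) a Ha Hc) as [M [HM Hb]].
  exists (B0 + B1 + M * a). assert (0 <= M * a) by now apply Rmult_le_pos. split; [lra|].
  intros m Hm. specialize (Q0 m Hm). specialize (Q1 m Hm).
  destruct (Lfin_sin_bound (fun z => f (a - z)) a M m Ha HM) as [Q _]; [|assumption|repeat split; lra].
  intros y Hy. split; [now apply Hc|now apply Hb].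
Qed.

Lemma Im_Cexp_strip (u : C) : strip u -> Im (Cexp u) <= 0.
Proof.
  intros [H1 H2]. simpl. pose proof (exp_pos (Re u)).
  assert (0 <= sin (- Im u)) by (apply sin_ge_0; lra). rewrite sin_neg in *. nra.
Qed.

Lemma ray_converges (F : C -> C) (th c B : R) : 0 < c -> 0 <= B ->
  (forall s : R, 0 <= s -> Ccont (fun s : R => F (s * dir th)%C) s) ->
  (forall s : R, 0 <= s -> Cmod (F (s * dir th)%C) <= B * exp (- (c * s))) ->
  exists l, Clim (fun K => ray F K th) l.
Proof.
  intros Hc HB HF Hb. apply (Clim_CInt_tail (fun s : R => F (s * dir th) * dir th)%C (B * (4 / c ^ 2))).
  - intros s Hs. specialize (HF s Hs). ccont.
  - intros s Hs. rewrite Cmod_mult, Cmod_dir, Rmult_1_r.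
    (* The inequality [exp y >= 1 + y] at [y = c s / 2], squared. *)
    assert (E : exp (- (c * s)) * s ^ 2 <= 4 / c ^ 2).
    { assert (E1 : 1 + c * s / 2 <= exp (c * s / 2)) by (apply exp_ineq1_le).
      assert (E2 : exp (c * s / 2) * exp (c * s / 2) * exp (- (c * s)) = 1).
      { rewrite <- !exp_plus. rewrite <- exp_0. f_equal. field. }
      assert (E3 : 0 < c * s) by (apply Rmult_lt_0_compat; lra).
      assert (E4 : (c * s) ^ 2 <= 4 * (exp (c * s / 2) * exp (c * s / 2))) by nra.
      pose proof (exp_pos (- (c * s))) as E5.
      apply Rmult_le_reg_r with (c ^ 2); [nra|].
      replace (4 / c ^ 2 * c ^ 2) with 4 by (field; lra).
      replace (exp (- (c * s)) * s ^ 2 * c ^ 2) with (exp (- (c * s)) * (c * s) ^ 2) by ring.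
      apply Rle_trans with (exp (- (c * s)) * (4 * (exp (c * s / 2) * exp (c * s / 2)))); [apply Rmult_le_compat_l; lra|].
      replace (exp (- (c * s)) * (4 * (exp (c * s / 2) * exp (c * s / 2))))
        with (4 * (exp (c * s / 2) * exp (c * s / 2) * exp (- (c * s)))) by ring.
      rewrite E2. lra. }
    apply Rle_trans with (B * exp (- (c * s)) * s ^ 2).
    + apply Rmult_le_compat_r; [nra|]. apply Hb. lra.
    + rewrite Rmult_assoc. now apply Rmult_le_compat_l.
Qed.

(** The tails of order [1/s] converge by oscillation only, separately on each half line. The
    constant [b'] equals [b] for the even phase [k^2] and [- b] for the odd phase [k^3]. *)
Lemma real_line_converges (f : R -> C) (F : C -> C) (a b : R) (b' : R) (p : nat) : nice f -> (1 <= p)%nat -> b <> 0 -> b' <> 0 ->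
  (forall s : R, F (RtoC s) = (Cexp (Ci * (a * s + b * s ^ S p)%R) * L f (RtoC (- s)))%C) ->
  (forall s : R, F (RtoC (- s)) = (Cexp (Ci * (- a * s + b' * s ^ S p)%R) * L f (RtoC s))%C) ->
  exists l, Clim (fun K => ray F K 0 - ray F K PI)%C l.
Proof.
  intros Hf Hp Hb Hb' E1 E2.
  assert (Cn : forall (c s : R), Ccont (fun s : R => L f (RtoC (c * s))) s).
  { intros c s. apply (continuous_ext (fun s : R => L f (clampIm (RtoC (c * s))))).
    - intros y. now rewrite clampIm_id by (unfold upper; simpl; lra).
    - apply (Ccont_comp (fun s : R => RtoC (c * s)) (fun z => L f (clampIm z))); [ccont|].
      apply (Hol_cont _ _ _ _ (nice_L_Hol_0 f Hf) I). }
  destruct Hf as [_ [_ [B [HB Ex]]]].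
  destruct (oscillatory_converges (fun s => L f (RtoC (- s))) (- (Ci * f 0%R))%C a b B p Hp Hb) as [l1 H1].
  - intros s _. apply (continuous_ext (fun s : R => L f (RtoC (-1 * s)))); [|apply Cn].
    intros y. do 2 f_equal. ring.
  - intros s Hs. specialize (Ex (- s) ltac:(lra)).
    replace ((- s) ^ 2) with (s ^ 2) in Ex by ring.
    replace (- (Ci * f 0%R) / s)%C with (Ci * f 0%R / RtoC (- s))%C; [exact Ex|].
    rewrite RtoC_opp. field. intros X; apply (f_equal Re) in X; simpl in X; lra.
  - destruct (oscillatory_converges (fun s => L f (RtoC s)) (Ci * f 0%R)%C (- a) b' B p Hp Hb') as [l2 H2].
    + intros s _. apply (continuous_ext (fun s : R => L f (RtoC (1 * s)))); [|apply Cn].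
      intros y. now rewrite Rmult_1_l.
    + intros s Hs. apply Ex. lra.
    + exists (l1 + l2)%C. refine (Clim_ext_loc _ _ _ 0 _ (Clim_plus _ _ _ _ H1 H2)).
      intros K HK. cbv beta.
      assert (A1 : ray F K 0 = CInt (fun s : R => Cexp (Ci * (a * s + b * s ^ S p)%R) * L f (RtoC (- s)))%C 0 K).
      { apply CInt_ext. intros s _. now rewrite dir_0, !Cmult_1_r, E1. }
      assert (A2 : ray F K PI = (- CInt (fun s : R => Cexp (Ci * (- a * s + b' * s ^ S p)%R) * L f (RtoC s)) 0 K)%C).
      { transitivity ((-1) * CInt (fun s : R => Cexp (Ci * (- a * s + b' * s ^ S p)%R) * L f (RtoC s)) 0 K)%C; [|ring].
        rewrite <- CInt_cmult.
        - apply CInt_ext. intros s _. rewrite dir_PI.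
          replace (s * -1)%C with (RtoC (- s)) by (rewrite RtoC_opp; ring). rewrite E2. ring.
        - apply ex_CInt_le; [lra|]. intros s _.
          assert (Ccont (fun s : R => L f (RtoC s)) s).
          { apply (continuous_ext (fun s : R => L f (RtoC (1 * s)))); [|apply Cn]. intros y. now rewrite Rmult_1_l. }
          assert (continuous (fun s => - a * s + b' * s ^ S p) s).
          { apply (ex_derive_continuous (V := R_NormedModule)). auto_derive. trivial. }
          ccont. }
      rewrite A1, A2. ring.
Qed.

(* The substitution [lam = e^u], [k = z u], where [k^n] is a multiple of [lam]. *)
Lemma ArcL_power (F P z : C -> C) (t K n b : R) (eps : C) : 0 < n ->
  (forall k, holcont F k) ->
  (forall u, strip u -> z u = (exp (Re u / n) * dir (b + Im u / n))%C) ->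
  (forall u, strip u -> (n * Cexp u * (Cexp (Ci * Cexp u * t) * P u))%C = (eps * (z u * F (z u)))%C) ->
  ArcL t P K = (eps * arc F (exp (ln K / n)) (b - PI / n) b)%C.
Proof.
  intros Hn HF Hz HP. pose proof PI_RGT_0 as Hpi. set (kap := exp (ln K / n)).
  assert (Hpn : 0 < PI / n) by (apply Rdiv_lt_0_compat; lra).
  set (g := fun ph : R => (Ci * (kap * dir ph) * F (kap * dir ph))%C).
  assert (Ex : ex_CInt g (b - PI / n) b) by (apply arc_ex; [lra|intros; apply HF]).
  unfold arc. fold g. rewrite <- (arc_rescale g n b Hn Ex).
  rewrite <- CInt_cmult.
  - apply CInt_ext. rewrite Rmin_left, Rmax_right by lra. intros th Hth.
    pose proof (strip_lg K th ltac:(lra)) as Hs. pose proof (HP _ Hs) as E. pose proof (Hz _ Hs) as Ez.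
    rewrite Re_lg, Im_lg in Ez. fold kap in Ez. unfold g. rewrite <- Ez.
    assert (Hn0 : RtoC n <> 0%C) by (intros X; apply (f_equal Re) in X; simpl in X; lra).
    transitivity (Ci / n * (n * Cexp (lg K th) * (Cexp (Ci * Cexp (lg K th) * t) * P (lg K th))))%C; [now field|].
    rewrite E, RtoC_inv by lra. now field.
  - apply ex_CInt_le; [lra|]. intros th Hth.
    apply Ccont_mult; [apply Ccont_const|].
    apply (continuous_comp (fun th => b + th / n) g).
    + unfold Rdiv. apply Rcont_plus; [apply continuous_const|]. apply Rcont_mult; [apply continuous_id|apply continuous_const].
    + unfold g. assert (Ccont (fun ph : R => F (kap * dir ph)%C) (b + th / n)).
      { apply (Ccont_comp (fun ph : R => kap * dir ph)%C F); [ccont|apply HF]. }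
      ccont.
Qed.

Notation UHol := (Hol (fun z => 0 < Im z) (fun _ => True)).

Lemma upper_arc (F : C -> C) (K c d : R) : 0 <= K -> 0 <= c <= d -> d <= PI -> UHol F ->
  arc F K c d = (ray F K d - ray F K c)%C.
Proof.
  intros HK Hcd Hd HF. apply (cauchy_sector (fun z => 0 < Im z) (fun _ => True)); auto; [lra|].
  intros s th Hs Hth. apply Im_polar_pos; lra.
Qed.

Lemma ray_ex (F : C -> C) (K th : R) : 0 <= K -> (forall z, holcont F z) ->
  ex_CInt (fun s : R => F (s * dir th) * dir th)%C 0 K.
Proof.
  intros HK HF. apply ex_CInt_le; [assumption|]. intros s _.
  assert (Ccont (fun s : R => F (s * dir th)%C) s).
  { apply (Ccont_comp (fun s : R => s * dir th)%C F); [ccont|apply HF]. }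
  ccont.
Qed.

Lemma ray_ext (F G : C -> C) (K th : R) : 0 <= K -> (forall s, 0 <= s -> F (s * dir th)%C = G (s * dir th)%C) ->
  ray F K th = ray G K th.
Proof.
  intros HK E. apply CInt_ext. rewrite Rmin_left, Rmax_right by lra. intros s Hs. rewrite E by lra. reflexivity.
Qed.

Lemma sector_path (F G : C -> C) (K c d : R) : 0 <= K ->
  (forall s th, th = c \/ th = d -> 0 <= s -> F (s * dir th)%C = G (s * dir th)%C) ->
  (forall z, holcont G z) ->
  is_path_int F (sector_boundary c d K) (ray G K c - ray G K d)%C.
Proof.
  intros HK E HG.
  assert (X : forall th, th = c \/ th = d -> ex_CInt (fun s : R => F (s * dir th) * dir th)%C 0 K).
  { intros th Hth. destruct (ray_ex G K th HK HG) as [z Hz]. exists z. refine (is_CInt_ext _ _ _ _ _ _ Hz).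
    rewrite Rmin_left, Rmax_right by lra. intros s Hs. rewrite E by (assumption || lra). reflexivity. }
  rewrite <- (ray_ext F G K c HK) by auto. rewrite <- (ray_ext F G K d HK) by auto.
  apply sector_boundary_int; auto.
Qed.

Lemma UHol_cont (F : C -> C) : UHol F -> forall z, holcont F z.
Proof. intros H z. exact (Hol_cont _ _ F z H I). Qed.

(* The part of [hat f] coming from distances larger than [a] is reflected, [k -> -k], before the real line
   is deformed into the upper half plane. *)
Lemma real_line_arcs (f : R -> C) (E F : C -> C) (a K : R) : nice f -> 0 <= a -> 0 <= K ->
  UHol E -> UHol (fun k => E (- k)%C) ->
  (forall s : R, F (RtoC s) = (Cexp (Ci * s * a) * E (RtoC s) * L f (RtoC (- s)))%C) ->
  (ray F K 0 - ray F K PI =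
   - arc (fun k => E k * Lfin a (fun z => f (a - z)%R) (clampIm k)) K 0 PI
   - arc (fun k => E (- k) * L (fun z => f (a + z)%R) (clampIm k)) K 0 PI)%C.
Proof.
  intros Hf Ha HK HE HE' HF. pose proof PI_RGT_0.
  set (B := fun k => Lfin a (fun z => f (a - z)) (clampIm k)).
  set (A := fun k => L (fun z => f (a + z)) (clampIm k)).
  assert (HB : UHol B) by exact (nice_Lfin_Hol f a Hf Ha).
  assert (HA : UHol A) by exact (nice_L_Hol f a Hf Ha).
  set (Fb := fun k => (E k * B k)%C). set (Fa := fun k => (E (- k) * A k)%C).
  assert (Hb : UHol Fb) by (unfold Fb; holo). assert (Hh : UHol Fa) by (unfold Fa; holo).
  change (ray F K 0 - ray F K PI = - arc Fb K 0 PI - arc Fa K 0 PI)%C.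
  rewrite !upper_arc by (assumption || lra).
  assert (R0 : forall G, ray G K 0 = CInt (fun s : R => G (RtoC s)) 0 K).
  { intros G. apply CInt_ext. intros s _. now rewrite dir_0, !Cmult_1_r. }
  assert (RP : forall G, ray G K PI = CInt (fun s : R => - G (RtoC (- s)))%C 0 K).
  { intros G. apply CInt_ext. intros s _. rewrite dir_PI.
    replace (s * -1)%C with (RtoC (- s)) by (rewrite RtoC_opp; ring). ring. }
  assert (X0 : forall G, UHol G -> ex_CInt (fun s : R => G (RtoC s)) 0 K).
  { intros G HG. apply ex_CInt_le; [assumption|]. intros s _.
    apply (Ccont_comp (fun s : R => RtoC s) G); [ccont|now apply UHol_cont]. }
  assert (XP : forall G, UHol G -> ex_CInt (fun s : R => - G (RtoC (- s)))%C 0 K).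
  { intros G HG. apply ex_CInt_le; [assumption|]. intros s _. apply Ccont_opp.
    apply (Ccont_comp (fun s : R => RtoC (- s)) G); [|now apply UHol_cont].
    apply (continuous_ext (fun s : R => - RtoC s)%C); [intros; now rewrite RtoC_opp|ccont]. }
  destruct (nice_dominated_0 f Hf) as [g D].
  assert (Key : forall s : R, F (RtoC s) = (Fb (RtoC s) + Fa (RtoC (- s)))%C).
  { intros s. rewrite HF. unfold Fb, Fa, A, B.
    assert (U : forall q : R, upper (RtoC q)) by (intros q; unfold upper; simpl; lra).
    rewrite !clampIm_id by apply U.
    pose proof (L_shift f g (RtoC (- s)) a D (U _) Ha) as E1.
    pose proof (Lfin_reflect f a (RtoC s) Ha (fun y _ => proj1 Hf y)) as E2.
    rewrite <- E2. replace (- RtoC s)%C with (RtoC (- s)) by apply RtoC_opp.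
    replace (L f (RtoC (- s))) with (Lfin a f (RtoC (- s)) + (L f (RtoC (- s)) - Lfin a f (RtoC (- s))))%C by ring.
    rewrite E1.
    replace (- RtoC (- s))%C with (RtoC s) by (rewrite RtoC_opp; ring).
    assert (E3 : (Cexp (Ci * s * a) * Cexp (Ci * RtoC (- s) * a) = 1)%C).
    { rewrite <- Cexp_plus, <- Cexp_0. apply f_equal. rewrite RtoC_opp. ring. }
    transitivity (E (RtoC s) * (Cexp (Ci * s * a) * Lfin a f (RtoC (- s)))
      + E (RtoC s) * (Cexp (Ci * s * a) * Cexp (Ci * RtoC (- s) * a)) * L (fun y => f (a + y)%R) (RtoC (- s)))%C; [ring|].
    rewrite E3. ring. }
  (* Reflection exchanges the two rays, so [Fa] appears with the opposite ray and a minus sign. *)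
  assert (F0 : ray F K 0 = (ray Fb K 0 - ray Fa K PI)%C).
  { rewrite !R0, RP, <- CInt_minus by auto. apply CInt_ext. intros s _. rewrite Key. ring. }
  assert (FP : ray F K PI = (ray Fb K PI - ray Fa K 0)%C).
  { rewrite !RP, R0, <- CInt_minus by auto. apply CInt_ext. intros s _. rewrite Key, Ropp_involutive. ring. }
  rewrite F0, FP. ring.
Qed.

Lemma real_line_path (f : R -> C) (F G : C -> C) (K : R) : nice f -> 0 <= K -> UHol G ->
  (forall s : R, F (RtoC s) = (G (RtoC s) * L f (RtoC (- s)))%C) ->
  is_path_int F (real_line K) (ray F K 0 - ray F K PI)%C.
Proof.
  intros Hf HK HG HF. apply real_line_int; [assumption|]. intros s.
  apply (continuous_ext (fun s : R => G (RtoC s) * L f (clampIm (RtoC (- s))))%C).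
  - intros q. rewrite clampIm_id by (unfold upper; simpl; lra). symmetry. apply HF.
  - apply Ccont_mult.
    + apply (Ccont_comp (fun s : R => RtoC s) G); [ccont|now apply UHol_cont].
    + apply (Ccont_comp (fun s : R => RtoC (- s)) (fun z => L f (clampIm z))); [|apply UHol_cont, nice_L_Hol_0, Hf].
      apply (continuous_ext (fun s : R => - RtoC s)%C); [intros; now rewrite RtoC_opp|ccont].
Qed.

(** * The interface term *)

Section Data.
Variables (w0 v0 W h : R -> C).
Hypotheses (Hf : nice (fun y => W (- y))) (Hh : nice h)
  (Ew : forall x, x < 0 -> w0 x = W x) (Ev : forall x, 0 < x -> v0 x = h x).
Let f := fun y => W (- y).

Lemma interface_term_bvalc (u : C) : strip u -> interface_term w0 v0 (Cexp u) = bvalc f h u.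
Proof.
  intros Hu. destruct (strip_upper u Hu) as [u1 [u2 [u3 _]]].
  unfold interface_term. rewrite sigmaC_Cexp, rhoC_Cexp by assumption.
  rewrite (hat_neg_L w0 W (sg u) Hf Ew u1), (hat_pos_L v0 h (rh u) Hh Ev u2), (hat_pos_L v0 h (alpha ^ 2 * rh u) Hh Ev u3).
  unfold bvalc. rewrite !clampIm_id by assumption. unfold f, den, Cdiv. reflexivity.
Qed.

(** For every [r] the part of the contour up to radius [K] has exactly the integral of the lower
    arc, so the limit does not depend on [r]. *)
Lemma interface_path (F s : C -> C) (a t r K : R) : 0 < r <= K -> Hol ostrip strip s ->
  (forall u, strip u -> F (Cexp u) = (Cexp (Ci * s u * a + Ci * Cexp u * t) * interface_term w0 v0 (Cexp u))%C) ->
  is_path_int F (R_tilde r K) (ArcL t (fun u => Cexp (Ci * s u * a) * bvalc f h u)%C K).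
Proof.
  intros HrK Hs HF.
  assert (HG : Hol ostrip strip (fun u => Cexp (Ci * Cexp u * t) * (Cexp (Ci * s u * a) * bvalc f h u))%C).
  { pose proof (bvalc_Hol f h Hf Hh). holo. }
  refine (R_tilde_int F _ r K HrK _ HG).
  intros u Hu. rewrite HF, interface_term_bvalc, Cexp_plus by assumption. ring.
Qed.
End Data.

Lemma root_to_infinity (n : R) : 0 < n -> forall A, exists X, forall x, X < x -> A < exp (ln x / n).
Proof.
  intros Hn A. set (q := Rmax 1 A). assert (0 < q) by (unfold q; pose proof (Rmax_l 1 A); lra).
  exists (exp (n * ln q)). intros x Hx. pose proof (exp_pos (n * ln q)).
  apply Rle_lt_trans with q; [apply Rmax_r|]. rewrite <- (exp_ln q) by assumption.
  apply exp_increasing. apply Rmult_lt_reg_l with n; [assumption|].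
  replace (n * (ln x / n)) with (ln x) by (field; lra).
  rewrite <- (ln_exp (n * ln q)). now apply ln_increasing.
Qed.

Section Initial.
Variables (f h f0 h0 : R -> C) (a : R) (rho sigma : C).
Hypotheses (Hf : nice f) (Hh : nice h) (Ha : 0 < a)
  (Ef : forall x, 0 < x -> f0 x = f x) (Eh : forall x, 0 < x -> h0 x = h x)
  (us : upper sigma) (ur : upper (- rho)) (ur2 : upper (- (alpha ^ 2 * rho))).

(** The solution at time 0 is known to agree with the smooth datum for [x > 0] only, which the
    integrals do not notice. *)
Lemma L_initial (p q : R -> C) (m : C) : nice p -> (forall x, 0 < x -> q x = p x) -> upper m ->
  L q m = L p m /\ L (fun z => q (a + z)) m = L (fun z => p (a + z)) m /\
  Lfin a (fun z => q (a - z)) m = Lfin a (fun z => p (a - z)) m.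
Proof.
  intros Hp E Hm. split; [|split].
  - symmetry. exact (L_ext p q m (fun y Hy => eq_sym (E y Hy)) (nice_dominated_0 p Hp) Hm).
  - symmetry. refine (L_ext (fun z => p (a + z)) (fun z => q (a + z)) m _ (nice_dominated p a Hp (Rlt_le _ _ Ha)) Hm).
    intros y Hy. symmetry. apply E. lra.
  - apply CInt_ext. rewrite Rmin_left, Rmax_right by lra. intros y Hy. rewrite E by lra. reflexivity.
Qed.

Lemma bval_initial : bval f0 h0 rho sigma = bval f h rho sigma.
Proof.
  unfold bval. destruct (L_initial f f0 sigma Hf Ef us) as [-> _].
  destruct (L_initial h h0 _ Hh Eh ur) as [-> _]. destruct (L_initial h h0 _ Hh Eh ur2) as [-> _]. reflexivity.
Qed.

Lemma uval_initial : uval a f0 h0 rho sigma = uval a f h rho sigma.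
Proof.
  unfold uval. rewrite bval_initial. destruct (L_initial f f0 sigma Hf Ef us) as [-> [-> ->]]. reflexivity.
Qed.

Lemma vval_initial : upper (alpha * rho) -> vval a f0 h0 rho sigma = vval a f h rho sigma.
Proof.
  intros ua. unfold vval. rewrite bval_initial.
  destruct (L_initial h h0 _ Hh Eh ur) as [-> [-> _]]. destruct (L_initial h h0 _ Hh Eh ur2) as [-> [-> _]].
  destruct (L_initial h h0 _ Hh Eh ua) as [_ [_ ->]]. reflexivity.
Qed.
End Initial.

Lemma ray_bound_decay (K c B : R) (E G : C) : Cmod E <= exp (- (c * K)) -> Cmod G <= B ->
  Cmod (E * G) <= B * exp (- (c * K)).
Proof.
  intros HE HG. rewrite Cmod_mult, Rmult_comm. pose proof (Cmod_ge_0 E). pose proof (Cmod_ge_0 G).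
  now apply Rmult_le_compat.
Qed.

Lemma arc_vanishes_upper (E A : C -> C) (c d t B : R) (n : nat) : (2 <= n)%nat -> 0 < t -> 0 <= B ->
  d = c + PI / INR n -> UHol E -> UHol A -> (forall k, Cmod (A k) <= B) ->
  (forall K th : R, Cmod (E (K * dir th)%C) = exp (- (K ^ n * t * sin (INR n * (th - c))))) ->
  Clim (fun K => arc (fun k => E k * A k)%C K c d) 0%C.
Proof.
  intros Hn Ht HB Hd HE HA Hb He. apply (arc_vanishes _ c d t B n Hn Ht HB Hd).
  intros K th _ _. split.
  - apply UHol_cont. holo.
  - rewrite Cmod_mult, He, Rmult_comm. apply Rmult_le_compat_r; [left; apply exp_pos|apply Hb].
Qed.

Lemma arc_split3 (F : C -> C) (K c d : R) : UHol F -> 0 <= c <= d -> d <= PI ->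
  arc F K 0 PI = (arc F K 0 c + arc F K c d + arc F K d PI)%C.
Proof.
  intros HF Hc Hd. rewrite (arc_Chasles F K 0 c PI) by (lra || (intros; now apply UHol_cont)).
  rewrite (arc_Chasles F K c d PI) by (lra || (intros; now apply UHol_cont)). ring.
Qed.

Lemma dir_pow (th : R) (n : nat) : (dir th ^ n)%C = dir (INR n * th).
Proof.
  induction n as [|n IH].
  - simpl INR. rewrite Rmult_0_l, dir_0. reflexivity.
  - rewrite S_INR. simpl Cpow. rewrite IH, <- dir_plus. do 3 f_equal. ring.
Qed.

Lemma polar_pow (K th : R) (n : nat) : ((K * dir th) ^ n)%C = ((K ^ n)%R * dir (INR n * th))%C.
Proof.
  rewrite <- dir_pow. rewrite RtoC_pow. induction n as [|n IH]; simpl; [ring|]. rewrite IH. ring.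
Qed.

(** The sign of [b sin (n th)] decides in which sectors the phase decays, hence which arcs
    vanish. *)
Lemma Cmod_phase (b K th : R) (n : nat) :
  Cmod (Cexp (Ci * (K * dir th) ^ n * b)) = exp (- (K ^ n * b * sin (INR n * th))).
Proof.
  rewrite Cmod_Cexp, polar_pow. f_equal.
  replace (Re (Ci * ((K ^ n)%R * dir (INR n * th)) * b)) with (- Im ((K ^ n)%R * dir (INR n * th))%C * b)
    by (simpl; unfold Re, Im; ring).
  rewrite Im_polar. ring.
Qed.

Lemma phase_UHol (b : R) (n : nat) : UHol (fun k => Cexp (Ci * k ^ n * b)).
Proof.
  assert (H : UHol (fun k => k ^ n)%C) by (apply Hol_pow, Hol_id). holo.
Qed.

(** * The two solution formulas at distance [a] from the interface *)

Section Formulas.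
Variables (T : R) (u0 u1 ut : R -> R -> C) (gu : R -> R) (y0 y1 y2 yt : R -> R -> C) (gy : R -> R).
Variables (w0 v0 W h : R -> C).
Hypotheses (HT : 0 < T) (Hu : schroedinger T u0 u1 ut gu) (Hy : airy T y0 y1 y2 yt gy)
  (Hi0 : forall t, 0 <= t <= T -> u0 0 t = y0 0 t)
  (Hi1 : forall t, 0 <= t <= T -> u1 0 t = (- y1 0%R t)%C)
  (Hf : nice (fun y => W (- y))) (Hh : nice h)
  (Ew : forall x, x < 0 -> w0 x = W x) (Ev : forall x, 0 < x -> v0 x = h x)
  (Eu : forall x, 0 < x -> u0 x 0 = W (- x)) (Ey : forall x, 0 < x -> y0 x 0 = h x).
Let f := fun y => W (- y).

Lemma final_data_bound (a : R) : 0 <= a -> exists B, 0 <= B /\ forall m, upper m ->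
  (Cmod (L (fun x => u0 x T) m) <= B /\ Cmod (L (fun x => y0 x T) m) <= B) /\
  (Cmod (Lfin a (fun z => u0 (a - z)%R T) m) <= B /\ Cmod (L (fun z => u0 (a + z)%R T) m) <= B) /\
  (Cmod (Lfin a (fun z => y0 (a - z)%R T) m) <= B /\ Cmod (L (fun z => y0 (a + z)%R T) m) <= B).
Proof.
  intros Ha. destruct Hu as [Cu [_ [[Gu Du] _]]]. destruct Hy as [Cy [_ [[Gy Dy] _]]].
  destruct (dominated_bounds (fun x => u0 x T) gu a) as [B1 [P1 Q1]]; [|assumption|].
  { split; [|split; [|assumption]].
    - intros x _. exact (cont2_slice1 u0 x T (proj1 (Cu x T))).
    - intros x Hx. apply Du; lra. }
  destruct (dominated_bounds (fun x => y0 x T) gy a) as [B2 [P2 Q2]]; [|assumption|].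
  { split; [|split; [|assumption]].
    - intros x _. exact (cont2_slice1 y0 x T (proj1 (Cy x T))).
    - intros x Hx. apply Dy; lra. }
  exists (B1 + B2). split; [lra|]. intros m Hm.
  destruct (Q1 m Hm) as [? [? ?]]. destruct (Q2 m Hm) as [? [? ?]]. repeat split; lra.
Qed.

(** [X0] is free off the strip, so a version of [uval] built from clamped transforms, continuous at
    the boundary of the strip, can be used. *)
Lemma schroedinger_limit (X0 : C -> C) (a t : R) : 0 < a -> 0 < t < T ->
  (forall u, strip u -> holcont X0 u) ->
  (forall u, strip u -> X0 u = uval a f h (rh u) (sg u)) ->
  Clim (fun K => ArcL t X0 K) (2 * PI * u0 a t)%C.
Proof.
  intros Ha Ht HX E. destruct (final_data_bound a (Rlt_le _ _ Ha)) as [B [HB Q]].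
  pose proof Hu as [Cu [Du _]].
  apply (ArcL_inversion (fun s => u0 a s) (fun s => ut a s) X0
    (fun u => uval a (fun x => u0 x T) (fun x => y0 x T) (rh u) (sg u)) T t B Ht HB).
  - intros s. exact (cont2_slice2 u0 a s (proj1 (Cu a s))).
  - intros s. exact (cont2_slice2 ut a s (proj2 (proj2 (Cu a s)))).
  - intros s Hs. apply (Du a s Ha Hs).
  - exact HX.
  - intros u Hs. destruct (strip_upper u Hs) as [s1 [s2 [s3 _]]].
    rewrite (schroedinger_value T u0 u1 ut gu y0 y1 y2 yt gy (rh u) (sg u) (Cexp u) HT Hu Hy Hi0 Hi1
      (Im_Cexp_strip u Hs) (sg_square u) (rh_cube u) s1 s2 s3 (sg_neq_0 u) (rh_neq_0 u) (sum_neq_0 u Hs) a (Rlt_le _ _ Ha)).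
    rewrite E by assumption.
    rewrite (uval_initial f h (fun x => u0 x 0) (fun x => y0 x 0) a (rh u) (sg u) Hf Hh Ha Eu Ey s1 s2 s3). reflexivity.
  - intros u Hs Hr. apply (uval_bound _ _ a B u Hs Hr (Rlt_le _ _ Ha)). intros m Hm.
    destruct (Q m Hm) as [[q1 q2] [[q3 q4] _]]. now repeat split.
Qed.

Lemma airy_limit (X0 : C -> C) (a t : R) : 0 < a -> 0 < t < T ->
  (forall u, strip u -> holcont X0 u) ->
  (forall u, strip u -> X0 u = vval a f h (rh u) (sg u)) ->
  Clim (fun K => ArcL t X0 K) (2 * PI * y0 a t)%C.
Proof.
  intros Ha Ht HX E. destruct (final_data_bound a (Rlt_le _ _ Ha)) as [B [HB Q]].
  pose proof Hy as [Cy [Dy _]].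
  apply (ArcL_inversion (fun s => y0 a s) (fun s => yt a s) X0
    (fun u => vval a (fun x => u0 x T) (fun x => y0 x T) (rh u) (sg u)) T t B Ht HB).
  - intros s. exact (cont2_slice2 y0 a s (proj1 (Cy a s))).
  - intros s. exact (cont2_slice2 yt a s (proj2 (proj2 (proj2 (Cy a s))))).
  - intros s Hs. apply (Dy a s Ha Hs).
  - exact HX.
  - intros u Hs. destruct (strip_upper u Hs) as [s1 [s2 [s3 s4]]].
    rewrite (airy_value T u0 u1 ut gu y0 y1 y2 yt gy (rh u) (sg u) (Cexp u) HT Hu Hy Hi0 Hi1
      (Im_Cexp_strip u Hs) (sg_square u) (rh_cube u) s1 s2 s3 (rh_neq_0 u) (sum_neq_0 u Hs) a (Rlt_le _ _ Ha)).
    rewrite E by assumption.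
    rewrite (vval_initial f h (fun x => u0 x 0) (fun x => y0 x 0) a (rh u) (sg u) Hf Hh Ha Eu Ey s1 s2 s3 s4). reflexivity.
  - intros u Hs Hr. apply (vval_bound _ _ a B u Hs Hr (Rlt_le _ _ Ha)). intros m Hm.
    destruct (Q m Hm) as [[q1 q2] [_ [q3 q4]]]. now repeat split.
Qed.

Lemma half_line_bounds (p : R -> C) (a : R) : nice p -> 0 <= a -> exists B, 0 <= B /\ forall k,
  Cmod (L p (clampIm k)) <= B /\ Cmod (Lfin a (fun z => p (a - z)%R) (clampIm k)) <= B /\
  Cmod (L (fun z => p (a + z)%R) (clampIm k)) <= B.
Proof.
  intros Hp Ha. destruct (nice_dominated_0 p Hp) as [g D]. destruct (dominated_bounds p g a D Ha) as [B [HB Q]].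
  exists B. split; [assumption|]. intros k. apply Q, clampIm_upper.
Qed.

(** The exponential is kept as [e^{ika}] times the phase: on the real line [e^{ika}] is absorbed
    into the transforms of the data on [(0, a)] and beyond [a], and the phase alone governs the
    deformation. *)
Theorem schroedinger_formula (a t r : R) : 0 < a -> 0 < t < T -> 0 < r -> exists I1 I2 I3 : C,
  is_contour_int (fun k => Cexp (Ci * k * a) * Cexp (Ci * k ^ 2 * (- t)%R) * hat_neg w0 (- k))%C real_line I1 /\
  is_contour_int (fun k => Cexp (Ci * k * a) * Cexp (Ci * k ^ 2 * (- t)%R) * hat_neg w0 k)%C C_S I2 /\
  is_contour_int (fun k => Cexp (Ci * sigmaC k * a + Ci * k * t) * interface_term w0 v0 k)%C (R_tilde r) I3 /\
  (2 * PI * u0 a t = I1 - I2 + I3)%C.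
Proof.
  intros Ha Ht Hr. pose proof PI_RGT_0 as Hpi.
  set (E := fun k => Cexp (Ci * k ^ 2 * (- t)%R)).
  assert (HE : UHol E) by apply phase_UHol.
  assert (EE : forall k, E (- k)%C = E k) by (intros k; unfold E; apply f_equal; ring).
  assert (HE' : UHol (fun k => E (- k)%C)) by (apply (Hol_ext _ _ E); [intros; now rewrite EE|exact HE]).
  set (B := fun k => Lfin a (fun z => f (a - z)) (clampIm k)).
  set (A := fun k => L (fun z => f (a + z)) (clampIm k)).
  set (G := fun k => L f (clampIm k)).
  assert (HB : UHol B) by exact (nice_Lfin_Hol f a Hf (Rlt_le _ _ Ha)).
  assert (HA : UHol A) by exact (nice_L_Hol f a Hf (Rlt_le _ _ Ha)).
  assert (HG : UHol G) by exact (nice_L_Hol_0 f Hf).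
  set (Fb := fun k => (E k * B k)%C). set (Fa := fun k => (E (- k) * A k)%C).
  assert (Hb : UHol Fb) by (unfold Fb; holo). assert (Hh' : UHol Fa) by (unfold Fa; holo).
  set (F2 := fun k => (Cexp (Ci * k * a) * E k * G k)%C).
  assert (HX : UHol (fun k => Cexp (Ci * k * a))) by holo.
  assert (H2 : UHol F2) by (unfold F2; apply Hol_mult; [apply Hol_mult|]; assumption).
  (* The parts of [uval]: [P3] leads to the third contour, [P2] to the boundary of the quadrant,
     [Pb] and [Pa] to the real line through the data on [(0, a)] and beyond [a]. *)
  set (P3 := fun u => (Cexp (Ci * sg u * a) * bvalc f h u)%C).
  set (P2 := fun u => (Cexp (Ci * sg u * a) * G (sg u) * / (2 * sg u))%C).
  set (Pb := fun u => (B (sg u) * / (2 * sg u))%C). set (Pa := fun u => (A (sg u) * / (2 * sg u))%C).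
  assert (Sg : Hol ostrip strip sg) by exact sg_Hol.
  assert (S2 : Hol ostrip strip (fun u => / (2 * sg u))%C).
  { apply Hol_inv; [| |holo]; intros u _; apply Cmult_neq_0; try apply sg_neq_0;
      intros X; apply (f_equal Re) in X; simpl in X; lra. }
  assert (Up : forall F, UHol F -> Hol ostrip strip (fun u => F (sg u))).
  { intros F HF. apply (Hol_upper F sg HF Sg). intros u Hs. apply (ostrip_upper u Hs). }
  pose proof (bvalc_Hol f h Hf Hh) as Hbv. pose proof (Up G HG). pose proof (Up A HA). pose proof (Up B HB).
  assert (C3 : forall u, strip u -> holcont P3 u).
  { intros u Hs. apply (Hol_cont ostrip strip); [unfold P3; holo|exact Hs]. }
  assert (C2 : forall u, strip u -> holcont P2 u).
  { intros u Hs. apply (Hol_cont ostrip strip); [unfold P2; holo|exact Hs]. }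
  assert (Cb : forall u, strip u -> holcont Pb u).
  { intros u Hs. apply (Hol_cont ostrip strip); [unfold Pb; holo|exact Hs]. }
  assert (Ca : forall u, strip u -> holcont Pa u).
  { intros u Hs. apply (Hol_cont ostrip strip); [unfold Pa; holo|exact Hs]. }
  (* The circle [|lam| = K] corresponds to [|k| = K^{1/2}]. *)
  set (kap := fun K : R => exp (ln K / 2)).
  assert (Kap : forall A, exists X, forall x, X < x -> A < kap x) by (apply root_to_infinity; lra).
  assert (kap0 : forall K, 0 < kap K) by (intros; apply exp_pos).
  (* Since [lam = - sigma^2], the measure is [d lam = - 2 sigma d sigma]: the denominators [2 sigma]
     cancel and a minus sign stays. The lower half circle becomes the first quadrant. *)
  assert (Pw : forall F P K, UHol F -> (forall u, strip u -> (2 * sg u * P u)%C = (Cexp (- (Ci * Cexp u * t)) * F (sg u))%C) ->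
    ArcL t P K = (- arc F (kap K) 0 (PI / 2))%C).
  { intros F P K HF HP.
    rewrite (ArcL_power F P sg t K 2 (PI / 2) (-1)%C); [|lra|now apply UHol_cont| |].
    - replace (PI / 2 - PI / 2) with 0 by lra. unfold kap. ring.
    - intros u _. rewrite sg_polar. reflexivity.
    - intros u Hs. specialize (HP u Hs).
      replace (Cexp u) with (- (sg u * sg u))%C at 1 by (rewrite sg_square; ring).
      transitivity (- sg u * Cexp (Ci * Cexp u * t) * (2 * sg u * P u))%C; [ring|]. rewrite HP.
      transitivity (- sg u * (Cexp (Ci * Cexp u * t) * Cexp (- (Ci * Cexp u * t))) * F (sg u))%C; [ring|].
      rewrite <- Cexp_plus. replace (Ci * Cexp u * t + - (Ci * Cexp u * t))%C with (RtoC 0) by ring.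
      rewrite Cexp_0. ring. }
  assert (Esg : forall u, (Cexp (- (Ci * Cexp u * t)) * E (sg u) = 1)%C).
  { intros u. unfold E. rewrite <- Cexp_plus, <- Cexp_0. apply f_equal. rewrite RtoC_opp. simpl.
    transitivity (- (Ci * t) * (Cexp u + sg u * sg u))%C; [ring|]. rewrite sg_square. ring. }
  assert (Div : forall u X, (2 * sg u * (X * / (2 * sg u)) = X)%C).
  { intros u X. field. apply sg_neq_0. }
  assert (W2 : forall K, ArcL t P2 K = (- arc F2 (kap K) 0 (PI / 2))%C).
  { intros K. apply Pw; [exact H2|]. intros u _. unfold P2, F2. rewrite Div.
    transitivity (Cexp (Ci * sg u * a) * (Cexp (- (Ci * Cexp u * t)) * E (sg u)) * G (sg u))%C; [|ring].
    rewrite Esg. ring. }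
  assert (Wb : forall K, ArcL t Pb K = (- arc Fb (kap K) 0 (PI / 2))%C).
  { intros K. apply Pw; [exact Hb|]. intros u _. unfold Pb, Fb. rewrite Div, Cmult_assoc, Esg. ring. }
  assert (Wa : forall K, ArcL t Pa K = (- arc Fa (kap K) 0 (PI / 2))%C).
  { intros K. apply Pw; [exact Hh'|]. intros u _. unfold Pa, Fa. rewrite Div, EE, Cmult_assoc, Esg. ring. }
  set (FR := fun k => (Cexp (Ci * k * a) * Cexp (Ci * k ^ 2 * (- t)%R) * hat_neg w0 (- k))%C).
  assert (EFR : forall s : R, FR (RtoC s) = (Cexp (Ci * s * a) * E (RtoC s) * L f (RtoC (- s)))%C).
  { intros s. unfold FR, E. rewrite <- RtoC_opp.
    rewrite (hat_neg_L w0 W (RtoC (- s)) Hf Ew) by (unfold upper; simpl; lra). reflexivity. }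
  destruct (half_line_bounds f a Hf (Rlt_le _ _ Ha)) as [M [HM Bd]].
  (* In the second quadrant [e^{- i k^2 t}] decays, so the arcs over the first quadrant may be
     completed to half circles at no cost in the limit. *)
  assert (Ph : forall K th : R, Cmod (E (K * dir th)%C) = exp (- (K ^ 2 * t * sin (INR 2 * (th - PI / 2))))).
  { intros K th. unfold E. rewrite Cmod_phase. f_equal.
    replace (INR 2 * (th - PI / 2)) with (INR 2 * th - PI) by (simpl; field).
    rewrite sin_minus, cos_PI, sin_PI. ring. }
  assert (Hd : PI = PI / 2 + PI / INR 2) by (simpl; field).
  pose proof (arc_vanishes_upper E B (PI / 2) PI t M 2 (le_n 2) (proj1 Ht) HM Hd HE HB
    (fun k => proj1 (proj2 (Bd k))) Ph) as Vb.
  assert (Ph' : forall K th : R, Cmod (E (- (K * dir th))%C) = exp (- (K ^ 2 * t * sin (INR 2 * (th - PI / 2)))))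
    by (intros; rewrite EE; apply Ph).
  pose proof (arc_vanishes_upper (fun k => E (- k)%C) A (PI / 2) PI t M 2 (le_n 2) (proj1 Ht) HM Hd HE' HA
    (fun k => proj2 (proj2 (Bd k))) Ph') as Va.
  fold Fb in Vb. fold Fa in Va.
  destruct (real_line_converges f FR a (- t) (- t) 1 Hf) as [I1 L1]; [lia|lra|lra| | |].
  { intros s. rewrite EFR. unfold E. rewrite <- Cexp_plus.
    apply (f_equal (fun z => Cexp z * L f (RtoC (- s)))%C). rewrite RtoC_plus, !RtoC_mult, !RtoC_pow. simpl. ring. }
  { intros s. rewrite EFR, Ropp_involutive. unfold E. rewrite <- Cexp_plus.
    apply (f_equal (fun z => Cexp z * L f (RtoC s))%C).
    rewrite RtoC_plus, !RtoC_mult, !RtoC_pow, !RtoC_opp. simpl. ring. }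
  assert (C0 : exists l, Clim (fun K => ray F2 K 0) l).
  { destruct Hf as [_ [_ [B0 [HB0 Ex]]]].
    destruct (oscillatory_converges (fun s => G (RtoC s)) (Ci * f 0%R)%C a (- t) B0 1 (le_n 1)) as [l Hl]; [lra| | |].
    - intros s _. apply (Ccont_comp (fun s : R => RtoC s) G); [ccont|now apply UHol_cont].
    - intros s Hs. unfold G. rewrite clampIm_id by (unfold upper; simpl; lra). apply Ex. lra.
    - exists l. refine (Clim_ext_loc _ _ _ 0 _ Hl). intros K HK. apply CInt_ext. intros s _.
      rewrite dir_0, !Cmult_1_r. unfold F2, E. rewrite <- Cexp_plus.
      apply (f_equal (fun z => Cexp z * G (RtoC s))%C). rewrite RtoC_plus, !RtoC_mult, !RtoC_pow. simpl. ring. }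
  (* On the imaginary axis the phase has modulus 1 and the decay is that of [e^{ika}]. *)
  assert (C1 : exists l, Clim (fun K => ray F2 K (PI / 2)) l).
  { apply (ray_converges F2 (PI / 2) a M Ha HM).
    - intros s _. apply (Ccont_comp (fun s : R => s * dir (PI / 2))%C F2); [ccont|now apply UHol_cont].
    - intros s Hs. set (z := (s * dir (PI / 2))%C).
      refine (ray_bound_decay s a M (Cexp (Ci * z * a) * E z)%C (G z) _ (proj1 (Bd z))).
      rewrite Cmod_mult. unfold E, z. rewrite Cmod_phase, Cmod_Cexp, Re_Ci_mult, Im_polar, sin_PI2.
      replace (INR 2 * (PI / 2)) with PI by (simpl; field). rewrite sin_PI, Rmult_0_r, Ropp_0, exp_0.
      right. rewrite Rmult_1_r. f_equal. ring. }
  destruct C0 as [l0 L0]. destruct C1 as [l1 Ll1].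
  pose proof (Clim_minus _ _ _ _ L0 Ll1) as L2.
  (* The third integral is what the arc integral of [X0] leaves over, which also gives its convergence. *)
  set (X0 := fun u => (P3 u - P2 u + Pb u + Pa u)%C).
  assert (CX : forall u, strip u -> holcont X0 u).
  { intros u Hs. apply Ccont_plus; [apply Ccont_plus; [apply Ccont_minus|]|]; auto. }
  pose proof (schroedinger_limit X0 a t Ha Ht CX) as Lim.
  assert (EX : forall u, strip u -> X0 u = uval a f h (rh u) (sg u)).
  { intros u Hs. destruct (strip_upper u Hs) as [s1 _].
    unfold X0, P3, P2, Pb, Pa, G, A, B, uval, Cdiv. rewrite bvalc_eq, clampIm_id by assumption. ring. }
  specialize (Lim EX).
  assert (AX : forall K, ArcL t X0 K = (ArcL t P3 K - ArcL t P2 K + ArcL t Pb K + ArcL t Pa K)%C).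
  { intros K.
    assert (C32 : forall u, strip u -> holcont (fun u => P3 u - P2 u)%C u) by (intros u Hs; apply Ccont_minus; auto).
    assert (C32b : forall u, strip u -> holcont (fun u => P3 u - P2 u + Pb u)%C u) by (intros u Hs; apply Ccont_plus; auto).
    pose proof (ArcL_plus t (fun u => P3 u - P2 u + Pb u)%C Pa K C32b Ca) as E1. pose proof (ArcL_plus t (fun u => P3 u - P2 u)%C Pb K C32 Cb) as E2.
    pose proof (ArcL_minus t P3 P2 K C3 C2) as E3. cbv beta in E1, E2, E3.
    refine (eq_trans E1 _). apply (f_equal (fun z => z + ArcL t Pa K)%C).
    refine (eq_trans E2 _). apply (f_equal (fun z => z + ArcL t Pb K)%C). exact E3. }
  exists I1, (l0 - l1)%C, (2 * PI * u0 a t - I1 + (l0 - l1))%C.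
  split; [|split; [|split; [|ring]]].
  - apply (contour_limit FR real_line (fun K => ray FR K 0 - ray FR K PI)%C I1 0); [|exact L1].
    intros K HK. apply (real_line_path f FR (fun k => Cexp (Ci * k * a) * E k)%C K Hf); [lra|now apply Hol_mult|exact EFR].
  - apply (contour_limit _ C_S (fun K => ray F2 K 0 - ray F2 K (PI / 2))%C (l0 - l1)%C 0); [|exact L2].
    intros K HK. apply sector_path; [lra| |now apply UHol_cont].
    intros s th Hth Hs. assert (U : upper (s * dir th)%C) by (apply upper_polar; destruct Hth; subst; lra).
    unfold F2, G, E. rewrite (hat_neg_L w0 W _ Hf Ew U), clampIm_id by exact U. reflexivity.
  - apply (contour_limit _ (R_tilde r) (ArcL t P3) _ r).
    + intros K HK. apply (interface_path w0 v0 W h Hf Hh Ew Ev _ sg); [lra|exact Sg|].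
      intros u Hs. rewrite sigmaC_Cexp by assumption. reflexivity.
    + assert (K1 : Clim (fun K => ray FR (kap K) 0 - ray FR (kap K) PI)%C I1) by exact (Clim_comp (fun K => ray FR K 0 - ray FR K PI)%C kap _ L1 Kap).
      assert (K2 : Clim (fun K => ray F2 (kap K) 0 - ray F2 (kap K) (PI / 2))%C (l0 - l1)%C) by exact (Clim_comp (fun K => ray F2 K 0 - ray F2 K (PI / 2))%C kap _ L2 Kap).
      assert (K3 : Clim (fun K => arc Fb (kap K) (PI / 2) PI + arc Fa (kap K) (PI / 2) PI)%C 0%C).
      { apply Clim_eq with (0 + 0)%C; [|ring]. apply Clim_plus; [exact (Clim_comp (fun K => arc Fb K (PI / 2) PI) kap _ Vb Kap)|exact (Clim_comp (fun K => arc Fa K (PI / 2) PI) kap _ Va Kap)]. }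
      apply Clim_eq with (2 * PI * u0 a t - I1 + (l0 - l1) - 0)%C; [|ring].
      set (D1 := fun K => (ray FR (kap K) 0 - ray FR (kap K) PI)%C) in K1.
      set (D2 := fun K => (ray F2 (kap K) 0 - ray F2 (kap K) (PI / 2))%C) in K2.
      set (D3 := fun K => (arc Fb (kap K) (PI / 2) PI + arc Fa (kap K) (PI / 2) PI)%C) in K3.
      pose proof (Clim_minus (ArcL t X0) D1 _ _ Lim K1) as S1. pose proof (Clim_plus _ D2 _ _ S1 K2) as S4.
      pose proof (Clim_minus _ D3 _ _ S4 K3) as S3. cbv beta in S3.
      (* An identity for each [K]: the [P2] part of [X0] equals [D2], and the [Pb] and [Pa] parts
         minus [D1] are the second quadrant arcs [D3], so only [P3] is left. *)
      refine (Clim_ext_loc (fun K => ArcL t X0 K - D1 K + D2 K - D3 K)%C (ArcL t P3) _ 0 _ S3).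
      intros K HK. unfold D1, D2, D3. rewrite AX, W2, Wb, Wa.
      pose proof (real_line_arcs f E FR a (kap K) Hf (Rlt_le _ _ Ha) (Rlt_le _ _ (kap0 K)) HE HE' EFR) as Q.
      change (ray FR (kap K) 0 - ray FR (kap K) PI = - arc Fb (kap K) 0 PI - arc Fa (kap K) 0 PI)%C in Q.
      rewrite Q. rewrite (arc_Chasles Fb (kap K) 0 (PI / 2) PI), (arc_Chasles Fa (kap K) 0 (PI / 2) PI)
        by (lra || (intros; now apply UHol_cont)).
      rewrite (upper_arc F2 (kap K) 0 (PI / 2) (Rlt_le _ _ (kap0 K))) by (assumption || lra).
      ring.
Qed.

Theorem airy_formula (a t r : R) : 0 < a -> 0 < t < T -> 0 < r -> exists I1 I2 I3 : C,
  is_contour_int (fun k => Cexp (Ci * k * a) * Cexp (Ci * k ^ 3 * t) * hat_pos v0 k)%C real_line I1 /\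
  is_contour_int (fun k => Cexp (Ci * k * a) * Cexp (Ci * k ^ 3 * t) *
    (alpha * hat_pos v0 (alpha * k) + alpha ^ 2 * hat_pos v0 (alpha ^ 2 * k)))%C C_3 I2 /\
  is_contour_int (fun k => Cexp (Ci * alpha * rhoC k * a + Ci * k * t) * interface_term w0 v0 k)%C (R_tilde r) I3 /\
  (2 * PI * y0 a t = I1 + I2 + I3)%C.
Proof.
  intros Ha Ht Hr. pose proof PI_RGT_0 as Hpi.
  set (E := fun k => Cexp (Ci * k ^ 3 * t)).
  assert (HE : UHol E) by apply phase_UHol.
  assert (EE : forall k, E (- k)%C = Cexp (Ci * k ^ 3 * (- t)%R)) by (intros k; unfold E; apply f_equal; rewrite RtoC_opp; ring).
  assert (HE' : UHol (fun k => E (- k)%C)).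
  { apply (Hol_ext _ _ (fun k => Cexp (Ci * k ^ 3 * (- t)%R))); [intros; now rewrite EE|apply phase_UHol]. }
  set (B := fun k => Lfin a (fun z => h (a - z)) (clampIm k)).
  set (A := fun k => L (fun z => h (a + z)) (clampIm k)).
  set (G := fun k => L h (clampIm k)).
  assert (HB : UHol B) by exact (nice_Lfin_Hol h a Hh (Rlt_le _ _ Ha)).
  assert (HA : UHol A) by exact (nice_L_Hol h a Hh (Rlt_le _ _ Ha)).
  assert (HG : UHol G) by exact (nice_L_Hol_0 h Hh).
  set (Fb := fun k => (E k * B k)%C). set (Fa := fun k => (E (- k) * A k)%C).
  assert (Hb : UHol Fb) by (unfold Fb; holo). assert (Hh' : UHol Fa) by (unfold Fa; holo).
  set (N := fun k => (alpha * G (- (alpha * k)) + alpha ^ 2 * G (- (alpha ^ 2 * k)))%C).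
  set (F2 := fun k => (Cexp (Ci * k * a) * E k * N k)%C).
  (* The open sector [PI/3 < arg k < 2 PI/3], where both arguments in [N] have positive imaginary
     part; unlike in the other problem, [F2] can be deformed only there. *)
  set (U2 := fun k => 0 < Im (- (alpha * k))%C /\ 0 < Im (- (alpha ^ 2 * k))%C).
  assert (HX : forall U V, Hol U V (fun k => Cexp (Ci * k * a))) by (intros; holo).
  assert (HN : Hol U2 (fun _ => True) N).
  { assert (N1 : Hol U2 (fun _ => True) (fun k => G (- (alpha * k))%C)).
    { apply (Hol_comp _ _ (fun z => 0 < Im z) (fun _ => True) G (fun k => - (alpha * k))%C HG); [holo| |auto]. intros k [? _]; assumption. }
    assert (N2 : Hol U2 (fun _ => True) (fun k => G (- (alpha ^ 2 * k))%C)).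
    { apply (Hol_comp _ _ (fun z => 0 < Im z) (fun _ => True) G (fun k => - (alpha ^ 2 * k))%C HG); [holo| |auto]. intros k [_ ?]; assumption. }
    unfold N. holo. }
  assert (H2 : Hol U2 (fun _ => True) F2).
  { assert (HE2 : Hol U2 (fun _ => True) E).
    { apply (Hol_ext _ _ (fun k => Cexp (Ci * (k * k * k) * t))%C); [intros k; unfold E; apply f_equal; ring|holo]. }
    unfold F2. apply Hol_mult; [apply Hol_mult|]; auto. }
  assert (CF2 : forall k, holcont F2 k) by (intros k; exact (Hol_cont _ _ F2 k H2 I)).
  (* This denominator is the Jacobian of [lam = k^3]. With [k = alpha rho] the arc for [P2] and [Pb]
     is the middle third of the upper half circle; with [k = - rho] and [k = - alpha^2 rho] the arcs
     for [Pa] and [Pc] are the outer thirds. *)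
  set (D3 := fun u => (/ (3 * rh u ^ 3))%C).
  set (P3 := fun u => (Cexp (Ci * (alpha * rh u) * a) * bvalc f h u)%C).
  set (P2 := fun u => (Cexp (Ci * (alpha * rh u) * a) * (rh u * G (- rh u) + alpha ^ 2 * rh u * G (- (alpha ^ 2 * rh u))) * D3 u)%C).
  set (Pb := fun u => (alpha * rh u * B (alpha * rh u) * D3 u)%C).
  set (Pa := fun u => (rh u * A (- rh u) * D3 u)%C).
  set (Pc := fun u => (alpha ^ 2 * rh u * A (- (alpha ^ 2 * rh u)) * D3 u)%C).
  assert (Rh : Hol ostrip strip rh) by exact rh_Hol.
  assert (D0 : forall u, (3 * rh u ^ 3)%C <> 0%C).
  { intros u. replace (rh u ^ 3)%C with (rh u * rh u * rh u)%C by ring.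
    repeat apply Cmult_neq_0; try apply rh_neq_0. intros X; apply (f_equal Re) in X; simpl in X; lra. }
  assert (S3 : Hol ostrip strip D3).
  { apply Hol_inv; [| |]; auto. apply Hol_mult; [apply Hol_const|now apply Hol_pow]. }
  assert (Ax : Hol ostrip strip (fun u => alpha * rh u)%C) by holo.
  assert (Up1 : forall F, UHol F -> Hol ostrip strip (fun u => F (alpha * rh u)%C)).
  { intros F HF. apply (Hol_upper F (fun u => alpha * rh u)%C HF Ax). intros u Hs. apply (ostrip_upper u Hs). }
  assert (Up2 : forall F, UHol F -> Hol ostrip strip (fun u => F (- rh u)%C)).
  { intros F HF. apply (Hol_upper F (fun u => - rh u)%C HF); [holo|]. intros u Hs. apply (ostrip_upper u Hs). }
  assert (Up3 : forall F, UHol F -> Hol ostrip strip (fun u => F (- (alpha ^ 2 * rh u))%C)).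
  { intros F HF. apply (Hol_upper F (fun u => - (alpha ^ 2 * rh u))%C HF); [holo|]. intros u Hs. apply (ostrip_upper u Hs). }
  pose proof (bvalc_Hol f h Hf Hh) as Hbv.
  pose proof (Up2 G HG). pose proof (Up3 G HG). pose proof (Up2 A HA). pose proof (Up3 A HA). pose proof (Up1 B HB).
  assert (C3 : forall u, strip u -> holcont P3 u).
  { intros u Hs. apply (Hol_cont ostrip strip); [|exact Hs]. unfold P3. holo. }
  assert (C2 : forall u, strip u -> holcont P2 u).
  { intros u Hs. apply (Hol_cont ostrip strip); [|exact Hs]. unfold P2. holo. }
  assert (Cb : forall u, strip u -> holcont Pb u).
  { intros u Hs. apply (Hol_cont ostrip strip); [|exact Hs]. unfold Pb. holo. }
  assert (Ca : forall u, strip u -> holcont Pa u).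
  { intros u Hs. apply (Hol_cont ostrip strip); [|exact Hs]. unfold Pa. holo. }
  assert (Cc : forall u, strip u -> holcont Pc u).
  { intros u Hs. apply (Hol_cont ostrip strip); [|exact Hs]. unfold Pc. holo. }
  set (kap := fun K : R => exp (ln K / 3)).
  assert (Kap : forall A, exists X, forall x, X < x -> A < kap x) by (apply root_to_infinity; lra).
  assert (kap0 : forall K, 0 < kap K) by (intros; apply exp_pos).
  assert (Div : forall u X, (3 * Cexp u * (Cexp (Ci * Cexp u * t) * (X * D3 u)) = Cexp (Ci * Cexp u * t) * X)%C).
  { intros u X. unfold D3.
    transitivity (Cexp (Ci * Cexp u * t) * X * (3 * Cexp u * / (3 * rh u ^ 3)))%C; [ring|].
    replace (3 * Cexp u)%C with (3 * rh u ^ 3)%C by (rewrite <- rh_cube; ring).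
    rewrite Cinv_r by apply D0. ring. }
  assert (Ea : forall u, E (alpha * rh u)%C = Cexp (Ci * Cexp u * t)).
  { intros u. unfold E. apply f_equal. rewrite <- (rh_cube u).
    transitivity (Ci * ((alpha * alpha * alpha) * (rh u * rh u * rh u)) * t)%C; [ring|]. rewrite alpha_cube. ring. }
  assert (Er : forall u, E (- - rh u)%C = Cexp (Ci * Cexp u * t)).
  { intros u. unfold E. apply f_equal. rewrite <- (rh_cube u). ring. }
  assert (Ec : forall u, E (- - (alpha ^ 2 * rh u))%C = Cexp (Ci * Cexp u * t)).
  { intros u. unfold E. apply f_equal. rewrite <- (rh_cube u).
    transitivity (Ci * ((alpha * alpha * alpha) * (alpha * alpha * alpha) * (rh u * rh u * rh u)) * t)%C; [ring|].
    rewrite alpha_cube. ring. }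
  assert (W2 : forall K, ArcL t P2 K = arc F2 (kap K) (PI / 3) (2 * PI / 3)).
  { intros K.
    rewrite (ArcL_power F2 P2 (fun u => alpha * rh u)%C t K 3 (2 * PI / 3) 1%C); [|lra|exact CF2|intros; apply arh_polar|].
    - replace (2 * PI / 3 - PI / 3) with (PI / 3) by field. unfold kap. ring.
    - intros u _. unfold P2, F2, N. rewrite Div, Ea.
      replace (alpha * (alpha * rh u))%C with (alpha ^ 2 * rh u)%C by ring.
      replace (alpha ^ 2 * (alpha * rh u))%C with (rh u)%C
        by (transitivity (alpha * alpha * alpha * rh u)%C; [rewrite alpha_cube|]; ring).
      transitivity (Cexp (Ci * (alpha * rh u) * a) * Cexp (Ci * Cexp u * t) *
        ((alpha * alpha * alpha) * rh u * G (- rh u) + alpha ^ 2 * rh u * G (- (alpha ^ 2 * rh u))))%C; [rewrite alpha_cube|]; ring. }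
  assert (Wb : forall K, ArcL t Pb K = arc Fb (kap K) (PI / 3) (2 * PI / 3)).
  { intros K.
    rewrite (ArcL_power Fb Pb (fun u => alpha * rh u)%C t K 3 (2 * PI / 3) 1%C); [|lra|now apply UHol_cont|intros; apply arh_polar|].
    - replace (2 * PI / 3 - PI / 3) with (PI / 3) by field. unfold kap. ring.
    - intros u _. unfold Pb, Fb. rewrite Div, Ea. ring. }
  assert (Wa : forall K, ArcL t Pa K = (- arc Fa (kap K) (2 * PI / 3) PI)%C).
  { intros K.
    rewrite (ArcL_power Fa Pa (fun u => - rh u)%C t K 3 PI (-1)%C); [|lra|now apply UHol_cont|intros; apply mrh_polar|].
    - replace (PI - PI / 3) with (2 * PI / 3) by field. unfold kap. ring.
    - intros u _. unfold Pa, Fa. rewrite Div, Er. ring. }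
  assert (Wc : forall K, ArcL t Pc K = (- arc Fa (kap K) 0 (PI / 3))%C).
  { intros K.
    rewrite (ArcL_power Fa Pc (fun u => - (alpha ^ 2 * rh u))%C t K 3 (PI / 3) (-1)%C); [|lra|now apply UHol_cont|intros; apply ma2rh_polar|].
    - replace (PI / 3 - PI / 3) with 0 by ring. unfold kap. ring.
    - intros u _. unfold Pc, Fa. rewrite Div, Ec. ring. }
  set (FR := fun k => (Cexp (Ci * k * a) * Cexp (Ci * k ^ 3 * t) * hat_pos v0 k)%C).
  assert (EFR : forall s : R, FR (RtoC s) = (Cexp (Ci * s * a) * E (RtoC s) * L h (RtoC (- s)))%C).
  { intros s. unfold FR, E.
    rewrite (hat_pos_L v0 h (RtoC s) Hh Ev) by (unfold upper; simpl; lra). rewrite <- RtoC_opp. reflexivity. }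
  destruct (half_line_bounds h a Hh (Rlt_le _ _ Ha)) as [M [HM Bd]].
  assert (Per : forall th, sin (INR 3 * (th - 0)) = sin (INR 3 * th) /\
     sin (INR 3 * (th - PI / 3)) = - sin (INR 3 * th) /\ sin (INR 3 * (th - 2 * PI / 3)) = sin (INR 3 * th)).
  { intros th. replace (INR 3) with 3 by (simpl; ring). repeat split.
    - f_equal; ring.
    - replace (3 * (th - PI / 3)) with (3 * th - PI) by field. rewrite sin_minus, cos_PI, sin_PI. ring.
    - replace (3 * (th - 2 * PI / 3)) with (3 * th - 2 * PI) by field. rewrite sin_minus, cos_2PI, sin_2PI. ring. }
  assert (n23 : (2 <= 3)%nat) by lia.
  (* The phase [E k] decays in the two outer sectors and [E (- k)] in the middle one: these are
     exactly the arcs missing for [Fb] and for [Fa]. *)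
  assert (Vb1 : Clim (fun K => arc Fb K 0 (PI / 3)) 0%C).
  { apply (arc_vanishes_upper E B 0 (PI / 3) t M 3 n23 (proj1 Ht) HM); [simpl; field|exact HE|exact HB|intros k; apply Bd|].
    intros K th. unfold E. rewrite Cmod_phase. destruct (Per th) as [-> _]. reflexivity. }
  assert (Vb2 : Clim (fun K => arc Fb K (2 * PI / 3) PI) 0%C).
  { apply (arc_vanishes_upper E B (2 * PI / 3) PI t M 3 n23 (proj1 Ht) HM); [simpl; field|exact HE|exact HB|intros k; apply Bd|].
    intros K th. unfold E. rewrite Cmod_phase. destruct (Per th) as [_ [_ ->]]. reflexivity. }
  assert (Va : Clim (fun K => arc Fa K (PI / 3) (2 * PI / 3)) 0%C).
  { apply (arc_vanishes_upper (fun k => E (- k)%C) A (PI / 3) (2 * PI / 3) t M 3 n23 (proj1 Ht) HM); [simpl; field|exact HE'|exact HA|intros k; apply Bd|].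
    intros K th. rewrite EE, Cmod_phase. destruct (Per th) as [_ [-> _]]. f_equal. ring. }
  destruct (real_line_converges h FR a t (- t) 2 Hh) as [I1 L1]; [lia|lra|lra| | |].
  { intros s. rewrite EFR. unfold E. rewrite <- Cexp_plus.
    apply (f_equal (fun z => Cexp z * L h (RtoC (- s)))%C). rewrite RtoC_plus, !RtoC_mult, !RtoC_pow. simpl. ring. }
  { intros s. rewrite EFR, Ropp_involutive. unfold E. rewrite <- Cexp_plus.
    apply (f_equal (fun z => Cexp z * L h (RtoC s))%C).
    rewrite RtoC_plus, !RtoC_mult, !RtoC_pow, !RtoC_opp. simpl. ring. }
  assert (BN : forall k, Cmod (N k) <= M + M).
  { intros k. unfold N. eapply Rle_trans; [apply Cmod_triangle|]. rewrite !Cmod_mult, Cmod_pow, Cmod_alpha, pow1, !Rmult_1_l.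
    destruct (Bd (- (alpha * k))%C) as [b1 _]. destruct (Bd (- (alpha ^ 2 * k))%C) as [b2 _]. fold (G (- (alpha * k))%C) in b1. fold (G (- (alpha ^ 2 * k))%C) in b2. lra. }
  (* On the rays bounding the middle sector the cubic phase has modulus 1, and [e^{ika}] decays at
     the rate [a sin th]. *)
  assert (Cv : forall th, 0 < th < PI -> sin (INR 3 * th) = 0 -> exists l, Clim (fun K => ray F2 K th) l).
  { intros th Hth Hs3. assert (0 < sin th) by (apply sin_gt_0; lra).
    apply (ray_converges F2 th (a * sin th) (M + M)); [now apply Rmult_lt_0_compat|lra| |].
    - intros s _. apply (Ccont_comp (fun s : R => s * dir th)%C F2); [ccont|apply CF2].
    - intros s Hs. set (z := (s * dir th)%C).
      refine (ray_bound_decay s (a * sin th) (M + M) (Cexp (Ci * z * a) * E z)%C (N z) _ (BN z)).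
      rewrite Cmod_mult. unfold E, z. rewrite Cmod_phase, Cmod_Cexp, Re_Ci_mult, Im_polar.
      rewrite Hs3, Rmult_0_r, Ropp_0, exp_0.
      right. rewrite Rmult_1_r. f_equal. ring. }
  destruct (Cv (PI / 3)) as [l0 L0]; [lra|replace (INR 3 * (PI / 3)) with PI by (simpl; field); apply sin_PI|].
  destruct (Cv (2 * PI / 3)) as [l1 Ll1]; [lra|replace (INR 3 * (2 * PI / 3)) with (2 * PI) by (simpl; field); apply sin_2PI|].
  pose proof (Clim_minus _ _ _ _ L0 Ll1) as L2.
  set (X0 := fun u => (P3 u - P2 u - Pb u + Pa u + Pc u)%C).
  assert (C32 : forall u, strip u -> holcont (fun u => P3 u - P2 u)%C u) by (intros u Hs; apply Ccont_minus; auto).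
  assert (C32b : forall u, strip u -> holcont (fun u => P3 u - P2 u - Pb u)%C u) by (intros u Hs; apply Ccont_minus; auto).
  assert (C32ba : forall u, strip u -> holcont (fun u => P3 u - P2 u - Pb u + Pa u)%C u) by (intros u Hs; apply Ccont_plus; auto).
  assert (CX : forall u, strip u -> holcont X0 u) by (intros u Hs; apply Ccont_plus; auto).
  pose proof (airy_limit X0 a t Ha Ht CX) as Lim.
  assert (EX : forall u, strip u -> X0 u = vval a f h (rh u) (sg u)).
  { intros u Hs. destruct (strip_upper u Hs) as [_ [s2 [s3 s4]]].
    unfold X0, P3, P2, Pb, Pa, Pc, D3, G, A, B, vval, Cdiv. rewrite bvalc_eq, !clampIm_id by assumption. ring. }
  specialize (Lim EX).
  assert (AX : forall K, ArcL t X0 K = (ArcL t P3 K - ArcL t P2 K - ArcL t Pb K + ArcL t Pa K + ArcL t Pc K)%C).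
  { intros K.
    pose proof (ArcL_plus t (fun u => P3 u - P2 u - Pb u + Pa u)%C Pc K C32ba Cc) as E0.
    pose proof (ArcL_plus t (fun u => P3 u - P2 u - Pb u)%C Pa K C32b Ca) as E1.
    pose proof (ArcL_minus t (fun u => P3 u - P2 u)%C Pb K C32 Cb) as E2.
    pose proof (ArcL_minus t P3 P2 K C3 C2) as E3. cbv beta in E0, E1, E2, E3.
    refine (eq_trans E0 _). apply (f_equal (fun z => z + ArcL t Pc K)%C).
    refine (eq_trans E1 _). apply (f_equal (fun z => z + ArcL t Pa K)%C).
    refine (eq_trans E2 _). apply (f_equal (fun z => z - ArcL t Pb K)%C). exact E3. }
  (* The third value is again the remainder, so convergence along the third contour is a
     consequence. *)
  exists I1, (l0 - l1)%C, (2 * PI * y0 a t - I1 - (l0 - l1))%C.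
  assert (SecU : forall s th, 0 <= s -> PI / 3 <= th <= 2 * PI / 3 ->
    (- (alpha * (s * dir th)) = s * dir (th - PI / 3))%C /\ (- (alpha ^ 2 * (s * dir th)) = s * dir (th + PI / 3))%C).
  { intros s th _ _. split.
    - transitivity (s * (alpha * dir th * -1))%C; [ring|]. rewrite alpha_dir, <- dir_mPI, <- !dir_plus. do 4 f_equal. field.
    - transitivity (s * (- alpha ^ 2 * dir th))%C; [ring|]. rewrite malpha2_dir, <- dir_plus. do 4 f_equal. field. }
  split; [|split; [|split; [|ring]]].
  - apply (contour_limit FR real_line (fun K => ray FR K 0 - ray FR K PI)%C I1 0); [|exact L1].
    intros K HK. apply (real_line_path h FR (fun k => Cexp (Ci * k * a) * E k)%C K Hh); [lra|apply Hol_mult; auto|exact EFR].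
  - apply (contour_limit _ C_3 (fun K => ray F2 K (PI / 3) - ray F2 K (2 * PI / 3))%C (l0 - l1)%C 0); [|exact L2].
    intros K HK. apply sector_path; [lra| |exact CF2].
    intros s th Hth Hs. destruct (SecU s th Hs ltac:(destruct Hth; subst; lra)) as [e1 e2].
    assert (U1 : upper (- (alpha * (s * dir th)))%C) by (rewrite e1; apply upper_polar; destruct Hth; subst; lra).
    assert (U3 : upper (- (alpha ^ 2 * (s * dir th)))%C) by (rewrite e2; apply upper_polar; destruct Hth; subst; lra).
    unfold F2, N, G, E. rewrite (hat_pos_L v0 h _ Hh Ev U1), (hat_pos_L v0 h _ Hh Ev U3), !clampIm_id by assumption. reflexivity.
  - apply (contour_limit _ (R_tilde r) (ArcL t P3) _ r).
    + intros K HK. apply (interface_path w0 v0 W h Hf Hh Ew Ev _ (fun u => alpha * rh u)%C); [lra|exact Ax|].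
      intros u Hs. rewrite rhoC_Cexp by assumption.
      apply (f_equal (fun z => Cexp z * interface_term w0 v0 (Cexp u))%C). ring.
    + set (D1 := fun K => (ray FR (kap K) 0 - ray FR (kap K) PI)%C).
      set (D2 := fun K => (ray F2 (kap K) (PI / 3) - ray F2 (kap K) (2 * PI / 3))%C).
      set (D4 := fun K => (arc Fb (kap K) 0 (PI / 3) + arc Fb (kap K) (2 * PI / 3) PI + arc Fa (kap K) (PI / 3) (2 * PI / 3))%C).
      assert (K1 : Clim D1 I1) by exact (Clim_comp (fun K => ray FR K 0 - ray FR K PI)%C kap _ L1 Kap).
      assert (K2 : Clim D2 (l0 - l1)%C) by exact (Clim_comp (fun K => ray F2 K (PI / 3) - ray F2 K (2 * PI / 3))%C kap _ L2 Kap).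
      assert (K3 : Clim D4 0%C).
      { apply Clim_eq with (0 + 0 + 0)%C; [|ring]. apply Clim_plus; [apply Clim_plus|].
        - exact (Clim_comp (fun K => arc Fb K 0 (PI / 3)) kap _ Vb1 Kap).
        - exact (Clim_comp (fun K => arc Fb K (2 * PI / 3) PI) kap _ Vb2 Kap).
        - exact (Clim_comp (fun K => arc Fa K (PI / 3) (2 * PI / 3)) kap _ Va Kap). }
      apply Clim_eq with (2 * PI * y0 a t - I1 - (l0 - l1) - 0)%C; [|ring].
      pose proof (Clim_minus (ArcL t X0) D1 _ _ Lim K1) as S1. pose proof (Clim_minus _ D2 _ _ S1 K2) as S4.
      pose proof (Clim_minus _ D4 _ _ S4 K3) as S5. cbv beta in S5.
      (* Again exact for each [K]: [- P2] supplies [D2], and the arcs of [Pb], [Pa], [Pc] together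
         with the vanishing ones in [D4] fill two half circles, which make up [D1]. *)
      refine (Clim_ext_loc (fun K => ArcL t X0 K - D1 K - D2 K - D4 K)%C (ArcL t P3) _ 0 _ S5).
      intros K HK. unfold D1, D2, D4. rewrite AX, W2, Wb, Wa, Wc.
      pose proof (real_line_arcs h E FR a (kap K) Hh (Rlt_le _ _ Ha) (Rlt_le _ _ (kap0 K)) HE HE' EFR) as Q.
      change (ray FR (kap K) 0 - ray FR (kap K) PI = - arc Fb (kap K) 0 PI - arc Fa (kap K) 0 PI)%C in Q.
      rewrite Q, (arc_split3 Fb (kap K) (PI / 3) (2 * PI / 3)), (arc_split3 Fa (kap K) (PI / 3) (2 * PI / 3)) by (assumption || lra).
      rewrite (cauchy_sector U2 (fun _ => True) F2 (kap K) (PI / 3) (2 * PI / 3)); [ring|left; apply kap0|lra|auto| |exact H2].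
      intros s th Hs Hth. destruct (SecU s th (Rlt_le _ _ Hs) ltac:(lra)) as [e1 e2].
      split; [rewrite e1|rewrite e2]; apply Im_polar_pos; lra.
Qed.
End Formulas.

(** * From the interface problem to two half line systems *)

(** Composition with a map [s] into the half line and with the projection onto [[0, T]] turns
    continuity relative to the closed domain into continuity on the plane, the form in which
    [schroedinger] and [airy] want it. *)
Lemma continuous_on_extend (X : R -> Prop) (s : R -> R) (T : R) (f : R -> R -> C) : 0 <= T ->
  (forall x, continuous s x) -> (forall x, X (s x)) ->
  continuous_on (U := C_UniformSpace) (fun p : R * R => X (fst p) /\ 0 <= snd p <= T)
    (fun p : R * R => f (fst p) (snd p)) ->
  forall x t, cont2 (fun x t => f (s x) (clamp 0 T t)) x t.
Proof.
  intros HT Hs HX Hf x t P HP.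
  specialize (Hf (s x, clamp 0 T t) (conj (HX x) (clamp_in 0 T t HT)) P HP).
  unfold filtermap, within in Hf. simpl in Hf.
  assert (Hphi : filterlim (fun p : R * R => (s (fst p), clamp 0 T (snd p))) (locally (T := prod_UniformSpace R_UniformSpace R_UniformSpace) (x, t))
     (locally (T := prod_UniformSpace R_UniformSpace R_UniformSpace) (s x, clamp 0 T t))).
  { intros Q [e HQ].
    destruct (Hs x _ (locally_ball (s x) e)) as [d1 H1].
    destruct (continuous_clamp 0 T t _ (locally_ball (clamp 0 T t) e)) as [d2 H2].
    exists (mkposreal (Rmin d1 d2) (Rmin_stable_in_posreal d1 d2)). intros p [b1 b2]. apply HQ. split; simpl.
    - apply H1. refine (ball_le _ _ _ _ _ b1). apply Rmin_l.
    - apply H2. refine (ball_le _ _ _ _ _ b2). apply Rmin_r. }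
  specialize (Hphi _ Hf). unfold filtermap in Hphi |- *.
  revert Hphi. apply filter_imp. intros p Hp. apply Hp. simpl. split; [apply HX|now apply clamp_in].
Qed.

(** Near an interior point the restriction of the neighbourhood filter to [D] changes nothing. *)
Lemma is_derive_within_interior (D : R -> Prop) (f : R -> C) (x : R) (l : C) : locally x D ->
  is_derive_within D f x l -> CRderive f x l.
Proof.
  intros HD [Hl H]. split; [exact Hl|]. intros y Hy.
  assert (Hy' : is_filter_lim (within D (locally x)) y).
  { intros P HP. specialize (Hy P HP). unfold within. revert Hy. apply filter_imp. auto. }
  intros eps. specialize (H y Hy' eps). unfold within in H.
  generalize (filter_and _ _ HD H). apply filter_imp. intros z [h1 h2]. now apply h2.
Qed.

Lemma locally_gt_0 (x : R) : 0 < x -> locally x (fun y => 0 < y).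
Proof. intros Hx. exact (open_gt 0 x Hx). Qed.

Lemma locally_between (T t : R) : 0 < t < T -> locally t (fun s => 0 < s < T).
Proof. intros [H1 H2]. apply filter_and; [exact (open_gt 0 t H1)|exact (open_lt T t H2)]. Qed.

Lemma time_derivative (T t : R) (u ut v : R -> C) : 0 < t < T -> 
  (forall s, 0 <= s <= T -> v s = u s) ->
  is_derive_within (fun s => 0 <= s <= T) u t (ut t) ->
  CRderive (fun s => v (clamp 0 T s)) t (ut (clamp 0 T t)).
Proof.
  intros Ht E H. rewrite clamp_id by lra.
  apply (is_derive_ext_loc (K := R_AbsRing) (V := C_R_NormedModule) u).
  - generalize (locally_between T t Ht). apply filter_imp. intros s Hs. rewrite clamp_id, E by lra. reflexivity.
  - apply (is_derive_within_interior (fun s => 0 <= s <= T)); [|exact H].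
    generalize (locally_between T t Ht). apply filter_imp. intros s Hs. lra.
Qed.

Lemma space_derivative (x : R) (u u' : R -> C) : 0 < x -> is_derive_within (fun y => 0 <= y) u x (u' x) ->
  CRderive (fun y => u (Rmax 0 y)) x (u' (Rmax 0 x)).
Proof.
  intros Hx H. rewrite Rmax_right by lra.
  apply (is_derive_ext_loc (K := R_AbsRing) (V := C_R_NormedModule) u).
  - generalize (locally_gt_0 x Hx). apply filter_imp. intros s Hs. rewrite Rmax_right by lra. reflexivity.
  - apply (is_derive_within_interior (fun s => 0 <= s)); [|exact H].
    generalize (locally_gt_0 x Hx). apply filter_imp. intros s Hs. lra.
Qed.

Lemma space_derivative_reflected (x : R) (u u' : R -> C) : 0 < x -> is_derive_within (fun y => y <= 0) u (- x) (u' (- x)) ->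
  CRderive (fun y => u (- Rmax 0 y)) x (- u' (- Rmax 0 x)%R)%C.
Proof.
  intros Hx H. rewrite Rmax_right by lra.
  apply (is_derive_ext_loc (K := R_AbsRing) (V := C_R_NormedModule) (fun y => u (- y))).
  - generalize (locally_gt_0 x Hx). apply filter_imp. intros s Hs. rewrite Rmax_right by lra. reflexivity.
  - assert (H' : CRderive u (- x) (u' (- x))).
    { apply (is_derive_within_interior (fun s => s <= 0)); [|exact H].
      assert (Q : locally (- x) (fun y => y < 0)) by (apply (open_lt 0 (- x)); lra).
      revert Q. apply filter_imp. intros s Hs. lra. }
    eapply CRderive_eq.
    + apply (is_derive_comp (K := R_AbsRing) (V := C_R_NormedModule) u Ropp x _ (-1) H').
      auto_derive; [trivial|ring].
    + apply C_ext; unfold scal; simpl; unfold scal, Re, Im; simpl; unfold mult; simpl; ring.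
Qed.

Lemma admissible_dominated2 (T : R) (f : R -> R -> C) : 0 <= T -> admissible (fun x => 0 <= x) p_infty T f ->
  exists g, dominated2 T (fun x t => f (Rmax 0 x) (clamp 0 T t)) g.
Proof.
  intros HT [_ [_ [g [Hg Hb]]]]. exists g. split; [exact Hg|].
  intros x t Hx Ht. rewrite Rmax_right, clamp_id by lra. apply Hb; lra.
Qed.

(** The given integral runs from 0 to minus infinity, whence the opposite sign of the limit. *)
Lemma ex_RInt_gen_reflect (g : R -> R) : ex_RInt_gen g (at_point 0) (Rbar_locally m_infty) ->
  ex_RInt_gen (fun x => g (- x)) (at_point 0) (Rbar_locally p_infty).
Proof.
  intros [l H]. exists (opp l). intros P HP.
  assert (HP' : locally l (fun y => P (opp y))) by (apply (filterlim_opp (K := R_AbsRing) (V := R_NormedModule) l P HP)).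
  destruct (H _ HP') as [Q S HQ [M HM] HI].
  exists (fun x => x = 0) (fun y => - M < y); [reflexivity|now exists (- M)|].
  intros x y -> Hy. destruct (HI 0 (- y) HQ (HM (- y) ltac:(lra))) as [z [Hz HPz]].
  exists (opp z). split; [|exact HPz]. simpl in Hz |- *.
  assert (Hz' : is_RInt g (- 0) (- y) z) by now rewrite Ropp_0.
  apply (is_RInt_comp_opp (V := R_NormedModule)) in Hz'. apply (is_RInt_opp (V := R_NormedModule)) in Hz'.
  eapply is_RInt_ext; [|exact Hz']. intros q _. apply (opp_opp (G := R_AbelianGroup)).
Qed.

Lemma admissible_dominated2_reflected (T : R) (f : R -> R -> C) : 0 <= T -> admissible (fun x => x <= 0) m_infty T f ->
  exists g, dominated2 T (fun x t => f (- Rmax 0 x) (clamp 0 T t)) g.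
Proof.
  intros HT [_ [_ [g [Hg Hb]]]]. exists (fun x => g (- x)). split; [now apply ex_RInt_gen_reflect|].
  intros x t Hx Ht. rewrite Rmax_right, clamp_id by lra. apply Hb; lra.
Qed.

(** The sum is a common majorant: each summand bounds a modulus, for instance at time 0, and so is
    non-negative. *)
Lemma dominated2_plus (T : R) (p q : R -> R -> C) (g k : R -> R) : 0 <= T -> dominated2 T p g -> dominated2 T q k ->
  dominated2 T p (fun x => g x + k x) /\ dominated2 T q (fun x => g x + k x).
Proof.
  intros HT [[l1 H1] B1] [[l2 H2] B2].
  assert (S : ex_RInt_gen (fun x => g x + k x) (at_point 0) (Rbar_locally p_infty)).
  { exists (plus l1 l2). apply (is_RInt_gen_plus (V := R_NormedModule)); assumption. }
  assert (P1 : forall x, 0 <= x -> 0 <= g x /\ 0 <= k x).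
  { intros x Hx. specialize (B1 x 0 Hx ltac:(lra)). specialize (B2 x 0 Hx ltac:(lra)).
    pose proof (Cmod_ge_0 (p x 0)). pose proof (Cmod_ge_0 (q x 0)). lra. }
  split; (split; [exact S|]); intros x t Hx Ht; specialize (P1 x Hx).
  - specialize (B1 x t Hx Ht). lra.
  - specialize (B2 x t Hx Ht). lra.
Qed.

(** Reflection changes the sign of the first derivative and not of the second, so the equation keeps
    its form. *)
Lemma schroedinger_of_regular (T : R) (w wt : R -> R -> C) (wx : nat -> R -> R -> C) : 0 < T ->
  regular (fun x => x <= 0) m_infty T 2 w wt wx ->
  (forall x t, x < 0 -> 0 < t < T -> (Ci * wt x t + wx 2%nat x t = 0)%C) ->
  exists g, schroedinger T (fun x t => wx 0%nat (- Rmax 0 x)%R (clamp 0 T t))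
    (fun x t => - wx 1%nat (- Rmax 0 x)%R (clamp 0 T t))%C (fun x t => wt (- Rmax 0 x)%R (clamp 0 T t)) g.
Proof.
  intros HT [Hd [At Aj]] Pde. pose proof (Rlt_le _ _ HT) as HT'.
  assert (Cs : forall x, continuous (fun x => - Rmax 0 x) x).
  { intros x. apply (continuous_opp (V := R_NormedModule)), continuous_Rmax_l. }
  assert (Hs : forall x, - Rmax 0 x <= 0) by (intros x; pose proof (Rmax_l 0 x); lra).
  assert (Cx : forall f, admissible (fun x => x <= 0) m_infty T f ->
    forall x t, cont2 (fun x t => f (- Rmax 0 x) (clamp 0 T t)) x t).
  { intros f [Hc _]. exact (continuous_on_extend (fun x => x <= 0) (fun x => - Rmax 0 x) T f HT' Cs Hs Hc). }
  destruct (admissible_dominated2_reflected T _ HT' (Aj 0%nat ltac:(lia))) as [g0 D0].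
  destruct (admissible_dominated2_reflected T _ HT' (Aj 1%nat ltac:(lia))) as [g1 D1].
  destruct (dominated2_plus T _ _ _ _ HT' D0 D1) as [E0 E1].
  exists (fun x => g0 x + g1 x). split; [|split; [|split]].
  - intros x t. split; [apply (Cx _ (Aj 0%nat ltac:(lia)))|split; [|apply (Cx _ At)]].
    apply (Ccont_opp (U := prod_UniformSpace R_UniformSpace R_UniformSpace)), (Cx _ (Aj 1%nat ltac:(lia))).
  - intros x t Hx Ht.
    assert (Hxr : - Rmax 0 x = - x) by (rewrite Rmax_right; lra).
    assert (Htr : clamp 0 T t = t) by (apply clamp_id; lra).
    destruct (Hd (- x) t ltac:(lra) ltac:(lra)) as [_ [d1 d2]]. split; [|split].
    + rewrite Hxr. apply (time_derivative T t (fun s => w (- x) s) (fun s => wt (- x) s) (fun s => wx 0%nat (- x) s) Ht); [|exact d1].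
      intros s Hs'. apply (Hd (- x) s); lra.
    + rewrite Htr. apply (space_derivative_reflected x (fun y => wx 0%nat y t) (fun y => wx 1%nat y t) Hx). apply d2. lia.
    + rewrite Htr. eapply CRderive_eq.
      * apply CRderive_opp, (space_derivative_reflected x (fun y => wx 1%nat y t) (fun y => wx 2%nat y t) Hx). apply d2. lia.
      * cbv beta. rewrite Hxr. pose proof (Pde (- x) t ltac:(lra) Ht) as E.
        replace (wx 2%nat (- x) t) with (Ci * wt (- x)%R t + wx 2%nat (- x)%R t - Ci * wt (- x)%R t)%C by ring.
        rewrite E. ring.
  - exact E0.
  - split; [apply E1|]. intros x t Hx Ht. rewrite Cmod_opp. now apply E1.
Qed.

Lemma airy_of_regular (T : R) (v vt : R -> R -> C) (vx : nat -> R -> R -> C) : 0 < T ->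
  regular (fun x => 0 <= x) p_infty T 3 v vt vx ->
  (forall x t, 0 < x -> 0 < t < T -> (vt x t + vx 3%nat x t = 0)%C) ->
  exists g, airy T (fun x t => vx 0%nat (Rmax 0 x) (clamp 0 T t)) (fun x t => vx 1%nat (Rmax 0 x) (clamp 0 T t))
    (fun x t => vx 2%nat (Rmax 0 x) (clamp 0 T t)) (fun x t => vt (Rmax 0 x) (clamp 0 T t)) g.
Proof.
  intros HT [Hd [At Aj]] Pde. pose proof (Rlt_le _ _ HT) as HT'.
  assert (Cx : forall f, admissible (fun x => 0 <= x) p_infty T f ->
    forall x t, cont2 (fun x t => f (Rmax 0 x) (clamp 0 T t)) x t).
  { intros f [Hc _]. exact (continuous_on_extend (fun x => 0 <= x) (Rmax 0) T f HT' (continuous_Rmax_l 0) (Rmax_l 0) Hc). }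
  destruct (admissible_dominated2 T _ HT' (Aj 0%nat ltac:(lia))) as [g0 D0].
  destruct (admissible_dominated2 T _ HT' (Aj 1%nat ltac:(lia))) as [g1 D1].
  destruct (admissible_dominated2 T _ HT' (Aj 2%nat ltac:(lia))) as [g2 D2].
  destruct (dominated2_plus T _ _ _ _ HT' D0 D1) as [E0 E1].
  destruct (dominated2_plus T _ _ _ _ HT' E0 D2) as [F0 F2].
  destruct (dominated2_plus T _ _ _ _ HT' E1 D2) as [F1 _].
  exists (fun x => g0 x + g1 x + g2 x). split; [|split; [|split; [|split]]]; try assumption.
  - intros x t. split; [|split; [|split]]; apply Cx; try apply Aj; try exact At; lia.
  - intros x t Hx Ht.
    assert (Hxr : Rmax 0 x = x) by (rewrite Rmax_right; lra).
    assert (Htr : clamp 0 T t = t) by (apply clamp_id; lra).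
    destruct (Hd x t ltac:(lra) ltac:(lra)) as [_ [d1 d2]]. split; [|split; [|split]].
    + rewrite Hxr. apply (time_derivative T t (fun s => v x s) (fun s => vt x s) (fun s => vx 0%nat x s) Ht); [|exact d1].
      intros s Hs'. apply (Hd x s); lra.
    + rewrite Htr. apply (space_derivative x (fun y => vx 0%nat y t) (fun y => vx 1%nat y t) Hx). apply d2. lia.
    + rewrite Htr. apply (space_derivative x (fun y => vx 1%nat y t) (fun y => vx 2%nat y t) Hx). apply d2. lia.
    + rewrite Htr. eapply CRderive_eq.
      * apply (space_derivative x (fun y => vx 2%nat y t) (fun y => vx 3%nat y t) Hx). apply d2. lia.
      * cbv beta. rewrite Hxr. pose proof (Pde x t ltac:(lra) Ht) as E.
        replace (vx 3%nat x t) with (vt x t + vx 3%nat x t - vt x t)%C by ring.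
        rewrite E. ring.
Qed.

Lemma is_contour_int_ext (F G : C -> C) (P : contour) (I : C) : (forall k, F k = G k) ->
  is_contour_int F P I -> is_contour_int G P I.
Proof.
  intros E H. replace G with F; [exact H|].
  apply functional_extensionality, E.
Qed.

Lemma schwartz_nice_id (V : R -> C) : schwartz V -> nice V.
Proof.
  intros H. pose proof (schwartz_nice V 1 H (or_introl eq_refl)) as Q.
  replace V with (fun y => V (1 * y)); [exact Q|].
  apply functional_extensionality. intros y. now rewrite Rmult_1_l.
Qed.

Lemma schwartz_nice_opp (W : R -> C) : schwartz W -> nice (fun y => W (- y)).
Proof.
  intros H. pose proof (schwartz_nice W (-1) H (or_intror eq_refl)) as Q.
  replace (fun y => W (- y)) with (fun y => W (-1 * y)); [exact Q|].
  apply functional_extensionality. intros y. f_equal. ring.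
Qed.

Theorem proposition1 (T : R) (w0 v0 : R -> C) (w v : R -> R -> C) (r : R)
  (hT : 0 < T) (hr : 0 < r)
  (hw0 : exists W : R -> C, schwartz W /\ forall x, x < 0 -> w0 x = W x)
  (hv0 : exists V : R -> C, schwartz V /\ forall x, 0 < x -> v0 x = V x)
  (hsol : interface_solution T w0 v0 w v) :
  (forall x t : R, x < 0 -> 0 < t < T ->
     exists I1 I2 I3 : C,
       is_contour_int
         (fun k => Cexp (- (Ci * k * x) - Ci * k ^ 2 * t) * hat_neg w0 (- k))%C
         real_line I1 /\
       is_contour_int
         (fun k => Cexp (- (Ci * k * x) - Ci * k ^ 2 * t) * hat_neg w0 k)%C
         C_S I2 /\
       is_contour_int
         (fun k => Cexp (- (Ci * sigmaC k * x) + Ci * k * t)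
                   * interface_term w0 v0 k)%C
         (R_tilde r) I3 /\
       w x t = (1 / (2 * PI) * I1 - 1 / (2 * PI) * I2 + 1 / (2 * PI) * I3)%C)
  /\
  (forall x t : R, 0 < x -> 0 < t < T ->
     exists I1 I2 I3 : C,
       is_contour_int
         (fun k => Cexp (Ci * k * x + Ci * k ^ 3 * t) * hat_pos v0 k)%C
         real_line I1 /\
       is_contour_int
         (fun k => Cexp (Ci * k * x + Ci * k ^ 3 * t)
                   * (alpha * hat_pos v0 (alpha * k)
                      + alpha ^ 2 * hat_pos v0 (alpha ^ 2 * k)))%C
         C_3 I2 /\
       is_contour_int
         (fun k => Cexp (Ci * alpha * rhoC k * x + Ci * k * t)
                   * interface_term w0 v0 k)%C
         (R_tilde r) I3 /\
       v x t = (1 / (2 * PI) * I1 + 1 / (2 * PI) * I2 + 1 / (2 * PI) * I3)%C).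
Proof.
  destruct hw0 as [W [HW Ew]]. destruct hv0 as [V [HV Ev]].
  destruct hsol as [wt [vt [wx [vx [Rw [Rv [Pw [Pv [Iw [Iv Hi]]]]]]]]]].
  destruct (schroedinger_of_regular T w wt wx hT Rw Pw) as [gu Hu].
  destruct (airy_of_regular T v vt vx hT Rv Pv) as [gy Hy].
  set (u0 := fun x t => wx 0%nat (- Rmax 0 x)%R (clamp 0 T t)) in *.
  set (u1 := fun x t => (- wx 1%nat (- Rmax 0 x)%R (clamp 0 T t))%C) in *.
  set (y0 := fun x t => vx 0%nat (Rmax 0 x) (clamp 0 T t)) in *.
  set (y1 := fun x t => vx 1%nat (Rmax 0 x) (clamp 0 T t)) in *.
  assert (Z : Rmax 0 0 = 0) by (apply Rmax_right; lra).
  assert (Hi0 : forall t, 0 <= t <= T -> u0 0 t = y0 0 t).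
  { intros t Ht. unfold u0, y0. rewrite Z, Ropp_0, clamp_id by assumption. apply Hi; [lia|assumption]. }
  assert (Hi1 : forall t, 0 <= t <= T -> u1 0 t = (- y1 0%R t)%C).
  { intros t Ht. unfold u1, y1. rewrite Z, Ropp_0, clamp_id by assumption. rewrite Hi by (lia || assumption). reflexivity. }
  assert (Uw : forall x t, 0 < x -> 0 <= t <= T -> u0 x t = w (- x) t).
  { intros x t Hx Ht. unfold u0. rewrite Rmax_right, clamp_id by lra. apply Rw; lra. }
  assert (Yv : forall x t, 0 < x -> 0 <= t <= T -> y0 x t = v x t).
  { intros x t Hx Ht. unfold y0. rewrite Rmax_right, clamp_id by lra. apply Rv; lra. }
  assert (Eu : forall x, 0 < x -> u0 x 0 = W (- x)).
  { intros x Hx. rewrite Uw, Iw by lra. apply Ew. lra. }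
  assert (Ey : forall x, 0 < x -> y0 x 0 = V x).
  { intros x Hx. rewrite Yv, Iv by lra. now apply Ev. }
  pose proof (schwartz_nice_opp W HW) as Hf. pose proof (schwartz_nice_id V HV) as Hh.
  assert (P0 : RtoC PI <> 0%C).
  { intros X. apply (f_equal Re) in X. simpl in X. pose proof PI_RGT_0. lra. }
  split; intros x t Hx Ht.
  - destruct (schroedinger_formula T u0 u1 _ gu y0 y1 _ _ gy w0 v0 W V hT Hu Hy Hi0 Hi1 Hf Hh Ew Ev Eu Ey (- x) t r
      ltac:(lra) Ht hr) as [I1 [I2 [I3 [H1 [H2 [H3 E]]]]]].
    exists I1, I2, I3. split; [|split; [|split]].
    + refine (is_contour_int_ext _ _ _ _ _ H1). intros k. rewrite <- Cexp_plus.
      apply (f_equal (fun z => Cexp z * hat_neg w0 (- k))%C). rewrite !RtoC_opp. ring.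
    + refine (is_contour_int_ext _ _ _ _ _ H2). intros k. rewrite <- Cexp_plus.
      apply (f_equal (fun z => Cexp z * hat_neg w0 k)%C). rewrite !RtoC_opp. ring.
    + refine (is_contour_int_ext _ _ _ _ _ H3). intros k.
      apply (f_equal (fun z => Cexp z * interface_term w0 v0 k)%C). rewrite !RtoC_opp. ring.
    + rewrite Uw, Ropp_involutive in E by lra.
      transitivity (1 / (2 * PI) * (2 * PI * w x t))%C; [field; exact P0|]. rewrite E. field. exact P0.
  - destruct (airy_formula T u0 u1 _ gu y0 y1 _ _ gy w0 v0 W V hT Hu Hy Hi0 Hi1 Hf Hh Ew Ev Eu Ey x t r
      Hx Ht hr) as [I1 [I2 [I3 [H1 [H2 [H3 E]]]]]].
    exists I1, I2, I3. split; [|split; [|split]].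
    + refine (is_contour_int_ext _ _ _ _ _ H1). intros k. rewrite <- Cexp_plus. reflexivity.
    + refine (is_contour_int_ext _ _ _ _ _ H2). intros k. rewrite <- Cexp_plus. reflexivity.
    + exact H3.
    + rewrite Yv in E by lra.
      transitivity (1 / (2 * PI) * (2 * PI * v x t))%C; [field; exact P0|]. rewrite E. field. exact P0.
Qed.
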